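(* Every h-perfect graph $G$ is $(\omega(G)+199050)$-colourable, where $\omega(G)$ is the maximum size of a clique of $G$.
   Context: All graphs are finite and simple. For a graph $G=(V,E)$, the stable set polytope $\mathrm{STAB}(G)\subseteq\mathbb{R}^{V}$ is the convex hull of the incidence vectors of the stable sets of $G$. Let $\mathrm{HSTAB}(G)$ be the set of all $x\in\mathbb{R}^V$ satisfying $x_v\ge 0$ for every vertex $v$, $\sum_{v\in K}x_v\le 1$ for every clique $K$ of $G$, and $\sum_{v\in V(C)}x_v\le \frac{|V(C)|-1}{2}$ for every odd cycle $C$ of $G$. A graph $G$ is h-perfect if $\mathrm{STAB}(G)=\mathrm{HSTAB}(G)$. A graph is $k$-colourable if its vertex set is a union of $k$ stable sets. *)

(* Defs.v *)
From mathcomp Require Export all_boot all_order all_algebra.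
From mathcomp Require Export classical_sets reals.

Set Implicit Arguments.
Unset Strict Implicit.
Unset Printing Implicit Defensive.

Import Order.TTheory GRing.Theory Num.Theory.

Local Open Scope ring_scope.

(* A finite simple graph is a finType T of vertices together with a symmetric
   and irreflexive adjacency relation e : rel T. *)
Definition simple_graph (T : finType) (e : rel T) : Prop :=
  symmetric e /\ irreflexive e.

Definition stable (T : finType) (e : rel T) (S : {set T}) : bool :=
  [forall x in S, forall y in S, ~~ e x y].

Definition clique (T : finType) (e : rel T) (K : {set T}) : bool :=
  [forall x in K, forall y in K, (x != y) ==> e x y].

Definition clique_number (T : finType) (e : rel T) : nat :=
  \max_(K : {set T} | clique e K) #|K|%N.

(* The sequence of vertices of a cycle, in cyclic order. The cycle need not be
   induced, and triangles count as odd cycles. *)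
Definition odd_cycle (T : finType) (e : rel T) (c : seq T) : bool :=
  [&& (2 < size c)%N, odd (size c), cycle e c & uniq c].

Definition colourable (T : finType) (e : rel T) (k : nat) : Prop :=
  exists S : 'I_k -> {set T},
    (forall i, stable e (S i)) /\ \bigcup_(i < k) S i = [set: T]%SET.

(* The convex hull in R^T: all finite convex combinations of points of A. *)
Definition convex_hull (R : realType) (T : finType)
    (A : set {ffun T -> R}) : set {ffun T -> R} :=
  [set x | exists (n : nat) (p : 'I_n -> {ffun T -> R}) (a : 'I_n -> R),
    [/\ forall i, A (p i), forall i, 0 <= a i, \sum_(i < n) a i = 1
      & forall v, x v = \sum_(i < n) a i * p i v]]%classic.

Definition incidence_vector (R : realType) (T : finType) (S : {set T}) :
  {ffun T -> R} := [ffun v => (v \in S)%:R].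

Definition STAB (R : realType) (T : finType) (e : rel T) :
    set {ffun T -> R} :=
  convex_hull [set incidence_vector R S | S in [set S | stable e S]]%classic.

Definition HSTAB (R : realType) (T : finType) (e : rel T) :
    set {ffun T -> R} :=
  [set x : {ffun T -> R} |
    [/\ forall v, 0 <= x v,
        forall K : {set T}, clique e K -> \sum_(v in K) x v <= 1
      & forall c : seq T, odd_cycle e c ->
          \sum_(v <- c) x v <= ((size c)%:R - 1) / 2]]%classic.

Arguments STAB R {T} e.
Arguments HSTAB R {T} e.

Definition h_perfect (R : realType) (T : finType) (e : rel T) : Prop :=
  STAB R e = HSTAB R e.

Arguments h_perfect R {T} e.

(* Main.v *)
(** In an h-perfect graph, a point of HSTAB is a convex combination of stable
    sets, each of which meets with equality every inequality that is tight at
    the point. Applied to the constant 1/w on a set with clique number w > 2,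
    this gives a stable set meeting all cliques of size w; applied to the
    constant 2/5 on a triangle-free set, a stable set meeting all pentagons.
    So it suffices to colour a graph without triangles and pentagons with a
    bounded number of colours.

    There h-perfectness is used only through one more point of HSTAB: it
    excludes wheels, that is a connected hub block and an odd number of
    connected rim blocks arranged cyclically and all joined to the hub, where
    every block has a 2-colouring whose first class contains all ends of edges
    between blocks. With three rim blocks this is a signed K4.

    Suppose that the chromatic number is large. Breadth-first search, applied
    twice, gives a connected set J of large chromatic number inside one level,
    with two connected bodies U and M, anticomplete to J, such that every
    vertex of J has a parent attached to U and a parent attached to M.
    Starting from a parent attached to U, a rope is wound through J: at each
    stage it first makes contact with (a slight enlargement of) M and then
    passes through an odd ring, which makes two consecutive contacts joined by
    induced paths of both parities. After three contacts the rope is closed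
    through U, so that each two of the three contacts are joined by paths of
    both parities while all three see the connected hub M. Choosing parities
    then produces a signed K4.

    The rope must be anticomplete to what remains of J, and no parent may see
    both the remaining part and an old piece of the rope. Each piece of the
    rope is therefore required to "guard" it: the vertices of the remaining
    part at a given distance from the tip that have such a parent have bounded
    chromatic number, so they can be thrown away. *)

Require Import Defs.
From mathcomp Require Import fintype finset zify ring lra.

Set Implicit Arguments.
Unset Strict Implicit.
Unset Printing Implicit Defensive.

(** * Colourings of vertex subsets *)

(** h-perfectness is assumed of the whole graph only, while the argument passes to subsets; so
    points of [HSTAB] are taken to vanish outside a subset, and wheels of a subgraph are read as
    wheels of the whole graph. Colour bounds come from one source: a set that is not 2-colourable
    contains an odd hole, and an odd hole that sees a connected bipartite set on one side only, at
    three places of alternating parity, is the rim of a wheel. This gives 2 for the vertices at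
    distance two from a vertex, 14 for those at distance two from an odd ring, and 32 for a piece of
    rope ending in a ring. Each deleted neighbourhood costs 1, and each passage to a BFS level
    doubles the bound. The nested constants evaluate to [rope_bound] = 6738 and [core_bound] =
    107960, so the proof reaches the clique number plus 107961. Pentagons are excluded besides
    triangles for two reasons: a path with five vertices must stay induced when it serves as a hub
    in [ring_col], and the ring cut from two geodesics in [geod_ring] must be long enough for the
    next tip to miss its entry vertex. *)

Section Colouring.
Variables (T : finType) (e : rel T).

Definition proper_col (A : {set T}) (n : nat) (f : T -> nat) : bool :=
  [forall x in A, (f x < n) && [forall y in A, e x y ==> (f x != f y)]].

(** The target is ['I_n.+1] so that candidates exist even for [n = 0]. A canonical choice makes
    [col] decidable and gives equal sets equal colourings, which allows colourings of levels and
    components to be glued. *)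
Definition colour_map (A : {set T}) (n : nat) : {ffun T -> 'I_n.+1} :=
  odflt [ffun => ord0]
    [pick f : {ffun T -> 'I_n.+1} | proper_col A n (fun x => f x)].

Definition col (A : {set T}) (n : nat) : bool :=
  proper_col A n (fun x => colour_map A n x).

Lemma proper_colP (A : {set T}) n (f : T -> nat) :
  reflect ({in A, forall x, f x < n}%N /\
           {in A &, forall x y, e x y -> f x != f y}) (proper_col A n f).
Proof.
apply: (iffP forall_inP) => [h|[h1 h2] x xA].
  split=> [x xA|x y xA yA exy]; have /andP[h1 /forall_inP h2] := h x xA => //.
  by apply: implyP exy; apply: h2.
rewrite h1 //=; apply/forall_inP => y yA.
by apply/implyP; apply: h2.
Qed.

Lemma colP (A : {set T}) n :
  reflect (exists f : T -> nat, {in A, forall x, f x < n}%N /\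
           {in A &, forall x y, e x y -> f x != f y}) (col A n).
Proof.
apply: (iffP idP) => [/proper_colP h|[f [h1 h2]]]; first by eexists; exact: h.
rewrite /col /colour_map; case: pickP => //= /(_ [ffun x => inord (f x)]).
case/negP; apply/proper_colP; split=> [x xA|x y xA yA exy]; rewrite !ffunE !inordK.
all: try by rewrite ltnS ltnW // h1.
  exact: h1.
exact: h2.
Qed.

Lemma col_sub (A B : {set T}) n : A \subset B -> col B n -> col A n.
Proof.
move=> /subsetP sAB /colP[f [h1 h2]]; apply/colP; exists f; split.
  by move=> x /sAB; apply: h1.
by move=> x y /sAB xB /sAB yB; apply: h2.
Qed.

Lemma col_leq (A : {set T}) m n : (m <= n)%N -> col A m -> col A n.
Proof.
move=> mn /colP[f [h1 h2]]; apply/colP; exists f; split=> // x xA.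
exact: leq_trans (h1 x xA) mn.
Qed.

Lemma colU (A B : {set T}) m n : col A m -> col B n -> col (A :|: B) (m + n).
Proof.
move=> /colP[f [f1 f2]] /colP[g [g1 g2]]; apply/colP.
exists (fun x => if x \in A then f x else m + g x)%N; split=> [x|x y].
  rewrite inE; case: ifP => [xA _|_ /= xB]; first by have := f1 _ xA; lia.
  by have := g1 _ xB; lia.
rewrite !inE; case: ifP => xA /= xB; case: ifP => yA /= yB exy.
- exact: f2.
- by have := f1 _ xA; lia.
- by have := f1 _ yA; lia.
- by have := g2 _ _ xB yB exy; lia.
Qed.

Lemma col_indep (A : {set T}) : {in A &, forall x y, ~~ e x y} -> col A 1.
Proof.
move=> h; apply/colP; exists (fun=> 0%N); split=> // x y xA yA exy.
by have := h x y xA yA; rewrite exy.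
Qed.

Lemma col0 n : col set0 n.
Proof. by apply/colP; exists (fun=> 0%N); split=> x; rewrite inE. Qed.

Lemma ncol_nonempty (A : {set T}) n : ~~ col A n -> exists x, x \in A.
Proof.
by case: (set_0Vmem A) => [->|[x xA]]; [rewrite col0|exists x].
Qed.

Lemma ncolD (A B : {set T}) m n : col B m -> ~~ col A (n + m) ->
  ~~ col (A :\: B) n.
Proof.
move=> cB; apply: contra => cA; apply: col_sub (colU cA cB).
by apply/subsetP => x xA; rewrite !inE xA andbT orNb.
Qed.

(** Each level is coloured on its own, the odd levels with a second palette of [n] colours. An edge
    between different levels joins consecutive ones, hence different palettes. *)
Lemma col_levels (A : {set T}) (d : T -> nat) n :
  {in A &, forall x y, e x y -> (d x <= (d y).+1)%N} ->
  {in A &, forall x y, e x y -> (d y <= (d x).+1)%N} ->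
  (forall r, col [set x in A | d x == r] n) -> col A (n + n).
Proof.
move=> h1 h2 hl; apply/colP.
pose g x : nat := colour_map [set y in A | d y == d x] n x.
have glt x : x \in A -> (g x < n)%N.
  by move=> xA; have /proper_colP[+ _] := hl (d x); apply; rewrite !inE xA eqxx.
exists (fun x => g x + (odd (d x)) * n)%N; split=> [x xA|x y xA yA exy].
  by have := glt x xA; case: (odd _); lia.
case: (eqVneq (d x) (d y)) => [E|N].
  have := hl (d x) => /proper_colP[_ /(_ x y)]; rewrite !inE xA yA E !eqxx.
  by move=> /(_ isT isT exy); rewrite /g E; lia.
have := h1 _ _ xA yA exy; have := h2 _ _ xA yA exy.
have := glt x xA; have := glt y yA.
move: (g x) (g y) (d x) (d y) N => a b c d'.
by case: (ltngtP c d') => // cd _ ? ? ? ?;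
  [have -> : d' = c.+1 by lia|have -> : c = d'.+1 by lia]; rewrite /=;
  case: (odd _) => /=; lia.
Qed.

End Colouring.

(** * Connected sets and breadth-first levels *)

Section Connectivity.
Variables (T : finType) (e : rel T).
Hypothesis e_sym : symmetric e.
Hypothesis e_irr : irreflexive e.

Notation col := (col e).

Definition restr (A : {set T}) : rel T := fun x y => [&& x \in A, y \in A & e x y].

Definition conn (A : {set T}) : bool :=
  [forall x in A, forall y in A, connect (restr A) x y].

Definition touch (x : T) (A : {set T}) : bool := [exists y in A, e x y].

Lemma touchP x (A : {set T}) : reflect (exists2 y, y \in A & e x y) (touch x A).
Proof. exact: exists_inP. Qed.

Lemma touchPn x (A : {set T}) :
  reflect {in A, forall y, e x y = false} (~~ touch x A).
Proof.
rewrite negb_exists_in; apply: (iffP forall_inP) => h y yA.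
  exact: negbTE (h y yA).
by rewrite h.
Qed.

Lemma restr_sym (A : {set T}) : symmetric (restr A).
Proof. by move=> x y; rewrite /restr e_sym andbCA. Qed.

Lemma connP (A : {set T}) :
  reflect {in A &, forall x y, connect (restr A) x y} (conn A).
Proof.
apply: (iffP forall_inP) => [h x y xA yA|h x xA].
  by have /forall_inP := h x xA; apply.
by apply/forall_inP => y; apply: h.
Qed.

Lemma conn_const (R : eqType) (A : {set T}) (f : T -> R) : conn A ->
  {in A &, forall x y, e x y -> f x = f y} -> {in A &, forall x y, f x = f y}.
Proof.
move=> /connP cA h x y xA yA; have /connectP[p pp ->] := cA _ _ xA yA.
elim: p x {xA} pp => //= z p IH x /andP[/and3P[xA zA exz] pp].
by rewrite (h x z) //; apply: IH.
Qed.

Lemma connect_subset (A B : {set T}) x y :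
  A \subset B -> connect (restr A) x y -> connect (restr B) x y.
Proof.
move=> /fintype.subsetP sAB; apply: connect_sub => u v /and3P[uA vA euv].
by apply: connect1; rewrite /restr !sAB.
Qed.

Lemma conn1 x : conn [set x].
Proof. by apply/connP => y z /set1P-> /set1P->; apply: connect0. Qed.

Lemma connU (A B : {set T}) a b : conn A -> conn B -> a \in A -> b \in B ->
  (a == b) || e a b -> conn (A :|: B).
Proof.
move=> /connP cA /connP cB aA bB ab.
have sA : A \subset A :|: B by apply: subsetUl.
have sB : B \subset A :|: B by apply: subsetUr.
have cab : connect (restr (A :|: B)) a b.
  case/orP: ab => [/eqP->|ab]; first exact: connect0.
  by apply: connect1; rewrite /restr !inE aA bB orbT.
have csym : connect_sym (restr (A :|: B)).
  by apply: sym_connect_sym; apply: restr_sym.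
have toa x : x \in A :|: B -> connect (restr (A :|: B)) a x.
  case/setUP=> xX; first by apply: connect_subset sA _; apply: cA.
  apply: connect_trans cab _; apply: connect_subset sB _; exact: cB.
apply/connP => x y xX yX; apply: connect_trans (toa y yX).
by rewrite csym; apply: toa.
Qed.

Lemma conn_add (A : {set T}) x : conn A -> touch x A -> conn (x |: A).
Proof.
move=> cA /touchP[y yA exy].
by apply: connU (conn1 x) cA (set11 x) yA _; rewrite exy orbT.
Qed.

Definition comp (A : {set T}) x := [set y in A | connect (restr A) x y].

Lemma conn_comp (A : {set T}) x : x \in A -> conn (comp A x).
Proof.
move=> xA; have csym : connect_sym (restr (comp A x)).
  by apply: sym_connect_sym; apply: restr_sym.
have tox y : y \in comp A x -> connect (restr (comp A x)) x y.
  rewrite inE => /andP[yA /connectP[p pp ->]] {y yA}.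
  have : x \in comp A x by rewrite inE xA connect0.
  suff : forall u, path (restr A) u p -> u \in comp A x ->
    connect (restr (comp A x)) u (last u p) by apply.
  elim: p {pp} => [|z p IH] u /=; first by rewrite connect0.
  case/andP=> /and3P[uA zA euz] pp uC.
  have zC : z \in comp A x.
    move: uC; rewrite !inE zA => /andP[_ h].
    by apply: connect_trans h _; apply: connect1; rewrite /restr uA zA.
  by apply: connect_trans (IH _ pp zC); apply: connect1; rewrite /restr uC zC.
by apply/connP => y z /tox yC /tox zC; apply: connect_trans zC; rewrite csym.
Qed.

(** If every component were [n]-colourable, their canonical colourings would combine: adjacent
    vertices have the same component and so use the same [colour_map]. *)
Lemma ncol_comp (A : {set T}) n : ~~ col A n ->
  exists C : {set T}, [/\ C \subset A, conn C, ~~ col C n &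
    {in C & A, forall x y, e x y -> y \in C}].
Proof.
move=> nA; have [/exists_inP[x xA nc]|] := boolP [exists x in A, ~~ col (comp A x) n].
  exists (comp A x); split=> //; first by apply/fintype.subsetP => y; rewrite inE => /andP[].
    exact: conn_comp.
  move=> y z; rewrite !inE => /andP[yA cy] zA eyz; rewrite zA.
  by apply: connect_trans cy _; apply: connect1; rewrite /restr yA zA.
rewrite negb_exists_in => /forall_inP h; case/negP: nA; apply/colP.
have csym : connect_sym (restr A) by apply: sym_connect_sym; apply: restr_sym.
exists (fun x => colour_map e (comp A x) n x); split=> [x xA|x y xA yA exy].
  have := h x xA; rewrite negbK => /proper_colP[+ _]; apply.
  by rewrite inE xA connect0.
have E : comp A y = comp A x.
  apply/setP => z; rewrite !inE; case: (z \in A) => //=.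
  have cxy : connect (restr A) x y by apply: connect1; rewrite /restr xA yA.
  apply/idP/idP => c; first exact: connect_trans cxy c.
  by apply: connect_trans c; rewrite csym.
rewrite E; have := h x xA; rewrite negbK => /proper_colP[_]; apply=> //.
  by rewrite inE xA connect0.
by rewrite inE yA connect1 //= /restr xA yA.
Qed.

Lemma conn_exit (A B : {set T}) x y : conn A -> B \subset A ->
  x \in B -> y \in A :\: B -> exists2 g, g \in A :\: B & touch g B.
Proof.
move=> cA sBA xB yAB; case: (boolP [exists g in A :\: B, touch g B]).
  by move/exists_inP.
rewrite negb_exists_in => /forall_inP h; have := yAB; rewrite inE => /andP[yB yA].
suff : (x \in B) = (y \in B) by rewrite xB (negbTE yB).
apply: (conn_const (f := fun z => z \in B) cA) => //; last exact: (fintype.subsetP sBA).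
move=> u v uA vA euv; apply/idP/idP => [uB|vB]; apply/negPn/negP => nB.
  have vAB : v \in A :\: B by rewrite inE nB.
  by have /touchPn/(_ u uB) := h v vAB; rewrite e_sym euv.
have uAB : u \in A :\: B by rewrite inE nB.
by have /touchPn/(_ v vB) := h u uAB; rewrite euv.
Qed.

(** [K] is a component of [A] minus [X]. As [A] is connected, some vertex of [A] outside [K] touches
    [K], and it lies in [X], since otherwise it would belong to the component. This is the standard
    way below to retreat from the neighbourhoods of given vertices while keeping an entrance to what
    remains. *)
Lemma gate (A X : {set T}) m n : conn A -> col (A :&: X) m ->
  A :&: X != set0 -> ~~ col A (n + m) ->
  exists (K : {set T}) g, [/\ K \subset A :\: X, conn K, ~~ col K n,
    g \in A :&: X & touch g K].
Proof.
move=> cA cX /set0Pn[y yX] nA.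
have {}nA : ~~ col (A :\: X) n.
  have -> : A :\: X = A :\: (A :&: X) by rewrite setDIr setDv set0U.
  exact: ncolD nA.
have [K [sK cK nK clK]] := ncol_comp nA; have [x xK] := ncol_nonempty nK.
have sKA : K \subset A by apply: fintype.subset_trans sK (subsetDl _ _).
have [g gAK gK] : exists2 g, g \in A :\: K & touch g K.
  apply: (conn_exit (x := x) (y := y)) => //.
  move: yX; rewrite !inE => /andP[yA yX]; rewrite yA andbT.
  by apply: contraL yX => /(fintype.subsetP sK); rewrite inE => /andP[].
exists K, g; split=> //; move: gAK; rewrite !inE => /andP[gK' gA]; rewrite gA /=.
apply: contraR gK' => gX; have /touchP[z zK egz] := gK.
by apply: (clK z) => //; rewrite ?inE ?gX ?gA // e_sym.
Qed.

(** An axiomatic form of the distance from [q] in the graph induced on [S]; values outside [S] are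
    arbitrary. *)
Definition bfs (S : {set T}) (q : T) (d : T -> nat) : Prop :=
  [/\ q \in S, d q = 0%N,
      {in S, forall v, 0 < d v -> exists2 u, u \in S & e u v /\ d v = (d u).+1}%N,
      {in S, forall v, d v = 0%N -> v = q}
    & {in S &, forall u v, e u v -> (d v <= (d u).+1)%N}].

Lemma bfs_exists (S : {set T}) q : conn S -> q \in S -> exists d, bfs S q d.
Proof.
move=> /connP cS qS.
pose P v n := [exists t : n.-tuple T, path (restr S) q t && (last q t == v)].
have [d hd] : exists d : T -> nat, forall v, v \in S ->
    P v (d v) /\ forall n, P v n -> (d v <= n)%N.
  apply: (@fin_all_exists _ (fun=> nat) (fun v n => v \in S ->
    P v n /\ forall m, P v m -> (n <= m)%N)) => v.
  have [vS|_] := boolP (v \in S); last by exists 0%N.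
  have exP : exists n, P v n.
    have /connectP[p pp ->] := cS q v qS vS.
    by exists (size p); apply/existsP; exists (in_tuple p); rewrite /= pp eqxx.
  by exists (ex_minn exP) => _; case: ex_minnP.
have path_in p u : u \in S -> path (restr S) u p -> last u p \in S.
  by elim: p u => //= z p IH u _ /andP[/and3P[_ zS _]]; apply: IH.
exists d; split=> //.
- have [_ /(_ 0%N)] := hd q qS; rewrite leqn0 => h; apply/eqP/h.
  by apply/existsP; exists [tuple]; rewrite /= eqxx.
- move=> v vS v0; have [/existsP[t /andP[pt /eqP lt]] _] := hd v vS.
  have := size_tuple t; case/lastP: (tval t) pt lt => [|p z] /=.
    by move=> _ _ E; rewrite -E in v0.
  rewrite rcons_path last_rcons size_rcons => /andP[pp /and3P[uS zS euz]] zv szt.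
  exists (last q p) => //; rewrite -zv; split=> //.
  have [/existsP[t' /andP[pt' /eqP lt']] minu] := hd _ uS.
  have pu : P (last q p) (size p).
    by apply/existsP; exists (in_tuple p); rewrite /= pp eqxx.
  have := minu _ pu; have [_ minv] := hd v vS.
  have /minv : P v (d (last q p)).+1.
    apply/existsP; exists [tuple of rcons t' z].
    rewrite /= rcons_path last_rcons pt' lt' zv eqxx andbT /= /restr.
    by rewrite uS -zv zS.
  by rewrite zv; lia.
- move=> v vS dv0; have [/existsP[t /andP[pt /eqP lt]] _] := hd v vS.
  have := size_tuple t; case: (tval t) lt => [<-//|z p _ /=].
  by rewrite dv0.
- move=> u v uS vS euv; have [_ ->//] := hd v vS.
  have [/existsP[t /andP[pt /eqP lt]] _] := hd u uS.
  apply/existsP; exists [tuple of rcons t v].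
  by rewrite /= rcons_path last_rcons pt lt eqxx /restr uS vS euv.
Qed.

Lemma bfs_geodesic (S : {set T}) q d v : bfs S q d -> v \in S ->
  exists g : nat -> T, [/\ g 0%N = q, g (d v) = v,
    forall i, (i <= d v)%N -> g i \in S /\ d (g i) = i &
    forall i, (i < d v)%N -> e (g i) (g i.+1)].
Proof.
case=> qS dq par zero _ vS.
suff gen n : forall v, d v = n -> v \in S -> exists g : nat -> T,
    [/\ g 0%N = q, g n = v, forall i, (i <= n)%N -> g i \in S /\ d (g i) = i
      & forall i, (i < n)%N -> e (g i) (g i.+1)] by apply: gen.
elim: n {v vS} => [|n IH] v dv vS.
  exists (fun=> q); split=> //; first by rewrite [RHS]zero.
  by move=> i; rewrite leqn0 => /eqP->; rewrite dq.
have v0 : (0 < d v)%N by rewrite dv.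
have [u uS [euv duv]] := par v vS v0.
have {}duv : d u = n by lia.
have [g [g0 gd gi ge]] := IH u duv uS.
exists (fun i => if (i <= n)%N then g i else v); split=> //.
- by rewrite ltnn.
- move=> i; case: (leqP i n) => [h _|ni h]; first exact: gi.
  by rewrite dv vS; split=> //; lia.
- move=> i; rewrite ltnS => h; rewrite h; case: (ltnP i n) => [/ge//|ni].
  by have -> : i = n; [lia|rewrite gd].
Qed.

Lemma bfs_conn (S : {set T}) q d n :
  bfs S q d -> conn [set v in S | d v <= n]%N.
Proof.
move=> b; have [qS dq _ _ _] := b.
set B := [set _ in _ | _]; have qB : q \in B by rewrite inE qS dq.
have csym : connect_sym (restr B) by apply: sym_connect_sym; apply: restr_sym.
have toq v : v \in B -> connect (restr B) q v.
  rewrite inE => /andP[vS vn]; have [g [g0 gd gi ge]] := bfs_geodesic b vS.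
  suff : forall i, (i <= d v)%N -> connect (restr B) q (g i).
    by move/(_ (d v) (leqnn _)); rewrite gd.
  elim=> [|i IH] h; first by rewrite g0.
  apply: connect_trans (IH (ltnW h)) _; apply: connect1.
  have [g1 g2] := gi _ h; have [g3 g4] := gi _ (ltnW h).
  by rewrite /restr !inE g1 g2 g3 g4 ge // !andbT; apply/andP; split; lia.
by apply/connP => x y /toq cx /toq cy; apply: connect_trans cy; rewrite csym.
Qed.

(** [D r] is what has to be avoided on level [r]; it depends on the level because dirty vertices are
    only controlled one level at a time. If every level minus its [D r] were [n]-colourable,
    [col_levels] would colour [A]. *)
Lemma bfs_level (S : {set T}) q d (A : {set T}) (D : nat -> {set T}) m n :
  bfs S q d -> A \subset S -> (forall r, col (D r) m) ->
  ~~ col A (2 * (n + m)) ->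
  exists r (K : {set T}), [/\ K \subset A :\: D r, {in K, forall v, d v = r},
    conn K & ~~ col K n].
Proof.
case=> _ _ _ _ lip /fintype.subsetP sA cD nA.
case: (boolP [exists v : T, ~~ col ([set x in A | d x == d v] :\: D (d v)) n]).
  case/existsP=> v /ncol_comp[K [/fintype.subsetP sK cK nK _]].
  exists (d v), K; split=> //.
    by apply/fintype.subsetP => x /sK; rewrite !inE => /and3P[-> ->].
  by move=> x /sK; rewrite !inE => /and3P[_ _ /eqP].
rewrite negb_exists => /forallP h; case/negP: nA; rewrite mul2n -addnn.
apply: (col_levels (d := d)) => [x y /sA xS /sA yS|x y /sA xS /sA yS|r].
- by rewrite e_sym => /lip; apply.
- exact: lip.
have [/existsP[v /eqP<-]|] := boolP [exists v, d v == r]; last first.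
  rewrite negb_exists => /forallP hr; apply: (col_sub (B := set0)); last exact: col0.
  by apply/fintype.subsetP => x; rewrite !inE (negbTE (hr x)) andbF.
have := h v; rewrite negbK => cv; apply: col_sub (colU cv (cD (d v))).
by apply/fintype.subsetP => x xA; rewrite in_setU in_setD xA andbT orNb.
Qed.

End Connectivity.

(** * Wheels *)

(* Block 0 is the hub and blocks 1, ..., m are the rim in cyclic order; vertices
   with [blk x > m] do not belong to the wheel.  Rim blocks [b] and [b'] are
   consecutive when [b' = (b %% m).+1]. *)
Definition wheel (T : finType) (e : rel T) (m : nat) (blk : T -> nat)
    (sg : T -> bool) : Prop :=
  [/\ odd m /\ (1 < m)%N,
      forall b, (b <= m)%N -> conn e [set x | blk x == b],
      forall x y, e x y -> (blk x <= m)%N -> blk x = blk y -> sg x != sg y,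
      forall x y, e x y -> (blk x <= m)%N -> (blk y <= m)%N -> blk x != blk y ->
        [/\ sg x, sg y & [|| blk x == 0, blk y == 0,
          (blk y).-1 == blk x %% m | (blk x).-1 == blk y %% m]]%N
    & forall i, (i < m)%N ->
        (exists x y, [/\ blk x = 0, blk y = i.+1 & e x y])%N /\
        (exists x y, [/\ blk x = i.+1, blk y = (i.+1 %% m).+1 & e x y])%N].

(** Invariant of a walk on the rim blocks from [b] to [c] that changes block [r] times, [j] times
    forwards: its displacement is [j - (r - j)], so [c + r] and [b + 2j] agree modulo [m]. Here a
    forward change is put in front of the walk, in the next lemma a backward one. *)
Lemma modn_step_up m a b c r j : b.-1 = a %% m -> b != 0 ->
  c + r = b + j.*2 %[mod m] -> c + r.+1 = a + j.+1.*2 %[mod m].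
Proof.
move=> hb b0 E; have Eb : b = a.+1 %[mod m].
  have -> : b = b.-1 + 1 by lia.
  by rewrite hb modnDml addn1.
rewrite -addn1 addnA -(modnDml _ 1) E modnDml doubleS -addnA -(modnDml b) Eb modnDml.
by congr (_ %% _); lia.
Qed.

Lemma modn_step_down m a b c r j : a.-1 = b %% m -> a != 0 ->
  c + r = b + j.*2 %[mod m] -> c + r.+1 = a + j.*2 %[mod m].
Proof.
move=> ha a0 E; have Ea : a = b.+1 %[mod m].
  have -> : a = a.-1 + 1 by lia.
  by rewrite ha modnDml addn1.
rewrite -addn1 addnA -(modnDml _ 1) E modnDml -[RHS]modnDml Ea modnDml.
by congr (_ %% _); lia.
Qed.

(** For a closed walk the displacement [2j - r] is divisible by [m]. It is odd, hence not zero, and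
    at most [r] in absolute value, so [r < m] is impossible. *)
Lemma odd_double_modn m r j : r <= m -> odd r -> j <= r ->
  r = j.*2 %[mod m] -> r = m.
Proof.
rewrite leq_eqVlt => /orP[/eqP//|rm] or jr; rewrite modn_small // => Er.
have [jm|jm] := ltnP j.*2 m.
  by move: Er; rewrite modn_small // => Er; rewrite Er odd_double in or.
have : j.*2 %% m = j.*2 - m by rewrite -{1}(subnK jm) modnDr modn_small //; lia.
by rewrite -Er; lia.
Qed.

Lemma double_le_odd m k : odd m -> 2 * k <= m -> 2 * k <= m - 1.
Proof.
move=> om; rewrite leq_eqVlt => /orP[/eqP E|]; last by lia.
by rewrite -E oddM in om.
Qed.

Section Polytope.
Import Order.TTheory GRing.Theory Num.Theory.
Local Open Scope ring_scope.
Variables (R : realType) (T : finType) (e : rel T).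
Hypothesis e_sym : symmetric e.

Lemma STABP (x : {ffun T -> R}) : STAB R e x ->
  exists (n : nat) (S : 'I_n -> {set T}) (a : 'I_n -> R),
    [/\ forall i, stable e (S i), forall i, 0 <= a i, \sum_i a i = 1
      & forall v, x v = \sum_i a i * (v \in S i)%:R].
Proof.
move=> [n [p [a [hp a0 a1 hx]]]].
have [S hS] : exists S : 'I_n -> {set T}, forall i, stable e (S i) /\
    p i = incidence_vector R (S i).
  apply: (@fin_all_exists _ (fun=> {set T})
    (fun i S => stable e S /\ p i = incidence_vector R S)) => i.
  by have [S sS <-] := hp i; exists S.
exists n, S, a; split=> // [i|v]; first by have [] := hS i.
by rewrite hx; apply: eq_bigr => i _; have [_ ->] := hS i; rewrite ffunE.
Qed.

Lemma stableP (S : {set T}) :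
  reflect {in S &, forall x y, ~~ e x y} (stable e S).
Proof.
apply: (iffP forall_inP) => [h x y xS yS|h x xS].
  by have /forall_inP := h x xS; apply.
by apply/forall_inP => y; apply: h.
Qed.

Lemma tight (n : nat) (a f : 'I_n -> R) M : (forall i, 0 <= a i) ->
  \sum_i a i = 1 -> (forall i, f i <= M) -> \sum_i a i * f i = M ->
  forall i, 0 < a i -> f i = M.
Proof.
move=> a0 a1 fM E i ai; have : \sum_i a i * (M - f i) = 0.
  under eq_bigr do rewrite mulrBr.
  by rewrite sumrB E -mulr_suml a1 mul1r subrr.
move/psumr_eq0P => h.
have /eqP : a i * (M - f i) = 0.
  by apply: h => // j _; rewrite mulr_ge0 // subr_ge0.
by rewrite mulf_eq0 gt_eqF //= subr_eq0 => /eqP.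
Qed.

(** The vertices are grouped into consecutive pairs. *)
Lemma sum_even_path (x : T -> R) (p : seq T) :
  (forall u v, e u v -> x u + x v <= 1) -> sorted e p -> ~~ odd (size p) ->
  2 * \sum_(v <- p) x v <= (size p)%:R.
Proof.
move=> xe; have [n] := ubnP (size p).
elim: n p => // n IH [|u [|v p]] //=.
  by move=> _ _ _; rewrite big_nil mulr0.
rewrite !ltnS => szp /andP[euv pp] op; have := xe _ _ euv.
have := IH p (leq_trans (leqnSn _) szp) (path_sorted pp).
rewrite negbK in op; move=> /(_ op); rewrite !big_cons -[(size p).+2]addn2 natrD.
lra.
Qed.

Section WheelPoint.
Variables (m : nat) (blk : T -> nat) (sg : T -> bool).
Hypothesis W : wheel e m blk sg.
Hypothesis tri : forall x y z, (blk x <= m)%N -> (blk y <= m)%N ->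
  (blk z <= m)%N -> e x y -> e y z -> ~~ e x z.

Let z : R := m%:R^-1.

(* The inequalities of all edges inside blocks are tight at this point, those of
   edges from hub to rim have slack (1 - 1/m)/2 and those along the rim 1/m. *)
Definition wheel_point : {ffun T -> R} := [ffun v =>
  if (m < blk v)%N then 0
  else if blk v == 0%N then (if sg v then z else 1 - z)
  else (if sg v then (1 - z) / 2 else (1 + z) / 2)].

Let mz : m%:R * z = 1.
Proof.
have [[om m1] _ _ _ _] := W; rewrite /z mulfV // pnatr_eq0; lia.
Qed.

Let z_bounds : 0 < z /\ 3 * z <= 1.
Proof.
have [[om m1] _ _ _ _] := W; have m3 : (3 <= m)%N.
  by case: (m) om m1 => [|[|[|]]].
have z0 : 0 < z by rewrite /z invr_gt0 ltr0n; lia.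
split=> //; apply: (@le_trans _ _ (m%:R * z)); last by rewrite mz.
by rewrite ler_pM2r // ler_nat.
Qed.

Let point_ge0 v : 0 <= wheel_point v.
Proof.
by have [? ?] := z_bounds; rewrite ffunE; case: ifP => // _; case: ifP => _;
  case: ifP => _; lra.
Qed.

Let point_le1 v : wheel_point v <= 1.
Proof.
by have [? ?] := z_bounds; rewrite ffunE; case: ifP => // _; try lra;
  case: ifP => _; case: ifP => _; lra.
Qed.

Let gap u v : R := 1 - wheel_point u - wheel_point v.

Let gapE u v : e u v -> (blk u <= m)%N -> (blk v <= m)%N ->
  gap u v = if blk u == blk v then 0 else
    if (blk u == 0%N) || (blk v == 0%N) then (1 - z) / 2 else z.
Proof.
have [_ _ W3 W4 _] := W => euv um vm; rewrite /gap !ffunE !ltnNge um vm /=.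
case: (eqVneq (blk u) (blk v)) => [E|N].
  have := W3 _ _ euv um E; rewrite E; case: (sg u); case: (sg v) => //= _; case: ifP => _; lra.
have [-> -> _] := W4 _ _ euv um vm N.
case: (eqVneq (blk u) 0%N) N => [->|_]; case: (eqVneq (blk v) 0%N) => //= *; lra.
Qed.

Let gap_ge0 u v : e u v -> 0 <= gap u v.
Proof.
move=> euv; have [? ?] := z_bounds.
have [um|um] := leqP (blk u) m; last first.
  by rewrite /gap ffunE um; have := point_le1 v; lra.
have [vm|vm] := leqP (blk v) m; last first.
  by rewrite /gap [wheel_point v]ffunE vm; have := point_le1 u; lra.
by rewrite gapE //; case: ifP => _ //; case: ifP => _; lra.
Qed.

(** Total slack of the edge inequalities along a walk. On a closed walk of length [n] it equals [n]
    minus twice the weight, so an odd cycle inequality says that it is at least 1. *)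
Fixpoint gaps u p : R := if p is v :: p' then gap u v + gaps v p' else 0.

Let gaps_sum u p :
  gaps u p = (size p)%:R - wheel_point u - 2 * (\sum_(v <- p) wheel_point v)
    + wheel_point (last u p).
Proof.
elim: p u => [|v p IH] u /=; first by rewrite big_nil; lra.
by rewrite IH big_cons /gap -natr1; lra.
Qed.

(** Here [h] counts the edges between hub and rim, and [r] those between rim blocks. Edges inside
    blocks reverse the sign and have no slack, crossing edges have two positive ends; this
    determines the final sign. Without hub edges the walk stays in the hub or winds along the
    rim. *)
Let gaps_walk u p : path e u p -> all (fun v => blk v <= m)%N (u :: p) ->
  exists h r, [/\ gaps u p = h%:R * ((1 - z) / 2) + r%:R * z,
    sg (last u p) = sg u (+) odd (size p) (+) odd h (+) odd r,
    (blk (last u p) == 0%N) = (blk u == 0%N) (+) odd h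
  & h = 0%N -> (blk u == 0%N /\ r = 0%N) \/ (blk u != 0%N /\ exists2 j, (j <= r)%N &
      (blk (last u p) + r = blk u + j.*2 %[mod m])%N)].
Proof.
have [_ _ W3 W4 _] := W.
elim: p u => [|v p IH] u /=.
  move=> _ _; exists 0%N, 0%N; rewrite !mul0r addr0 !addbF; split=> // _.
  by case: (eqVneq (blk u) 0%N) => _; [left|right; split=> //; exists 0%N].
move=> /andP[euv pp] /andP[um vpm]; have vm : (blk v <= m)%N by case/andP: vpm.
have [h [r [Eg Es Eb E0]]] := IH v pp vpm; rewrite gapE // Es Eb Eg.
case: (eqVneq (blk u) (blk v)) => [E|N].
  have Nsg := W3 _ _ euv um E.
  exists h, r; rewrite add0r E; split=> //.
  by move: Nsg; case: (sg u) (sg v) (odd _) (odd h) (odd r) => [] [] [] [] [].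
have [su sv hb] := W4 _ _ euv um vm N; rewrite su sv.
case: (boolP ((blk u == 0) || (blk v == 0)))%N => [hr|nhr].
  exists h.+1, r; rewrite -natr1 /=; split=> //; first lra.
  - by case: (odd _) (odd h) (odd r) => [] [] [].
  - move: hr N; case: (eqVneq (blk u) 0%N) => [->|_] /=; case: (eqVneq (blk v) 0%N) => [Ev|_] //=; rewrite ?Ev ?negbK ?eqxx //.
exists h, r.+1; rewrite -natr1 /=; split=> //; first lra.
- by case: (odd _) (odd h) (odd r) => [] [] [].
- by move: nhr; rewrite negb_or => /andP[/negbTE-> /negbTE->].
move=> /E0; move: nhr; rewrite negb_or => /andP[u0 v0]; rewrite (negbTE v0).
case=> [[]//|[_ [j jr Ej]]]; right; split=> //.
move: hb; rewrite (negbTE u0) (negbTE v0) /= => /orP[/eqP hb|/eqP hb].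
  by exists j.+1; [exact: jr|exact: modn_step_up hb v0 Ej].
by exists j; [exact: leqW|exact: modn_step_down hb u0 Ej].
Qed.

(** As the wheel has no triangle, clique inequalities reduce to edges. An odd cycle that leaves the
    wheel has a vertex of weight 0, and the rest is an even path. For the other odd cycles [h] is
    even and [r] is odd. If [h > 0], the slack is at least [(1 - z) + z]; if [h = 0], the cycle
    winds around the rim, so [r >= m] and the slack is at least [m * z = 1]. *)
Lemma wheel_point_HSTAB : HSTAB R e wheel_point.
Proof.
have [? ?] := z_bounds; have [[om m1] _ _ _ _] := W.
have xe u v : e u v -> wheel_point u + wheel_point v <= 1.
  by move/gap_ge0; rewrite /gap; lra.
split=> // [K cK|c /and4P[c2 oc cc uc]].
  pose K' := [set v in K | blk v <= m]%N.
  have -> : \sum_(v in K) wheel_point v = \sum_(v in K') wheel_point v.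
    rewrite [LHS](bigID (fun v => blk v <= m)%N) /= [X in _ + X]big1 ?addr0.
      by apply: eq_bigl => v; rewrite inE.
    by move=> v /andP[_]; rewrite -ltnNge ffunE => ->.
  have cK' x y : x \in K' -> y \in K' -> x != y -> e x y.
    rewrite !inE => /andP[xK _] /andP[yK _].
    by have /forall_inP/(_ x xK)/forall_inP/(_ y yK)/implyP := cK.
  have [->|[x xK]] := set_0Vmem K'; first by rewrite big_set0.
  rewrite (big_setD1 x) //=; have [->|[y yK]] := set_0Vmem (K' :\ x).
    by rewrite big_set0 addr0.
  have := yK; rewrite in_setD1 => /andP[yx yK'].
  rewrite (big_setD1 y) //= big1 => [|t].
    by rewrite addr0; apply: xe; apply: cK'; rewrite // eq_sym.
  rewrite !in_setD1 => /and3P[ty tx tK].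
  have [xm ym tm] : [/\ blk x <= m, blk y <= m & blk t <= m]%N.
    by move: xK yK' tK; rewrite !inE => /andP[_ ->] /andP[_ ->] /andP[_ ->].
  have exy : e x y by apply: cK' => //; rewrite eq_sym.
  have eyt : e y t by apply: cK' => //; rewrite eq_sym.
  have ext : e x t by apply: cK' => //; rewrite eq_sym.
  by have := tri xm ym tm exy eyt; rewrite ext.
case: (boolP (all (fun v => blk v <= m)%N c)) => [allc|]; last first.
  rewrite -has_predC => /hasP[v vc /=]; rewrite -ltnNge => vm.
  have [i p Ep] := rot_to vc; have : cycle e (rot i c) by rewrite rot_cycle.
  rewrite Ep /= rcons_path => /andP[pp _].
  have pc : perm_eq (rot i c) c by rewrite perm_rot.
  rewrite -(perm_big _ pc) Ep big_cons ffunE vm /= add0r.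
  have szp : size c = (size p).+1 by rewrite -(size_rot i) Ep.
  have op : ~~ odd (size p) by move: oc; rewrite szp.
  have := sum_even_path xe (path_sorted pp) op.
  by rewrite szp -[(size p).+1%:R]natr1; lra.
case: c c2 oc cc uc allc => // v p; set n := size (v :: p) => c2 oc cc uc allc.
have allp : all (fun v => blk v <= m)%N (v :: rcons p v).
  by rewrite -rcons_cons all_rcons allc andbT; case/andP: allc.
have [h [r [Eg Es Eb E0]]] := gaps_walk cc allp.
have := gaps_sum v (rcons p v); rewrite big_cons last_rcons size_rcons.
have -> : \sum_(w <- rcons p v) wheel_point w = \sum_(w <- p) wheel_point w + wheel_point v.
  by rewrite -cats1 big_cat big_seq1.
rewrite last_rcons in Es Eb E0; rewrite size_rcons in Es.
have oh : ~~ odd h by move: Eb; case: (blk v == 0)%N; case: odd.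
have or : odd r.
  by move: Es oc; rewrite /n /= (negbTE oh); case: (sg v) (odd (size p)) (odd r) => [] [] [].
suff : 1 <= gaps v (rcons p v) by rewrite -[(size p).+1]/n /=; lra.
rewrite Eg; case: h oh E0 {Eg Es Eb} => [_ /(_ erefl)|[//|h _ _]].
  case=> [[_ r0]|[v0 [j jr Ej]]]; first by rewrite r0 in or.
  rewrite mul0r add0r; apply: (@le_trans _ _ (m%:R * z)); first by rewrite mz.
  rewrite ler_pM2r // ler_nat leqNgt; apply/negP => rm.
  have Er : (r = j.*2 %[mod m])%N by apply/eqP; rewrite -(eqn_modDl (blk v)) Ej.
  by have := rm; rewrite (odd_double_modn (ltnW rm) or jr Er) ltnn.
have r1 : (1 <= r)%N by case: (r) or.
have : 1 * z <= r%:R * z by rewrite ler_pM2r // (ler_nat _ 1).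
have : 2 * ((1 - z) / 2) <= h.+2%:R * ((1 - z) / 2).
  by rewrite ler_wpM2r ?(ler_nat _ 2) //; lra.
lra.
Qed.

(** Write the point as a convex combination of stable sets. Edges inside blocks are tight, so each
    set of positive weight takes from each block either all positive or all negative vertices.
    Consecutive rim blocks are not both taken positively, so at most [(m - 1) / 2] of them are, and
    on average it is exactly this number; hence it is always this number. But a set containing a
    positive hub vertex, which has weight [z > 0], takes no rim block positively. *)
Lemma wheel_not_hperfect : h_perfect R e -> False.
Proof.
move=> hp; have : STAB R e wheel_point by rewrite hp; exact: wheel_point_HSTAB.
case/STABP=> n [S [a [stS a0 a1 xE]]]; have [zp z3] := z_bounds.
have [[om m1] Wc W3 W4 W5] := W; have m0 : (0 < m)%N by lia.
have stSe i x y : x \in S i -> y \in S i -> e x y -> False.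
  by move=> xS yS exy; have /stableP/(_ x y xS yS) := stS i; rewrite exy.
have tightS i : 0 < a i -> forall x y, e x y -> (blk x <= m)%N ->
    blk x = blk y -> (x \in S i) = ~~ (y \in S i).
  move=> ai x y exy xm Exy; have := gapE exy xm; rewrite -Exy eqxx => /(_ xm).
  rewrite /gap !xE => E.
  have := @tight _ a (fun i => (x \in S i)%:R + (y \in S i)%:R) 1 a0 a1.
  have le1 j : (x \in S j)%:R + (y \in S j)%:R <= 1 :> R.
    have := @stSe j x y; case: (x \in _); case: (y \in _) => /= h; try lra.
    by case: h.
  move=> /(_ le1); have -> : \sum_i0 a i0 * ((x \in S i0)%:R + (y \in S i0)%:R) = 1.
    by under eq_bigr do rewrite mulrDr; rewrite big_split /=; lra.
  move=> /(_ erefl i ai); case: (x \in _); case: (y \in _) => //= h; lra.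
have sameS i : 0 < a i -> forall x y, blk x = blk y -> (blk x <= m)%N ->
    ((x \in S i) == sg x) = ((y \in S i) == sg y).
  move=> ai x y Exy xm.
  apply: (conn_const (f := fun v => (v \in S i) == sg v) (Wc _ xm)); rewrite ?inE ?Exy //.
  move=> u v; rewrite !inE => /eqP Eu /eqP Ev euv.
  have um : (blk u <= m)%N by rewrite Eu -Exy.
  have Ebb : blk u = blk v by rewrite Eu Ev.
  have := W3 u v euv um Ebb; rewrite (tightS _ ai u v euv um Ebb).
  by case: (v \in S i); case: (sg u); case: (sg v).
pose good i (xy : T * T) := [&& blk xy.1 == 0, blk xy.2 == i.+1 & e xy.1 xy.2]%N.
have exg (i : 'I_m) : exists xy : T * T, good i xy.
  by have [[x [y [? ? ?]]] _] := W5 i (ltn_ord i); exists (x, y); rewrite /good /=; apply/and3P; split=> //; apply/eqP.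
(* The representative of a rim block is an end of a hub edge; it is therefore positive and has a
   positive hub neighbour, needed for [F0]. *)
pose r (i : 'I_m) := (xchoose (exg i)).2.
have rP i : blk (r i) = i.+1 /\ sg (r i).
  have /and3P[/eqP h1 /eqP h2 h3] := xchooseP (exg i).
  have := W4 _ _ h3; rewrite h1 h2 leq0n ltn_ord => /(_ isT isT isT).
  by case.
have [p0 [bp0 sp0]] : exists p0, blk p0 = 0%N /\ sg p0.
  have [[x [y [bx by_ exy]]] _] := W5 0%N m0.
  exists x; split=> //; have := W4 _ _ exy; rewrite bx by_ leq0n m0.
  by move=> /(_ isT isT isT)[].
pose F i : R := \sum_(j < m) (r j \in S i)%:R.
have nextm (j : 'I_m) : (j.+1 %% m < m)%N by rewrite ltn_mod.
have consec i (j : 'I_m) : 0 < a i ->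
    (r j \in S i) -> (r (Ordinal (nextm j)) \in S i) -> False.
  move=> ai rj rj'; have [_ [x [y [bx by_ exy]]]] := W5 j (ltn_ord j).
  have [b1 s1] := rP j; have [b2 s2] := rP (Ordinal (nextm j)).
  have jj' : blk x != blk y.
    rewrite bx by_ eqSS; have := ltn_ord j.
    rewrite leq_eqVlt => /orP[/eqP jm|jm].
      by rewrite jm modnn -lt0n -ltnS jm.
    by rewrite modn_small // -addn1 -{1}[j : nat]addn0 eqn_add2l.
  have xm : (blk x <= m)%N by rewrite bx ltn_ord.
  have ym : (blk y <= m)%N by rewrite by_.
  have [sx sy _] := W4 _ _ exy xm ym jj'.
  apply: (@stSe i x y) => //.
    have := sameS i ai (r j) x; rewrite b1 bx rj s1 sx => /(_ erefl (ltn_ord j)).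
    by rewrite eqxx; case: (x \in _).
  have := sameS i ai (r (Ordinal (nextm j))) y; rewrite b2 by_ rj' s2 sy.
  by move=> /(_ erefl (nextm j)); rewrite eqxx; case: (y \in _).
(* Adding the count to its cyclic shift gives at most 1 for each consecutive pair, hence at most [m]
   in total; oddness of [m] improves this to [m - 1]. *)
have F2 i : 0 < a i -> 2 * F i <= m%:R - 1.
  move=> ai; pose k := (\sum_(j < m) (r j \in S i))%N.
  have Fk : F i = k%:R by rewrite /F /k natr_sum.
  suff : (2 * k <= m)%N.
    move=> h; rewrite Fk -(natrM _ 2) -(natrB _ m0) ler_nat.
    exact: double_le_odd.
  have shift : k = (\sum_(j < m) (r (Ordinal (nextm j)) \in S i))%N.
    have inj : injective (fun j : 'I_m => Ordinal (nextm j)).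
      move=> j1 j2 /(congr1 val) /= /eqP.
      rewrite -(addn1 j1) -(addn1 j2) eqn_modDr !modn_small //.
      by move/eqP/val_inj.
    by rewrite /k (reindex_inj inj).
  rewrite mul2n -addnn {2}shift /k -big_split /= -[m in (_ <= m)%N]card_ord -sum1_card.
  apply: leq_sum => j _; case E1: (_ \in _); case E2: (_ \in _) => //=.
  by case: (consec i j ai E1 E2).
have sumF : \sum_i a i * (2 * F i) = m%:R - 1.
  have -> : \sum_i a i * (2 * F i) = \sum_(j < m) 2 * wheel_point (r j).
    under [RHS]eq_bigr do rewrite xE mulr_sumr.
    rewrite exchange_big /=; apply: eq_bigr => i _.
    rewrite /F !mulr_sumr; apply: eq_bigr => j _; ring.
  under eq_bigr => j _.
    have [bj sj] := rP j; rewrite ffunE bj sj ltnNge ltn_ord /=.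
    over.
  rewrite sumr_const card_ord -[LHS]mulr_natl.
  have -> : m%:R * (2 * ((1 - z) / 2)) = m%:R - m%:R * z by field.
  by rewrite mz.
have [i0 [ai0 pi0]] : exists i0, 0 < a i0 /\ p0 \in S i0.
  have [/existsP[i /andP[? ?]]|] := boolP [exists i, (0 < a i) && (p0 \in S i)].
    by exists i.
  rewrite negb_exists => /forallP h; exfalso; have : wheel_point p0 = 0.
    rewrite xE big1 // => i _; have := h i.
    case: (p0 \in S i); last by rewrite mulr0.
    by rewrite andbT lt_def a0 andbT negbK => /eqP->; rewrite mul0r.
  by rewrite ffunE bp0 sp0 ltn0 /=; lra.
have F0 : F i0 = 0.
  rewrite /F big1 // => j _; case E: (_ \in _) => //; exfalso.
  have /and3P[/eqP h1 /eqP h2 h3] := xchooseP (exg j).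
  have := W4 _ _ h3; rewrite h1 h2 leq0n ltn_ord => /(_ isT isT isT)[s1 s2 _].
  apply: (@stSe i0 (xchoose (exg j)).1 (r j)) => //.
  have := sameS i0 ai0 p0 (xchoose (exg j)).1; rewrite bp0 h1 pi0 sp0 s1.
  by move=> /(_ erefl isT); rewrite eqxx; case: (_ \in _).
(* [tight] needs its bound at every index, whereas [F2] holds for positive weights only; indices of
   weight 0 get the extreme value. *)
pose f i := if 0 < a i then 2 * F i else m%:R - 1.
have : f i0 = m%:R - 1.
  apply: (tight a0 a1) => //.
    by move=> i; rewrite /f; case: ifP => // /F2.
  rewrite -[RHS]sumF; apply: eq_bigr => i _; rewrite /f; case: ifP => // /negbT.
  by rewrite lt_def a0 andbT negbK => /eqP->; rewrite !mul0r.
rewrite /f ai0 F0 mulr0 => /esym/eqP; rewrite subr_eq0 (eqr_nat _ m 1) => /eqP E.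
by rewrite E in m1.
Qed.

End WheelPoint.
End Polytope.

(** * Induced paths and cycles *)

Section InducedPaths.
Variables (T : finType) (e : rel T).
Hypothesis e_sym : symmetric e.
Hypothesis e_irr : irreflexive e.
Implicit Types (r s t : seq T) (x y w : T).

Lemma nth_ex x0 s x : x \in s -> exists2 i, i < size s & nth x0 s i = x.
Proof. by move/(nthP x0). Qed.

Lemma nth_eq x0 s i j : i < size s -> j < size s -> uniq s ->
  (nth x0 s i == nth x0 s j) = (i == j).
Proof. exact: nth_uniq. Qed.

Fixpoint ipath s : bool :=
  if s is x :: s' then
    [&& x \notin s', (if s' is y :: _ then e x y else true),
        all (fun z => ~~ e x z) (behead s') & ipath s']
  else true.

Lemma ipathP x0 s :
  reflect (uniq s /\ forall i j, i < j < size s ->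
                     e (nth x0 s i) (nth x0 s j) = (j == i.+1)) (ipath s).
Proof.
elim: s => [|x s IH] /=; first by apply: ReflectT; split=> // i j /andP[].
apply: (iffP and4P) => [[xs exy /allP nxs /IH[us h]]|[/andP[xs us] h]].
  split=> [|i [|j] //]; first by rewrite xs.
  case: i => [|i] /= ij; last by rewrite h.
  case: s {IH us h} xs exy nxs ij => [//|y s] xs exy nxs.
  case: j => [|j] /= js; first by rewrite exy.
  by apply/negbTE/nxs/mem_nth.
split=> //; last by apply/IH; split=> // i j ij; exact: (h i.+1 j.+1).
  by case: s {IH xs us} h => // y s h; rewrite (h 0 1).
apply/allP => z /(nth_ex x0)[i]; rewrite size_behead nth_behead => is_ <-.
have /= -> // := h 0 i.+2; by rewrite ltnS -ltn_predRL.
Qed.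

Lemma ipath_uniq s : ipath s -> uniq s.
Proof. by case: s => // x s /(ipathP x)[]. Qed.

Lemma ipath_nth x0 s i j : ipath s -> i < size s -> j < size s ->
  e (nth x0 s i) (nth x0 s j) = (j == i.+1) || (i == j.+1).
Proof.
move=> /(ipathP x0)[us h] si sj; case: (ltngtP i j) => ij.
- by rewrite h ?ij // (_ : (i == j.+1) = false) ?orbF //; lia.
- by rewrite e_sym h ?ij // (_ : (j == i.+1) = false) //; lia.
- by rewrite ij e_irr; lia.
Qed.

Lemma ipath_cat s t : ipath s -> ipath t ->
  (forall x y, x \in s -> y \in t ->
     x != y /\ e x y = (x == last y s) && (y == head x t)) ->
  ipath (s ++ t).
Proof.
move=> ps pt h; case: s ps h => [//|x s ps h].
apply/(ipathP x); have [us hs] := ipathP x _ ps; have [ut ht] := ipathP x _ pt.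
split.
  rewrite cat_uniq us ut andbT /=; apply/hasPn => y yt; apply/negP => ys.
  by have [] := h y y ys yt; rewrite eqxx.
move=> i j; rewrite size_cat => /andP[ij js]; rewrite !nth_cat.
case: (ltnP i (size (x :: s))) => si; case: (ltnP j (size (x :: s))) => sj.
- by apply: hs; rewrite ij.
- have jt : j - size (x :: s) < size t by lia.
  have [_ ->] := h _ _ (mem_nth x si) (mem_nth x jt).
  have -> : last (nth x t (j - size (x :: s))) (x :: s) = nth x (x :: s) (size s).
    exact: last_nth.
  have -> : head (nth x (x :: s) i) t = nth x t 0 by case: (t) jt.
  rewrite !nth_eq //; last by case: (t) jt.
  by move: si sj => /= si sj; lia.
- by exfalso; lia.
- by rewrite ht; lia.
Qed.

Lemma ipath_catl s t : ipath (s ++ t) -> ipath s.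
Proof.
case: s => // x s /(ipathP x)[]; rewrite cat_uniq => /andP[us _] h.
apply/(ipathP x); split=> // i j /andP[ij js].
have /h : i < j < size ((x :: s) ++ t) by rewrite ij size_cat; lia.
by rewrite !nth_cat js (ltn_trans ij js).
Qed.

Lemma ipath_catr s t : ipath (s ++ t) -> ipath t.
Proof. by elim: s => //= x s IH /and4P[_ _ _ /IH]. Qed.

Lemma ipath_cross s t x y : ipath (s ++ t) -> x \in s -> y \in t ->
  x != y /\ e x y = (x == last y s) && (y == head x t).
Proof.
move=> p xs yt; have [u h] := ipathP x _ p.
have := u; rewrite cat_uniq => /and3P[us /hasPn hst ut].
have xy : x != y by apply: contraNneq (hst y yt) => <-.
split=> //; have [i si Ex] := nth_ex x xs; have [j sj Ey] := nth_ex x yt.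
have := h i (size s + j); rewrite size_cat !nth_cat si.
have -> : (size s + j < size s) = false by lia.
rewrite addKn Ex Ey => ->; last by lia.
have -> : last y s = nth x s (size s).-1 by case: (s) si => //= ? ? _; apply: last_nth.
have -> : head x t = nth x t 0 by rewrite nth0.
by rewrite -{1}Ex -{1}Ey !nth_eq //; lia.
Qed.

Lemma ipath_rev s : ipath s -> ipath (rev s).
Proof.
case: s => // x s /[dup] p /(ipathP x)[us h]; apply/(ipathP x).
rewrite rev_uniq us size_rev; split=> // i j /andP[ij js].
rewrite !nth_rev ?(ltn_trans ij js) // (ipath_nth x p); try lia.
Qed.

Lemma ipath_cons x s : ipath s ->
  (forall y, y \in s -> x != y /\ e x y = (y == head x s)) -> ipath (x :: s).
Proof.
move=> ps h; rewrite -cat1s; apply: ipath_cat => // u y; rewrite inE => /eqP-> ys.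
by have [h1 ->] := h y ys; rewrite /= eqxx.
Qed.

Lemma ipath_rcons s x : ipath s ->
  (forall y, y \in s -> x != y /\ e x y = (y == last x s)) -> ipath (rcons s x).
Proof.
move=> ps h; rewrite -cats1; apply: ipath_cat => // y u ys; rewrite inE => /eqP->.
have [h1 h2] := h y ys; rewrite eq_sym e_sym h2 /= eqxx andbT; split=> //.
Qed.

Lemma ipath_mkseq (g : nat -> T) n :
  (forall i j, i < j < n -> g i != g j /\ e (g i) (g j) = (j == i.+1)) ->
  ipath (mkseq g n).
Proof.
move=> h; case: n h => // n h; apply/(ipathP (g 0)); split.
  apply/(uniqP (g 0)) => i j; rewrite !inE size_mkseq => si sj.
  rewrite !nth_mkseq // => E; case: (ltngtP i j) => // ij.
    by have [] := h i j; rewrite ?ij // E eqxx.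
  by have [] := h j i; rewrite ?ij // E eqxx.
move=> i j; rewrite size_mkseq => /andP[ij jn].
by rewrite !nth_mkseq ?(ltn_trans ij jn) //; have [] := h i j; rewrite ?ij.
Qed.

(* [cyc r] says that [r] lists the vertices of an induced cycle in order. *)
Definition cyc r : Prop := uniq r /\
  forall x0 i j, i < j < size r ->
    e (nth x0 r i) (nth x0 r j) = (j == i.+1) || ((i == 0) && (j.+1 == size r)).

Lemma cyc_rot k r : k <= size r -> cyc r -> cyc (rot k r).
Proof.
move=> kr [ur h]; split; first by rewrite rot_uniq.
move=> x0 i j; rewrite size_rot => /andP[ij jr].
rewrite /rot !nth_cat size_drop !nth_drop.
case: (ltnP i (size r - k)) => ik; case: (ltnP j (size r - k)) => jk.
- by rewrite h; lia.
- by rewrite nth_take; [rewrite e_sym h; lia|lia].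
- by exfalso; lia.
- by rewrite !nth_take ?h; lia.
Qed.

Lemma cyc_rcons s w : ipath s -> 1 < size s -> w \notin s ->
  (forall y, y \in s -> e w y = (y == head w s) || (y == last w s)) ->
  cyc (rcons s w).
Proof.
move=> ps s1 ws h; split; first by rewrite rcons_uniq ws ipath_uniq.
have us := ipath_uniq ps.
move=> x0 i j; rewrite size_rcons => /andP[ij js]; rewrite !nth_rcons.
have -> : i < size s by lia.
case: ltnP => sj; first by rewrite (ipath_nth x0 ps); lia.
have -> : j = size s by lia.
have si : i < size s by lia.
rewrite eqxx e_sym h ?mem_nth //; case: s s1 {ps ws h} us si {js ij sj} => // y s _ us si.
rewrite -nth_last /= (set_nth_default x0) //= -[y in X in X || _]/(nth x0 (y :: s) 0).
rewrite -[nth x0 (y :: s) (size s)]/(nth x0 (y :: s) (size s)) !nth_eq //=.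
by lia.
Qed.

End InducedPaths.

(** * Odd holes as rims of wheels *)

Section Wheels.
Variables (T : finType) (e : rel T).
Hypothesis e_sym : symmetric e.
Hypothesis e_irr : irreflexive e.
Hypothesis nowheel : forall m blk sg, ~ wheel e m blk sg.
Implicit Types (r s t : seq T) (x y w : T).

Notation conn := (conn e).
Notation touch := (touch e).
Notation cyc := (cyc e).

Definition indep (A : {set T}) := {in A &, forall x y, e x y = false}.

Section Rim.
Variables (x0 : T) (r : seq T) (P N : {set T}).
Hypothesis cr : cyc r.
Hypothesis or : odd (size r).
Hypothesis cPN : conn (P :|: N).
Hypothesis iP : indep P.
Hypothesis iN : indep N.
Hypothesis rPN : forall x, x \in r -> x \notin P :|: N.
Hypothesis rN : forall x y, x \in N -> y \in r -> e x y = false.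

Let tt i := touch (nth x0 r i) P.
Hypothesis t0 : tt 0.

(* Walking along the hole, a new rim block starts at each vertex touching [P]
   whose predecessor is already positive; elsewhere signs alternate. *)
Fixpoint rim_sign i : bool :=
  if i is k.+1 then tt k.+1 || ~~ rim_sign k else true.

Fixpoint rim_count i : nat :=
  if i is k.+1 then rim_count k + (tt k.+1 && rim_sign k) else 0.

Let rim_sign_count i : rim_sign i = ~~ odd (i + rim_count i).
Proof.
elim: i => //= i ->; case: (tt i.+1); case E: (odd (i + rim_count i)) => /=;
  by rewrite ?addn0 ?addn1 ?addnS /= E.
Qed.

Let touch_sign i : tt i -> rim_sign i.
Proof. by case: i => //= i ->. Qed.

Let count_mono i k : i <= k -> rim_count i <= rim_count k.
Proof.
elim: k => [|k IH]; first by rewrite leqn0 => /eqP->.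
by rewrite leq_eqVlt => /orP[/eqP->//|]; rewrite ltnS => /IH /=; lia.
Qed.

Let n := (size r).-1.
(** If the last vertex is positive, the edge back to the first vertex separates two blocks and adds
    one to the count. If it is negative, the final stretch continues the block of the first vertex,
    and its count [m] is 0 modulo [m]. *)
Let m := rim_count n + rim_sign n.

Let sizer : size r = n.+1.
Proof. by rewrite /n; case: (size r) or. Qed.

Let m_odd : odd m.
Proof.
have := rim_sign_count n; rewrite /m; move: or; rewrite sizer /=.
by rewrite !oddD; case: (odd n); case: (odd (rim_count n)); case: (rim_sign n).
Qed.

(* Every value up to the last one is first attained along an edge whose two
   ends are both positive. *)
Let first_count b : 0 < b -> b <= rim_count n ->
  exists k, [/\ k < n, rim_count k = b.-1, rim_count k.+1 = b, tt k.+1 & rim_sign k].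
Proof.
elim: (n) => [|k IH] /= b0; first by lia.
case: (leqP b (rim_count k)) => [bk _|kb bk].
  by have [i [? ? ? ? ?]] := IH b0 bk; exists i; split=> //; lia.
by exists k; rewrite /= -/(tt k.+1); case: (tt k.+1) (rim_sign k) kb bk => [] [] /= *;
  split=> //; lia.
Qed.

Let idx x := index x r.

Definition rim_block x : nat :=
  if x \in P :|: N then 0
  else if x \in r then (rim_count (idx x) %% m).+1 else m.+1.

Definition rim_sg x : bool := if x \in r then rim_sign (idx x) else x \in P.

Let m0 : 0 < m.
Proof. by case: (m) m_odd. Qed.

Let rU : uniq r. Proof. by case: cr. Qed.

Let idx_nth i : i < n.+1 -> idx (nth x0 r i) = i.
Proof. by move=> h; apply: index_uniq => //; rewrite sizer. Qed.

Let nth_r i : i < n.+1 -> nth x0 r i \in r.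
Proof. by move=> h; apply: mem_nth; rewrite sizer. Qed.

Let r_nth x : x \in r -> exists2 i, i < n.+1 & x = nth x0 r i.
Proof. by move/(nth_ex x0) => [i]; rewrite sizer => ? <-; exists i. Qed.

Let blk_nth i : i < n.+1 -> rim_block (nth x0 r i) = (rim_count i %% m).+1.
Proof. by move=> h; rewrite /rim_block (negbTE (rPN (nth_r h))) nth_r // idx_nth. Qed.

Let sg_nth i : i < n.+1 -> rim_sg (nth x0 r i) = rim_sign i.
Proof. by move=> h; rewrite /rim_sg nth_r // idx_nth. Qed.

Let edge_nth i j : i < j < n.+1 ->
  e (nth x0 r i) (nth x0 r j) = (j == i.+1) || ((i == 0) && (j == n)).
Proof. by case: cr => _ h ij; rewrite h sizer // eqSS. Qed.

Let count_m i : i < n.+1 -> rim_count i <= m.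
Proof. by rewrite ltnS => /count_mono; rewrite /m; lia. Qed.

Let chain b k l : k <= l -> l < n.+1 -> rim_count k = rim_count l ->
  b = (rim_count k %% m).+1 ->
  connect (restr e [set x | rim_block x == b]) (nth x0 r k) (nth x0 r l).
Proof.
move=> kl ln Ekl Eb; elim: l kl ln Ekl => [|l IH] kl ln Ekl.
  by move: kl; rewrite leqn0 => /eqP->.
case: (ltngtP k l.+1) kl => // [kl _|-> _]; last by rewrite connect0.
have El : rim_count k = rim_count l.
  by have := @count_mono k l; have := @count_mono l l.+1; lia.
apply: connect_trans (IH _ _ El) _; try lia.
apply: connect1; rewrite /restr !inE !blk_nth ?Eb; try lia.
by rewrite -El -Ekl !eqxx edge_nth ?eqxx //; lia.
Qed.

(** A position is positive exactly when its index plus its block count is even. The contacts at the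
    odd [j] and the even [k] are positive, so the counts there are odd and even, hence at least 1
    and 2. Since [m] is odd, at least three rim blocks arise around the hub [P :|: N]. *)
Lemma rim_wheel_false j k : j < k < size r -> odd j -> ~~ odd k -> tt j -> tt k ->
  False.
Proof.
rewrite sizer => /andP[jk kn] oj ok tj tk; have nlt : n < n.+1 by [].
have m1 : 1 < m.
  have sj := touch_sign tj; have sk := touch_sign tk.
  rewrite !rim_sign_count !oddD oj (negbTE ok) /= negbK in sj sk.
  have := count_mono (ltnW jk); have := count_mono (kn : k <= n).
  case: (rim_count j) sj => [//|cj] sj; case: (rim_count k) sk => [|[|ck]] // sk.
  by rewrite /m; lia.
have hubN x : x \in P :|: N -> rim_block x = 0 by rewrite /rim_block => ->.
have hub0 x : rim_block x = 0 -> x \in P :|: N.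
  by rewrite /rim_block; case: ifP => //; case: ifP.
have rimB x : rim_block x <= m -> rim_block x != 0 -> x \in r.
  by rewrite /rim_block; case: ifP => //; case: ifP => //; rewrite ltnn.
have hubr x : x \in P :|: N -> x \in r = false.
  by move=> h; apply: contraTF h; exact: rPN.
have tch x y : x \in r -> y \in P :|: N -> e x y -> y \in P /\ rim_sg x.
  move=> xr; rewrite inE => /orP[] yX exy; last by rewrite e_sym rN in exy.
  split=> //; have [i il Ex] := r_nth xr; rewrite Ex sg_nth //.
  by apply: touch_sign; rewrite /tt -Ex; apply/touchP; exists y.
have rimrim i l : i < l < n.+1 -> e (nth x0 r i) (nth x0 r l) ->
    (rim_count i = rim_count l %[mod m] /\ rim_sign i != rim_sign l) \/
    [/\ rim_count i != rim_count l %[mod m], rim_sign i, rim_sign l &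
      (rim_count l %% m == (rim_count i %% m).+1 %% m) ||
      (rim_count i %% m == (rim_count l %% m).+1 %% m)].
  move=> il; rewrite edge_nth // => /orP[/eqP El|/andP[/eqP Ei /eqP El]].
    subst l => /=; rewrite -/(tt i.+1).
    case: (tt i.+1); case: (rim_sign i) => /=; rewrite ?addn0; try by left.
    right; rewrite -[(_ %% m).+1]addn1 modnDml eqxx; split=> //.
    by rewrite -{1}[rim_count i]addn0 eqn_modDl mod0n modn_small.
  subst i l => /=; case E: (rim_sign n); last first.
    have -> : rim_count n = m by rewrite /m E addn0.
    by left; rewrite modnn mod0n.
  have -> : rim_count n = m.-1 by rewrite /m E addn1.
  right; rewrite mod0n modn_small; last by lia.
  by rewrite (prednK m0) modnn eqxx; split=> //; lia.
apply: (nowheel (m := m) (blk := rim_block) (sg := rim_sg)); split.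
- by [].
- move=> b bm; case: b bm => [_|b bm].
    suff -> : [set x | rim_block x == 0] = P :|: N by [].
    by apply/setP => x; rewrite [LHS]inE; apply/eqP/idP => [/hub0|/hubN].
  set B := [set x | _]; apply/connP.
  have csym : connect_sym (restr e B) by apply: sym_connect_sym; apply: restr_sym.
  suff main i l : i <= l -> l < n.+1 -> (rim_count i %% m).+1 = b.+1 ->
      (rim_count l %% m).+1 = b.+1 -> connect (restr e B) (nth x0 r i) (nth x0 r l).
    move=> x y; rewrite !inE => /eqP Bx /eqP By_.
    have [i il Ex] : exists2 i, i < n.+1 & x = nth x0 r i.
      by apply/r_nth/rimB; rewrite Bx.
    have [l ll Ey] : exists2 i, i < n.+1 & y = nth x0 r i.
      by apply/r_nth/rimB; rewrite By_.
    rewrite Ex blk_nth // in Bx; rewrite Ey blk_nth // in By_; rewrite Ex Ey.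
    by case: (leqP i l) => [il'|/ltnW li]; [|rewrite csym]; apply: main.
  move=> il ln Ei El; have := count_mono il; rewrite leq_eqVlt => /orP[/eqP Eil|lt].
    exact: chain.
  have cl := count_m ln.
  have Em : rim_count l = m.
    move: cl; rewrite leq_eqVlt => /orP[/eqP//|clm].
    by move: Ei El; rewrite !modn_small ?(ltn_trans lt) //; lia.
  have Ei0 : rim_count i = 0.
    by move: Ei El; rewrite Em modnn modn_small -?Em //; lia.
  have b0 : b = 0 by move: El; rewrite Em modnn; lia.
  have En : rim_count n = m.
    by have := count_m nlt; have := @count_mono l n; lia.
  have c0 : connect (restr e B) (nth x0 r 0) (nth x0 r i).
    by apply: chain; rewrite //= ?mod0n ?b0 //; lia.
  have cn : connect (restr e B) (nth x0 r l) (nth x0 r n).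
    by apply: chain; rewrite //= ?Em ?modnn ?b0 //; lia.
  apply: (@connect_trans _ _ (nth x0 r 0)); first by rewrite csym.
  rewrite csym; apply: (connect_trans cn); rewrite csym.
  apply: connect1; rewrite /restr !inE !blk_nth // En modnn mod0n b0 !eqxx /=.
  have n0 : 0 < n by lia.
  by rewrite edge_nth ?n0 // !eqxx orbT.
- move=> x y exy bm Eb; have [x0b|xb] := eqVneq (rim_block x) 0.
    have xh := hub0 _ x0b; have yh := hub0 y; rewrite -Eb in yh; have {}yh := yh x0b.
    rewrite /rim_sg !hubr //; move: xh yh; rewrite !inE.
    case xP: (x \in P); case yP: (y \in P) => //=; first by rewrite iP in exy.
    by move=> xN yN; rewrite iN in exy.
  have xr := rimB x bm xb; have yr : y \in r by apply: rimB; rewrite -Eb.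
  have [i il Ex] := r_nth xr; have [l ll Ey] := r_nth yr.
  move: Eb; rewrite Ex Ey !blk_nth // !sg_nth // => -[Eb].
  rewrite Ex Ey in exy; case: (ltngtP i l) => il'.
  + have il2 : i < l < n.+1 by rewrite il'.
    have [[_ //]|[+ _ _ _]] := rimrim i l il2 exy.
    by rewrite Eb eqxx.
  + have il2 : l < i < n.+1 by rewrite il'.
    rewrite e_sym in exy; have [[_ h]|[+ _ _ _]] := rimrim l i il2 exy.
      by rewrite eq_sym.
    by rewrite Eb eqxx.
  + by rewrite il' e_irr in exy.
- have key x y : e x y -> rim_block x <= m -> rim_block y <= m ->
      rim_block x != rim_block y -> rim_block x != 0 ->
      [/\ rim_sg x, rim_sg y & [|| rim_block x == 0, rim_block y == 0,
       (rim_block y).-1 == rim_block x %% m | (rim_block x).-1 == rim_block y %% m]].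
    move=> exy bx by_ bxy xb; have xr := rimB x bx xb.
    have [y0|yb] := eqVneq (rim_block y) 0.
      have [yP sx] := tch x y xr (hub0 _ y0) exy; rewrite sx orbT; split=> //.
      by rewrite /rim_sg hubr ?hub0.
    have yr : y \in r by apply: rimB.
    have [i il Ex] := r_nth xr; have [l ll Ey] := r_nth yr.
    move: bxy; rewrite Ex Ey !blk_nth // !sg_nth // eqSS => bxy /=.
    rewrite Ex Ey in exy; case: (ltngtP i l) => il'.
    + have il2 : i < l < n.+1 by rewrite il'.
      have [[E _]|[_ -> -> ->]] := rimrim i l il2 exy; last by [].
      by rewrite E eqxx in bxy.
    + have il2 : l < i < n.+1 by rewrite il'.
      rewrite e_sym in exy; have [[E _]|[_ -> -> h]] := rimrim l i il2 exy.
        by rewrite E eqxx in bxy.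
      by rewrite orbC h.
    + by rewrite il' e_irr in exy.
  move=> x y exy bx by_ bxy; case: (boolP (rim_block x == 0)) => xb; last first.
    by have := key x y exy bx by_ bxy xb; rewrite (negbTE xb).
  have yb : rim_block y != 0 by rewrite -(eqP xb) eq_sym.
  have eyx : e y x by rewrite e_sym.
  have byx : rim_block y != rim_block x by rewrite eq_sym.
  by have [sy sx _] := key y x eyx by_ bx byx yb; split; rewrite ?orTb.
- move=> i im.
  have [k0 [k0n kc kt]] : exists k0, [/\ k0 < n.+1, rim_count k0 = i & tt k0].
    case: i im => [|i] im; first by exists 0.
    have [//||l [ln _ lc lt _]] := first_count (b := i.+1).
      by move: im; rewrite /m; case: (rim_sign n); lia.
    by exists l.+1.
  have bk : rim_block (nth x0 r k0) = i.+1 by rewrite blk_nth // kc modn_small.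
  split.
    have /touchP[p pP ep] := kt; exists p, (nth x0 r k0).
    by rewrite e_sym ep hubN // inE pP.
  have [im'|im'] := ltnP i.+1 m.
    have [//||l [ln lc lc' _ _]] := first_count (b := i.+1).
      by move: im'; rewrite /m; case: (rim_sign n); lia.
    exists (nth x0 r l), (nth x0 r l.+1).
    by rewrite !blk_nth ?lc ?lc' //= ?modn_small ?edge_nth ?eqxx //; lia.
  have Em : i.+1 = m by lia.
  rewrite Em modnn; case E: (rim_sign n).
    have n0 : 0 < n by lia.
    exists (nth x0 r n), (nth x0 r 0); rewrite !blk_nth // mod0n.
    rewrite (_ : rim_count n = i); last by move: Em; rewrite /m E; lia.
    by rewrite modn_small // Em e_sym edge_nth ?n0 // !eqxx orbT.
  have En : rim_count n = m by rewrite /m E addn0.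
  have [//||l [ln lc lc' _ _]] := first_count (b := m); first by rewrite En.
  exists (nth x0 r l), (nth x0 r l.+1).
  rewrite !blk_nth ?lc ?lc' ?modnn ?modn_small ?edge_nth ?eqxx //.
  - by rewrite prednK.
  - by rewrite ltnSn.
  - by rewrite ltn_predL.
  - exact: ltnW.
Qed.

End Rim.
End Wheels.

(** * Odd holes in sets that are not bipartite *)

Section OddHoles.
Variables (T : finType) (e : rel T).
Hypothesis e_sym : symmetric e.
Hypothesis e_irr : irreflexive e.
Implicit Types (r s t : seq T) (x y w : T).

Definition closed_walk (R : {set T}) (f : nat -> T) n : Prop :=
  f n = f 0 /\ forall i, i < n -> restr e R (f i) (f i.+1).

(** Induction on the length. A repeated vertex splits the walk into two shorter closed walks, and so
    does a chord, which is then used by both; one of the two lengths is odd. A walk with neither is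
    an induced cycle. *)
Lemma closed_walk_hole (R : {set T}) f n : odd n -> closed_walk R f n ->
  exists r, [/\ cyc e r, odd (size r), 2 < size r & {subset r <= R}].
Proof.
have [k] := ubnP n; elim: k n f => // k IH n f nk on [fn fe].
have fR i : i <= n -> f i \in R.
  case: i => [|i] h; last by have /and3P[] := fe i h.
  by have n0 : 0 < n; [case: (n) on|have /and3P[] := fe 0 n0].
have step i : i < n -> e (f i) (f i.+1) by move=> h; have /and3P[] := fe i h.
have n1 : n != 1.
  by apply/eqP => n1; have := step 0; rewrite -{2}n1 fn e_irr n1 => /(_ isT).
have n3 : 2 < n by case: (n) on n1 => [|[|[|]]].
have [/existsP[i /existsP[j /and3P[ij Ef nij]]]|] := boolP
  [exists i : 'I_n.+1, exists j : 'I_n.+1,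
     [&& i < j, f i == f j & ~~ ((i == 0 :> nat) && (j == n :> nat))]].
  have jn : j <= n by rewrite -ltnS.
  have [od|ed] := boolP (odd (j - i)).
    apply: (IH (j - i) (fun k => f (i + k))) => //; first by lia.
    split=> [|l lj]; first by rewrite addn0 subnKC ?(eqP Ef) // ltnW.
    by rewrite addnS; apply: fe; lia.
  apply: (IH (n - (j - i)) (fun k => if k <= i then f k else f (k + (j - i)))).
  - by lia.
  - by rewrite oddB ?on ?(negbTE ed) //; lia.
  - split=> [|l lj] /=.
      case: leqP => h; last by rewrite subnK //; lia.
      by have -> : n - (j - i) = i; [lia|rewrite (eqP Ef) -fn; congr f; lia].
    case: (ltngtP l i) => li.
    + by apply: fe; lia.
    + by rewrite addSn; apply: fe; lia.
    + by rewrite li (eqP Ef) (_ : i.+1 + _ = j.+1); [apply: fe|]; lia.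
rewrite negb_exists => /forallP inj.
have {}inj i j : i < j <= n -> f i = f j -> i = 0 /\ j = n.
  move=> /andP[ij jn] Ef; have ilt : i < n.+1 by lia.
  have := inj (Ordinal ilt); rewrite negb_exists => /forallP/(_ (Ordinal (jn : j < n.+1))).
  by rewrite /= ij Ef eqxx /= negbK => /andP[/eqP-> /eqP->].
have [/existsP[i /existsP[j /and3P[ij ef nij]]]|] := boolP
  [exists i : 'I_n, exists j : 'I_n,
     [&& i.+1 < j, e (f i) (f j) & ~~ ((i == 0 :> nat) && (j == n.-1 :> nat))]].
  have jn := ltn_ord j.
  have [od|ed] := boolP (odd (j - i)).
    apply: (IH (n - (j - i) + 1)
      (fun k => if k <= i then f k else f (k + (j - i) - 1))).
    - by lia.
    - by rewrite oddD oddB ?on ?od //; lia.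
    split=> [|l lj] /=.
      by rewrite ifN; [rewrite -fn; congr f; lia|lia].
    case: (ltngtP l i) => li.
    + by apply: fe; lia.
    + rewrite (_ : l.+1 + (j - i) - 1 = (l + (j - i) - 1).+1); last by lia.
      by apply: fe; lia.
    + rewrite li (_ : i.+1 + _ - _ = j); last by lia.
      by rewrite /restr ef !fR //; lia.
  apply: (IH (j - i + 1) (fun k => if k <= j - i then f (i + k) else f i)).
  - by lia.
  - by rewrite oddD (negbTE ed).
  split=> [|l lj] /=; first by rewrite ifN ?addn0 //; lia.
  case: (ltngtP l (j - i)) => li.
  + by rewrite addnS; apply: fe; lia.
  + by lia.
  + rewrite li (_ : i + (j - i) = j); last by lia.
    by rewrite /restr e_sym ef !fR //; lia.
rewrite negb_exists => /forallP cho.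
have {}cho i j : i.+1 < j < n -> e (f i) (f j) -> i = 0 /\ j = n.-1.
  move=> /andP[ij jn] ef; have ilt : i < n by lia.
  have := cho (Ordinal ilt); rewrite negb_exists => /forallP/(_ (Ordinal jn)).
  by rewrite /= ij ef /= negbK => /andP[/eqP-> /eqP->].
exists (mkseq f n); rewrite size_mkseq; split=> //; last first.
  by move=> x /mapP[i]; rewrite mem_iota => /andP[_ h] ->; apply: fR; lia.
split.
  rewrite map_inj_in_uniq ?iota_uniq // => i j; rewrite !mem_iota => hi hj Ef.
  case: (ltngtP i j) => // ij.
    by have := inj i j; case=> //; lia.
  by have := inj j i; case=> //; lia.
move=> x0 i j; rewrite size_mkseq => /andP[ij jn]; rewrite !nth_mkseq ?(ltn_trans ij) //.
apply/idP/idP => [ef|/orP[/eqP->|/andP[/eqP-> /eqP jn']]].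
- case: (ltngtP j i.+1) => //= ij'; first by lia.
  by have [-> ->] := cho i j (introT andP (conj ij' jn)) ef; lia.
- by apply: step; lia.
- by rewrite e_sym -fn -jn'; apply: step.
Qed.

(** In the bipartite double cover [D], a path between the two lifts of a vertex projects to an odd
    closed walk. If no vertex has connected lifts, comparing the ranks of the components of the two
    lifts is a proper 2-colouring, since along an edge these components are exchanged. *)
Lemma ncol2_hole (R : {set T}) : ~~ col e R 2 ->
  exists r, [/\ cyc e r, odd (size r), 2 < size r & {subset r <= R}].
Proof.
pose D : rel (T * bool) := fun u v => restr e R u.1 v.1 && (u.2 != v.2).
have Dsym : connect_sym D.
  by apply: sym_connect_sym => u v; rewrite /D restr_sym // eq_sym.
have [/existsP[x cx] _|] := boolP [exists x : T, connect D (x, false) (x, true)].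
  have /connectP[p pp lp] := cx.
  pose f i := (nth (x, false) ((x, false) :: p) i).1.
  have par : forall u, path D u p -> (last u p).2 = u.2 (+) odd (size p).
    elim: (p) => [|v q IH] u /=; first by rewrite addbF.
    by move=> /andP[/andP[_ uv] /IH->]; case: (u.2) (v.2) uv => [] [] //; case: odd.
  have op : odd (size p) by have := par _ pp; rewrite -lp.
  apply: (closed_walk_hole op (f := f)); split.
    by rewrite /f -last_nth -lp.
  by move=> i ip; have /(pathP (x, false))/(_ i ip)/andP[] := pp.
rewrite negb_exists => /forallP nc; case/negP; apply/colP.
pose rk u := enum_rank (fingraph.root D u) : nat.
exists (fun x => nat_of_bool (rk (x, false) < rk (x, true))); split=> [x _|x y xR yR exy].
  by rewrite ltnS leq_b1.
have E b : rk (x, b) = rk (y, ~~ b).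
  rewrite /rk; congr (nat_of_ord (enum_rank _)); apply/eqP; rewrite root_connect //.
  by apply: connect1; rewrite /D /restr /= xR yR exy; case: b.
have := E true; have := E false => /= -> ->.
have : rk (y, true) != rk (y, false).
  apply: contra (nc y) => /eqP/ord_inj/enum_rank_inj/eqP.
  by rewrite root_connect // Dsym.
by case: ltngtP.
Qed.

End OddHoles.

(** * Four connected blocks; odd rings *)

Section Rings.
Variables (T : finType) (e : rel T).
Hypothesis e_sym : symmetric e.
Hypothesis e_irr : irreflexive e.
Hypothesis tri : forall x y z, e x y -> e y z -> e x z = false.
Hypothesis nowheel : forall m blk sg, ~ wheel e m blk sg.
Implicit Types (r s t : seq T) (x y w : T) (A B K P N X : {set T}).

Notation conn := (conn e).
Notation touch := (touch e).
Notation col := (col e).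
Notation ipath := (ipath e).
Notation indep := (indep e).

(** The wheel with [m = 3]: three rim blocks are pairwise consecutive, so the cyclic order imposes
    nothing and the four blocks play equal roles. *)
Lemma K4_false (B0 B1 B2 B3 : {set T}) (sg : T -> bool) :
  conn B0 -> conn B1 -> conn B2 -> conn B3 ->
  [/\ [disjoint B0 & B1], [disjoint B0 & B2], [disjoint B0 & B3],
      [disjoint B1 & B2] & [disjoint B1 & B3] /\ [disjoint B2 & B3]] ->
  (forall B, B \in [:: B0; B1; B2; B3] ->
     {in B &, forall x y, e x y -> sg x != sg y}) ->
  (forall A B, A \in [:: B0; B1; B2; B3] -> B \in [:: B0; B1; B2; B3] -> A != B ->
     {in A & B, forall x y, e x y -> sg x}) ->
  [/\ exists2 x, x \in B0 & touch x B1, exists2 x, x \in B0 & touch x B2,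
      exists2 x, x \in B0 & touch x B3, exists2 x, x \in B1 & touch x B2
    & (exists2 x, x \in B1 & touch x B3) /\ (exists2 x, x \in B2 & touch x B3)] ->
  False.
Proof.
move=> c0 c1 c2 c3 [d01 d02 d03 d12 [d13 d23]] hin hout [t01 t02 t03 t12 [t13 t23]].
pose blk x := if x \in B0 then 0 else if x \in B1 then 1 else
  if x \in B2 then 2 else if x \in B3 then 3 else 4.
have disj A B x : [disjoint A & B] -> x \in A -> x \in B = false.
  by move=> /pred0P/(_ x) /= /[swap] -> /=.
have b0 x : x \in B0 -> blk x = 0 by rewrite /blk => ->.
have disj' A B x : [disjoint B & A] -> x \in A -> x \in B = false.
  by rewrite disjoint_sym; apply: disj.
have b1 x : x \in B1 -> blk x = 1.
  by move=> h; rewrite /blk h (disj' B1 B0).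
have b2 x : x \in B2 -> blk x = 2.
  by move=> h; rewrite /blk h (disj' B2 B0) ?(disj' B2 B1).
have b3 x : x \in B3 -> blk x = 3.
  by move=> h; rewrite /blk h (disj' B3 B0) ?(disj' B3 B1) ?(disj' B3 B2).
pose Bs b := nth B3 [:: B0; B1; B2; B3] b.
have blkB x : blk x <= 3 -> x \in Bs (blk x).
  by rewrite /Bs /blk; do 4 (case: ifP => //).
have BsE b : b <= 3 -> [set x | blk x == b] = Bs b.
  move=> bm; apply/setP => x; rewrite inE; apply/eqP/idP => [E|].
    by rewrite -E; apply: blkB; rewrite E.
  by case: b bm => [|[|[|[|]]]] //= _; [apply: b0|apply: b1|apply: b2|apply: b3].
have Bsm b : b <= 3 -> Bs b \in [:: B0; B1; B2; B3].
  by move=> h; apply: mem_nth.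
have sgout x y : e x y -> blk x <= 3 -> blk y <= 3 -> blk x != blk y -> sg x.
  move=> exy bx by_ bxy; apply: (hout _ _ (Bsm _ bx) (Bsm _ by_) _ x y) => //; try exact: blkB.
  apply: contra bxy => /eqP E; have := blkB x bx; rewrite E -BsE // inE => /eqP->.
  by [].
apply: (nowheel (m := 3) (blk := blk) (sg := sg)); split=> //.
- by move=> b bm; rewrite BsE //; case: b bm => [|[|[|[|]]]].
- move=> x y exy bx E; apply: (hin _ (Bsm _ bx) x y) => //; first exact: blkB.
  by rewrite E; apply: blkB; rewrite -E.
- move=> x y exy bx by_ bxy; split; first exact: sgout bxy.
    by apply: (sgout y x); rewrite 1?e_sym 1?eq_sym.
  by case: (blk x) (blk y) bx by_ bxy => [|[|[|[|]]]] // [|[|[|[|]]]].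
- have ex A B a b : (forall x, x \in A -> blk x = a) -> (forall x, x \in B -> blk x = b) ->
      (exists2 x, x \in A & touch x B) -> exists x y, [/\ blk x = a, blk y = b & e x y].
    by move=> hA hB [x xA /touchP[y yB exy]]; exists x, y; rewrite hA ?hB.
  move=> [|[|[|]]] // _; split.
  + exact: ex t01.
  + exact: ex t12.
  + exact: ex t02.
  + exact: ex t23.
  + exact: ex t03.
  + have [x [y [? ? ?]]] := ex _ _ _ _ b1 b3 t13; exists y, x.
    by rewrite e_sym.
Qed.

Lemma conn_addset A B : conn A -> (forall x, x \in B -> touch x A) -> conn (A :|: B).
Proof.
move=> cA h; pose A' := A :|: B.
have [->|[x0 x0B]] := set_0Vmem B; first by rewrite setU0.
have /touchP[a aA _] := h x0 x0B.
have csym : connect_sym (restr e A') by apply: sym_connect_sym; apply: restr_sym.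
have sA : A \subset A' by apply: subsetUl.
have toa x : x \in A' -> connect (restr e A') a x.
  case/setUP => [xA|xB].
    by apply: connect_subset sA _; move/connP: cA; apply.
  have /touchP[y yA exy] := h x xB.
  apply: (@connect_trans _ _ y); first by apply: connect_subset sA _; move/connP: cA; apply.
  by apply: connect1; rewrite /restr !inE yA xB orbT e_sym.
apply/connP => x y /toa cx /toa cy; apply: connect_trans cy.
by rewrite csym.
Qed.

Definition nbr x : {set T} := [set y | e x y].

Lemma nbr_indep x : indep (nbr x).
Proof. by move=> y z; rewrite !inE => xy xz; apply/negbTE/negP => yz; rewrite (tri xy yz) in xz. Qed.

Lemma col_nbr A x : col (A :&: nbr x) 1.
Proof.
apply: col_indep => y z; rewrite inE => /andP[_ hy]; rewrite inE => /andP[_ hz].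
by rewrite (nbr_indep hy hz).
Qed.

(** An odd hole in [R] would touch [P] at every vertex, in particular at the positions 0, 1 and 2,
    and would be a rim around the hub [P :|: N]. *)
Lemma col2_touch (R P N : {set T}) : conn (P :|: N) -> indep P -> indep N ->
  (forall x, x \in R -> x \notin P :|: N) ->
  (forall x y, x \in R -> y \in N -> e x y = false) ->
  (forall x, x \in R -> touch x P) -> col R 2.
Proof.
move=> cPN iP iN hd hN ht; apply: contraT => /(ncol2_hole e_sym e_irr)[r [cr or r2 rR]].
have x0 : T by case: (r) r2.
have tc i : i < size r -> touch (nth x0 r i) P.
  by move=> h; apply/ht/rR/mem_nth.
exfalso; apply: (rim_wheel_false e_sym e_irr nowheel cr or cPN iP iN
  _ _ (tc 0 _) (j := 1) (k := 2)) => //; try by apply: tc; lia.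
- by move=> x /rR/hd.
- by move=> x y xN /rR yR; rewrite e_sym hN.
- by lia.
Qed.

(** The hub is the star of [u]; its leaves are stable for lack of triangles and form the positive
    side. *)
Lemma col2_N2 (u : T) K : (forall x, x \in K -> [/\ x != u, e x u = false &
  exists2 w, e u w & e w x]) -> col K 2.
Proof.
move=> h; apply: (col2_touch (P := nbr u) (N := [set u])).
- rewrite setUC; apply: conn_addset (conn1 _ _) _ => x; rewrite inE => ux.
  by apply/touchP; exists u; rewrite ?inE // e_sym.
- exact: nbr_indep.
- by move=> x y /set1P-> /set1P->.
- by move=> x /h[xu exu _]; rewrite !inE negb_or e_sym exu.
- by move=> x y /h[_ exu _] /set1P->.
- by move=> x /h[_ _ [w uw wx]]; apply/touchP; exists w; rewrite ?inE // e_sym.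
Qed.

(** [W] is 2-colourable by the hub [X1 :|: X2]. Adding one colour class of [W] to the hub, on the
    side of [X2], keeps it bipartite, and [K] sees the enlarged hub only through that class. So the
    part of [K] touching the class is 2-colourable as well. *)
Lemma col4_hub (X1 X2 W K : {set T}) : conn (X1 :|: X2) -> indep X1 -> indep X2 ->
  (forall w, w \in W -> [/\ w \notin X1 :|: X2, touch w X1 &
      forall y, y \in X2 -> e w y = false]) ->
  (forall x, x \in K -> [/\ x \notin X1 :|: X2,
      forall y, y \in X1 :|: X2 -> e x y = false & touch x W]) ->
  col K 4.
Proof.
move=> cX i1 i2 hW hK.
have /colP[f [f2 fP]] : col W 2.
  apply: (col2_touch cX i1 i2); first by move=> x /hW[].
    by move=> x y /hW[_ _ h] /h.
  by move=> x /hW[].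
pose Wb b := [set w in W | f w == b].
pose Kb b := [set x in K | touch x (Wb b)].
suff cK b : col (Kb b) 2.
  apply: col_sub (colU (cK 0) (cK 1)); apply/fintype.subsetP => x xK.
  have [_ _ /touchP[w wW xw]] := hK x xK; rewrite !inE xK /=.
  have := f2 w wW; case E: (f w) => [|[|]] // _; apply/orP; [left|right];
    by apply/touchP; exists w; rewrite // inE wW E.
have sW w : w \in Wb b -> w \in W by rewrite inE => /andP[].
apply: (col2_touch (P := X2 :|: Wb b) (N := X1)).
- rewrite setUC setUA; apply: conn_addset => // w /sW/hW[_ /touchP[y yX wy] _].
  by apply/touchP; exists y; rewrite // inE yX.
- move=> x y /setUP[xX|xW] /setUP[yX|yW].
  + exact: i2.
  + by rewrite e_sym; have [_ _ ->] := hW y (sW y yW).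
  + by have [_ _ ->] := hW x (sW x xW).
  + apply/negbTE/negP => exy; have := fP x y (sW _ xW) (sW _ yW) exy.
    by move: xW yW; rewrite !inE => /andP[_ /eqP->] /andP[_ /eqP->]; rewrite eqxx.
- by [].
- move=> x; rewrite inE => /andP[/hK[xX xa _] _]; move: xX; rewrite !inE !negb_or.
  case/andP=> -> -> /=; rewrite andbT negb_and; apply/orP; left.
  apply: contraTN isT => /hW[_ /touchP[y yX xy] _].
  by rewrite xa // inE yX in xy.
- by move=> x y; rewrite inE => /andP[/hK[_ xa _] _] yX; rewrite xa // inE yX.
- move=> x; rewrite inE => /andP[_ /touchP[w wW xw]].
  by apply/touchP; exists w; rewrite // inE wW orbT.
Qed.

Definition seg s m n : {set T} :=
  [set x | [exists i : 'I_(size s), (m <= i < n) && (x == nth x s i)]].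

Lemma segP x0 s m n x :
  reflect (exists2 i, m <= i < n /\ i < size s & x = nth x0 s i) (x \in seg s m n).
Proof.
rewrite inE; apply: (iffP existsP) => [[i /andP[h /eqP E]]|[i [h si] E]].
  by exists i; [split|rewrite {1}E; apply: set_nth_default].
exists (Ordinal si); rewrite h /= {1}E; apply/eqP; exact: set_nth_default.
Qed.

Lemma conn_seg s m n : ipath s -> conn (seg s m n).
Proof.
case: s => [_|x0 s0].
  by apply/connP => x y; rewrite inE => /existsP[[]].
set s := x0 :: s0 => ps; apply/connP.
have csym : connect_sym (restr e (seg s m n)).
  by apply: sym_connect_sym; apply: restr_sym.
suff main i j : m <= i -> i <= j -> j < n -> j < size s ->
    connect (restr e (seg s m n)) (nth x0 s i) (nth x0 s j).
  move=> x y /(segP x0)[i [/andP[mi ni] si] ->] /(segP x0)[j [/andP[mj nj] sj] ->].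
  by case: (leqP i j) => [ij|/ltnW ij]; [|rewrite csym]; apply: main.
move=> mi; elim: j => [|j IH] ij jn sj; first by move: ij; rewrite leqn0 => /eqP->.
case: (ltngtP i j.+1) ij => // [ij _|-> _]; last by rewrite connect0.
apply: connect_trans (IH _ _ _) _; try lia.
apply: connect1; rewrite /restr (ipath_nth e_sym e_irr x0 ps) ?eqxx //; last by lia.
rewrite andbT; apply/andP; split; apply/(segP x0); [exists j|exists j.+1] => //; lia.
Qed.

Lemma conn_ipath s : ipath s -> conn [set x in s].
Proof.
move=> ps; have -> : [set x in s] = seg s 0 (size s); last exact: conn_seg.
apply/setP => x; rewrite inE; apply/idP/(segP x) => [/(nth_ex x)[i si E]|[i [_ si] ->]].
  by exists i.
exact: mem_nth.
Qed.

(* [rcons s w] is an odd hole, as [size s] is even and [w] sees the two ends of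
   the induced path [s] only. *)
Definition ring s w : Prop := [/\ ipath s, ~~ odd (size s), 1 < size s, w \notin s
  & forall y, y \in s -> e w y = (y == head w s) || (y == last w s)].

Lemma ring_alternate s w P N i1 i2 i3 : ring s w ->
  conn (P :|: N) -> indep P -> indep N ->
  (forall x, x \in rcons s w -> x \notin P :|: N) ->
  (forall x y, x \in N -> y \in rcons s w -> e x y = false) ->
  i1 < i2 -> i2 < i3 < size s -> odd i1 != odd i2 -> odd i2 != odd i3 ->
  touch (nth w s i1) P -> touch (nth w s i2) P -> touch (nth w s i3) P -> False.
Proof.
move=> [ps es s1 ws hw] cPN iP iN hd hN i12 /andP[i23 i3s] o12 o23 t1 t2 t3.
have cr := cyc_rcons e_sym e_irr ps s1 ws hw.
have szr : size (rcons s w) = (size s).+1 by rewrite size_rcons.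
have i1r : i1 <= size (rcons s w) by rewrite szr; lia.
have cr' := cyc_rot e_sym i1r cr.
have nthE i : i1 <= i -> i < size s -> nth w (rot i1 (rcons s w)) (i - i1) = nth w s i.
  move=> h1 h2; rewrite /rot nth_cat size_drop szr nth_drop.
  by rewrite ifT ?subnKC ?nth_rcons ?h2 //; lia.
apply: (rim_wheel_false e_sym e_irr nowheel (x0 := w) cr' _ cPN iP iN _ _ _
  (j := i2 - i1) (k := i3 - i1)); rewrite ?size_rot ?szr /= ?(negbTE es) //.
- by move=> x; rewrite mem_rot => /hd.
- by move=> x y xN; rewrite mem_rot; apply: hN.
- by rewrite -(subnn i1) nthE //; lia.
- by lia.
- by rewrite oddB; [case: (odd i1) (odd i2) o12 => [] []|lia].
- by rewrite oddB; [case: (odd i1) (odd i2) (odd i3) o12 o23 => [] [] []|lia].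
- by rewrite nthE //; lia.
- by rewrite nthE //; lia.
Qed.

End Rings.

Ltac nlia := repeat match goal with
  | H : is_true (leq _ _) |- _ => revert H
  | H : is_true (leq _ _ && leq _ _) |- _ => revert H
  | H : is_true ((_ == _ :> nat) || (_ == _ :> nat)) |- _ => revert H
  | H : is_true (negb (@eq_op _ ?a _)) |- _ => let t := type of a in unify t nat; revert H
  | H : @eq _ ?a _ |- _ => let t := type of a in unify t nat; revert H
  end; clear; intros; lia.

(** * Colouring around an odd ring *)

Section RingColouring.
Variables (T : finType) (e : rel T).
Hypothesis e_sym : symmetric e.
Hypothesis e_irr : irreflexive e.
Hypothesis tri : forall x y z, e x y -> e y z -> e x z = false.
Hypothesis no5 : forall a b c d f,
  e a b -> e b c -> e c d -> e d f -> e f a = false.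
Hypothesis nowheel : forall m blk sg, ~ wheel e m blk sg.
Implicit Types (r s t : seq T) (x y w : T) (A B K P N X : {set T}).

Notation conn := (conn e).
Notation touch := (touch e).
Notation col := (col e).
Notation ipath := (ipath e).
Notation indep := (indep e).
Notation nbr := (nbr e).
Notation ring := (ring e).

(* All neighbours of [p] on [s] with index of parity [c] precede those of the
   other parity. *)
Definition sep w s c p : bool :=
  [exists a : 'I_(size s), exists b : 'I_(size s),
    [&& a < b, e p (nth w s a), e p (nth w s b), odd a == c, odd b != c &
     [forall i : 'I_(size s), e p (nth w s i) ==> (if odd i == c then i <= a else b <= i)]]].

Lemma sepP w s c p : reflect (exists a b, [/\ a < b < size s,
    e p (nth w s a) /\ e p (nth w s b), odd a = c, odd b != c &
    forall i, i < size s -> e p (nth w s i) -> if odd i == c then i <= a else b <= i])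
  (sep w s c p).
Proof.
apply: (iffP existsP) => [[a /existsP[b /and5P[ab ea eb /eqP oa /andP[ob /forallP h]]]]|].
  exists a, b; rewrite ab ltn_ord; split=> // i si ei.
  by have /implyP/= := h (Ordinal si); apply.
move=> [a [b [/andP[ab bs] [ea eb] oa ob h]]].
have as_ : a < size s by lia.
exists (Ordinal as_); apply/existsP; exists (Ordinal bs); rewrite /= ab ea eb oa ob eqxx /=.
by apply/forallP => i; apply/implyP/h.
Qed.

(** Let [c] be the parity of the first contact. If some contact of the other parity preceded the
    last one of parity [c], three contacts would alternate in parity and the ring would be a rim
    around the hub [[set p]]. *)
Lemma sep_or w s p i j : ring s w -> p \notin rcons s w -> i < size s -> j < size s ->
  e p (nth w s i) -> e p (nth w s j) -> odd i != odd j -> exists c, sep w s c p.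
Proof.
move=> rg ps si sj ei ej oij.
pose tt k := (k < size s) && e p (nth w s k).
have ext : exists k, tt k by exists i; rewrite /tt si.
case: (ex_minnP ext) => k0 /andP[sk0 ek0] mink; set c := odd k0.
have exa : exists k, tt k && (odd k == c) by exists k0; rewrite /tt sk0 ek0 eqxx.
have bnd k : tt k && (odd k == c) -> k <= size s by rewrite /tt; lia.
have exb : exists k, tt k && (odd k != c).
  case: (eqVneq (odd i) c) => oi; last by exists i; rewrite /tt si ei.
  by exists j; rewrite /tt sj ej -oi eq_sym.
case: (ex_maxnP exa bnd) => a /andP[/andP[sa ea] /eqP oa] maxa.
case: (ex_minnP exb) => b /andP[/andP[sb eb] ob] minb.
exists c; apply/sepP; exists a, b; split=> //; last first.
  move=> k sk ek; case: eqP => ok; first by apply: maxa; rewrite /tt sk ek ok /=.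
  by apply: minb; rewrite /tt sk ek; apply/eqP.
rewrite sb andbT; case: (ltngtP a b) => // ab; last by rewrite -ab oa eqxx in ob.
exfalso.
have k0b : k0 < b.
  have : k0 <= b by apply: mink; rewrite /tt sb.
  by rewrite leq_eqVlt => /orP[/eqP E|//]; rewrite /c E eqxx in ob.
have tch k : e p (nth w s k) -> touch (nth w s k) [set p].
  by move=> h; apply/touchP; exists p; rewrite ?inE // e_sym.
apply: (ring_alternate e_sym e_irr nowheel rg (P := [set p]) (N := set0)
  _ _ _ _ _ k0b _ _ _ (tch _ ek0) (tch _ eb) (tch _ ea)).
- by rewrite setU0; apply: conn1.
- by move=> x y /set1P-> /set1P->.
- by move=> x y; rewrite inE.
- by move=> x xr; rewrite !inE orbF; apply: contraNneq ps => <-.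
- by move=> x y; rewrite inE.
- by rewrite ab.
- by rewrite eq_sym.
- by rewrite oa.
Qed.

(* Two vertices seeing an induced path with the same parity switch, joined off
   the path, form a K4 with the two parts of the path. *)
Lemma K4_switch w s c p q (B0 : {set T}) (sg0 : T -> bool) a b a' b' :
  ipath s -> conn B0 -> p \in B0 -> touch q B0 -> q \notin B0 -> q \notin s ->
  (forall x, x \in B0 -> x \notin s) ->
  {in B0 &, forall x y, e x y -> sg0 x != sg0 y} -> sg0 p ->
  (forall x, x \in B0 -> e q x -> sg0 x) ->
  (forall x y, x \in B0 -> y \in s -> e x y -> x = p) ->
  a < b < size s -> e p (nth w s a) -> e p (nth w s b) -> odd a = c -> odd b != c ->
  (forall i, i < size s -> e p (nth w s i) -> if odd i == c then i <= a else b <= i) ->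
  a' < b' < size s -> e q (nth w s a') -> e q (nth w s b') -> odd a' = c -> odd b' != c ->
  (forall i, i < size s -> e q (nth w s i) -> if odd i == c then i <= a' else b' <= i) ->
  a < b' -> a' < b -> False.
Proof.
move=> ps cB pB qB qnB qs Bs sB sp sq Bp /andP[ab bs] ea eb oa ob hp.
move=> /andP[ab' bs'] ea' eb' oa' ob' hq h1 h2.
(* The intervals overlap, so [hi] lies beyond [a] and [a'] but not beyond [b] and [b']. With parity
   [c] positive before [hi] and the other parity positive from [hi] on, all neighbours of [p] and
   [q] on the path are positive. *)
pose hi := minn b b'; pose lo := minn a a'; pose top := (maxn b b').+1.
have us := ipath_uniq ps.
have ohi : odd hi != c by rewrite /hi /minn; case: ifP.
have ohi1 : odd hi.-1 = c.
  have : 0 < hi by rewrite /hi; nlia.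
  by case: (hi) ohi => //= k; case: (odd k); case: (c).
pose sg v := if v \in s then (if index v s < hi then odd (index v s) == c
                              else odd (index v s) != c)
             else (v == q) || sg0 v.
have sgn i : i < size s -> sg (nth w s i) = (if i < hi then odd i == c else odd i != c).
  by move=> si; rewrite /sg mem_nth // index_uniq.
have sgB x : x \in B0 -> sg x = sg0 x.
  move=> xB; rewrite /sg (negbTE (Bs x xB)); case: eqP => // E.
  by rewrite -E xB in qnB.
have sgq : sg q by rewrite /sg (negbTE qs) eqxx.
have hs : hi < size s by rewrite /hi; nlia.
have segs x m n : x \in seg s m n -> x \in s.
  by move/(segP w) => [i [_ si] ->]; apply: mem_nth.
have sgp i : i < size s -> e p (nth w s i) -> sg (nth w s i).
  move=> si /(hp i si); rewrite sgn //; case: (odd i == c) => h.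
    by rewrite ifT //; rewrite /hi; nlia.
  by rewrite ifF //; rewrite /hi; nlia.
have sgq' i : i < size s -> e q (nth w s i) -> sg (nth w s i).
  move=> si /(hq i si); rewrite sgn //; case: (odd i == c) => h.
    by rewrite ifT //; rewrite /hi; nlia.
  by rewrite ifF //; rewrite /hi; nlia.
have crossB x y : x \in B0 -> y \in s -> e x y -> sg x /\ sg y.
  move=> xB /[dup] ys /(nth_ex w)[i si Ey] exy; have E := Bp x y xB ys exy.
  by rewrite sgB // E sp; split=> //; rewrite -Ey; apply: sgp; rewrite // Ey -E.
have crossq y : y \in s -> e q y -> sg y.
  by move=> /(nth_ex w)[i si <-]; apply: sgq'.
have seg2 i : lo <= i < hi -> nth w s i \in seg s lo hi.
  by move=> h; apply/(segP w); exists i => //; split=> //; nlia.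
have seg3 i : hi <= i < top -> i < size s -> nth w s i \in seg s hi top.
  by move=> h h'; apply/(segP w); exists i.
have segdisj x : x \in seg s lo hi -> x \in seg s hi top -> False.
  move=> /(segP w)[i [h si] ->] /(segP w)[j [h' sj] /eqP].
  by rewrite nth_eq // => /eqP E; nlia.
have cross23 x y : x \in seg s lo hi -> y \in seg s hi top -> e x y -> sg x /\ sg y.
  move=> /(segP w)[i [h si] ->] /(segP w)[j [h' sj] ->].
  rewrite (ipath_nth e_sym e_irr) // => hij.
  have [-> ->] : i = hi.-1 /\ j = hi by nlia.
  rewrite !sgn //; last by nlia.
  rewrite ltnn ohi ohi1 eqxx; split=> //; rewrite ifT //; nlia.
have inseg m n x y : x \in seg s m n -> y \in seg s m n ->
    (n <= hi) || (hi <= m) -> e x y -> sg x != sg y.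
  move=> /(segP w)[i [h si] ->] /(segP w)[j [h' sj] ->] hmn.
  rewrite (ipath_nth e_sym e_irr) // => hij; rewrite !sgn //.
  case/orP: hmn => hmn.
    rewrite (_ : i < hi); last by nlia.
    rewrite (_ : j < hi); last by nlia.
    by case/orP: hij => /eqP-> /=; case: (odd _) (c) => [] [].
  rewrite (_ : i < hi = false); last by nlia.
  rewrite (_ : j < hi = false); last by nlia.
  by case/orP: hij => /eqP-> /=; case: (odd _) (c) => [] [].
apply: (K4_false e_sym nowheel (B0 := B0) (B1 := [set q]) (B2 := seg s lo hi)
  (B3 := seg s hi top) (sg := sg)) => //.
- exact: conn1.
- exact: (conn_seg e_sym e_irr).
- exact: (conn_seg e_sym e_irr).
- split.
  + by rewrite disjoint_sym disjoints1.
  + by apply/pred0P => x /=; apply/andP => -[/Bs/negP xs /segs].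
  + by apply/pred0P => x /=; apply/andP => -[/Bs/negP xs /segs].
  + by rewrite disjoints1; apply: contra qs; apply: segs.
  + split; first by rewrite disjoints1; apply: contra qs; apply: segs.
    by apply/pred0P => x /=; apply/andP => -[]; apply: segdisj.
- move=> B; rewrite !inE => /or4P[] /eqP-> x y xX yX exy.
  + by rewrite !sgB // sB.
  + by move: exy; rewrite (set1P xX) (set1P yX) e_irr.
  + by apply: inseg xX yX _ exy; rewrite leqnn.
  + by apply: inseg xX yX _ exy; rewrite leqnn orbT.
- move=> A B; rewrite !inE => /or4P[] /eqP-> /or4P[] /eqP-> AB x y xX yX exy;
    try by rewrite eqxx in AB.
  + by rewrite sgB // sq // e_sym -(set1P yX).
  + by have [] := crossB x y xX (segs _ _ _ yX) exy.
  + by have [] := crossB x y xX (segs _ _ _ yX) exy.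
  + by rewrite (set1P xX).
  + by rewrite (set1P xX).
  + by rewrite (set1P xX).
  + by rewrite e_sym in exy; have [] := crossB y x yX (segs _ _ _ xX) exy.
  + by rewrite e_sym (set1P yX) in exy; apply: crossq exy; apply: segs xX.
  + by have [] := cross23 x y xX yX exy.
  + by rewrite e_sym in exy; have [] := crossB y x yX (segs _ _ _ xX) exy.
  + by rewrite e_sym (set1P yX) in exy; apply: crossq exy; apply: segs xX.
  + by rewrite e_sym in exy; have [] := cross23 y x yX xX exy.
- have ta : nth w s a \in seg s lo hi by apply: seg2; rewrite /lo /hi; nlia.
  have ta' : nth w s a' \in seg s lo hi by apply: seg2; rewrite /lo /hi; nlia.
  have tb : nth w s b \in seg s hi top by apply: seg3 => //; rewrite /top /hi; nlia.
  have tb' : nth w s b' \in seg s hi top by apply: seg3 => //; rewrite /top /hi; nlia.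
  split; [|by exists p => //; apply/touchP; eexists; first exact: ta|
    by exists p => //; apply/touchP; eexists; first exact: tb|
    by exists q; rewrite ?inE //; apply/touchP; eexists; first exact: ta'|split].
  + by have /touchP[z zB qz] := qB; exists z => //; apply/touchP; exists q; rewrite ?inE // e_sym.
  + by exists q; rewrite ?inE //; apply/touchP; eexists; first exact: tb'.
  + exists (nth w s hi.-1); first by apply: seg2; rewrite /lo /hi; nlia.
    apply/touchP; exists (nth w s hi); first by apply: seg3 => //; rewrite /top /hi; nlia.
    rewrite (ipath_nth e_sym e_irr) //; last by nlia.
    by rewrite prednK ?eqxx // /hi; nlia.
Qed.

(** 14 is 2 for parents that see [w], twice 4 for parents that see one parity class of [s] only,
    where [col4_hub] applies with the two classes as sides of the hub, and twice 2 for parents that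
    see both. In the last case [sep_or] says which class comes first, and each vertex receives the
    interval between the last contact of its parent with the first class and the first contact with
    the second. *)
Lemma ring_col s w K : ring s w ->
  (forall x, x \in K -> [/\ x \notin rcons s w,
     forall y, y \in rcons s w -> e x y = false &
     exists2 p, e x p & exists2 y, y \in rcons s w & e p y]) -> col K 14.
Proof.
move=> rg hK; have [ps es s1 ws hw] := rg.
have us := ipath_uniq ps.
have pring x p : x \in K -> e x p -> p \notin rcons s w.
  by move=> /hK[_ h _] exp; apply: contraTN exp => /h->.
pose Kw := [set x in K | touch x (nbr w)].
pose X (b : bool) := [set y in s | odd (index y s) == b].
pose Wb b := [set p | [&& p \notin s, touch p (X b) & ~~ touch p (X (~~ b))]].
pose Kb b := [set x in K | touch x (Wb b)].
pose Kc c := [set x in K | [exists p, e x p && sep w s c p]].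
have XX b : X b :|: X (~~ b) = [set y in s].
  by apply/setP => y; rewrite !inE -andb_orr; case: (odd _) b => [] []; rewrite andbT.
have iX b : indep (X b).
  move=> y z; rewrite !inE => /andP[/(nth_ex w)[i si <-] /eqP oi].
  move=> /andP[/(nth_ex w)[j sj <-] /eqP oj].
  rewrite !index_uniq // in oi oj; rewrite (ipath_nth e_sym e_irr) //.
  apply/negbTE/norP; split; apply/eqP => E; move: oi oj; rewrite E /=;
  by case: (odd _) (b) => [] [].
have sr y : y \in s -> y \in rcons s w by rewrite mem_rcons inE => ->; rewrite orbT.
have cw : col Kw 2.
  apply: (col2_N2 e_sym e_irr tri nowheel (u := w)) => x; rewrite inE => /andP[/hK[h1 h2 _]].
  move=> /touchP[p]; rewrite inE => wp xp; split; last by exists p; rewrite // e_sym.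
    by apply: contraNneq h1 => ->; rewrite mem_rcons mem_head.
  by rewrite h2 // mem_rcons mem_head.
have cb b : col (Kb b) 4.
  apply: (col4_hub e_sym e_irr nowheel (X1 := X b) (X2 := X (~~ b)) (W := Wb b)) => //.
  - by rewrite XX; apply: conn_ipath.
  - move=> p; rewrite XX inE [in X in X -> _]inE => /and3P[h1 h2 h3].
    by split=> // y yX; have /touchPn := h3; apply.
  - move=> x; rewrite inE => /andP[/hK[h1 h2 _] h3]; rewrite XX inE; split=> //.
      by apply: contra h1; apply: sr.
    by move=> y; rewrite inE => /sr; apply: h2.
have cc c : col (Kc c) 2.
  have [f hf] : exists f : T -> T * (nat * nat), forall x, x \in Kc c ->
      let: (p, (a, b)) := f x in e x p /\ [/\ a < b < size s,
    e p (nth w s a) /\ e p (nth w s b), odd a = c, odd b != c &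
    forall i, i < size s -> e p (nth w s i) -> if odd i == c then i <= a else b <= i].
    apply: (@fin_all_exists _ (fun=> (T * (nat * nat))%type) (fun x v => x \in Kc c ->
      let: (p, (a, b)) := v in e x p /\ [/\ a < b < size s,
    e p (nth w s a) /\ e p (nth w s b), odd a = c, odd b != c &
    forall i, i < size s -> e p (nth w s i) -> if odd i == c then i <= a else b <= i])).
    move=> x; case: (boolP (x \in Kc c)); last by exists (x, (0, 0)).
    rewrite inE => /andP[_ /existsP[p /andP[exp /sepP[a [b h]]]]].
    by exists (p, (a, b)).
  pose pa x := (f x).1; pose la x := (f x).2.1; pose lb x := (f x).2.2.
  have {}hf x : x \in Kc c -> x \in K /\ e x (pa x) /\ [/\ la x < lb x < size s,
      e (pa x) (nth w s (la x)) /\ e (pa x) (nth w s (lb x)), odd (la x) = c,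
      odd (lb x) != c & forall i, i < size s -> e (pa x) (nth w s i) ->
        if odd i == c then i <= la x else lb x <= i].
    move=> xc; split; first by move: xc; rewrite inE => /andP[].
    by move: (hf x xc); rewrite /pa /la /lb; case: (f x) => p [a b].
  (* Adjacent vertices with overlapping intervals lead to [K4_switch]: their parents are joined off
     the ring, either by an edge or through [x] and [y], where [x] is then the only negative
     vertex. *)
  have no_overlap x y : x \in Kc c -> y \in Kc c -> e x y ->
      (lb x <= la y) || (lb y <= la x).
    move=> xc yc exy; apply/negPn; rewrite negb_or -!ltnNge; apply/andP => -[o1 o2].
    have [xK [xp [ab [ea eb] oa ob h]]] := hf x xc.
    have [yK [yq [ab' [ea' eb'] oa' ob' h']]] := hf y yc.
    move: (pa x) (pa y) xp yq ea eb ea' eb' h h' => p q xp yq ea eb ea' eb' h h'.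
    have py : e p y = false by apply: (@tri p x y); rewrite // e_sym.
    have xq : e x q = false by apply: (@tri x y q).
    have pq : p != q by apply: contraFneq py => ->; rewrite e_sym.
    have pr := pring _ _ xK xp; have qr := pring _ _ yK yq.
    have ns z : z \notin rcons s w -> z \notin s by apply: contra; apply: sr.
    have [xr xa _] := hK x xK; have [yr ya _] := hK y yK.
    have [epq|npq] := boolP (e p q).
      apply: (@K4_switch w s c p q [set p] (fun=> true) (la x) (lb x) (la y) (lb y)) => //.
      - exact: conn1.
      - exact: set11.
      - by apply/touchP; exists p; rewrite ?inE // e_sym.
      - by rewrite inE eq_sym.
      - exact: ns.
      - by move=> z /set1P->; apply: ns.
      - by move=> u v /set1P-> /set1P->; rewrite e_irr.
      - by move=> u v /set1P->.
    have xy : x != y by apply: contraTneq exy => ->; rewrite e_irr.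
    have px : p != x by apply: contraTneq xp => ->; rewrite e_irr.
    apply: (@K4_switch w s c p q [set p; x; y] (fun z => z != x)
      (la x) (lb x) (la y) (lb y)) => //.
    - have -> : [set p; x; y] = p |: (x |: [set y]) by rewrite setUA.
      apply: (conn_add e_sym); first apply: (conn_add e_sym); first exact: conn1.
        by apply/touchP; exists y; rewrite ?inE.
      by apply/touchP; exists x; rewrite ?inE ?eqxx // e_sym.
    - by rewrite !inE eqxx.
    - by apply/touchP; exists y; rewrite ?inE ?eqxx ?orbT // e_sym.
    - rewrite !inE !negb_or eq_sym pq /=; apply/andP; split.
        by apply: contraNneq npq => ->; rewrite e_sym.
      by apply: contraTneq yq => ->; rewrite e_irr.
    - exact: ns.
    - by move=> z; rewrite !inE -orbA => /or3P[] /eqP->; apply: ns.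
    - move=> u v; rewrite !inE -!orbA => /or3P[] /eqP-> /or3P[] /eqP-> euv;
        rewrite ?eqxx ?px ?(eq_sym y) ?xy //; move: euv; rewrite ?e_irr //.
        by rewrite py.
      by rewrite e_sym py.
    - move=> u; rewrite !inE -orbA => /or3P[] /eqP->; rewrite ?px ?(eq_sym y) ?xy //.
      by rewrite e_sym xq.
    - by move=> u v; rewrite !inE -orbA => /or3P[] /eqP-> /sr vs //; rewrite ?xa ?ya.
  (* Intervals increasing along a path [x], [y], [z] give contacts at [la x], [lb x], [la z] of
     alternating parity with the hub formed by [p], [x], [y], [z], [q]. Its positive side is stable:
     [p] and [q] are not adjacent because there is no pentagon. *)
  have no_two x y z : x \in Kc c -> y \in Kc c -> z \in Kc c -> e x y -> e y z ->
      lb x <= la y -> lb y <= la z -> False.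
    move=> xc yc zc exy eyz o1 o2.
    have [xK [xp [ab [ea eb] oa ob h]]] := hf x xc.
    have [yK [yq [ab' _ _ _ _]]] := hf y yc.
    have [zK [zp [ab2 [ea2 _] oa2 _ _]]] := hf z zc.
    have [xr xa _] := hK x xK; have [yr ya _] := hK y yK; have [zr za _] := hK z zK.
    have pr := pring _ _ xK xp; have qr := pring _ _ zK zp.
    move: (pa x) (pa z) xp zp ea eb ea2 pr qr {h} => p q xp zp ea eb ea2 pr qr.
    have tch u i : u \in [set p; y; q] -> e u (nth w s i) -> touch (nth w s i) [set p; y; q].
      by move=> h1 h2; apply/touchP; exists u; rewrite // e_sym.
    have epx : e p x by rewrite e_sym.
    have exz := tri exy eyz; have epy := tri epx exy; have eyq := tri eyz zp.
    have eqp := no5 epx exy eyz zp.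
    apply: (ring_alternate e_sym e_irr nowheel rg (P := [set p; y; q]) (N := [set x; z])
      (i1 := la x) (i2 := lb x) (i3 := la z)).
    - have -> : [set p; y; q] :|: [set x; z] = p |: (x |: (y |: (z |: [set q]))).
        apply/setP => u; rewrite !inE.
        by case: (u == p) (u == y) (u == q) (u == x) (u == z) => [] [] [] [] [].
      apply: (conn_add e_sym); first (apply: (conn_add e_sym);
        first (apply: (conn_add e_sym); first (apply: (conn_add e_sym); first exact: conn1))).
      + by apply/touchP; exists q; rewrite ?inE.
      + by apply/touchP; exists z; rewrite ?inE ?eqxx.
      + by apply/touchP; exists y; rewrite ?inE ?eqxx.
      + by apply/touchP; exists x; rewrite ?inE ?eqxx.
    - move=> u v; rewrite !inE -!orbA => /or3P[] /eqP-> /or3P[] /eqP->;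
      by rewrite ?e_irr ?epy ?eyq ?eqp // e_sym ?epy ?eyq ?eqp.
    - move=> u v; rewrite !inE => /orP[] /eqP-> /orP[] /eqP->;
      by rewrite ?e_irr ?exz // e_sym exz.
    - move=> u ur; rewrite !inE -!orbA; apply/negP.
      case/or3P => [/eqP E|/eqP E|]; first by rewrite -E ur in pr.
        by rewrite -E ur in yr.
      by case/or3P => /eqP E; [rewrite -E ur in qr|rewrite -E ur in xr|rewrite -E ur in zr].
    - by move=> u v; rewrite !inE => /orP[] /eqP-> vr; [apply: xa|apply: za].
    - by case/andP: ab.
    - by move: ab ab' ab2 o1 o2; clear; lia.
    - by rewrite oa eq_sym.
    - by rewrite oa2.
    - by apply: tch ea; rewrite !inE eqxx.
    - by apply: tch eb; rewrite !inE eqxx.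
    - by apply: tch ea2; rewrite !inE eqxx orbT.
  (* With edges directed towards the later interval, no directed path has two edges; so the vertices
     with an out-neighbour and the remaining ones form a 2-colouring. *)
  pose out x := [exists y in Kc c, e x y && (lb x <= la y)].
  have outd x y : x \in Kc c -> y \in Kc c -> e x y -> lb x <= la y -> out x && ~~ out y.
    move=> xc yc exy o1; apply/andP; split.
      by apply/exists_inP; exists y => //; rewrite exy.
    rewrite negb_exists_in; apply/forall_inP => z zc; apply/negP => /andP[eyz o2].
    exact: (no_two x y z).
  apply/colP; exists (fun x => out x : nat); split=> [x _|x y xc yc exy]; first by case: (out x).
  case/orP: (no_overlap x y xc yc exy) => o.
    by have /andP[-> /negbTE->] := outd x y xc yc exy o.
  by rewrite e_sym in exy; have /andP[-> /negbTE->] := outd y x yc xc exy o.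
apply: col_sub (colU cw (colU (colU (cb true) (cb false)) (colU (cc true) (cc false)))).
apply/fintype.subsetP => x xK; have [xr xa [p xp [y yr py]]] := hK x xK.
have pr := pring _ _ xK xp; rewrite !in_setU.
move: yr; rewrite mem_rcons inE => /orP[/eqP yw|ys].
  apply/orP; left; rewrite inE xK; apply/touchP; exists p => //.
  by rewrite inE e_sym -yw.
apply/orP; right.
have pns : p \notin s by apply: contra pr; apply: sr.
pose b := odd (index y s).
have tb : touch p (X b) by apply/touchP; exists y; rewrite // inE ys eqxx.
have [tnb|ntb] := boolP (touch p (X (~~ b))); last first.
  apply/orP; left.
  have pW : p \in Wb b by rewrite inE pns tb.
  have xb : x \in Kb b by rewrite inE xK; apply/touchP; exists p.
  by case: (b) xb => ->; rewrite ?orbT.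
apply/orP; right; have /touchP[z] := tnb; rewrite inE => /andP[zs /eqP oz] pz.
have [|||||c hc] := @sep_or w s p (index y s) (index z s) rg pr.
- by rewrite index_mem.
- by rewrite index_mem.
- by rewrite nth_index.
- by rewrite nth_index.
- by rewrite oz -/b; case: (b).
have xc : x \in Kc c by rewrite inE xK; apply/existsP; exists p; rewrite xp.
by case: c xc {hc} => ->; rewrite ?orbT.
Qed.

End RingColouring.

(** * Links and guards *)

Section Links.
Variables (T : finType) (e : rel T).
Hypothesis e_sym : symmetric e.
Hypothesis e_irr : irreflexive e.
Hypothesis tri : forall x y z, e x y -> e y z -> e x z = false.
Hypothesis no5 : forall a b c d f,
  e a b -> e b c -> e c d -> e d f -> e f a = false.
Hypothesis nowheel : forall m blk sg, ~ wheel e m blk sg.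
Implicit Types (r s t : seq T) (x y w : T) (A B K P N X : {set T}).

Notation touch := (touch e).
Notation col := (col e).
Notation ipath := (ipath e).
Notation nbr := (nbr e).
Notation ring := (ring e).

Definition apart A B := forall x y, x \in A -> y \in B -> x != y /\ e x y = false.

Lemma apart_sym A B : apart A B -> apart B A.
Proof. by move=> h x y xB yA; have [] := h y x yA xB; rewrite eq_sym e_sym. Qed.

Lemma apart_sub A B A' B' : {subset A' <= A} -> {subset B' <= B} -> apart A B ->
  apart A' B'.
Proof. by move=> sA sB h x y /sA xA /sB; apply: h. Qed.

Lemma apartU A B B' : apart A B -> apart A B' -> apart A (B :|: B').
Proof. by move=> h h' x y xA /setUP[]; [apply: h|apply: h']. Qed.

(* The boolean is the parity of the number of inner vertices. *)
Definition lnk x A y (b : bool) := exists s,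
  [/\ ipath (x :: rcons s y), {subset s <= A} & odd (size s) = b].

Definition flx x A y := forall b, lnk x A y b.

Lemma ipath_comp x s y t z : ipath (x :: rcons s y) -> ipath (y :: rcons t z) ->
  (forall u v, u \in x :: s -> v \in rcons t z -> u != v /\ e u v = false) ->
  ipath (x :: rcons (s ++ y :: t) z).
Proof.
move=> p1 p2 h; rewrite rcons_cat -cat_cons rcons_cons -cat_rcons.
apply: ipath_cat => //; first exact: (ipath_catr (s := [:: y]) p2).
move=> u v; rewrite mem_rcons inE => /orP[/eqP->|us] vt.
  have [h1 h2] := ipath_cross (s := [:: y]) p2 (mem_head _ _) vt.
  by rewrite last_rcons h1 h2 /= eqxx.
have [h1 ->] := h u v us vt; split=> //; symmetry.
rewrite last_rcons; apply/negbTE; rewrite negb_and; apply/orP; left.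
have p1' : ipath ((x :: s) ++ [:: y]) by rewrite cats1.
by have [] := ipath_cross p1' us (mem_head y [::]).
Qed.

Lemma lnk_comp x A y b B z c : lnk x A y b -> lnk y B z c ->
  apart (x |: A) (z |: B) -> lnk x (A :|: (y |: B)) z (~~ (b (+) c)).
Proof.
move=> [s [ps sA <-]] [t [pt tB <-]] ap; exists (s ++ y :: t); split.
- apply: ipath_comp => // u v us vt; apply: ap.
    by move: us; rewrite !inE => /orP[->//|/sA->]; rewrite orbT.
  by move: vt; rewrite mem_rcons !inE => /orP[->//|/tB->]; rewrite orbT.
- move=> u; rewrite mem_cat !inE => /orP[/sA->//|/orP[->|/tB->]]; by rewrite !orbT.
- by rewrite size_cat /= oddD /= addbN.
Qed.

Lemma lnk_sub x A A' y b : {subset A <= A'} -> lnk x A y b -> lnk x A' y b.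
Proof. by move=> h [s [ps sA o]]; exists s; split=> // u /sA/h. Qed.

Lemma flx_compr x A y B z b : flx x A y -> lnk y B z b ->
  apart (x |: A) (z |: B) -> flx x (A :|: (y |: B)) z.
Proof.
move=> f l ap c; have := lnk_comp (f (~~ (c (+) b))) l ap.
by case: c b {f l ap} => [] [].
Qed.

Lemma flx_compl x A y B z b : lnk x A y b -> flx y B z ->
  apart (x |: A) (z |: B) -> flx x (A :|: (y |: B)) z.
Proof.
move=> l f ap c; have := lnk_comp l (f (~~ (c (+) b))) ap.
by case: c b {f l ap} => [] [].
Qed.

Lemma lnk_rev x A y b : lnk x A y b -> lnk y A x b.
Proof.
move=> [s [ps sA o]]; exists (rev s); split; last by rewrite size_rev.
  by have := ipath_rev e_sym e_irr ps; rewrite rev_cons rev_rcons.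
by move=> u; rewrite mem_rev; apply: sA.
Qed.

Lemma flx_rev x A y : flx x A y -> flx y A x.
Proof. by move=> h b; apply: lnk_rev. Qed.

(** The two ways around the hole from [x] to [q] have inner lengths that add up to [size s - 1],
    which is odd. As [x] does not see [q], neither way is a single edge. *)
Lemma ring_flx s x q : ring s x -> q \in s -> e x q = false ->
  flx x ([set y in s] :\ q) q.
Proof.
have half s1 s2 : ring (s1 ++ q :: s2) x -> e x q = false ->
    lnk x ([set y in s1 ++ q :: s2] :\ q) q (odd (size s1)).
  move=> [ps es sz ws hw] xq; have us := ipath_uniq ps.
  exists s1; split=> //; last first.
    move=> u us1; rewrite !inE mem_cat us1 andbT; apply: contraTneq us => uq.
    by rewrite cat_uniq /= -uq us1 !andbF.
  have p1 : ipath (rcons s1 q) by move: ps; rewrite -cat_rcons => /ipath_catl.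
  apply: ipath_cons => // y ys; split.
    by apply: contraNneq ws => ->; rewrite -cat_rcons mem_cat ys.
  move: ys; rewrite mem_rcons inE => /orP[/eqP->|ys].
    rewrite xq; case: (s1) hw sz us xq => [|u s1'] hw sz us xq; last first.
      rewrite /=; apply/esym/negbTE; apply: contraTneq us => ->.
      by rewrite /= mem_cat mem_head orbT.
    by move: (hw q); rewrite mem_head /= eqxx /= xq => /(_ isT).
  rewrite hw ?mem_cat ?ys // last_cat /=.
  have -> : (y == last q s2) = false.
    apply/negbTE; apply: contraTneq us => E; rewrite E in ys.
    by rewrite cat_uniq; apply/negP => /and3P[_ /hasPn/(_ _ (mem_last q s2)) /negP[]].
  rewrite orbF; case: (s1) ys => //.
move=> rg qs xq b; case/splitPr: qs rg => s1 s2 rg.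
have [ps es sz ws hw] := rg.
have [<-|nb] := eqVneq (odd (size s1)) b; first exact: half.
have rg' : ring (rev s2 ++ q :: rev s1) x.
  rewrite -cat_rcons -rev_cons -rev_cat; split.
  - exact: ipath_rev ps.
  - by rewrite size_rev.
  - by rewrite size_rev.
  - by rewrite mem_rev.
  - move=> y; rewrite mem_rev => /hw->; rewrite orbC.
    have hl r : head x (rev r) = last x r /\ last x (rev r) = head x r.
      by split; [case/lastP: r => // r z; rewrite rev_rcons last_rcons|
        case: r => // z r; rewrite rev_cons last_rcons].
    by have [-> ->] := hl (s1 ++ q :: s2).
have -> : b = odd (size (rev s2)).
  rewrite size_rev; move: es nb; rewrite size_cat /= oddD /=.
  by case: (odd _) (odd _) b => [] [] [].
have := half _ _ rg' xq; congr lnk.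
apply/setP => y; rewrite !inE !mem_cat !inE !mem_rev.
by case: (y == q) (y \in s1) (y \in s2) => [] [] [].
Qed.

Definition dirty R z t K (d : T -> nat) (r : nat) : {set T} :=
  [set v in K | (d v == r) && [exists w, [&& e v w, w \notin z |: K,
    touch w R & ~~ touch w [set y in t]]]].

Lemma dirtyP R z t K d (r : nat) v : reflect ([/\ v \in K, d v = r & exists w,
    [/\ e v w, w \notin z |: K, touch w R & ~~ touch w [set y in t]]])
  (v \in dirty R z t K d r).
Proof.
rewrite inE; apply: (iffP and3P) => [[vK /eqP dv /existsP[w /and4P[]]]|[vK dv [w []]]].
  by split=> //; exists w.
by move=> h1 h2 h3 h4; split=> //; [apply/eqP|apply/existsP; exists w; apply/and4P].
Qed.

(* Whenever the rope with vertex set [R] and tip [q] is prolonged by [t], the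
   vertices at a given distance in the remaining part [K] that have an outside
   neighbour touching [R] but not [t] are [D]-colourable. *)
Definition guard (R : {set T}) q D := forall t (K : {set T}) d (r : nat),
  ipath (q :: t) -> apart (R :\ q) [set y in t] ->
  apart ((R :|: [set y in t]) :\ last q t) K -> last q t \notin K ->
  bfs e (last q t |: K) (last q t) d -> col (dirty R (last q t) t K d r) D.

Lemma touchU w A B : touch w (A :|: B) = touch w A || touch w B.
Proof.
apply/touchP/orP => [[y /setUP[yA|yB] wy]|[/touchP[y yX wy]|/touchP[y yX wy]]].
- by left; apply/touchP; exists y.
- by right; apply/touchP; exists y.
- by exists y; rewrite // inE yX.
- by exists y; rewrite // inE yX orbT.
Qed.

Lemma touch_sub w A B : {subset A <= B} -> touch w A -> touch w B.
Proof. by move=> s /touchP[y /s yB wy]; apply/touchP; exists y. Qed.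

Lemma guardU R1 R2 q D1 D2 : guard R1 q D1 -> guard R2 q D2 ->
  guard (R1 :|: R2) q (D1 + D2).
Proof.
move=> g1 g2 t K d r pt ap1 ap2 zK b.
have c1 : col (dirty R1 (last q t) t K d r) D1.
  apply: g1 pt _ _ zK b.
    by apply: apart_sub ap1 => // x; rewrite !inE => /andP[-> ->].
  by apply: apart_sub ap2 => // x; rewrite !inE => /andP[-> /orP[]->] //; rewrite !orbT.
have c2 : col (dirty R2 (last q t) t K d r) D2.
  apply: g2 pt _ _ zK b.
    by apply: apart_sub ap1 => // x; rewrite !inE => /andP[-> ->]; rewrite orbT.
  by apply: apart_sub ap2 => // x; rewrite !inE => /andP[-> /orP[]->] //; rewrite !orbT.
apply: col_sub (colU c1 c2); apply/fintype.subsetP => v /dirtyP[vK dv [w [h1 h2 + h3]]].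
by rewrite touchU => /orP[h|h]; apply/setUP; [left|right]; apply/dirtyP; split=> //; exists w.
Qed.

(** A parent touching the new piece [J] is charged to the guard of [J]. Any other parent misses
    [t0], which lies in [J], and is covered by the old guard for the prolongation [t0 ++ t]. This is
    why guards quantify over all prolongations and exempt parents that touch them. *)
Lemma guard_ext (R J : {set T}) q t0 D1 D2 : guard R q D1 -> ipath (q :: t0) ->
  {subset t0 <= J} -> guard J (last q t0) D2 -> apart (R :\ q) J ->
  q \in R -> q \notin J -> guard (R :|: J) (last q t0) (D1 + D2).
Proof.
move=> g1 p0 sJ g2 apJ qR qJ t K d r pt ap1 ap2 zK b.
set q' := last q t0 in g2 pt ap1 ap2 zK b *.
have c2 : col (dirty J (last q' t) t K d r) D2.
  apply: (g2 t K d r pt) => //.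
    by apply: apart_sub ap1 => // x; rewrite !inE => /andP[-> ->]; rewrite orbT.
  by apply: apart_sub ap2 => // x; rewrite !inE => /andP[-> /orP[]->] //; rewrite !orbT.
have lE : last q (t0 ++ t) = last q' t by rewrite last_cat.
have pp : ipath (q :: t0 ++ t).
  rewrite -cat_cons; apply: ipath_cat => //.
    by apply: (ipath_catr (s := [:: q'])).
  move=> x y xs yt; have [xq|xq] := eqVneq x q'.
    have [h1 h2] := ipath_cross (s := [:: q']) pt (mem_head _ _) yt.
    by rewrite xq h1 h2 /= eqxx.
  have xR : x \in (R :|: J) :\ q'.
    by move: xs; rewrite !inE xq => /orP[/eqP->|/sJ->]; rewrite ?qR ?orbT.
  have [|h1 h2] := ap1 x y xR; first by rewrite inE.
  by rewrite h1 h2.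
have c1 : col (dirty R (last q' t) (t0 ++ t) K d r) D1.
  have := g1 (t0 ++ t) K d r pp; rewrite lE; apply=> //.
    move=> x y xR; rewrite inE mem_cat => /orP[/sJ yJ|yt]; first exact: apJ.
    have [xq'|xq'] := eqVneq x q'; last first.
      by apply: ap1; rewrite ?inE // xq'; move: xR; rewrite !inE => /andP[_ ->].
    exfalso; have : x \in q :: t0 by rewrite xq' mem_last.
    have xR' := xR; move: xR; rewrite !inE => /andP[/negbTE-> _] /= /sJ xJ.
    by have [/eqP] := apJ x x xR' xJ.
  apply: apart_sub ap2 => // x; rewrite !inE mem_cat => /andP[-> /orP[->//|/orP[/sJ->|->]]];
    by rewrite ?orbT.
apply: col_sub (colU c1 c2); apply/fintype.subsetP => v /dirtyP[vK dv [w [h1 h2 + h3]]].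
rewrite touchU; case: (boolP (touch w J)) => [hJ _|hJ].
  by apply/setUP; right; apply/dirtyP; split=> //; exists w.
rewrite orbF => hR; apply/setUP; left; apply/dirtyP; split=> //; exists w; split=> //.
apply: contra h3 => /touchP[y]; rewrite inE mem_cat => /orP[/sJ yJ|yt] wy.
  by case/negP: hJ; apply/touchP; exists y.
by apply/touchP; exists y; rewrite ?inE.
Qed.

Lemma guard1 u q : u != q -> guard [set u] q 2.
Proof.
move=> uq t K d r pt ap1 ap2 zK b.
have up : u \in [set u] :\ q by rewrite !inE uq eqxx.
apply: (col2_N2 e_sym e_irr tri nowheel (u := u)) => v.
case/dirtyP=> vK _ [w [vw _ /touchP[y /set1P-> wu] _]].
have uz : u \in ([set u] :|: [set y in t]) :\ last q t.
  rewrite !inE eqxx /= andbT; have := mem_last q t; rewrite inE => /orP[/eqP->//|lt].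
  by have [|] := ap1 u (last q t) up; rewrite ?inE.
have [h1 h2] := ap2 u v uz vK.
by split; [rewrite eq_sym|rewrite e_sym|exists w; rewrite // e_sym].
Qed.

Lemma colDnbr A x n : col (A :\: nbr x) n -> col A (n + 1).
Proof.
move=> h; apply: col_sub (colU h (col_nbr tri A x)); apply/fintype.subsetP => v vA.
by rewrite in_setU in_setD in_setI vA andbT orNb.
Qed.

(** Unlike earlier vertices of the rope, the tip may have neighbours in [K], namely when the
    prolongation is empty; they form a stable set and cost one colour more than in [guard1]. *)
Lemma guard_tip q : guard [set q] q 3.
Proof.
move=> t K d r pt ap1 ap2 zK b; apply: (@colDnbr _ q 2).
apply: (col2_N2 e_sym e_irr tri nowheel (u := q)) => v; rewrite in_setD => /andP[].
rewrite inE e_sym => /negbTE qv /dirtyP[vK _ [w [vw _ /touchP[y /set1P-> wu] _]]].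
split=> //; last by exists w; rewrite // e_sym.
apply: contraNneq zK => E; case: (eqVneq q (last q t)) => [<-|qz]; first by rewrite -E.
rewrite E in vK; have qR : q \in ([set q] :|: [set y in t]) :\ last q t.
  by rewrite !inE eqxx qz.
by have [/eqP] := ap2 q q qR vK.
Qed.

(* The witness whose last contact with the path comes first closes an odd ring
   through the flexible link, and every other witness touches that ring. *)
Lemma guard_path (P : seq T) x (S : {set T}) q : ipath (rcons P x) -> flx x S q -> q \notin S ->
  x \notin S -> x != q -> apart [set y in P] (q |: S) ->
  forall t K d (r : nat), ipath (q :: t) -> apart (([set y in rcons P x] :|: S) :\ q) [set y in t] ->
  apart (([set y in rcons P x] :|: (q |: S) :|: [set y in t]) :\ last q t) K ->
  last q t \notin K -> bfs e (last q t |: K) (last q t) d ->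
  col [set v in dirty [set y in rcons P x] (last q t) t K d r |
    [exists w, [&& e v w, w \notin last q t |: K, touch w [set y in rcons P x],
      ~~ touch w (q |: S) & ~~ touch w [set y in t]]]] 17.
Proof.
move=> pP fS qS xS xq apP t K d r pt ap1 ap2 zK b; set z := last q t in ap2 zK b *.
set Px := rcons P x; set D := [set v in _ | _].
have [qS0 dq par zero lip] := b.
(* The last contact of [w] with the path: from there on the path meets [w] at its first vertex only.
   The value 0 for a vertex without contacts is never of interest. *)
pose tau w := \max_(i < size Px | e w (nth x Px i)) i.
have tauP w : touch w [set y in Px] -> tau w < size Px /\ e w (nth x Px (tau w)).
  move/touchP=> [y]; rewrite inE => /(nth_ex x)[i si <-] ei.
  have c : 0 < #|[pred i : 'I_(size Px) | e w (nth x Px i)]|.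
    by apply/card_gt0P; exists (Ordinal si).
  have [j ej E] := eq_bigmax_cond (fun i : 'I_(size Px) => i : nat) c.
  have -> : tau w = j by exact: E.
  by split.
have tau_max w i : i < size Px -> e w (nth x Px i) -> i <= tau w.
  by move=> si ei; exact: (@leq_bigmax_cond _ (fun i : 'I_(size Px) => e w (nth x Px i))
    (fun i => i : nat) (Ordinal si)).
pose good v w := [/\ v \in K, d v = r, e v w & [/\ w \notin z |: K, touch w [set y in Px],
  ~~ touch w (q |: S) & ~~ touch w [set y in t]]].
have DP v : v \in D -> exists w, good v w.
  rewrite inE => /andP[/dirtyP[vK dv _] /existsP[w /and5P[h1 h2 h3 h4 h5]]].
  by exists w.
have [/eqP->|/set0Pn[v0 v0D]] := boolP (D == set0); first exact: col0.
have [w [v gvw minw]] : exists w, exists2 v, good v w &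
    forall v' w', good v' w' -> tau w <= tau w'.
  have ex : exists n, [exists v, exists w, [&& v \in D, e v w, w \notin z |: K,
      touch w [set y in Px], ~~ touch w (q |: S) && ~~ touch w [set y in t] & tau w == n]].
    have [w [_ _ h1 [h2 h3 h4 h5]]] := DP v0 v0D; exists (tau w).
    apply/existsP; exists v0; apply/existsP; exists w.
    by rewrite v0D h1 h2 h3 h4 h5 /=.
  case: (ex_minnP ex) => n /existsP[v /existsP[w]].
  case/and5P=> vD h1 h2 h3 /andP[/andP[h4 h5] /eqP tw] minn.
  have [w1 [vK dv _ _]] := DP v vD.
  exists w; exists v; first by [].
  move=> v' w' [vK' dv' h1' [h2' h3' h4' h5']]; rewrite tw; apply: minn.
  apply/existsP; exists v'; apply/existsP; exists w'; rewrite h1' h2' h3' h4' h5' eqxx !andbT.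
  rewrite inE; apply/andP; split; first by apply/dirtyP; split=> //; exists w'.
  by apply/existsP; exists w'; rewrite h1' h2' h3' h4' h5'.
have [vK dv evw [wK wP wS wt]] := gvw; have [tw etw] := tauP w wP.
have r0 : 0 < r.
  rewrite lt0n -dv; apply: contraNneq zK => dv0; rewrite -(zero v) //.
  by rewrite !inE vK orbT.
(* Choosing a neighbour of [w] nearest to the tip makes the geodesic from the tip to [u0] see [w] at
   its end only, and keeps it at distance at most [r]. *)
have [u0 [u0S eu0 minu]] : exists u, [/\ u \in z |: K, e w u &
    forall u', u' \in z |: K -> e w u' -> d u <= d u'].
  have vz : (v \in z |: K) && e w v by rewrite !inE vK orbT e_sym.
  case: (@arg_minnP _ v (fun u => (u \in z |: K) && e w u) d vz) => u /andP[h1 h2] h3.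
  by exists u; split=> // u' h4 h5; apply: h3; rewrite h4.
set i0 := d u0 in minu.
have wz : e w z = false.
  apply/negbTE; have := mem_last q t; rewrite -/z inE => /orP[/eqP->|zt].
    by apply: contra wS => ewq; apply/touchP; exists q; rewrite // !inE eqxx.
  by apply: contra wt => ewz; apply/touchP; exists z; rewrite // inE.
have [g [g0 gi gS ge]] := bfs_geodesic b u0S; rewrite -/i0 in gi gS ge.
have i0r : i0 <= r by rewrite -dv; apply: minu; rewrite ?inE ?vK ?orbT // e_sym.
have i00 : 0 < i0.
  rewrite lt0n; apply/eqP => i00; move: eu0; rewrite -gi i00 g0 wz //.
have gK j : 0 < j -> j <= i0 -> g j \in K.
  move=> j0 ji; have [] := gS j ji; rewrite !inE => /orP[/eqP->|//].
  by rewrite dq => ?; nlia.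
have gadj j k : j <= i0 -> k <= i0 -> e (g j) (g k) -> (k <= j.+1) && (j <= k.+1).
  move=> hj hk ejk; have [a1 a2] := gS j hj; have [a3 a4] := gS k hk.
  have := lip _ _ a1 a3 ejk; rewrite a2 a4 => ->.
  by rewrite e_sym in ejk; have := lip _ _ a3 a1 ejk; rewrite a2 a4.
pose bs := mkseq (fun j => g j.+1) i0.
have pg : ipath (z :: bs).
  have -> : z :: bs = mkseq g i0.+1.
    by rewrite /bs /mkseq /= g0; congr (_ :: _); rewrite -[1]addn0 iotaDl -map_comp.
  apply: ipath_mkseq => j k /andP[jk ki].
  have hj : j <= i0 by nlia.
  have hk : k <= i0 by nlia.
  have [_ a2] := gS j hj; have [_ a4] := gS k hk.
  split; first by apply/eqP => E; move: a2 a4; rewrite E => -> ?; nlia.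
  apply/idP/eqP => [/(gadj _ _ hj hk)/andP[h1 h2]|->]; first by nlia.
  by apply: ge; nlia.
have bsK y : y \in bs -> y \in K.
  by move=> /mapP[j]; rewrite mem_iota => h ->; apply: gK; nlia.
(* The flexible link is taken with the parity that makes the whole path from the last contact of [w]
   to [u0] have an even number of vertices. *)
have [uu [puu uuS ouu]] := fS (odd (size (drop (tau w) Px) + size (q :: t) + size bs)).
set A := drop (tau w) Px in ouu.
have pA : ipath A by move: pP; rewrite -/Px -(cat_take_drop (tau w) Px) => /ipath_catr.
have A0 : A = nth x Px (tau w) :: behead A by rewrite /A (drop_nth x tw).
have lA y : last y A = x.
  have : last y Px = x by rewrite last_rcons.
  by rewrite -{1}(cat_take_drop (tau w) Px) last_cat -/A A0.
have AP y : y \in A -> y \in Px by apply: mem_drop.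
have Pxx y : y \in Px -> y = x \/ y \in P.
  by rewrite mem_rcons inE => /orP[/eqP->|]; [left|right].
have p1 : ipath (A ++ rcons uu q).
  apply: ipath_cat => //; first exact: (ipath_catr (s := [:: x])).
  move=> y1 y2 /[dup] /AP/Pxx[-> _|yP yA] y2u; rewrite lA.
    have [h1 h2] := ipath_cross (s := [:: x]) puu (mem_head _ _) y2u.
    by rewrite h1 h2 /= eqxx.
  have y2S : y2 \in q |: S.
    by move: y2u; rewrite mem_rcons !inE => /orP[->//|/uuS->]; rewrite orbT.
  have [|h1 h2] := apP y1 y2 _ y2S; first by rewrite inE.
  rewrite h1 h2; split=> //; rewrite (_ : (y1 == x) = false) //.
  by apply: contraTF pP => /eqP E; apply/negP => /ipath_uniq; rewrite rcons_uniq -E yP.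
have APq y : y \in A ++ uu -> y \in ([set y in Px] :|: S) :\ q.
  rewrite mem_cat !inE => /orP[/AP|/uuS] h; rewrite h ?orbT ?andbT //=.
    case: (Pxx y h) => [->//|yP].
    by have [] : y != q /\ e y q = false by apply: apP; rewrite !inE ?eqxx.
  by apply: contraNneq qS => <-.
have p2 : ipath ((A ++ rcons uu q) ++ t).
  apply: ipath_cat => //; first exact: (ipath_catr (s := [:: q])).
  move=> y1 y2; rewrite -rcons_cat mem_rcons inE last_rcons => /orP[/eqP->|y1A] y2t.
    have [h1 h2] := ipath_cross (s := [:: q]) pt (mem_head _ _) y2t.
    by rewrite h1 h2 /= eqxx.
  have [|h1 h2] := ap1 y1 y2 (APq _ y1A); first by rewrite inE.
  by rewrite h1 h2; have := APq _ y1A; rewrite !inE => /andP[/negbTE->].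
set S1 := (A ++ rcons uu q) ++ t.
have lS1 y : last y S1 = z by rewrite /S1 last_cat last_cat last_rcons.
have S1R y : y \in S1 -> y \in [set y in Px] :|: (q |: S) :|: [set y in t].
  rewrite !mem_cat mem_rcons !inE => /orP[/orP[/AP->//|/orP[->|/uuS->]]|->];
    by rewrite ?orbT.
have p3 : ipath (S1 ++ bs).
  apply: ipath_cat => //; first exact: (ipath_catr (s := [:: z])).
  move=> y1 y2 y1S y2b; rewrite lS1; case: (eqVneq y1 z) => [->|yz].
    by have [h1 h2] := ipath_cross (s := [:: z]) pg (mem_head _ _) y2b; rewrite h1 h2 /= eqxx.
  by apply: ap2 (bsK _ y2b); rewrite in_setD1 yz S1R.
set S2 := S1 ++ bs.
have S2A : S2 = nth x Px (tau w) :: behead S2 by rewrite /S2 /S1 A0.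
have lS2 y : last y S2 = g i0.
  rewrite /S2 last_cat (last_nth (g 1)) size_mkseq -[in nth _ _ i0](prednK i00) /=.
  by rewrite nth_mkseq ?prednK.
have wS2 : w \notin S2.
  rewrite mem_cat negb_or; apply/andP; split; last first.
    by apply: contra wK => /bsK; rewrite !inE => ->; rewrite orbT.
  apply/negP => /S1R wR; case: (eqVneq w z) => [wz'|wz']; first by rewrite wz' !inE eqxx in wK.
  by have [|_] := ap2 w v _ vK; rewrite ?in_setD1 ?wz' // e_sym evw.
have rg : ring S2 w.
  split=> //.
  - rewrite /S2 /S1 !size_cat size_rcons -/A; move: ouu; rewrite !oddD /= => ->.
    by rewrite -/A; case: (odd (size A)) (odd (size t)) (odd (size bs)) => [] [] [].
  - rewrite /S2 /S1 A0 !size_cat /= size_rcons; nlia.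
  move=> y yS; rewrite lS2 S2A /=.
  move: yS; rewrite mem_cat => /orP[yS1|yb].
    have -> : (y == g i0) = false.
      apply/negbTE; apply: contraTneq (gK i0 i00 (leqnn _)) => <-; apply/negP => yK.
      case: (eqVneq y z) => [yz|yz]; first by rewrite -yz yK in zK.
      by have [|/eqP] := ap2 y y _ yK; rewrite // in_setD1 yz S1R.
    rewrite orbF; move: yS1; rewrite !mem_cat => /orP[/orP[yA|yu]|yt].
    + have [j sj <-] := nth_ex x yA; rewrite /A nth_drop.
      have sj' : tau w + j < size Px by move: sj; rewrite size_drop; nlia.
      rewrite (nth_eq x sj' tw (ipath_uniq pP)); apply/idP/eqP => [/tau_max h|->//].
      by have := h sj'; nlia.
    + rewrite (_ : e w y = false); last first.
        apply/negbTE; apply: contra wS => ewy; apply/touchP; exists y => //.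
        by move: yu; rewrite mem_rcons !inE => /orP[->//|/uuS->]; rewrite orbT.
      apply/esym/negbTE; apply: contraTneq p1 => E; apply/negP => /ipath_uniq.
      rewrite cat_uniq => /and3P[_ /hasPn/(_ y yu)/negP[]]; rewrite /= E A0; exact: mem_head.
    + rewrite (_ : e w y = false); last first.
        by apply/negbTE; apply: contra wt => ewy; apply/touchP; exists y; rewrite ?inE.
      apply/esym/negbTE; apply: contraTneq p2 => E; apply/negP => /ipath_uniq.
      rewrite cat_uniq => /and3P[_ /hasPn/(_ y yt)/negP[]]; rewrite /= E A0; exact: mem_head.
  have -> : (y == nth x Px (tau w)) = false.
    apply: contraTF p3 => /eqP E; apply/negP => /ipath_uniq.
    rewrite cat_uniq => /and3P[_ /hasPn/(_ y yb)/negP[]]; rewrite /= E /S1 A0; exact: mem_head.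
  move: yb => /mapP[j]; rewrite mem_iota => hj ->; have hj' : j.+1 <= i0 by nlia.
  have [a1 a2] := gS _ hj'.
  apply/idP/eqP => [ewg|->]; last by rewrite gi.
  by have := minu _ a1 ewg; rewrite a2 => h; congr g; nlia.
(* 17 is 14 plus three neighbourhoods. A vertex of level [r] can see the geodesic only at [g r] or
   [g r.-1], and if it lies on it, it is [g r] and sees [g r.-1]. Outside the neighbourhoods of
   these two and of [w], the vertices are anticomplete to the ring. *)
have key : col (((D :\: nbr w) :\: nbr (g r)) :\: nbr (g r.-1)) 14.
  apply: (ring_col e_sym e_irr tri no5 nowheel rg) => v'; rewrite !in_setD.
  case/and4P=> n1 n2 n3 /DP[w' gw']; rewrite inE in n1; rewrite inE in n2; rewrite inE in n3.
  have [vK' dv' evw' [wK' wP' _ _]] := gw'.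
  have vS : v' \notin S2 /\ forall y, y \in S2 -> e v' y = false.
    have v'z : v' \in z |: K by rewrite !inE vK' orbT.
    have g1 j : j <= i0 -> g j = v' -> False.
      move=> ji E; have [_] := gS j ji; rewrite E dv' => rj.
      have ei : i0 = r by nlia.
      case/negP: n1; rewrite -E -rj; have := ge r.-1; rewrite (prednK r0); apply; nlia.
    have g2 j : j <= i0 -> e v' (g j) = false.
      move=> ji; apply/negP => evg; have [a1 a2] := gS j ji.
      have := lip _ _ v'z a1 evg; rewrite a2 dv' => h1.
      have evg' : e (g j) v' by rewrite e_sym.
      have := lip _ _ a1 v'z evg'; rewrite a2 dv' => h2.
      have [E|E] : j = r \/ j = r.-1 by nlia.
        by rewrite E in evg'; rewrite evg' in n2.
      by rewrite E in evg'; rewrite evg' in n1.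
    have bsg y : y \in bs -> exists2 j, j <= i0 & y = g j.
      by move=> /mapP[j]; rewrite mem_iota => hj ->; exists j.+1 => //; nlia.
    split.
      rewrite mem_cat; apply/negP => /orP[/S1R vR|/bsg[j ji /esym]].
        case: (eqVneq v' z) => [vz|vz]; first by rewrite -vz vK' in zK.
        by have [|/eqP] := ap2 v' v' _ vK'; rewrite // in_setD1 vz.
      exact: g1.
    move=> y; rewrite mem_cat => /orP[/S1R yR|/bsg[j ji ->]]; last exact: g2.
    case: (eqVneq y z) => [->|yz]; first by rewrite -g0 g2.
    by rewrite e_sym; have [|] := ap2 y v' _ vK'; rewrite ?in_setD1 ?yz.
  have [tw' etw'] := tauP w' wP'; have := minw _ _ gw' => tle.
  have tS2 : nth x Px (tau w') \in S2.
    rewrite /S2 /S1 !mem_cat; apply/orP; left; apply/orP; left; apply/orP; left.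
    have -> : tau w' = tau w + (tau w' - tau w) by nlia.
    rewrite -nth_drop; apply: mem_nth; rewrite size_drop ltn_sub2r //.
  split; last by exists w' => //; exists (nth x Px (tau w')); rewrite // mem_rcons inE tS2 orbT.
    by rewrite mem_rcons inE negb_or vS.1 andbT; apply: contraNneq wK => <-; rewrite !inE vK' orbT.
  move=> y; rewrite mem_rcons inE => /orP[/eqP->|/vS.2//].
  by rewrite e_sym; apply/negbTE.
exact: (colDnbr (colDnbr (colDnbr key))).
Qed.

(** 32 is 15 plus 17. Vertices with a parent touching [s] fall under [ring_col], after the
    neighbourhood of the tip is deleted, since the tip may lie on the ring and see [K]. All other
    parents touch only the path, and [guard_path] applies with the ring as flexible link. *)
Lemma guard_ring (P : seq T) s x q : ipath (rcons P x) -> ring s x -> q \in s -> e x q = false ->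
  apart [set y in P] [set y in s] ->
  guard ([set y in rcons P x] :|: [set y in s]) q 32.
Proof.
move=> pP rg qs xq ap t K d r pt ap1 ap2 zK b; have [_ _ _ xs _] := rg.
set z := last q t in ap2 zK b *.
set R := _ :|: _; set D := dirty _ _ _ _ _ _.
pose Ds := [set v in D | [exists w, [&& e v w, w \notin z |: K &
  touch w [set y in s]]]].
have cs : col Ds (14 + 1).
  apply: (@colDnbr _ z 14).
  apply: (ring_col e_sym e_irr tri no5 nowheel rg) => v; rewrite in_setD in_set => /andP[zv].
  rewrite inE => /andP[/dirtyP[vK _ _] /existsP[w /and3P[evw wK ws]]].
  have sR y : y \in rcons s x -> y \in R :|: [set y in t].
    by rewrite mem_rcons !inE mem_rcons inE => /orP[->//|->]; rewrite !orbT.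
  have vy y : y \in rcons s x -> v != y /\ e v y = false.
    move=> /sR yR; case: (eqVneq y z) => [->|yz].
      by split; [apply: contraNneq zK => <-|rewrite e_sym; apply/negbTE].
    by have [|h1 h2] := ap2 y v _ vK; rewrite ?in_setD1 ?yz // eq_sym e_sym.
  split; first by apply/negP => /vy[/eqP].
    by move=> y /vy[].
  by exists w => //; have /touchP[y] := ws; rewrite inE => ys wy; exists y;
    rewrite // mem_rcons inE ys orbT.
have ss : q |: ([set y in s] :\ q) = [set y in s] by rewrite setD1K // inE.
have nx : x != q by apply: contraNneq xs => ->.
have RE : [set y in rcons P x] :|: (q |: ([set y in s] :\ q)) = R by rewrite ss.
have cp : col [set v in dirty [set y in rcons P x] z t K d r |
    [exists w, [&& e v w, w \notin z |: K, touch w [set y in rcons P x],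
      ~~ touch w (q |: ([set y in s] :\ q)) & ~~ touch w [set y in t]]]] 17.
  apply: (guard_path pP (ring_flx rg qs xq)) => //.
  - by rewrite !inE eqxx.
  - by rewrite !inE (negbTE xs) andbF.
  - by rewrite ss.
  - apply: apart_sub ap1 => // y; rewrite !inE => /andP[-> /orP[->//|/andP[_ ->]]].
    by rewrite orbT.
  - by rewrite RE.
apply: col_sub (colU cp cs); apply/fintype.subsetP => v vD.
have /dirtyP[vK dv [w [h1 h2 + h3]]] := vD.
case: (boolP (touch w [set y in s])) => [ws _|ws].
  by apply/setUP; right; rewrite inE vD; apply/existsP; exists w; rewrite h1 h2 ws.
rewrite touchU (negbTE ws) orbF => wP; apply/setUP; left; rewrite inE; apply/andP; split.
  by apply/dirtyP; split=> //; exists w.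
by apply/existsP; exists w; rewrite ss h1 h2 wP ws h3.
Qed.

End Links.

(** * Flexible links along geodesics *)

Section Flexing.
Variables (T : finType) (e : rel T).
Hypothesis e_sym : symmetric e.
Hypothesis e_irr : irreflexive e.
Hypothesis tri : forall x y z, e x y -> e y z -> e x z = false.
Hypothesis no5 : forall a b c d f,
  e a b -> e b c -> e c d -> e d f -> e f a = false.
Implicit Types (s t : seq T) (x y w : T) (A B K : {set T}).

Notation conn := (conn e).
Notation touch := (touch e).
Notation col := (col e).
Notation ipath := (ipath e).
Notation nbr := (nbr e).
Notation ring := (ring e).

Notation apart := (apart e).
Notation bfs := (bfs e).

Definition geod (S : {set T}) q (d : T -> nat) (g : nat -> T) n : Prop :=
  [/\ g 0 = q, forall i, i <= n -> g i \in S /\ d (g i) = i &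
      forall i, i < n -> e (g i) (g i.+1)].

Lemma geod_leq S q d g m n : m <= n -> geod S q d g n -> geod S q d g m.
Proof.
move=> mn [g0 gS ge]; split=> // i im; [apply: gS|apply: ge].
  exact: leq_trans im mn.
exact: leq_trans im mn.
Qed.

Lemma bfs_adj S q d u v : bfs S q d -> u \in S -> v \in S -> e u v ->
  (d v <= (d u).+1) && (d u <= (d v).+1).
Proof. by move=> [_ _ _ _ lip] uS vS euv; rewrite !lip // e_sym. Qed.

Lemma geod_edge S q d g n i j : bfs S q d -> geod S q d g n -> i < j -> j <= n ->
  e (g i) (g j) = (j == i.+1).
Proof.
move=> b [_ gS ge] ij jn; have in_ : i <= n by apply: leq_trans (ltnW ij) jn.
have [iS di] := gS i in_; have [jS dj] := gS j jn.
apply/idP/eqP => [/(bfs_adj b iS jS)|->]; last by apply: ge; apply: leq_trans ij jn.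
by rewrite di dj => h; nlia.
Qed.

Lemma geod_ipath S q d g n m : bfs S q d -> geod S q d g n -> m <= n.+1 ->
  ipath (mkseq g m).
Proof.
move=> b gg mn; apply: ipath_mkseq => i j /andP[ij jm].
have jn : j <= n by nlia.
rewrite (geod_edge b gg ij jn); split=> //.
have [_ gS _] := gg; apply/eqP => E; have in_ : i <= n by nlia.
by have [_] := gS i in_; have [_] := gS j jn; rewrite -E => -> ?; nlia.
Qed.

(* [g] and [h] meet again along the edge [g r - h r]; cutting them at their last
   earlier contact leaves an odd ring. *)
Lemma geod_ring_half S q d g h r i : bfs S q d -> geod S q d g r -> geod S q d h r ->
  i < r -> e (g r) (h r) -> (forall j, j < r -> e (g j) (h j) = false) ->
  (g i == h i) || e (g i) (h i.+1) ->
  (forall j, i < j -> j < r ->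
     [/\ g j != h j, e (g j) (h j.+1) = false & e (h j) (g j.+1) = false]) ->
  exists s, ring s (g i) /\
    forall y, y \in s <-> exists2 j, i < j <= r & y = g j \/ y = h j.
Proof.
move=> b gg gh ir er e0 ei ej; have [g0 gS ge] := gg; have [h0 hS he] := gh.
pose m := r - i.
have gi1 : e (g i) (g i.+1) by apply: ge.
have gh1 : e (g i) (h i.+1).
  by case/orP: ei => // /eqP->; apply: he.
have gne u : i < u -> u <= r -> g u != h u.
  move=> iu; rewrite leq_eqVlt => /orP[/eqP->|ur]; last by have [] := ej u iu ur.
  by apply: contraTneq er => ->; rewrite e_irr.
have gh_edge u v : i < u -> u <= r -> i < v -> v <= r ->
    g u != h v /\ e (g u) (h v) = (u == r) && (v == r).
  move=> iu ur iv vr; have [uS du] := gS u ur; have [vS dv] := hS v vr.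
  split.
    case: (eqVneq u v) => [<-|uv]; first exact: gne.
    by apply: contraNneq uv => E; rewrite -du -dv E.
  apply/idP/andP => [euv|[/eqP-> /eqP->]//].
  have := bfs_adj b uS vS euv; rewrite du dv => huv.
  have [E|[E|E]] : u = v \/ v = u.+1 \/ u = v.+1 by nlia.
  - move: ur; rewrite leq_eqVlt => /orP[/eqP E'|ur]; first by rewrite -E E' eqxx.
    by rewrite -E e0 in euv.
  - have ur' : u < r by nlia.
    by have [_ h1 _] := ej u iu ur'; rewrite E h1 in euv.
  - have vr' : v < r by nlia.
    by have [_ _ h1] := ej v iv vr'; rewrite e_sym E h1 in euv.
pose f k := if k < m then g (i.+1 + k) else h (i + m.*2 - k).
have fg k : k < m -> f k = g (i.+1 + k) by rewrite /f => ->.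
have fh k : m <= k -> f k = h (i + m.*2 - k) by rewrite /f ltnNge => ->.
have dgr u : u <= r -> d (g u) = u by move=> /gS[].
have dhr u : u <= r -> d (h u) = u by move=> /hS[].
exists (mkseq f m.*2).
have mem y : y \in mkseq f m.*2 <-> exists2 j, i < j <= r & y = g j \/ y = h j.
  split=> [/mapP[k]|[j ij [->|->]]].
  - rewrite mem_iota add0n => /andP[_ km] ->; case: (ltnP k m) => hk.
      by rewrite fg //; exists (i.+1 + k); [rewrite /m in hk *; nlia|left].
    by rewrite fh //; exists (i + m.*2 - k); [rewrite /m in hk km *; nlia|right].
  - apply/mapP; exists (j - i.+1); first by rewrite mem_iota /m; nlia.
    by rewrite fg ?subnKC //; rewrite /m; nlia.
  - apply/mapP; exists (i + m.*2 - j); first by rewrite mem_iota /m; nlia.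
    rewrite fh; last by rewrite /m; nlia.
    by congr h; rewrite /m; nlia.
have hd : head (g i) (mkseq f m.*2) = g i.+1.
  by rewrite -nth0 nth_mkseq ?fg ?addn0 // /m; nlia.
have la : last (g i) (mkseq f m.*2) = h i.+1.
  rewrite -nth_last size_mkseq nth_mkseq; last by nlia.
  by rewrite fh; [congr h|]; nlia.
split=> //; split.
- apply: ipath_mkseq => a c /andP[ac cm]; case: (ltnP c m) => hc.
    have ha : a < m by nlia.
    have h1 : i.+1 + a < i.+1 + c by nlia.
    have h2 : i.+1 + c <= r by rewrite /m in hc; nlia.
    rewrite !fg // (geod_edge b gg h1 h2) -addnS eqn_add2l; split=> //.
    apply/eqP => E; have := dgr _ h2; rewrite -E dgr; nlia.
  case: (ltnP a m) => ha; last first.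
    have h1 : i + m.*2 - c < i + m.*2 - a by nlia.
    have h2 : i + m.*2 - a <= r by rewrite /m in ha *; nlia.
    rewrite !fh // e_sym (geod_edge b gh h1 h2); split.
      apply/eqP => E; have := dhr _ h2; rewrite E dhr; nlia.
    by apply/eqP/eqP => ?; nlia.
  rewrite fg // fh //; have [||||h1 ->] := gh_edge (i.+1 + a) (i + m.*2 - c).
  + by nlia.
  + by rewrite /m in ha; nlia.
  + by nlia.
  + by rewrite /m in hc *; nlia.
  split=> //; apply/andP/eqP => [[/eqP h2 /eqP h3]|h2].
    by rewrite /m in h2 h3 hc ha *; nlia.
  by split; apply/eqP; rewrite /m in h2 hc ha *; nlia.
- by rewrite size_mkseq odd_double.
- by rewrite size_mkseq; nlia.
- apply/negP => /mem[j ij [E|E]]; have [_] := gS i (ltnW ir); rewrite E ?dgr ?dhr; nlia.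
move=> y /mem[j ij Ey]; rewrite hd la.
have ir' : i <= r by nlia.
have jr : j <= r by nlia.
have [iS di] := gS i ir'.
have [yS dy] : y \in S /\ d y = j by case: Ey => ->; [apply: gS|apply: hS].
case: (eqVneq j i.+1) => ji.
  have -> : e (g i) y by case: Ey => ->; rewrite ji.
  by case: Ey => ->; rewrite ji eqxx ?orbT.
have -> : e (g i) y = false.
  by apply/negP => /(bfs_adj b iS yS); rewrite di dy => ?; nlia.
apply/esym/negbTE; rewrite negb_or; apply/andP; split; apply: contraNneq ji => E.
  by rewrite -dy E dgr.
by rewrite -dy E dhr.
Qed.

(** [i] is the last level below [r] where the two geodesics coincide or one of them sees the next
    vertex of the other. The cycle closed between there and the edge on level [r] has
    [2 (r - i) + 1] vertices; without triangles and pentagons it has at least seven, whence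
    [i.+2 < r]. *)
Lemma geod_ring S q d g h r : bfs S q d -> geod S q d g r -> geod S q d h r ->
  0 < r -> e (g r) (h r) -> (forall j, j < r -> e (g j) (h j) = false) ->
  exists i (P : seq T) x (s : seq T), [/\ i.+2 < r, [/\ ipath (rcons P x), head x P = q & x = g i \/ x = h i],
    ring s x, forall y, y \in P -> exists2 j, j < i & y = g j \/ y = h j &
    forall y, y \in s <-> exists2 j, i < j <= r & y = g j \/ y = h j].
Proof.
move=> b gg gh r0 er e0; have [g0 gS ge] := gg; have [h0 hS he] := gh.
pose tt j := [|| g j == h j, e (g j) (h j.+1) | e (h j) (g j.+1)].
have ex : exists j, (j < r) && tt j by exists 0; rewrite r0 /tt g0 h0 eqxx.
have bd j : (j < r) && tt j -> j <= r by move=> /andP[/ltnW].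
case: (ex_maxnP ex bd) => i /andP[ir ti] maxi.
have nt j : i < j -> j < r -> tt j = false.
  by move=> ij jr; apply/negP => tj; have := maxi j; rewrite jr tj => /(_ isT); nlia.
have ntg j : i < j -> j < r ->
    [/\ g j != h j, e (g j) (h j.+1) = false & e (h j) (g j.+1) = false].
  by move=> ij jr; have := nt j ij jr; rewrite /tt => /norP[-> /norP[/negbTE-> /negbTE->]].
have ri x s : ring s x ->
    (forall y, y \in s <-> exists2 j, i < j <= r & y = g j \/ y = h j) ->
    e x (g i.+1) -> e x (h i.+1) -> i.+2 < r.
  move=> _ _ xg xh; rewrite ltn_neqAle; apply/andP; split; last first.
    rewrite ltn_neqAle ir andbT; apply/eqP => E; rewrite E in xg xh.
    by rewrite (tri xg er) in xh.
  apply/eqP => E; have i1 : i.+1 < r by rewrite -E.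
  have e1 : e (g i.+2) (h i.+2) by rewrite E.
  have e2 : e (h i.+2) (h i.+1) by rewrite e_sym; apply: he.
  by have := no5 xg (ge _ i1) e1 e2; rewrite e_sym xh.
have half g' h' : geod S q d g' r -> geod S q d h' r -> (g' = g /\ h' = h) \/ (g' = h /\ h' = g) ->
    (g' i == h' i) || e (g' i) (h' i.+1) -> exists i P x s,
    [/\ i.+2 < r, [/\ ipath (rcons P x), head x P = q & x = g i \/ x = h i],
    ring s x, forall y, y \in P -> exists2 j, j < i & y = g j \/ y = h j &
    forall y, y \in s <-> exists2 j, i < j <= r & y = g j \/ y = h j].
  move=> gg' gh' sw ti'; have [g0' gS' ge'] := gg'; have [h0' hS' he'] := gh'.
  have [||||s [rg mem]] := geod_ring_half b gg' gh' ir.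
  - by case: sw => -[-> ->]; rewrite // e_sym.
  - by move=> j jr; case: sw => -[-> ->]; rewrite ?(e_sym (h j)) e0.
  - exact: ti'.
  - by move=> j ij jr; have [h1 h2 h3] := ntg j ij jr; case: sw => -[-> ->];
      rewrite // eq_sym h1 h2 h3.
  exists i, (mkseq g' i), (g' i), s; have [_ dgi] := gS' i (ltnW ir).
  have mem' y : y \in s <-> exists2 j, i < j <= r & y = g j \/ y = h j.
    rewrite mem; case: sw => -[-> ->] //.
    by split=> -[j ij [->|->]]; exists j => //; [right|left|right|left].
  have rc : rcons (mkseq g' i) (g' i) = mkseq g' i.+1 by rewrite /mkseq -addn1 iotaD map_cat cats1.
  have xg1 : e (g' i) (g' i.+1) by apply: ge'.
  have xh1 : e (g' i) (h' i.+1) by case/orP: ti' => // /eqP->; apply: he'.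
  split=> //.
  - by apply: (ri (g' i) s) => //; case: sw => -[Eg Eh]; rewrite ?Eg ?Eh in xg1 xh1 *.
  - rewrite rc; split=> //; first by apply: geod_ipath b gg' _; rewrite ltnW.
      by case: (i) => //=; rewrite -g0'.
    by case: sw => -[-> _]; [left|right].
  - move=> y /mapP[j]; rewrite mem_iota => hj ->; exists j; first by nlia.
    by case: sw => -[-> _]; [left|right].
case/or3P: ti => ti; [apply: (half g h)|apply: (half g h)|apply: (half h g)] => //.
- by left.
- by rewrite ti.
- by left.
- by rewrite ti orbT.
- by right.
- by rewrite ti orbT.
Qed.

(* [P] leads from [q] to the vertex [x] of an odd ring [rcons s x], along which
   [q'] can be reached with both parities; [K'] hangs at [q'] only. *)
Definition flexed q (K : {set T}) (P : seq T) x (s : seq T) q' (K' : {set T}) : Prop :=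
  [/\ [/\ ipath (rcons P x), head x P = q & {subset behead (rcons P x) <= K}],
      [/\ ring s x, {subset s <= K}, q' \in s, e x q' = false &
          apart [set y in P] [set y in s]],
      [/\ {subset K' <= K}, conn K', touch q' K' & q' \notin K'] &
      apart (([set y in rcons P x] :|: [set y in s]) :\ q') K'].

(** The new tip lies on level [r] or [r.-1]. As [i.+2 < r], this is at least two levels beyond the
    entry [x] of the ring, so [x] does not see the tip, as [ring_flx] requires. *)
Lemma flexed_intro K q d g h r q' K' : bfs (q |: K) q d -> q \notin K ->
  geod (q |: K) q d g r -> geod (q |: K) q d h r ->
  0 < r -> e (g r) (h r) -> (forall j, j < r -> e (g j) (h j) = false) ->
  (exists2 j, r <= j.+1 <= r.+1 & q' = g j \/ q' = h j) ->
  {subset K' <= K} -> conn K' -> touch q' K' -> q' \notin K' ->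
  (forall j y, j <= r -> y = g j \/ y = h j -> y != q' ->
     y \notin K' /\ forall v, v \in K' -> e y v = false) ->
  exists P x s, flexed q K P x s q' K'.
Proof.
move=> b qK gg gh r0 er e0 hq' sK cK tK nK sep.
have [i [P [x [s [ir [pP hP dx] rg memP' mems]]]]] := geod_ring b gg gh r0 er e0.
have [g0 gS ge] := gg; have [h0 hS he] := gh; have [_ _ zero _ _] := b.
have memP y : y \in rcons P x -> exists2 j, j <= i & y = g j \/ y = h j.
  rewrite mem_rcons inE => /orP[/eqP->|/memP'[j /ltnW]]; [by exists i|by exists j].
have yS j y : j <= r -> y = g j \/ y = h j -> y \in q |: K /\ d y = j.
  by move=> jr [->|->]; [apply: gS|apply: hS].
have dq : d q = 0 by case: b.
have yK j y : 0 < j -> j <= r -> y = g j \/ y = h j -> y \in K.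
  move=> j0 jr hy; have [] := yS j y jr hy; rewrite !inE => /orP[/eqP->|//].
  by rewrite dq => ?; nlia.
exists P, x, s; split.
- split=> // y; case E : (rcons P x) => [|z t] // yt.
  have zq : z = q by rewrite -hP; case: (P) E => [|? ?] /= [].
  have yP : y \in rcons P x by rewrite E inE; move: yt => /= ->; rewrite orbT.
  have [j ji hy] := memP y yP; have jr : j <= r by nlia.
  have [+ _] := yS j y jr hy; rewrite !inE => /orP[/eqP yq|//].
  by have := ipath_uniq pP; rewrite E /= zq -yq; move: yt => /= ->.
- split=> //.
  + by move=> y /mems[j ij hy]; apply: (yK j) => //; nlia.
  + have [j jr hy] := hq'; apply/mems; exists j => //; nlia.
  + have [j jr hy] := hq'; have jr' : j <= r by nlia.
    have [q'S dq'] := yS j q' jr' hy.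
    have xS : x \in q |: K.
      have [|k ki hx] := memP x; first by rewrite mem_rcons mem_head.
      have kr : k <= r by nlia.
      by have [] := yS k x kr hx.
    have ir' : i <= r by nlia.
    have [_ {}dx] := yS i x ir' dx.
    by apply/negP => /(bfs_adj b xS q'S); rewrite dx dq' => ?; nlia.
  + move=> y z; rewrite !inE => yP zs.
    have [j ji hy] := memP' y yP; have /mems[k ik hz] := zs.
    have jr : j <= r by nlia.
    have kr : k <= r by nlia.
    have [yS' dy] := yS j y jr hy; have [zS dz] := yS k z kr hz.
    split; first by apply/eqP => E; move: dy; rewrite E dz => ?; nlia.
    by apply/negP => /(bfs_adj b yS' zS); rewrite dy dz => ?; nlia.
- by [].
move=> y v; rewrite !inE => /andP[yq' yPs] vK'.
have [j jr hy] : exists2 j, j <= r & y = g j \/ y = h j.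
  case/orP: yPs => [/memP[j ji hy]|/mems[j ij hy]]; exists j => //; nlia.
have [h1 h2] := sep j y jr hy yq'; rewrite h2 //; split=> //.
by apply: contraNneq h1 => ->.
Qed.

(** Inside one level there is an edge [g h] such that [a], one level below, sees [g] but not [h];
    two geodesics ending with this edge contain an odd ring. The 4 pays for the neighbourhoods of
    [a] and then of [bb], [h] and [g], from which two gates retreat so that the rest hangs at one
    vertex of the ring. *)
Lemma flex_step q K n : conn K -> q \notin K -> touch q K -> ~~ col K (2 * (n + 4)) ->
  exists P x s q' K', flexed q K P x s q' K' /\ ~~ col K' n.
Proof.
move=> cK qK tq nK; have cS := conn_add e_sym cK tq; have qS : q \in q |: K by rewrite !inE eqxx.
have [d b] := bfs_exists cS qS; have [_ dq par zero lip] := b.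
have [|r [Kf [sKf dKf cKf nKf]]] := bfs_level e_sym b (subsetUr _ _)
    (D := fun=> set0) (m := 0) (n := n + 4) (fun=> col0 e 0); first by rewrite addn0.
have KfK y : y \in Kf -> y \in K by move/(fintype.subsetP sKf); rewrite setD0.
have r0 : 0 < r.
  have [y yKf] := ncol_nonempty nKf; rewrite lt0n -(dKf y yKf).
  apply: contraNneq qK => /zero <-; first exact: KfK.
  by rewrite !inE KfK ?orbT.
have [v vKf] := ncol_nonempty nKf; have dv := dKf v vKf.
have vS : v \in q |: K by rewrite !inE KfK ?orbT.
have v0 : 0 < d v by rewrite dv.
have [a aS [eav dva]] := par v vS v0.
have [Ka [g [sKa cKa nKa gA tg]]] : exists (K0 : {set T}) g, [/\ K0 \subset Kf :\: nbr a,
    conn K0, ~~ col K0 (n + 3), g \in Kf :&: nbr a & touch g K0].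
  apply: (gate e_sym cKf (col_nbr tri Kf a)); last by rewrite -addnA.
  by apply/set0Pn; exists v; rewrite !inE vKf.
have [gKf eag] : g \in Kf /\ e a g by move: gA; rewrite !inE => /andP[].
have KaKf y : y \in Ka -> y \in Kf /\ e a y = false.
  by move/(fintype.subsetP sKa); rewrite !inE => /andP[/negbTE-> ->].
have /touchP[h hKa egh] := tg; have [hKf eah] := KaKf h hKa.
have inS y : y \in Kf -> y \in q |: K by move=> /KfK yK; rewrite !inE yK orbT.
have dr y : y \in Kf -> d y = r by apply: dKf.
have da : d a = r.-1 by rewrite -dv dva.
have prolong p y : p \in q |: K -> d p = r.-1 -> y \in Kf -> e p y ->
    exists g', [/\ geod (q |: K) q d g' r, g' r = y & g' r.-1 = p].
  move=> pS dp yKf epy; have [g' [g0 gd gi ge]] := bfs_geodesic b pS; rewrite dp in gd gi ge.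
  exists (fun i => if i < r then g' i else y); rewrite ltnn; split=> //; last first.
    by rewrite prednK // leqnn.
  split; first by rewrite r0.
    move=> i ir; case: ltnP => [ir'|ri]; first by apply: gi; nlia.
    by rewrite inS //; split=> //; rewrite dr //; nlia.
  move=> i ir; rewrite ir; case: ltnP => [ir'|ri]; first by apply: ge; nlia.
  by have -> : i = r.-1; [nlia|rewrite gd].
have hS : h \in q |: K by apply: inS.
have h0 : 0 < d h by rewrite dr.
have [bb bS [ebh dhb]] := par h hS h0.
have dbb : d bb = r.-1 by rewrite -(dr h hKf) dhb.
have [gg [Gg ggr gga]] := prolong a g aS da gKf eag.
have [hh [Gh hhr hhb]] := prolong bb h bS dbb hKf ebh.
have notq y : y \in q |: K -> 0 < d y -> y \in K.
  by rewrite !inE => /orP[/eqP->|//]; rewrite dq.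
have dist y z : y \in q |: K -> z \in q |: K -> (d z).+1 < d y \/ (d y).+1 < d z ->
    y != z /\ e y z = false.
  move=> yS zS dyz; split; first by apply: contraPneq dyz => ->; nlia.
  by apply/negP => /(bfs_adj b yS zS); move: dyz; nlia.
have ex : exists i, (i <= r) && e (gg i) (hh i) by exists r; rewrite leqnn ggr hhr.
case: (ex_minnP ex) => i0 /andP[i0r ei0] mini0.
have i00 : 0 < i0.
  by rewrite lt0n; apply: contraTneq ei0 => ->; have [-> _ _] := Gg; have [-> _ _] := Gh; rewrite e_irr.
have e0 j : j < i0 -> e (gg j) (hh j) = false.
  move=> ji; apply/negP => ej; have := mini0 j; rewrite ej andbT.
  have jr : j <= r by nlia.
  by rewrite jr => /(_ isT); nlia.
have [_ ggS gge] := Gg; have [_ hhS hhe] := Gh.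
have egg := geod_edge b Gg; have ehh := geod_edge b Gh.
(* If the geodesics are already joined by an edge on an earlier level [i0], the ring is closed
   there, and the tail of [hh] together with [Ka] remains. [gg i0] misses the tail for lack of
   triangles, and it can reach the level of [Ka] only when it is [a], which misses [Ka]. *)
move: i0r; rewrite leq_eqVlt => /orP[/eqP Ei|i0r]; last first.
  pose tl := mkseq (fun k => hh (i0.+1 + k)) (r - i0).
  pose K' : {set T} := [set y in tl] :|: Ka.
  have tlP y : y \in tl -> exists2 k, i0 < k <= r & y = hh k.
    move=> /mapP[k]; rewrite mem_iota => hk ->; exists (i0.+1 + k) => //; nlia.
  have htl : h \in tl.
    apply/mapP; exists (r - i0.+1); first by rewrite mem_iota; nlia.
    by rewrite subnKC.
  have K'P y : y \in K' -> y \in q |: K /\ i0 < d y.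
    case/setUP => [|/KaKf[yKf _]]; first rewrite inE => /tlP[k hk ->].
      by have [|-> ->] := hhS k; [nlia|split=> //; nlia].
    by rewrite inS // dr.
  have [||||||P [x [s fl]]] := @flexed_intro K q d gg hh i0 (hh i0) K' b qK
      (geod_leq (ltnW i0r) Gg) (geod_leq (ltnW i0r) Gh) i00 ei0 e0 _ _ _ _ _ _.
  - by exists i0; [nlia|right].
  - by move=> y /K'P[yS dy]; apply: notq => //; nlia.
  - apply: (connU e_sym (a := h) (b := h)) => //; rewrite ?inE ?eqxx //.
    apply: (conn_ipath e_sym e_irr); apply: ipath_mkseq => j k /andP[jk kr].
    have h1 : i0.+1 + j < i0.+1 + k by nlia.
    have h2 : i0.+1 + k <= r by nlia.
    rewrite (ehh _ _ h1 h2) -addnS eqn_add2l; split=> //.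
    have h3 : i0.+1 + j <= r by nlia.
    apply/eqP => E; have [_] := hhS _ h2; have [_] := hhS _ h3.
    by rewrite E => -> ?; nlia.
  - apply/touchP; exists (hh i0.+1); last by apply: hhe.
    rewrite in_setU inE; apply/orP; left; apply/mapP; exists 0; last by rewrite addn0.
    by rewrite mem_iota; nlia.
  - by apply/negP => /K'P[_]; have [_ ->] := hhS i0 (ltnW i0r); nlia.
  - move=> j y ji hy yq'; have jr : j <= r by nlia.
    have [yS dy] : y \in q |: K /\ d y = j by case: hy => ->; [apply: ggS|apply: hhS].
    split; first by apply/negP => /K'P[_]; rewrite dy; nlia.
    move=> z zK'; have [zS dz] := K'P z zK'; apply/negP => eyz.
    have := bfs_adj b yS zS eyz; rewrite dy => hd.
    have Ej : j = i0 by nlia.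
    have Ey : y = gg i0 by case: hy => E; rewrite E Ej ?eqxx // in yq' *.
    case/setUP: zK' => [|/KaKf[zKf eaz]]; first rewrite inE => /tlP[k hk Ez].
      have Ek : k = i0.+1.
        have kr : k <= r by nlia.
        have [_] := hhS k kr.
        by rewrite -Ez => Edz; nlia.
      by have := tri ei0 (hhe _ i0r); rewrite -Ek -Ez -Ey eyz.
    have Er : i0 = r.-1 by rewrite (dr z zKf) in hd; nlia.
    by rewrite Ey Er gga eaz in eyz.
  exists P, x, s, (hh i0), K'; split=> //.
  apply: contra nKa => /(col_sub (subsetUr _ _))/(col_leq _); apply; nlia.
subst i0.
have [Kb [y [sKb cKb nKb yA ty]]] : exists (K0 : {set T}) y,
    [/\ K0 \subset Ka :\: (nbr bb :|: (nbr h :|: nbr g)), conn K0, ~~ col K0 n,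
     y \in Ka :&: (nbr bb :|: (nbr h :|: nbr g)) & touch y K0].
  apply: (gate e_sym cKa (m := 1 + (1 + 1))) => //.
    rewrite !setIUr; exact: colU (col_nbr tri _ _) (colU (col_nbr tri _ _) (col_nbr tri _ _)).
  by apply/set0Pn; exists h; rewrite !inE hKa egh !orbT.
have KbP z : z \in Kb -> [/\ z \in Ka, e bb z = false, e h z = false & e g z = false].
  by move/(fintype.subsetP sKb); rewrite !inE !negb_or => /andP[/and3P[/negbTE-> /negbTE-> /negbTE->] ->].
have [yKa yN] : y \in Ka /\ [|| e bb y, e h y | e g y] by move: yA; rewrite !inE => /andP[].
have [yKf eay] := KaKf y yKa.
have e_r z w : z \in Kf -> w \in Kf -> e z w -> z != w.
  by move=> _ _; apply: contraTneq => ->; rewrite e_irr.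
have yKb : y \notin Kb.
  by apply/negP => /KbP[_ h1 h2 h3]; rewrite h1 h2 h3 in yN.
have gKb : g \notin Kb by apply/negP => /KbP[/KaKf[_]]; rewrite eag.
have aKb z : z \in Kb -> e a z = false by move=> /KbP[/KaKf[_ ->]].
have fin h' hh' q' K' : geod (q |: K) q d hh' r -> hh' r = h' -> hh' r.-1 = bb ->
    e g h' -> (forall j, j < r -> hh' j = hh j) ->
    [\/ q' = g, q' = h' | q' = bb] -> {subset K' <= Kf} -> {subset Kb <= K'} -> conn K' ->
    touch q' K' -> q' \notin K' ->
    (forall z, z \in [:: a; bb; g; h'] -> z != q' -> z \notin K' /\ forall v, v \in K' -> e z v = false) ->
    exists P x s q' K', flexed q K P x s q' K' /\ ~~ col K' n.
  move=> Gh' h'r h'b egh' hE hq' sK' sKb' cK' tK' nK' sep.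
  have [_ hS' he'] := Gh'.
  have [|||||P [x [s fl]]] := @flexed_intro K q d gg hh' r q' K' b qK Gg Gh' r0 _ _ _ _ cK' tK' nK' _.
  - by rewrite ggr h'r.
  - by move=> j jr; rewrite hE // e0.
  - case: hq' => ->; [exists r; [nlia|left]|exists r; [nlia|right]|exists r.-1; [nlia|right]];
      by rewrite ?ggr ?h'r ?h'b.
  - by move=> z /sK'/KfK.
  - move=> j z jr hz zq'.
    have [zS dz] : z \in q |: K /\ d z = j by case: hz => ->; [apply: ggS|apply: hS'].
    have [jlt|jge] := ltnP j.+1 r.
      split=> [|v1 v1K']; first by apply/negP => /sK'/dr; rewrite dz; nlia.
      have [|_ ->//] := dist z v1 zS (inS _ (sK' _ v1K')).
      by right; rewrite dz (dr _ (sK' _ v1K')).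
    apply: sep => //; rewrite !inE.
    have [Ej|Ej] : j = r \/ j = r.-1 by nlia.
      by case: hz => ->; rewrite Ej ?ggr ?h'r eqxx ?orbT.
    by case: hz => ->; rewrite Ej ?gga ?h'b eqxx ?orbT.
  exists P, x, s, q', K'; split=> //.
  apply: contra nKb; apply: col_sub; exact/fintype.subsetP.
have cyKb : conn (y |: Kb) by apply: (conn_add e_sym).
have yKbKf z : z \in y |: Kb -> z \in Kf.
  by rewrite !inE => /orP[/eqP->//|/KbP[/KaKf[]]].
have rr z : z \in q |: K -> d z = r.-1 -> forall w, w \in Kf -> z != w.
  by move=> _ dz w /dr; apply: contra_eqN => /eqP <-; rewrite dz; nlia.
have aKf z : z \in Kf -> a != z by apply: rr.
have bKf z : z \in Kf -> bb != z by apply: rr.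
have addy z : z != y -> z \notin Kb -> e z y = false -> (forall v, v \in Kb -> e z v = false) ->
    z \notin y |: Kb /\ forall v, v \in y |: Kb -> e z v = false.
  move=> zy zKb ezy ezKb; rewrite !inE negb_or zy zKb; split=> // v1.
  by rewrite !inE => /orP[/eqP->|/ezKb].
have aok : a \notin y |: Kb /\ forall v, v \in y |: Kb -> e a v = false.
  apply: addy => //; first exact: aKf.
  by apply: contraTN eag => /KbP[/KaKf[aKf' _] _ _ _]; have := aKf a aKf'; rewrite eqxx.
have bKb : bb \notin Kb by apply/negP => /KbP[/KaKf[/bKf]]; rewrite eqxx.
have hKb : h \notin Kb by apply/negP => /KbP[_ _ _]; rewrite egh.
have in4 (x1 x2 x3 x4 z : T) : z \in [:: x1; x2; x3; x4] -> [|| z == x1, z == x2, z == x3 | z == x4].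
  by rewrite !inE.
(* Exactly one ring vertex may see the remaining part. If [y] sees [g] and [bb], it replaces [h] on
   the ring and becomes the tip. Otherwise the tip is the first of [g], [h], [bb] that sees [y]; the
   others miss [y] by the case distinction or for lack of triangles. *)
have [egy|egy] := boolP (e g y).
  have [eby|eby] := boolP (e bb y).
    have [hh' [Gh' hr' hb']] := prolong bb y bS dbb yKf eby.
    pose hh2 i := if i < r then hh i else y.
    have Gh2 : geod (q |: K) q d hh2 r.
      split; first by rewrite /hh2 r0; case: Gh.
        move=> i ir; rewrite /hh2; case: ltnP => ri; first by apply: hhS; nlia.
        by rewrite inS // dr //; split=> //; nlia.
      move=> i ir; rewrite /hh2 ir; case: ltnP => ri; first by apply: hhe.
      by have -> : i = r.-1; [nlia|rewrite hhb].
    apply: (fin y hh2 y Kb Gh2) => //.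
    - by rewrite /hh2 ltnn.
    - by rewrite /hh2 ltn_predL r0 hhb.
    - by move=> j jr; rewrite /hh2 jr.
    - by constructor 2.
    - by move=> z /KbP[/KaKf[]].
    move=> z /in4/or4P[] /eqP-> zy.
    + by have [h1 h2] := aok; split=> [|v1 v1K]; [apply: contra h1|apply: h2]; rewrite !inE => *; apply/orP; right.
    + by split=> // v1 /KbP[].
    + by split=> // v1 /KbP[].
    + by rewrite eqxx in zy.
  apply: (fin h hh g (y |: Kb) Gh) => //.
  - by constructor 1.
  - by move=> z zK; rewrite !inE zK orbT.
  - by apply/touchP; exists y; rewrite ?inE ?eqxx.
  - by rewrite !inE negb_or gKb andbT; apply: e_r.
  move=> z /in4/or4P[] /eqP-> zg //.
  - apply: addy => //; [exact: bKf|exact: negbTE|by move=> v1 /KbP[]].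
  - by rewrite eqxx in zg.
  - apply: addy => //; [|by rewrite (@tri h g y) // e_sym|by move=> v1 /KbP[]].
    by apply: contraNneq eby => <-.
have [ehy|ehy] := boolP (e h y).
  apply: (fin h hh h (y |: Kb) Gh) => //.
  - by constructor 2.
  - by move=> z zK; rewrite !inE zK orbT.
  - by apply/touchP; exists y; rewrite ?inE ?eqxx.
  - by rewrite !inE negb_or hKb andbT; apply: e_r.
  move=> z /in4/or4P[] /eqP-> zh //.
  - apply: addy => //; [exact: bKf|exact: (tri ebh ehy)|by move=> v1 /KbP[]].
  - apply: addy => //; [by apply: contraTneq eag => ->; rewrite eay|exact: negbTE|by move=> v1 /KbP[]].
  - by rewrite eqxx in zh.
have eby : e bb y by move: yN; rewrite (negbTE egy) (negbTE ehy) !orbF.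
apply: (fin h hh bb (y |: Kb) Gh) => //.
- by constructor 3.
- by move=> z zK; rewrite !inE zK orbT.
- by apply/touchP; exists y; rewrite ?inE ?eqxx.
- by rewrite !inE negb_or bKb andbT; apply: bKf.
move=> z /in4/or4P[] /eqP-> zb //.
- by rewrite eqxx in zb.
- apply: addy => //; [by apply: contraTneq eag => ->; rewrite eay|exact: negbTE|by move=> v1 /KbP[]].
- apply: addy => //; [|exact: negbTE|by move=> v1 /KbP[]].
  by apply: contraNneq egy => <-.
Qed.

End Flexing.

(** * Contacts with the hub *)

Section Contacts.
Variables (T : finType) (e : rel T).
Hypothesis e_sym : symmetric e.
Hypothesis e_irr : irreflexive e.
Hypothesis tri : forall x y z, e x y -> e y z -> e x z = false.
Implicit Types (s t : seq T) (x y w : T) (A B K : {set T}).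

Notation conn := (conn e).
Notation touch := (touch e).
Notation col := (col e).
Notation ipath := (ipath e).
Notation nbr := (nbr e).

Notation apart := (apart e).
Notation bfs := (bfs e).
Notation guard := (guard e).
Notation geod := (geod e).

Lemma bfs_prolong S q d p y : bfs S q d -> p \in S -> y \in S -> e p y -> d y = (d p).+1 ->
  exists g, [/\ geod S q d g (d y), g (d y) = y & g (d p) = p].
Proof.
move=> b pS yS epy dy; have [g' [g0 gd gi ge]] := bfs_geodesic b pS; rewrite dy.
exists (fun i => if i <= d p then g' i else y); rewrite ltnn leqnn; split=> //.
split=> //.
  move=> i ir; case: leqP => [|ri]; first exact: gi.
  by split=> //; rewrite dy; nlia.
move=> i ir; have ir' : i <= d p by nlia.
rewrite ir'; case: ltnP => [ir2|ri]; first by apply: ge; nlia.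
by have -> : i = d p; [nlia|rewrite gd].
Qed.

(* The rope runs from [q] through [c] to [q'], and [c] is its only vertex
   touching the body [M :|: V], where [V] consists of at most two vertices. *)
Definition contacted (R K W M : {set T}) q (A1 : seq T) c (A2 : seq T) q' (K' V : {set T}) :=
  [/\ [/\ ipath (q :: A1 ++ c :: rcons A2 q'), q' \in K &
        forall y, y \in A1 ++ c :: A2 -> y \in K \/ [/\ y = c, c \in W & ~~ touch c R]],
      [/\ {subset K' <= K}, conn K', touch q' K', q' \notin K' &
        apart [set y in q :: A1 ++ c :: A2] K'] &
      [/\ conn (M :|: V), touch c (M :|: V) /\ c \notin V,
        forall y, y \in V -> y \in K \/ y \in W /\ ~~ touch y R,
        apart V [set y in q :: A1 ++ rcons A2 q'] /\ apart V K' &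
        (exists u v, {subset V <= [set u; v]}) /\ forall y, y \in V -> touch y (c |: V)]].

(** [p] is a parent in [W] of a clean vertex, so it touches [M] but not the rope. A path is led from
    the tip close to [p]. If [p] sees at least two of its vertices, the path is rerouted through
    [p], which becomes the contact; if it sees one, that vertex is the contact and [V] is [p]; if
    none, [a] is the contact and [V] consists of [p] and [g]. The bound pays [D + 1] for dirty
    vertices and neighbours of the tip, and 3 for the neighbourhoods of [p], [a] and [g]. *)
Lemma contact_step (R K W M : {set T}) q D n :
  conn K -> q \notin K -> touch q K -> q \in R -> apart (R :\ q) K -> guard R q D ->
  (forall v, v \in K -> touch v W) -> (forall w, w \in W -> w \notin q |: K) ->
  (forall w, w \in W -> touch w M) -> conn M -> ~~ col K (2 * (n + 3 + (D + 1))) ->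
  exists (A1 : seq T) c (A2 : seq T) q' (K' V : {set T}), contacted R K W M q A1 c A2 q' K' V /\ ~~ col K' n.
Proof.
move=> cK qK tq qR apRK gR KW WK WM cM nK; have cS := conn_add e_sym cK tq.
have qS : q \in q |: K by rewrite !inE eqxx.
have [d b] := bfs_exists cS qS; have [_ dq par zero lip] := b.
have p1 : ipath [:: q] by rewrite /= .
pose Dr r := dirty e R q [::] K d r :|: (K :&: nbr q).
have cDr r : col (Dr r) (D + 1).
  apply: colU (col_nbr tri _ _); apply: (gR [::] K d r p1) => //.
    by move=> x y _; rewrite inE.
  by move=> x y; rewrite !inE orbF => ? ?; apply: apRK; rewrite // !inE.
have [r [Kf [sKf dKf cKf nKf]]] := bfs_level e_sym b (subsetUr _ _) cDr nK.
have KfP y : y \in Kf -> [/\ y \in K, e q y = false &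
    forall w, e y w -> w \in W -> ~~ touch w R].
  move=> /[dup] yKf /(fintype.subsetP sKf); rewrite in_setD in_setU negb_or.
  case/andP=> /andP[nd nq] yK; split=> //.
    by apply: contraNF nq => eqy; rewrite !inE yK.
  move=> w eyw wW; apply: contra nd => tw; apply/dirtyP; split=> //; first exact: dKf.
  exists w; split=> //; first exact: WK.
  by apply/negP => /touchP[z]; rewrite inE.
have KfS y : y \in Kf -> y \in q |: K by move=> /KfP[yK _ _]; rewrite !inE yK orbT.
have dr y : y \in Kf -> d y = r by apply: dKf.
have [v vKf] := ncol_nonempty nKf; have [vK eqv vcl] := KfP v vKf.
have /touchP[p pW evp] := KW v vK.
have pcl : ~~ touch p R by apply: vcl evp pW.
have [K1 [g [sK1 cK1 nK1 gA tg]]] : exists (K1 : {set T}) g, [/\ K1 \subset Kf :\: nbr p,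
    conn K1, ~~ col K1 (n + 2), g \in Kf :&: nbr p & touch g K1].
  apply: (gate e_sym cKf (col_nbr tri Kf p)); last by rewrite -addnA.
  by apply/set0Pn; exists v; rewrite !inE vKf e_sym.
have [gKf epg] : g \in Kf /\ e p g by move: gA; rewrite !inE => /andP[].
have K1P y : y \in K1 -> y \in Kf /\ e p y = false.
  by move/(fintype.subsetP sK1); rewrite !inE => /andP[/negbTE-> ->].
have [gK eqg _] := KfP g gKf; have gS := KfS g gKf.
have r0 : 0 < r.
  rewrite lt0n -(dr g gKf); apply: contraNneq qK => dg; rewrite -(zero g) //.
have g0 : 0 < d g by rewrite dr.
have [a aS [eag dag]] := par g gS g0; have da : d a = r.-1 by rewrite -(dr g gKf) dag.
have r1 : 1 < r.
  rewrite ltn_neqAle r0 andbT; apply/eqP => r1.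
  by move: eag; rewrite (zero a) ?eqg // da -r1.
have [K2 [g2 [sK2 cK2 nK2 g2A tg2]]] : exists (K2 : {set T}) g2,
    [/\ K2 \subset K1 :\: (nbr a :|: nbr g), conn K2, ~~ col K2 n,
     g2 \in K1 :&: (nbr a :|: nbr g) & touch g2 K2].
  apply: (gate e_sym cK1 (m := 1 + 1)) => //.
    rewrite !setIUr; exact: colU (col_nbr tri _ _) (col_nbr tri _ _).
  have /touchP[z zK1 egz] := tg.
  by apply/set0Pn; exists z; rewrite !inE zK1 egz orbT.
have K2P z : z \in K2 -> [/\ z \in K1, e a z = false & e g z = false].
  by move/(fintype.subsetP sK2); rewrite !inE negb_or => /andP[/andP[/negbTE-> /negbTE->] ->].
have [g2K1 g2N] : g2 \in K1 /\ e a g2 || e g g2 by move: g2A; rewrite !inE => /andP[].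
have [g2Kf epg2] := K1P g2 g2K1; have [g2K _ _] := KfP g2 g2Kf.
have K2Kf z : z \in K2 -> z \in Kf by move=> /K2P[/K1P[]].
have K2K z : z \in K2 -> z \in K by move=> /K2Kf/KfP[].
have g2K2 : g2 \notin K2 by apply/negP => /K2P[_ h1 h2]; rewrite h1 h2 in g2N.
have [gg [Gg ggr gga]] := bfs_prolong b aS gS eag dag.
rewrite dr // in Gg ggr; rewrite da in gga.
have [gg0 ggS gge] := Gg; have egg := geod_edge e_sym b Gg.
have pK y : y \in K -> p != y.
  by move=> yK; apply: contraTneq (WK p pW) => ->; rewrite !inE yK orbT.
have pq : p != q by apply: contraTneq (WK p pW) => ->; rewrite !inE eqxx.
have epq : e p q = false by apply/negbTE; apply: contra pcl => epq; apply/touchP; exists q.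
have ggK j : 0 < j -> j <= r -> gg j \in K.
  move=> j0 jr; have [] := ggS j jr; rewrite !inE => /orP[/eqP->|//].
  by rewrite dq => ?; nlia.
have ggd j k : j <= r -> k <= r -> gg j = gg k -> j = k.
  by move=> /ggS[_ {2}<-] /ggS[_ {2}<-] ->.
have lev j z : j <= r -> z \in Kf -> j.+1 < r -> gg j != z /\ e (gg j) z = false.
  move=> jr zKf jr1; have [jS dj] := ggS j jr; split.
    by apply/eqP => E; move: dj; rewrite E dr // => ?; nlia.
  by apply/negP => /(bfs_adj e_sym b jS (KfS z zKf)); rewrite dj dr // => ?; nlia.
have rlev z : z \in Kf -> gg r.-1 != z.
  move=> zKf; have r1r : r.-1 <= r by nlia.
  by have [_ dj] := ggS _ r1r; apply/eqP => E; move: dj; rewrite E dr // => ?; nlia.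
have gK2 j z : j <= r -> z \in K2 -> gg j != z /\ e (gg j) z = false.
  move=> jr zK2; have [jr1|] := ltnP j.+1 r; first by apply: lev => //; apply: K2Kf.
  move=> jr1; have [zK1 eaz egz] := K2P z zK2; have [E|E] : j = r \/ j = r.-1 by nlia.
    rewrite E ggr egz; split=> //; apply: contraTneq epg => ->.
    by have [_ ->] := K1P z zK1.
  by rewrite E rlev ?gga ?eaz //; apply: K2Kf.
have pK2 z : z \in K2 -> p != z /\ e p z = false.
  by move=> zK2; have [/K1P[/KfP[/pK]]] := K2P z zK2.
(* the geodesic followed by the gate, skipping [g] when [g2] sees [a] *)
pose m := if e a g2 then r else r.+1.
have mr : m <= r.+1 by rewrite /m; case: ifP.
have rm : r <= m by rewrite /m; case: ifP.
have eg2 j : j < m -> gg j != g2 /\ e (gg j) g2 = (j.+1 == m).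
  move=> jm; have jr : j <= r by nlia.
  have [jr1|jr1] := ltnP j.+1 r.
    by have [-> ->] := lev j g2 jr g2Kf jr1; split=> //; apply/esym/negbTE; nlia.
  move: jm; rewrite /m; case: ifP => eag2 jm.
    have -> : j = r.-1 by nlia.
    by rewrite prednK // eqxx gga eag2 -gga rlev.
  have egg2 : e g g2 by rewrite eag2 in g2N.
  have [E|E] : j = r \/ j = r.-1 by nlia.
    rewrite E ggr egg2 eqxx; split=> //.
    by apply: contraTneq egg2 => ->; rewrite e_irr.
  by rewrite E rlev // gga eag2 prednK //; split=> //; apply/esym/negbTE; nlia.
have pL k : k <= m -> ipath (mkseq gg k) by move=> km; apply: (geod_ipath e_sym b Gg); nlia.
have Lmem k y : y \in mkseq gg k -> exists2 j, j < k & y = gg j.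
  by move=> /mapP[j]; rewrite mem_iota => jk ->; exists j.
pose L' := mkseq (fun j => gg j.+1) m.-1.
have LE : mkseq gg m = q :: L'.
  have -> : m = m.-1.+1 by nlia.
  by rewrite /L' /mkseq /= gg0; congr (_ :: _); rewrite -[1]addn0 iotaDl -map_comp.
have pLg : ipath (rcons (q :: L') g2).
  rewrite -LE; apply: (ipath_rcons e_sym); first exact: pL.
  move=> y /Lmem[j jm ->]; have [h1 h2] := eg2 j jm; rewrite eq_sym h1 e_sym h2; split=> //.
  have m0 : 0 < m by nlia.
  rewrite -nth_last size_mkseq nth_mkseq; last by rewrite prednK.
  apply/eqP/eqP => [<-|E]; first by rewrite /=.
  have := ggd j m.-1; rewrite E => h; rewrite h ?prednK //; nlia.
have inner f (V : {set T}) : 0 < f -> f < m -> conn (M :|: V) -> touch (gg f) (M :|: V) ->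
    gg f \notin V -> (forall y, y \in V -> y \in K \/ y \in W /\ ~~ touch y R) ->
    (forall j y, j < m -> j != f -> y \in V -> y != gg j /\ e y (gg j) = false) ->
    (forall y, y \in V -> y != g2 /\ e y g2 = false) -> apart V K2 ->
    (exists u v, {subset V <= [set u; v]}) -> (forall y, y \in V -> touch y (gg f |: V)) ->
    exists (A1 : seq T) c (A2 : seq T) q' (K' V : {set T}), contacted R K W M q A1 c A2 q' K' V /\ ~~ col K' n.
  move=> f0 fm cMV tV nV hV apV apVg2 apVK2 V2 Vt.
  have szL' : size L' = m.-1 by rewrite size_mkseq.
  have fL : f.-1 < size L' by rewrite szL'; nlia.
  have cE : nth q L' f.-1 = gg f by rewrite nth_mkseq ?prednK //; nlia.
  have dE : L' = take f.-1 L' ++ gg f :: drop f L'.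
    by rewrite -{1}(cat_take_drop f.-1 L') (drop_nth q fL) cE prednK.
  have memL' y : y \in L' -> exists2 j, 0 < j < m & y = gg j.
    by move=> /mapP[j]; rewrite mem_iota => hj ->; exists j.+1 => //; nlia.
  have uL : uniq (q :: L') by have := ipath_uniq pLg; rewrite rcons_uniq => /andP[].
  exists (take f.-1 L'), (gg f), (drop f L'), g2, K2, V; split=> //; split.
  - split=> //.
      by rewrite -rcons_cons -rcons_cat -dE -rcons_cons.
    by move=> y; rewrite -dE => /memL'[j hj ->]; left; apply: ggK; nlia.
  - split=> //; rewrite -dE -LE => y z; rewrite inE => /Lmem[j jm ->].
    by apply: gK2; nlia.
  split=> //; split=> // y z yV; rewrite inE => zp.
  have : z = g2 \/ exists2 j, j < m & j != f /\ z = gg j.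
    move: zp; rewrite inE mem_cat mem_rcons inE => /or4P[/eqP->|zt|/eqP->|zd].
    - by right; exists 0; [nlia|split; [rewrite eq_sym -lt0n|]].
    - right; have [j jm Ez] := memL' z (mem_take zt); exists j; first by nlia.
      split=> //; apply: contraTneq uL => jf; have Efz : gg f = z by rewrite Ez jf.
      rewrite {1}dE.
      rewrite cons_uniq cat_uniq; apply/negP => /and4P[_ _ /hasPn/(_ (gg f)) + _].
      by rewrite mem_head => /(_ isT); rewrite Efz zt.
    - by left.
    - right; have [j jm Ez] := memL' z (mem_drop zd); exists j; first by nlia.
      split=> //; apply: contraTneq uL => jf; have Efz : gg f = z by rewrite Ez jf.
      rewrite {1}dE.
      by rewrite cons_uniq cat_uniq cons_uniq Efz zd !andbF.
  case=> [->|[j jm [jf ->]]]; [exact: apVg2|exact: apV].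
have [/existsP[f /andP[ef /existsP[l /andP[fl el]]]]|one] := boolP
    [exists f : 'I_m, e p (gg f) && [exists l : 'I_m, (f != l) && e p (gg l)]].
  pose tt j := (j < m) && e p (gg j).
  have ex : exists j, tt j by exists f; rewrite /tt ltn_ord.
  have bd j : tt j -> j <= m by rewrite /tt => /andP[/ltnW].
  case: (ex_minnP ex) => i1 /andP[i1m ei1] min1.
  case: (ex_maxnP ex bd) => i2 /andP[i2m ei2] max2.
  have hf : i1 <= f <= i2 by rewrite min1 ?max2 // /tt ltn_ord.
  have hl : i1 <= l <= i2 by rewrite min1 ?max2 // /tt ltn_ord.
  have fl' : (f : nat) != l by [].
  have i12 : i1 < i2 by nlia.
  have i1r : i1 <= r by nlia.
  have i2r : i2 <= r by nlia.
  have i10 : 0 < i1.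
    by rewrite lt0n; apply: contraTneq ei1 => ->; rewrite gg0 epq.
  (* Consecutive neighbours of [p] on the geodesic would make a triangle; so the first and the last
     are not adjacent, and the detour through [p] is induced. *)
  have i12' : i1.+1 < i2.
    rewrite ltn_neqAle i12 andbT; apply/eqP => E.
    have e12 : e (gg i1) (gg i2) by rewrite -E; apply: gge; nlia.
    by rewrite (tri ei1 e12) in ei2.
  have touches j : j < m -> e p (gg j) -> i1 <= j <= i2.
    by move=> jm ej; rewrite min1 ?max2 // /tt jm.
  pose A1 := mkseq (fun j => gg j.+1) i1; pose A2 := drop i2 (mkseq gg m).
  have A1E : q :: A1 = mkseq gg i1.+1.
    by rewrite /A1 /mkseq /= gg0; congr (_ :: _); rewrite -[1]addn0 iotaDl -map_comp.
  have A2mem y : y \in A2 -> exists2 j, i2 <= j < m & y = gg j.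
    move=> /(nth_ex q)[j]; rewrite size_drop size_mkseq nth_drop => jm <-.
    have h : i2 + j < m by nlia.
    by exists (i2 + j); [rewrite leq_addr h|rewrite nth_mkseq].
  have pA2 : ipath (rcons A2 g2).
    have := pLg; rewrite -LE -{1}(cat_take_drop i2 (mkseq gg m)) rcons_cat.
    exact: ipath_catr.
  have hA2 y : head y (rcons A2 g2) = gg i2.
    by rewrite /A2 (drop_nth q) ?size_mkseq //= nth_mkseq.
  have ppA2 : ipath (p :: rcons A2 g2).
    apply: ipath_cons => // y; rewrite hA2 mem_rcons inE => /orP[/eqP->|/A2mem[j jm ->]].
      split; first exact: pK.
      by rewrite epg2; apply/esym/negbTE; rewrite eq_sym; have [] := eg2 i2 i2m.
    have j0 : 0 < j by nlia.
    have jr : j <= r by nlia.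
    split; first by apply/pK/ggK.
    apply/idP/eqP => [ej|/(ggd _ _ jr i2r)->//].
    have jm' : j < m by nlia.
    by have := touches j jm' ej => h; congr gg; nlia.
  have pall : ipath (q :: A1 ++ p :: rcons A2 g2).
    rewrite -cat_cons A1E; apply: ipath_cat => //; first by apply: pL; nlia.
    move=> x y /Lmem[j ji ->] /[!inE] yB.
    have jr : j <= r by nlia.
    have jm : j < m by nlia.
    have lastE : last y (mkseq gg i1.+1) = gg i1 by rewrite -nth_last size_mkseq nth_mkseq.
    rewrite lastE /=; case/orP: yB => [/eqP->|].
      rewrite eqxx andbT e_sym eq_sym; split.
        case: (posnP j) => [->|j0]; first by rewrite gg0.
        by apply/pK/ggK.
      apply/idP/eqP => [ej|/(ggd _ _ jr i1r)->//].
      by have := touches j jm ej => h; congr gg; nlia.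
    rewrite mem_rcons inE => /orP[/eqP->|/A2mem[k hk ->]].
      have [h1 ->] := eg2 j jm; split=> //.
      rewrite (_ : (g2 == p) = false) ?andbF; last by rewrite eq_sym; apply/negbTE/pK.
      by apply/negbTE; nlia.
    have jk : j < k by nlia.
    have kr : k <= r by nlia.
    rewrite egg //; split.
      by apply/eqP => /(ggd _ _ jr kr) ?; nlia.
    rewrite (_ : (gg k == p) = false) ?andbF; last first.
      by rewrite eq_sym; apply/negbTE/pK/ggK => //; nlia.
    by apply/negbTE; nlia.
  exists A1, p, A2, g2, K2, set0; split=> //; split.
  - split=> // y; rewrite mem_cat inE => /or3P[yA|/eqP->|/A2mem[j jm ->]]; last first.
    + by left; apply: ggK; nlia.
    + by right.
    have : y \in q :: A1 by rewrite inE yA orbT.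
    rewrite A1E => /Lmem[j ji Ey]; left; rewrite Ey; apply: ggK; last by nlia.
    rewrite lt0n; apply/eqP => j0; have := ipath_uniq pall; rewrite /= mem_cat.
    by rewrite -gg0 -j0 -Ey yA.
  - split=> // y z; rewrite inE -cat_cons mem_cat A1E => /orP[/Lmem[j ji ->]|].
      by apply: gK2; nlia.
    rewrite inE => /orP[/eqP->|/A2mem[j ji ->]]; first exact: pK2.
    by apply: gK2; nlia.
  rewrite setU0; split=> //.
  - by split; [exact: WM|rewrite inE].
  - by move=> y; rewrite inE.
  - by split=> y z; rewrite in_set0.
  - by split; [exists p, p => y; rewrite in_set0|move=> y; rewrite in_set0].
have one' j k : j < m -> k < m -> e p (gg j) -> e p (gg k) -> j = k.
  move=> jm km ej ek; apply/eqP; apply: contraNT one => jk.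
  apply/existsP; exists (Ordinal jm); rewrite /= ej; apply/existsP; exists (Ordinal km).
  by rewrite ek andbT; apply: contra jk => /eqP[->].
have pM : touch p M by apply: WM.
have cMp : conn (M :|: [set p]) by rewrite setUC; apply: (conn_add e_sym).
have pok : p \in K \/ p \in W /\ ~~ touch p R by right.
have pg2 : p != g2 /\ e p g2 = false by split=> //; apply: pK.
have apP (j : nat) : j < m -> e p (gg j) = false -> p != gg j /\ e p (gg j) = false.
  move=> jm ej; split=> //; case: (posnP j) => [->|j0]; first by rewrite gg0.
  by apply/pK/ggK => //; nlia.
have [/existsP[f ef]|none] := boolP [exists f : 'I_m, e p (gg f)].
  have f0 : 0 < f by rewrite lt0n; apply: contraTneq ef => ->; rewrite gg0 epq.
  have fr : f <= r by have := ltn_ord f; nlia.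
  apply: (inner f [set p]) => //.
  - by rewrite touchU; apply/orP; right; apply/touchP; exists p; rewrite ?inE // e_sym.
  - by rewrite inE eq_sym; apply/pK/ggK.
  - by move=> y /set1P->.
  - move=> j y jm jf /set1P->; apply: apP => //; apply: contraNF jf => ej.
    by apply/eqP/(one' j f).
  - by move=> y /set1P->.
  - by move=> y z /set1P->; apply: pK2.
  - by exists p, p => y; rewrite !inE => ->.
  - by move=> y /set1P->; apply/touchP; exists (gg f); rewrite // !inE eqxx.
have nt j : j < m -> e p (gg j) = false.
  move=> jm; apply/negbTE; move: none; rewrite negb_exists => /forallP/(_ (Ordinal jm)).
  by [].
(* [g] sees [p], so it cannot be on the path: [g2] sees [a] directly, and [g] is free to connect [a]
   with [p]. *)
have Em : m = r.
  move: nt; rewrite /m; case: ifP => // _ /(_ r (ltnSn r)).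
  by rewrite ggr epg.
have eag2 : e a g2.
  by move: Em; rewrite /m; case: ifP => // _ ?; nlia.
have gg2' : g != g2 /\ e g g2 = false.
  have ega : e g a by rewrite e_sym.
  rewrite (tri ega eag2); split=> //.
  by apply: contraTneq epg => ->; rewrite epg2.
apply: (inner r.-1 [set p; g]) => //.
- by nlia.
- by nlia.
- have -> : M :|: [set p; g] = g |: (M :|: [set p]).
    by apply/setP => y; rewrite !inE; case: (y \in M) (y == p) (y == g) => [] [] [].
  apply: (conn_add e_sym) => //; apply/touchP; exists p; first by rewrite !inE eqxx orbT.
  by rewrite e_sym.
- rewrite touchU; apply/orP; right; apply/touchP; exists g; first by rewrite !inE eqxx orbT.
  by rewrite gga.
- apply/negP => /set2P[] E; last by have := rlev g gKf; rewrite E eqxx.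
  have r1K : gg r.-1 \in K by apply: ggK; nlia.
  by have := pK _ r1K; rewrite E eqxx.
- by move=> y /set2P[->|->] //; left.
- move=> j y jm jf /set2P[->|->]; first by apply: apP => //; apply: nt.
  have jr : j <= r by nlia.
  have jr1 : j.+1 < r by nlia.
  by have [h1 h2] := lev j g jr gKf jr1; rewrite eq_sym e_sym.
- by move=> y /set2P[->|->].
- by move=> y z /set2P[->|->] zK2; [apply: pK2|rewrite -ggr; apply: gK2].
- by exists p, g.
- move=> y /set2P[->|->]; apply/touchP; [exists g|exists p]; rewrite ?(e_sym g) //;
    by rewrite !inE eqxx ?orbT.
Qed.

End Contacts.

(** * Signed bags *)

Section Bags.
Variables (T : finType) (e : rel T).
Hypothesis e_sym : symmetric e.
Hypothesis e_irr : irreflexive e.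
Hypothesis nowheel : forall m blk sg, ~ wheel e m blk sg.
Implicit Types (s t : seq T) (x y w : T) (A B K : {set T}).

Notation conn := (conn e).
Notation touch := (touch e).
Notation ipath := (ipath e).

Notation apart := (apart e).
Notation flx := (flx e).

Definition bag B (sg : T -> bool) : Prop :=
  conn B /\ {in B &, forall x y, e x y -> sg x != sg y}.

Definition joined A (sa : T -> bool) B (sb : T -> bool) : Prop :=
  (forall x y, x \in A -> y \in B -> x != y /\ (e x y -> sa x /\ sb y)) /\
  exists2 x, x \in A & touch x B.

Lemma joined_sym A sa B sb : joined A sa B sb -> joined B sb A sa.
Proof.
move=> [h [x xA /touchP[y yB exy]]]; split.
  by move=> y' x' yB' xA'; have [h1 h2] := h x' y' xA' yB'; rewrite eq_sym e_sym; split=> // /h2[].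
by exists y => //; apply/touchP; exists x; rewrite // e_sym.
Qed.

Lemma K4_bags (B0 B1 B2 B3 : {set T}) (s0 s1 s2 s3 : T -> bool) :
  [/\ bag B0 s0, bag B1 s1, bag B2 s2 & bag B3 s3] ->
  [/\ joined B0 s0 B1 s1, joined B0 s0 B2 s2 & joined B0 s0 B3 s3] ->
  [/\ joined B1 s1 B2 s2, joined B1 s1 B3 s3 & joined B2 s2 B3 s3] -> False.
Proof.
move=> [b0 b1 b2 b3] [j01 j02 j03] [j12 j13 j23].
pose sg x := if x \in B0 then s0 x else if x \in B1 then s1 x else
             if x \in B2 then s2 x else s3 x.
have dis A sa B sb : joined A sa B sb -> [disjoint A & B].
  move=> [h _]; apply/pred0P => x /=; apply/andP => -[xA xB].
  by have [/eqP] := h x x xA xB.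
have din A sa B sb x : joined A sa B sb -> x \in B -> x \in A = false.
  by move=> [h _] xB; apply/negP => xA; have [/eqP] := h x x xA xB.
have g0 x : x \in B0 -> sg x = s0 x by rewrite /sg => ->.
have g1 x : x \in B1 -> sg x = s1 x.
  by move=> h; rewrite /sg (din _ _ _ _ _ j01 h) h.
have g2 x : x \in B2 -> sg x = s2 x.
  by move=> h; rewrite /sg (din _ _ _ _ _ j02 h) (din _ _ _ _ _ j12 h) h.
have g3 x : x \in B3 -> sg x = s3 x.
  by move=> h; rewrite /sg (din _ _ _ _ _ j03 h) (din _ _ _ _ _ j13 h) (din _ _ _ _ _ j23 h).
have jn A sa B sb : joined A sa B sb -> (forall x, x \in A -> sg x = sa x) ->
    forall x y, x \in A -> y \in B -> e x y -> sg x.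
  by move=> [h _] gA x y xA yB exy; have [_ /(_ exy)[]] := h x y xA yB; rewrite gA.
apply: (K4_false e_sym nowheel (B0 := B0) (B1 := B1) (B2 := B2) (B3 := B3) (sg := sg)).
- by case: b0.
- by case: b1.
- by case: b2.
- by case: b3.
- split; [exact: dis j01|exact: dis j02|exact: dis j03|exact: dis j12|].
  by split; [exact: dis j13|exact: dis j23].
- move=> B; rewrite !inE => /or4P[] /eqP-> x y xB yB exy.
  + by rewrite !g0 //; case: b0 => _; apply.
  + by rewrite !g1 //; case: b1 => _; apply.
  + by rewrite !g2 //; case: b2 => _; apply.
  + by rewrite !g3 //; case: b3 => _; apply.
- have j10 := joined_sym j01; have j20 := joined_sym j02; have j30 := joined_sym j03.
  have j21 := joined_sym j12; have j31 := joined_sym j13; have j32 := joined_sym j23.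
  move=> A B; rewrite !inE => /or4P[] /eqP-> /or4P[] /eqP-> AB x y xA yB exy;
    try by rewrite eqxx in AB.
  all: try first [exact: (jn _ _ _ _ j01 g0 x y xA yB exy)|exact: (jn _ _ _ _ j02 g0 x y xA yB exy)|exact: (jn _ _ _ _ j03 g0 x y xA yB exy)|exact: (jn _ _ _ _ j10 g1 x y xA yB exy)|exact: (jn _ _ _ _ j12 g1 x y xA yB exy)|exact: (jn _ _ _ _ j13 g1 x y xA yB exy)|exact: (jn _ _ _ _ j20 g2 x y xA yB exy)|exact: (jn _ _ _ _ j21 g2 x y xA yB exy)|exact: (jn _ _ _ _ j23 g2 x y xA yB exy)|exact: (jn _ _ _ _ j30 g3 x y xA yB exy)|exact: (jn _ _ _ _ j31 g3 x y xA yB exy)|exact: (jn _ _ _ _ j32 g3 x y xA yB exy)].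
- by split; [case: j01|case: j02|case: j03|case: j12|split; [case: j13|case: j23]].
Qed.

Lemma bag1 x b : bag [set x] (fun=> b).
Proof.
split; first exact: conn1.
by move=> y z /set1P-> /set1P->; rewrite e_irr.
Qed.

Lemma bag_hang B sg c (L : seq T) : bag B sg -> c \in B -> ipath (c :: L) ->
  apart (B :\ c) [set y in L] ->
  exists sg', [/\ bag (B :|: [set y in L]) sg', forall x, x \in B -> sg' x = sg x &
    sg' (last c L) = sg c (+) odd (size L)].
Proof.
move=> [cB hB] cBin pL ap.
have LB y : y \in L -> y \notin B.
  move=> yL; apply/negP => yB; have yc : y != c.
    by apply: contraTneq pL => <-; apply/negP => /ipath_uniq; rewrite /= yL.
  by have [||/eqP] := ap y y; rewrite ?inE ?yc.
have uL : uniq L by have /ipath_uniq/= /andP[] := pL.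
exists (fun v => if v \in B then sg v else sg c (+) ~~ odd (index v L)); split.
- split.
    have -> : B :|: [set y in L] = B :|: [set y in c :: L].
      by apply/setP => y; rewrite !inE; case: (eqVneq y c) => [->|]; rewrite ?cBin.
    apply: (connU e_sym cB (conn_ipath e_sym e_irr pL) cBin (b := c)); rewrite ?eqxx //.
    by rewrite inE mem_head.
  have cross x y : x \in B -> y \in L -> e x y -> sg x != sg c (+) ~~ odd (index y L).
    move=> xB yL exy; have [xc|xc] := eqVneq x c; last first.
      by have [||_] := ap x y; rewrite ?inE ?xc ?exy.
    rewrite xc in exy *; have [_] := ipath_cross (s := [:: c]) pL (mem_head _ _) yL.
    rewrite exy eqxx /= => /esym/eqP yh.
    move: yL; rewrite yh; case: (L) => [|z L'] //= _; rewrite eqxx; by case: (sg c).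
  move=> x y; rewrite !inE => /orP[xB|xL] /orP[yB|yL] exy.
  + by rewrite xB yB hB.
  + by rewrite xB (negbTE (LB y yL)) cross.
  + by rewrite yB (negbTE (LB x xL)) eq_sym cross // e_sym.
  rewrite (negbTE (LB x xL)) (negbTE (LB y yL)).
  have [i si Ei] := nth_ex c xL; have [j sj Ej] := nth_ex c yL.
  have pL' := ipath_catr (s := [:: c]) pL.
  move: exy; rewrite -Ei -Ej (ipath_nth e_sym e_irr) // !index_uniq //.
  by case/orP => /eqP->; case: (sg c); rewrite /= ?addbT ?addbF ?negbK; case: (odd _).
- by move=> x ->.
case: L pL ap LB uL => [|z L] pL ap LB uL; first by rewrite /= cBin addbF.
have -> : last c (z :: L) = nth c (z :: L) (size L) by rewrite /= (last_nth c).
by rewrite (negbTE (LB _ _)) ?mem_nth // index_uniq.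
Qed.

(** The centre gets the sign [~~ f]; alternating along a leg whose length has parity [f] then ends
    at a positive vertex, also when the leg is empty. *)
Lemma spider c (G s1 s2 : seq T) f : ipath (c :: G) -> ipath (c :: s1) -> ipath (c :: s2) ->
  apart [set y in G] [set y in s1] -> apart [set y in G] [set y in s2] ->
  apart [set y in s1] [set y in s2] ->
  odd (size G) = f -> odd (size s1) = f -> odd (size s2) = f ->
  exists sg, [/\ bag [set y in c :: G ++ s1 ++ s2] sg, sg (last c G), sg (last c s1) &
    sg (last c s2)].
Proof.
move=> pG p1 p2 aG1 aG2 a12 oG o1 o2.
have ap0 : apart ([set c] :\ c) [set y in G] by move=> x y; rewrite setDv in_set0.
have [sg0 [b0 h0 l0]] := bag_hang (bag1 c (~~ f)) (set11 c) pG ap0.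
have cG : c \in [set c] :|: [set y in G] by rewrite !inE eqxx.
have [sg1 [b1 h1 l1]] : exists sg', [/\ bag ([set c] :|: [set y in G] :|: [set y in s1]) sg',
    forall x, x \in [set c] :|: [set y in G] -> sg' x = sg0 x &
    sg' (last c s1) = sg0 c (+) odd (size s1)].
  apply: bag_hang b0 cG p1 _ => x y; rewrite !inE => /andP[/negbTE-> /=] xG ys.
  by apply: aG1; rewrite inE.
have cG1 : c \in [set c] :|: [set y in G] :|: [set y in s1] by rewrite inE cG.
have [sg2 [b2 h2 l2]] : exists sg', [/\
    bag ([set c] :|: [set y in G] :|: [set y in s1] :|: [set y in s2]) sg',
    forall x, x \in [set c] :|: [set y in G] :|: [set y in s1] -> sg' x = sg1 x &
    sg' (last c s2) = sg1 c (+) odd (size s2)].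
  apply: bag_hang b1 cG1 p2 _ => x y; rewrite !inE => /andP[/negbTE-> /=] xG ys.
  by case/orP: xG => xG; [apply: aG2|apply: a12]; rewrite inE.
exists sg2; have lm s : last c s \in c :: s by apply: mem_last.
have E : [set y in c :: G ++ s1 ++ s2] =
    [set c] :|: [set y in G] :|: [set y in s1] :|: [set y in s2].
  by apply/setP => y; rewrite !inE !mem_cat !orbA.
have lG : last c G \in [set c] :|: [set y in G] by have := lm G; rewrite !inE.
have l1' : last c s1 \in [set c] :|: [set y in G] :|: [set y in s1].
  by have := lm s1; rewrite !inE => /orP[->|->]; rewrite ?orbT.
rewrite E; split=> //.
- have lG' : last c G \in [set c] :|: [set y in G] :|: [set y in s1] by rewrite in_setU lG.
  by rewrite h2 // h1 // l0 oG; case: (f).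
- by rewrite h2 // l1 h0 ?set11 // o1; case: (f).
- by rewrite l2 h1 // h0 ?set11 // o2; case: (f).
Qed.

(* The parity of the link is chosen to give both halves prescribed parities. *)
Lemma flx_cut c (I : {set T}) c' (f f' : bool) : flx c I c' -> apart [set c] [set c'] ->
  exists s1 s2 : seq T, [/\ [/\ ipath (c :: s1), ipath (c' :: s2), {subset s1 <= I} &
    {subset s2 <= I}], odd (size s1) = f, odd (size s2) = f' &
    (forall x y, x \in c :: s1 -> y \in c' :: s2 ->
      x != y /\ e x y = (x == last c s1) && (y == last c' s2))].
Proof.
move=> fl ap; have [t [pt tI ot]] := fl (f (+) f').
have [_ ncc'] := ap c c' (set11 _) (set11 _).
have t0 : 0 < size t.
  by case: (t) pt => //= /andP[_ /andP[]]; rewrite ncc'.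
(* The half at [c'] receives 0 or 1 vertices, as its parity demands. The link is not empty because
   [c] and [c'] are not adjacent. *)
pose k := size t - f'.
have kt : k <= size t by rewrite /k; nlia.
have E : c :: rcons t c' = (c :: take k t) ++ rcons (drop k t) c'.
  by rewrite cat_cons -rcons_cat cat_take_drop.
rewrite E in pt.
have sd : size (drop k t) = f' by rewrite size_drop /k subKn //; case: (f') t0.
exists (take k t), (rev (drop k t)); split.
- split; first exact: ipath_catl pt.
  + by have := ipath_rev e_sym e_irr (ipath_catr pt); rewrite rev_rcons.
  + by move=> x /mem_take/tI.
  + by move=> x; rewrite mem_rev => /mem_drop/tI.
- rewrite size_take_min (minn_idPl kt) /k; move: ot; case: (f') t0 => /=.
    by rewrite subn1; case: (size t) => //= n _; case: (odd n) (f) => [] [].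
  by rewrite subn0 addbF.
- by rewrite size_rev sd; case: (f').
move=> x y xs ys; have y' : y \in rcons (drop k t) c'.
  by move: ys; rewrite mem_rcons !inE mem_rev.
have [h1 h2] := ipath_cross pt xs y'; split=> //; rewrite h2 /=.
congr (_ && (y == _)).
by case: (drop k t) => //= z s; rewrite rev_cons last_rcons.
Qed.

Lemma joined_spider c (G s1 s2 : seq T) (sg : T -> bool) c' (G' s1' s2' : seq T)
    (sg' : T -> bool) :
  (forall x y, x \in c :: s1 -> y \in c' :: s2' ->
      x != y /\ e x y = (x == last c s1) && (y == last c' s2')) ->
  apart [set y in G ++ s2] [set y in c' :: G' ++ s1' ++ s2'] ->
  apart [set y in c :: s1] [set y in G' ++ s1'] -> sg (last c s1) -> sg' (last c' s2') ->
  joined [set y in c :: G ++ s1 ++ s2] sg [set y in c' :: G' ++ s1' ++ s2'] sg'.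
Proof.
move=> hc a1 a2 l1 l2; split.
  move=> x y; rewrite !in_set => xS yS.
  have xC : x \in c :: s1 \/ x \in G ++ s2.
    move: xS; rewrite inE !mem_cat inE; case/or4P=> ->; rewrite ?orbT; by [left|right].
  case: xC => xC; last by have [||-> ->] := a1 x y; rewrite ?in_set.
  have yC : y \in c' :: s2' \/ y \in G' ++ s1'.
    move: yS; rewrite inE !mem_cat inE; case/or4P=> ->; rewrite ?orbT; by [left|right].
  case: yC => yC; last by have [||-> ->] := a2 x y; rewrite ?in_set.
  by have [-> ->] := hc x y xC yC; split=> // /andP[/eqP-> /eqP->].
have lm s z : last z s \in z :: s by apply: mem_last.
exists (last c s1).
  by have := lm s1 c; rewrite in_set !inE !mem_cat => /orP[->|->]; rewrite ?orbT.
apply/touchP; exists (last c' s2'); last first.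
  by have [_ ->] := hc _ _ (lm s1 c) (lm s2' c'); rewrite !eqxx.
by have := lm s2' c'; rewrite in_set !inE !mem_cat => /orP[->|->]; rewrite ?orbT.
Qed.

Definition leg C (sg : T -> bool) c (G : seq T) : Prop :=
  [/\ ipath (c :: G), touch (last c G) C &
      forall y z, y \in c :: G -> z \in C -> y != z /\ (e y z -> y = last c G /\ sg z)].

(* The four bags of a K4: the centre [C], and each contact with its leg and the
   adjacent halves of the two flexible links. *)
Lemma tripod C sg c0 c1 c2 (G0 G1 G2 : seq T) (I0 I1 I2 : {set T}) : bag C sg ->
  [/\ leg C sg c0 G0, leg C sg c1 G1 & leg C sg c2 G2] ->
  [/\ flx c0 I0 c1, flx c1 I1 c2 & flx c2 I2 c0] ->
  [/\ apart [set y in c0 :: G0] [set y in c1 :: G1],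
      apart [set y in c1 :: G1] [set y in c2 :: G2] &
      apart [set y in c2 :: G2] [set y in c0 :: G0]] ->
  [/\ apart I0 I1, apart I1 I2 & apart I2 I0] ->
  [/\ apart I0 [set y in c2 :: G2], apart I1 [set y in c0 :: G0] &
      apart I2 [set y in c1 :: G1]] ->
  [/\ apart I0 [set y in G0 ++ G1], apart I1 [set y in G1 ++ G2] &
      apart I2 [set y in G2 ++ G0]] ->
  apart C (I0 :|: I1 :|: I2) -> False.
Proof.
move=> bC [g0 g1 g2] [f0 f1 f2] [a01 a12 a20] [i01 i12 i20] [o0 o1 o2] [n0 n1 n2] aC.
have cc c (G : seq T) c' (G' : seq T) : apart [set y in c :: G] [set y in c' :: G'] -> apart [set c] [set c'].
  by move=> h x y /set1P-> /set1P->; apply: h; rewrite inE mem_head.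
have [s0 [t1 [[ps0 pt1 s0I t1I] os0 ot1 h0]]] :=
  flx_cut (odd (size G0)) (odd (size G1)) f0 (cc _ _ _ _ a01).
have [s1 [t2 [[ps1 pt2 s1I t2I] os1 ot2 h1]]] :=
  flx_cut (odd (size G1)) (odd (size G2)) f1 (cc _ _ _ _ a12).
have [s2 [t0 [[ps2 pt0 s2I t0I] os2 ot0 h2]]] :=
  flx_cut (odd (size G2)) (odd (size G0)) f2 (cc _ _ _ _ a20).
have [pG0 _ _] := g0; have [pG1 _ _] := g1; have [pG2 _ _] := g2.
have sp c (G s t : seq T) f (I J : {set T}) : ipath (c :: G) -> ipath (c :: s) -> ipath (c :: t) ->
    {subset s <= I} -> {subset t <= J} -> apart I J -> apart I [set y in G] ->
    apart J [set y in G] -> odd (size G) = f -> odd (size s) = f -> odd (size t) = f ->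
    exists sg, [/\ bag [set y in c :: G ++ s ++ t] sg, sg (last c G), sg (last c s) &
    sg (last c t)].
  move=> pG p1 p2 sI tJ IJ IG JG; apply: spider => // x y; rewrite !inE => h h'.
  - by apply: (apart_sym e_sym IG); rewrite ?inE //; apply: sI.
  - by apply: (apart_sym e_sym JG); rewrite ?inE //; apply: tJ.
  - by apply: IJ; [apply: sI|apply: tJ].
have subl (G G' : seq T) (I : {set T}) : apart I [set y in G ++ G'] -> apart I [set y in G].
  by apply: apart_sub => // x; rewrite !inE mem_cat => ->.
have subr (G G' : seq T) (I : {set T}) : apart I [set y in G ++ G'] -> apart I [set y in G'].
  by apply: apart_sub => // x; rewrite !inE mem_cat => ->; rewrite orbT.
have [r0 [b0 lg0 ls0 lt0]] := sp c0 G0 s0 t0 _ I0 I2 pG0 ps0 pt0 s0I t0I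
  (apart_sym e_sym i20) (subl _ _ _ n0) (subr _ _ _ n2) (erefl _) os0 ot0.
have [r1 [b1 lg1 ls1 lt1]] := sp c1 G1 s1 t1 _ I1 I0 pG1 ps1 pt1 s1I t1I
  (apart_sym e_sym i01) (subl _ _ _ n1) (subr _ _ _ n0) (erefl _) os1 ot1.
have [r2 [b2 lg2 ls2 lt2]] := sp c2 G2 s2 t2 _ I2 I1 pG2 ps2 pt2 s2I t2I
  (apart_sym e_sym i12) (subl _ _ _ n2) (subr _ _ _ n1) (erefl _) os2 ot2.
have jC c (G s t : seq T) (r : T -> bool) (I J : {set T}) : {subset s <= I} -> {subset t <= J} -> leg C sg c G ->
    apart C (I :|: J) -> r (last c G) -> joined C sg [set y in c :: G ++ s ++ t] r.
  move=> sI tJ [_ tG hG] aIJ lG; apply: joined_sym; split.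
    move=> x y; rewrite in_set inE mem_cat orbA => /orP[xG|].
      by move=> yC; have [h3 h4] := hG x y xG yC; split=> // /h4[-> ->].
    rewrite mem_cat => xst yC; have [|h3 h4] := aIJ y x yC.
      by rewrite inE; case/orP: xst => [/sI->|/tJ->]; rewrite ?orbT.
    by rewrite eq_sym e_sym h4.
  exists (last c G) => //; rewrite in_set inE mem_cat orbA.
  by have := mem_last c G; rewrite inE => ->.
have jS c (G s t : seq T) (r : T -> bool) c' (G' s' t' : seq T) (r' : T -> bool)
    (I J J' : {set T}) : {subset s <= I} -> {subset t <= J} ->
    {subset s' <= J'} -> {subset t' <= I} ->
    (forall x y, x \in c :: s -> y \in c' :: t' ->
      x != y /\ e x y = (x == last c s) && (y == last c' t')) ->
    apart [set y in c :: G] [set y in c' :: G'] -> apart J I -> apart I J' -> apart J' J ->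
    apart J [set y in c' :: G'] -> apart J' [set y in c :: G] ->
    apart I [set y in G ++ G'] -> r (last c s) -> r' (last c' t') ->
    joined [set y in c :: G ++ s ++ t] r [set y in c' :: G' ++ s' ++ t'] r'.
  move=> sI tJ sJ' tI hc aG aJI aIJ' aJ'J aJG aJ'G aIG lr lr'; apply: joined_spider => //.
    move=> x y; rewrite !in_set mem_cat inE !mem_cat => /orP[xG|/tJ xJ] /or4P[yc|yG|ys|yt].
    - by apply: aG; rewrite in_set inE ?xG ?yc ?orbT.
    - by apply: aG; rewrite in_set inE ?xG ?yG ?orbT.
    - by apply: (apart_sym e_sym aJ'G); rewrite ?in_set ?inE ?xG ?orbT //; apply: sJ'.
    - by apply: (apart_sym e_sym aIG); rewrite ?in_set ?mem_cat ?xG //; apply: tI.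
    - by apply: aJG; rewrite ?in_set ?inE ?yc.
    - by apply: aJG; rewrite ?in_set ?inE ?yG ?orbT.
    - by apply: (apart_sym e_sym aJ'J) => //; apply: sJ'.
    - by apply: aJI => //; apply: tI.
  move=> x y; rewrite !in_set inE mem_cat => /orP[xc|/sI xI] /orP[yG|/sJ' yJ].
  - by apply: aG; rewrite in_set inE ?xc ?yG ?orbT.
  - by apply: (apart_sym e_sym aJ'G); rewrite ?in_set ?inE ?xc.
  - by apply: aIG; rewrite ?in_set ?mem_cat ?yG ?orbT.
  - exact: aIJ'.
have aCs (I : {set T}) : {subset I <= I0 :|: I1 :|: I2} -> apart C I by move=> h; apply: apart_sub aC.
apply: (K4_bags (B0 := C) (s0 := sg) (And4 bC b0 b1 b2)).
- split.
  + apply: (jC c0 G0 s0 t0 r0 I0 I2) => //; apply: aCs => x; rewrite !inE.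
    by case/orP=> ->; rewrite ?orbT.
  + apply: (jC c1 G1 s1 t1 r1 I1 I0) => //; apply: aCs => x; rewrite !inE.
    by case/orP=> ->; rewrite ?orbT.
  + apply: (jC c2 G2 s2 t2 r2 I2 I1) => //; apply: aCs => x; rewrite !inE.
    by case/orP=> ->; rewrite ?orbT.
- split.
  + by apply: (jS c0 G0 s0 t0 r0 c1 G1 s1 t1 r1 I0 I2 I1).
  + apply: joined_sym; by apply: (jS c2 G2 s2 t2 r2 c0 G0 s0 t0 r0 I2 I1 I0).
  + by apply: (jS c1 G1 s1 t1 r1 c2 G2 s2 t2 r2 I1 I0 I2).
Qed.

End Bags.

(** * Triads *)

Section Triads.
Variables (T : finType) (e : rel T).
Hypothesis e_sym : symmetric e.
Hypothesis e_irr : irreflexive e.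
Hypothesis nowheel : forall m blk sg, ~ wheel e m blk sg.
Implicit Types (s t : seq T) (x y w : T) (A B K : {set T}).

Notation conn := (conn e).
Notation ipath := (ipath e).
Notation ring := (ring e).

Notation apart := (apart e).
Notation flx := (flx e).
Notation geod := (geod e).
Notation bag := (bag e).
Notation leg := (leg e).

(** Take an induced path in [X] from an [a]-vertex to a [b]-vertex with as few vertices as possible:
    a later [a]-vertex or an earlier [b]-vertex would allow it to be shortened. *)
Lemma path_between (X : {set T}) (a b : pred T) : conn X ->
  (exists2 x, x \in X & a x) -> (exists2 y, y \in X & b y) ->
  exists x s, [/\ ipath (x :: s), {subset x :: s <= X},
    forall y, y \in x :: s -> a y = (y == x) & forall y, y \in x :: s -> b y = (y == last x s)].
Proof.
move=> cX [x xX ax] [y yX by_].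
pose good n := [exists t : n.-tuple T, [&& ipath t, all (mem X) t, n > 0, a (head x t) &
  b (last x t)]].
have goodI s : ipath s -> {subset s <= X} -> 0 < size s -> a (head x s) -> b (last x s) ->
    good (size s).
  move=> ps sX s0 as_ bs; apply/existsP; exists (in_tuple s).
  by rewrite /= ps s0 as_ bs !andbT; apply/allP.
have ex : exists n, good n.
  have [d bd] := bfs_exists cX xX; have [g gg] := bfs_geodesic bd yX.
  have Gg : geod X x d g (d y) by case: gg => h1 _ h2 h3.
  have [g0 gd gX _] := gg.
  exists (size (mkseq g (d y).+1)); apply: goodI.
  - by apply: (geod_ipath e_sym bd Gg).
  - move=> z /mapP[i]; rewrite mem_iota => hi ->; have hi' : i <= d y by nlia.
    by have [] := gX i hi'.
  - by rewrite size_mkseq.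
  - by rewrite /= g0.
  - by rewrite -nth_last size_mkseq nth_mkseq // gd.
case: (ex_minnP ex) => n /existsP[t /and5P[pt /allP tX n0 at_ bt]] minn.
have szt : size t = n by apply: size_tuple.
case Et : (tval t) szt pt tX at_ bt => [|z s] szt pt tX at_ bt; first by rewrite -szt in n0.
exists z, s; have us := ipath_uniq pt; split=> // w ws.
  apply/idP/eqP => [aw|->//]; have [i si Ei] := nth_ex x ws.
  case: (posnP i) => [i0|i0]; first by rewrite -Ei i0.
  have := minn (size (drop i (z :: s))); rewrite size_drop szt => h.
  have : n <= n - i; last by rewrite szt in si; nlia.
  apply: h; rewrite -szt -size_drop; apply: goodI.
  - by apply: (ipath_catr (s := take i (z :: s))); rewrite cat_take_drop.
  - by move=> v /mem_drop/tX.
  - by rewrite size_drop; nlia.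
  - by rewrite (drop_nth x si) /= Ei.
  - rewrite (_ : last x (drop i (z :: s)) = last x (z :: s)) //.
    by rewrite -{2}(cat_take_drop i (z :: s)) last_cat (drop_nth x si).
apply/idP/eqP => [bw|->//]; have [i si Ei] := nth_ex x ws.
case: (eqVneq i.+1 (size (z :: s))) => [i0|i0].
  by rewrite -Ei (last_nth x) -[i]/(i.+1.-1) i0.
have i1 : i.+1 < size (z :: s) by nlia.
have := minn (size (take i.+1 (z :: s))); rewrite (size_takel (ltnW i1)) => h.
have : n <= i.+1; last by rewrite szt in i1; nlia.
apply: h; rewrite -(size_takel (ltnW i1)); apply: goodI => //.
- by apply: (ipath_catl (t := drop i.+1 (z :: s))); rewrite cat_take_drop.
- by move=> v /mem_take/tX.
- by rewrite -nth_last (size_takel (ltnW i1)) nth_take //= Ei.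
Qed.

(* Three contacts with pairwise flexible links through [I0], [I1], [I2], and a
   set [X] that will be connected and see all three contacts. *)
Definition triad c0 c1 c2 (I0 I1 I2 X : {set T}) : Prop :=
  [/\ [/\ flx c0 I0 c1, flx c1 I1 c2 & flx c2 I2 c0],
      [/\ apart [set c0] [set c1], apart [set c1] [set c2] & apart [set c2] [set c0]],
      [/\ apart I0 I1, apart I1 I2 & apart I2 I0],
      [/\ apart I0 [set c2], apart I1 [set c0] & apart I2 [set c1]] &
      apart X (I0 :|: I1 :|: I2) /\ [/\ c0 \notin X, c1 \notin X & c2 \notin X]].

Lemma triad_rot c0 c1 c2 I0 I1 I2 X : triad c0 c1 c2 I0 I1 I2 X -> triad c1 c2 c0 I1 I2 I0 X.
Proof.
move=> [[? ? ?] [? ? ?] [? ? ?] [? ? ?] [aX [? ? ?]]]; split=> //; split=> //.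
by rewrite setUC setUA.
Qed.

Lemma triad_flip c0 c1 c2 I0 I1 I2 X : triad c0 c1 c2 I0 I1 I2 X -> triad c1 c0 c2 I0 I2 I1 X.
Proof.
move=> [[f0 f1 f2] [a b c] [x y z] [? ? ?] [aX [? ? ?]]].
split; split=> //; try exact: (flx_rev e_sym e_irr); try exact: (apart_sym e_sym).
by rewrite -setUA (setUC I2) setUA.
Qed.

(** With parity [pi] positive on [W], the contact [c2] sees positive vertices only, and [W] can be
    the centre of a tripod. An end of [W] of the wrong parity leaves the centre and becomes a leg of
    one vertex for [c0] or [c1]; [lo] and [hi] bound what is left. *)
Lemma triad_one_parity c0 c1 c2 (I0 I1 I2 X : {set T}) (W : seq T) i1 pi :
  triad c0 c1 c2 I0 I1 I2 X -> ipath W -> {subset W <= X} -> i1 < size W ->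
  (forall i, i < size W -> e c0 (nth c0 W i) = (i == 0)) ->
  (forall i, i < size W -> e c1 (nth c0 W i) = (i.+1 == size W)) ->
  e c2 (nth c0 W i1) -> (forall i, i < size W -> e c2 (nth c0 W i) -> odd i = pi) -> False.
Proof.
move=> [fl [a01 a12 a20] ai [n02 n10 n21] [aX [x0 x1 x2]]] pW WX i1n h0 h1 t1 par.
set n := size W in i1n h0 h1 par *; have uW := ipath_uniq pW.
pose f1 := odd n.-1 != pi; pose lo : nat := pi; pose hi := n - f1.
have o1 : odd i1 = pi by apply: par.
have hlo : lo <= i1 by rewrite /lo -o1; case: (i1) => //= k; case: (odd k).
have n0 : 0 < n by nlia.
have i1hi : i1 < hi.
  rewrite /hi /f1; case: eqP => [_|ne]; first by rewrite subn0.
  have : i1 != n.-1 by apply/eqP => E; rewrite E in o1.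
  by rewrite /= subn1 => ?; nlia.
pose w i := nth c0 W i.
have wX i : i < n -> w i \in X by move=> h; apply/WX/mem_nth.
have wne i j : i < n -> j < n -> (w i == w j) = (i == j) by move=> hi_ hj; apply: nth_eq.
have wadj i j : i < n -> j < n -> e (w i) (w j) = (j == i.+1) || (i == j.+1).
  exact: (ipath_nth e_sym e_irr).
have nX c i : c \notin X -> i < n -> c != w i.
  by move=> cX ni; apply: contraNneq cX => ->; apply: wX.
pose C := seg W lo hi.
have CP z : z \in C -> exists i, [/\ lo <= i < hi, i < n & z = w i].
  by move=> /(segP c0)[i [h1_ h2_] ->]; exists i.
have inC i : lo <= i < hi -> w i \in C.
  by move=> hi_; apply/(segP c0); exists i => //; split=> //; rewrite -/n; nlia.
pose sg z := odd (index z W) == pi.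
have sgw i : i < n -> sg (w i) = (odd i == pi) by move=> ni; rewrite /sg index_uniq.
have bC : bag C sg.
  split; first exact: (conn_seg e_sym e_irr).
  move=> x y /CP[i [hi_ ni ->]] /CP[j [hj nj ->]]; rewrite wadj // !sgw //.
  by case/orP=> /eqP-> /=; case: (odd _) (pi) => [] [].
pose G0 : seq T := if pi then [:: w 0] else [::].
pose G1 : seq T := if f1 then [:: w n.-1] else [::].
have G0P y : y \in G0 -> pi /\ y = w 0.
  by rewrite /G0; case: (pi) => //; rewrite inE => /eqP.
have G1P y : y \in G1 -> f1 /\ y = w n.-1.
  by rewrite /G1; case: (f1) => //; rewrite inE => /eqP.
have n1 : n.-1 < n by nlia.
have lo1 : pi -> lo = 1 by rewrite /lo => ->.
have hi1 : f1 -> hi = n.-1 by rewrite /hi => ->; rewrite subn1.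
have G0X y : y \in G0 -> y \in X by move=> /G0P[_ ->]; apply: wX.
have G1X y : y \in G1 -> y \in X by move=> /G1P[_ ->]; apply: wX.
have aXI (I : {set T}) y : {subset I <= I0 :|: I1 :|: I2} -> y \in X -> forall z, z \in I -> z != y /\ e z y = false.
  by move=> sI yX z /sI zI; have [h3 h4] := aX y z yX zI; rewrite eq_sym e_sym.
have s0 : {subset I0 <= I0 :|: I1 :|: I2} by move=> z; rewrite !inE => ->.
have s1 : {subset I1 <= I0 :|: I1 :|: I2} by move=> z; rewrite !inE => ->; rewrite orbT.
have s2 : {subset I2 <= I0 :|: I1 :|: I2} by move=> z; rewrite !inE => ->; rewrite orbT.
have eT0 : pi -> e c2 (w 0) = false by move=> hp; apply/negP => /(par 0 n0); rewrite hp.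
have eT1 : f1 -> e c2 (w n.-1) = false.
  by move=> hf; apply/negP => /(par _ n1) E; move: hf; rewrite /f1 E eqxx.
have e0n : f1 -> e c0 (w n.-1) = false by move=> /hi1 E; rewrite h0 //; apply/negbTE; nlia.
have e10 : pi -> e c1 (w 0) = false by move=> /lo1 E; rewrite h1 //; apply/negbTE; nlia.
have sing x y : apart [set x] [set y] -> x != y /\ e x y = false.
  by apply; rewrite inE.
have leg0 : leg C sg c0 G0.
  rewrite /G0; case: (boolP pi) => hp.
    have L := lo1 hp; split.
    - by rewrite /= inE nX //= h0 // eqxx.
    - apply/touchP; exists (w 1); first by apply: inC; nlia.
      by rewrite /= wadj //; nlia.
    move=> y z; rewrite mem_seq2 => /orP[] /eqP-> /CP[i [hi_ ni ->]].
      split; first exact: nX.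
      by rewrite h0 // => /eqP ?; nlia.
    rewrite wne // wadj // sgw //; split; first by apply/eqP => ?; nlia.
    by case/orP => /eqP E; [split=> //; rewrite E hp|nlia].
  have L : lo = 0 by rewrite /lo (negbTE hp).
  split=> //.
    apply/touchP; exists (w 0); last by rewrite /= h0.
    by apply: inC; nlia.
  move=> y z; rewrite mem_seq1 => /eqP-> /CP[i [hi_ ni ->]]; split; first exact: nX.
  by rewrite h0 // sgw // => /eqP->; rewrite (negbTE hp).
have leg1 : leg C sg c1 G1.
  rewrite /G1; case: (boolP f1) => hp.
    have L := hi1 hp; split.
    - by rewrite /= inE nX //= h1 // prednK // eqxx.
    - apply/touchP; exists (w n.-2); first by apply: inC; nlia.
      by rewrite /= wadj //; nlia.
    move=> y z; rewrite mem_seq2 => /orP[] /eqP-> /CP[i [hi_ ni ->]].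
      split; first exact: nX.
      by rewrite h1 // => /eqP ?; nlia.
    rewrite wne // wadj // sgw //; split; first by apply/eqP => ?; nlia.
    case/orP => /eqP E; first by nlia.
    by split=> //; move: hp; rewrite /f1 E /=; case: (odd i) (pi) => [] [].
  have L : hi = n by rewrite /hi (negbTE hp) subn0.
  split=> //.
    apply/touchP; exists (w n.-1); last by rewrite /= h1 // prednK.
    by apply: inC; nlia.
  move=> y z; rewrite mem_seq1 => /eqP-> /CP[i [hi_ ni ->]]; split; first exact: nX.
  rewrite h1 // sgw // => /eqP E; split=> //; move: hp.
  by rewrite /f1 -E /= negbK.
have leg2 : leg C sg c2 [::].
  split=> //; first by apply/touchP; exists (w i1) => //; apply: inC; rewrite hlo.
  move=> y z; rewrite mem_seq1 => /eqP-> /CP[i [hi_ ni ->]]; split; first exact: nX.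
  by move=> /(par i ni) E; rewrite sgw // E.
apply: (tripod e_sym e_irr nowheel bC (And3 leg0 leg1 leg2) fl _ ai).
- split.
  + move=> x y; rewrite !in_set !inE => /orP[/eqP->|/G0P[hp ->]] /orP[/eqP->|/G1P[hp' ->]].
    * exact: sing.
    * by rewrite e0n // nX.
    * by rewrite eq_sym e_sym e10 // nX.
    * have := lo1 hp; have := hi1 hp'; rewrite wne // wadj // => L1 L2.
      by split; [|apply/negbTE]; nlia.
  + move=> x y; rewrite !in_set !inE => /orP[/eqP->|/G1P[hp' ->]] /eqP->.
      exact: sing.
    by rewrite eq_sym e_sym eT1 // nX.
  + move=> x y; rewrite !in_set !inE => /eqP-> /orP[/eqP->|/G0P[hp ->]].
      exact: sing.
    by rewrite eT0 // nX.
- split.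
  + by move=> x y xI; rewrite !in_set inE => yc; apply: n02; rewrite ?inE.
  + move=> x y xI; rewrite !in_set inE => /orP[yc|/G0X yX]; first by apply: n10; rewrite ?inE.
    exact: aXI s1 yX _ xI.
  + move=> x y xI; rewrite !in_set inE => /orP[yc|/G1X yX]; first by apply: n21; rewrite ?inE.
    exact: aXI s2 yX _ xI.
- split.
  + move=> x y xI; rewrite !in_set mem_cat => /orP[/G0X|/G1X] yX; exact: aXI s0 yX _ xI.
  + move=> x y xI; rewrite !in_set mem_cat => /orP[/G1X|//] yX; exact: aXI s1 yX _ xI.
  + move=> x y xI; rewrite !in_set mem_cat => /orP[//|/G0X] yX; exact: aXI s2 yX _ xI.
- apply: apart_sub aX => // z /CP[i [_ ni ->]]; exact: wX.
Qed.

(** Here [W] itself is divided. A link between [c1] and [c0] closes it to an odd ring, so by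
    [sep_or] all contacts of [c2] of one parity precede the others. The four bags are [c2], the part
    of [W] before [b], the part from [b] on, and a spider at [c1] formed by its links to [c0] and
    [c2]. *)
Lemma triad_two_parities c0 c1 c2 (I0 I1 I2 X : {set T}) (W : seq T) i j :
  triad c0 c1 c2 I0 I1 I2 X -> ipath W -> {subset W <= X} -> i < size W -> j < size W ->
  (forall i, i < size W -> e c0 (nth c0 W i) = (i == 0)) ->
  (forall i, i < size W -> e c1 (nth c0 W i) = (i.+1 == size W)) ->
  e c2 (nth c0 W i) -> e c2 (nth c0 W j) -> odd i != odd j -> False.
Proof.
move=> [[fl0 fl1 fl2] [a01 a12 a20] [i01 i12 i20] [n02 n10 n21] [aX [x0 x1 x2]]].
move=> pW WX ni nj h0 h1 ti tj oij.
set n := size W in ni nj h0 h1; have uW := ipath_uniq pW.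
have n0 : 0 < n by nlia.
have sing x y : apart [set x] [set y] -> x != y /\ e x y = false.
  by apply; rewrite inE.
have [c01 e01] := sing _ _ a01; have [c12 e12] := sing _ _ a12; have [c20 e20] := sing _ _ a20.
pose w i := nth c0 W i.
have wX k : k < n -> w k \in X by move=> h; apply/WX/mem_nth.
have wne k l : k < n -> l < n -> (w k == w l) = (k == l) by move=> hi_ hj; apply: nth_eq.
have wadj k l : k < n -> l < n -> e (w k) (w l) = (l == k.+1) || (k == l.+1).
  exact: (ipath_nth e_sym e_irr).
have nX c k : c \notin X -> k < n -> c != w k.
  by move=> cX nk; apply: contraNneq cX => ->; apply: wX.
have aXI (I : {set T}) y z : {subset I <= I0 :|: I1 :|: I2} -> y \in X -> z \in I -> y != z /\ e y z = false.
  by move=> sI yX /sI zI; apply: aX.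
have s0 : {subset I0 <= I0 :|: I1 :|: I2} by move=> z; rewrite !inE => ->.
have s1 : {subset I1 <= I0 :|: I1 :|: I2} by move=> z; rewrite !inE => ->; rewrite orbT.
have lastE (c c' : T) (t : seq T) y : ipath (c :: rcons t c') -> y \in c :: t ->
    e y c' = (y == last c t).
  rewrite -rcons_cons -cats1 => pt yt.
  by have [_ ->] := ipath_cross pt yt (mem_head c' [::]); rewrite /= eqxx andbT.
have [t [pt tI ot]] := flx_rev e_sym e_irr fl0 (~~ odd n).
have t0 : t != [::].
  by apply: contraTneq pt => ->; rewrite /= e_sym e01 /= andbF.
have tX y : y \in t -> y \notin X.
  by move=> yt; apply/negP => yX; have [/eqP] := aXI _ y y s0 yX (tI y yt).
have ut := ipath_uniq pt.
have c1t : c1 \notin t by move: ut; rewrite /= mem_rcons inE negb_or -andbA => /and3P[].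
have c0t : c0 \notin t by move: ut; rewrite /= rcons_uniq => /and3P[].
have p1t : ipath (c1 :: t) by move: pt; rewrite -cats1 -cat_cons => /ipath_catl.
pose s := W ++ c1 :: t.
have Wl y : last y W = w n.-1 by rewrite -nth_last; apply: set_nth_default; rewrite -/n; nlia.
have W_ y : y \in W -> exists2 k, k < n & y = w k by move=> /(nth_ex c0)[k ? <-]; exists k.
have n1 : n.-1 < n by nlia.
have tlast : last c1 t \in t.
  by case Et : t t0 => [//|z t''] _; rewrite /= mem_last.
have rg : ring s c0.
  split.
  - apply: ipath_cat => // x y /W_[k nk ->]; rewrite inE Wl => /orP[/eqP->|yt].
      rewrite eqxx andbT e_sym h1 // eq_sym nX // wne //; split=> //.
      by apply/eqP/eqP => ?; nlia.
    have [-> ->] := aXI _ _ _ s0 (wX k nk) (tI y yt); split=> //.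
    by rewrite (_ : (y == c1) = false) ?andbF //; apply: contraNF c1t => /eqP<-.
  - by rewrite size_cat /= addnS /= oddD ot; case: (odd n).
  - by rewrite size_cat /=; nlia.
  - rewrite mem_cat inE !negb_or c01 c0t !andbT.
    by apply: contra x0; apply: WX.
  move=> y; rewrite mem_cat => /orP[/W_[k nk ->]|yt].
    rewrite h0 // /s.
    have -> : head c0 (W ++ c1 :: t) = w 0 by rewrite -nth0 nth_cat -/n n0.
    rewrite last_cat wne // (_ : (w k == last c1 t) = false) ?orbF //.
    by apply: contraNF (tX _ tlast) => /eqP<-; apply: wX.
  have -> : head c0 s = w 0 by rewrite -nth0 nth_cat -/n n0.
  rewrite last_cat e_sym (lastE _ _ _ _ pt yt) (_ : (y == w 0) = false) //.
  move: yt; rewrite inE => /orP[/eqP->|yt]; first by apply/negbTE/nX.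
  by apply: contraNF (tX _ yt) => /eqP->; apply: wX.
have c2s : c2 \notin rcons s c0.
  rewrite mem_rcons inE mem_cat inE !negb_or c20 (eq_sym c2) c12 /=; apply/andP; split.
    by apply: contra x2; apply: WX.
  apply/negP => /tI c2I; by have [/eqP] := n02 c2 c2 c2I (set11 _).
have ns : n <= size s by rewrite size_cat leq_addr.
have nthW k : k < n -> nth c0 s k = w k by move=> nk; rewrite nth_cat -/n nk.
have [|||||c /sepP[a [b [/andP[ab bs] [ea eb] oa ob sepab]]]] := @sep_or _ e e_sym e_irr nowheel c0 s c2 i j rg c2s.
- by nlia.
- by nlia.
- by rewrite nthW.
- by rewrite nthW.
- exact: oij.
have touchW k : k < size s -> e c2 (nth c0 s k) -> k < n.
  move=> ks; rewrite ltnNge; apply: contraTN => nk.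
  have : nth c0 s k \in c1 :: t.
    rewrite nth_cat -/n ltnNge nk /=; apply: mem_nth.
    by rewrite ltn_subLR //; move: ks; rewrite size_cat.
  rewrite inE => /orP[/eqP->|/tI cI]; first by rewrite e_sym e12.
  by rewrite e_sym; have [_ ->] := n02 _ c2 cI (set11 _).
have bn : b < n by apply: touchW eb.
have an : a < n by nlia.
rewrite nthW // in ea; rewrite nthW // in eb.
have {}sepab k : k < n -> e c2 (w k) -> if odd k == c then k <= a else b <= k.
  by move=> nk ek; apply: sepab; rewrite ?nthW //; nlia.
(* [f0] and [f1] say that the first or the last vertex of [W] would be negative in its part; it is
   then moved to the bag of [c1], through [pre] or [post]. *)
pose f0 := c; pose f1 := odd n.-1 == c.
have a1 : f0 -> 0 < a by rewrite /f0 -oa; case: (a).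
have bn1 : f1 -> b < n.-1.
  move=> hf; have : b != n.-1 by apply: contraNneq ob => ->.
  by move=> ?; nlia.
pose lo : nat := f0; pose hi := n - f1.
have hlo : lo <= a by rewrite /lo; case E: f0 => //; apply: a1.
have hhi : b < hi by rewrite /hi; case E: f1; rewrite ?subn0 // subn1; apply: bn1.
have hin : hi <= n by rewrite /hi leq_subr.
have lo1 : f0 -> lo = 1 by rewrite /lo => ->.
have hi1 : f1 -> hi = n.-1 by rewrite /hi => ->; rewrite subn1.
have ob1 : odd b.-1 = c.
  have b0 : 0 < b by nlia.
  by move: ob; rewrite -{1}(prednK b0) /=; case: (odd _) (c) => [] [].
pose sgW v := if index v W < b then odd (index v W) == c else odd (index v W) != c.
have sgw k : k < n -> sgW (w k) = if k < b then odd k == c else odd k != c.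
  by move=> nk; rewrite /sgW index_uniq.
pose B1 := seg W lo b; pose B2 := seg W b hi.
have BP l m z : m <= n -> z \in seg W l m -> exists k, [/\ l <= k < m, k < n & z = w k].
  by move=> mn /(segP c0)[k [h1_ h2_] ->]; exists k.
have inB l m k : l <= k < m -> k < n -> w k \in seg W l m.
  by move=> hk nk; apply/(segP c0); exists k.
have bn' : b <= n by nlia.
have alt l m : m <= n -> (m <= b) || (b <= l) -> bag (seg W l m) sgW.
  move=> mn hm; split; first exact: (conn_seg e_sym e_irr).
  move=> x y /(BP _ _ _ mn)[k [hk nk ->]] /(BP _ _ _ mn)[p [hp np ->]].
  rewrite wadj // !sgw // => kp; have -> : (p < b) = (k < b).
    by case/orP: hm => hm; apply/idP/idP => ?; nlia.
  by case/orP: kp => /eqP-> /=; case: ifP => _; case: (odd _) (c) => [] [].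
pose pre : seq T := if f0 then [:: w 0] else [::].
pose post : seq T := if f1 then [:: w n.-1] else [::].
have preP y : y \in pre -> f0 /\ y = w 0.
  by rewrite /pre; case: (f0) => //; rewrite inE => /eqP.
have postP y : y \in post -> f1 /\ y = w n.-1.
  by rewrite /post; case: (f1) => //; rewrite inE => /eqP.
(* The parities are chosen so that all three legs of the spider at [c1] have the parity [f1], which
   is that of [post]. *)
have [t' [pt' tI' ot']] := flx_rev e_sym e_irr fl0 (~~ (f1 (+) f0)).
have [u [pu uI ou]] := fl1 f1.
pose L1 := t' ++ c0 :: pre.
have oL1 : odd (size L1) = f1.
  rewrite /L1 size_cat /= addnS /= oddD ot' /pre.
  by case: (f0); case: (f1).
have opost : odd (size post) = f1 by rewrite /post; case: (f1).
have e1w0 : f0 -> e c1 (w 0) = false.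
  by move=> /a1 ?; rewrite h1 //; apply/negbTE; nlia.
have e0w1 : f1 -> e c0 (w n.-1) = false.
  by move=> /bn1 ?; rewrite h0 //; apply/negbTE; nlia.
have pL1 : ipath (c1 :: L1).
  have -> : c1 :: L1 = (c1 :: rcons t' c0) ++ pre by rewrite /L1 -cat_rcons.
  apply: ipath_cat => //; first by rewrite /pre; case: (f0).
  move=> x y; rewrite -rcons_cons mem_rcons inE last_rcons => xt /preP[hf ->].
  have -> : head x pre = w 0 by rewrite /pre hf.
  rewrite eqxx andbT; case/orP: xt => [/eqP->|]; first by rewrite h0 // nX // !eqxx.
  rewrite inE => /orP[/eqP->|xt']; first by rewrite e1w0 // nX // eq_sym (negbTE c01).
  have xI := tI' _ xt'.
  have [h2 h3] := aXI _ _ _ s0 (wX 0 n0) xI; rewrite eq_sym h2 e_sym h3; split=> //.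
  apply/esym/negbTE; apply: contraTneq pt' => E; apply/negP => /ipath_uniq.
  by rewrite /= rcons_uniq -E xt' !andbF.
have ppost : ipath (c1 :: post).
  by rewrite /post; case: (f1) => //=; rewrite inE nX //= h1 // prednK // eqxx.
have pu1 : ipath (c1 :: u) by move: pu; rewrite -cats1 -cat_cons => /ipath_catl.
have L1P y : y \in L1 -> [\/ y \in I0, y = c0 | f0 /\ y = w 0].
  rewrite mem_cat inE => /or3P[/tI'|/eqP|/preP]; by [constructor 1|constructor 2|constructor 3].
have [sgZ [bZ z1 z2 z3]] : exists sg, [/\ bag [set y in c1 :: L1 ++ post ++ u] sg,
    sg (last c1 L1), sg (last c1 post) & sg (last c1 u)].
  apply: (spider e_sym e_irr pL1 ppost pu1) oL1 opost ou.
  - move=> x y; rewrite !in_set => /L1P[xI|->|[hf ->]] /postP[hf' ->].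
    + by rewrite eq_sym e_sym; apply: aXI s0 _ xI; apply: wX.
    + by rewrite e0w1 // nX.
    + have := a1 hf; have := bn1 hf'; rewrite wne // wadj // => L2 L3.
      by split; [|apply/negbTE]; nlia.
  - move=> x y; rewrite !in_set => /L1P[xI|->|[hf ->]] /uI yI.
    + exact: i01.
    + by rewrite eq_sym e_sym; apply: n10; rewrite ?inE.
    + by apply: aXI s1 _ yI; apply: wX.
  - by move=> x y; rewrite !in_set => /postP[hf ->] /uI yI; apply: aXI s1 _ yI; apply: wX.
set Z := [set y in _] in bZ.
have ZP y : y \in Z -> [\/ y = c1, y \in L1, y \in post | y \in u].
  rewrite in_set inE !mem_cat => /or4P[/eqP|||];
    by [constructor 1|constructor 2|constructor 3|constructor 4].
have lL1 : last c1 L1 = if f0 then w 0 else c0.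
  by rewrite /L1 last_cat /= /pre; case: (f0).
have lpost : last c1 post = if f1 then w n.-1 else c1.
  by rewrite /post; case: (f1).
have inlast (v : seq T) : {subset v <= L1 ++ (post ++ u)} -> last c1 v \in Z.
  by move=> h; rewrite in_set inE; have := mem_last c1 v; rewrite inE => /orP[->//|/h->]; rewrite orbT.
have inZ0 : last c1 L1 \in Z by apply: inlast => y yv; rewrite mem_cat yv.
have inZ1 : last c1 post \in Z by apply: inlast => y yv; rewrite mem_cat [_ \in post ++ u]mem_cat yv orbT.
have inZ2 : last c1 u \in Z by apply: inlast => y yv; rewrite mem_cat [_ \in post ++ u]mem_cat yv !orbT.
have WZ k y : k < n -> lo <= k < hi -> y \in Z -> w k != y /\ (e (w k) y ->
    [\/ [/\ k = n.-1, ~~ f1 & y = last c1 post], [/\ k = 0, ~~ f0 & y = last c1 L1],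
        [/\ k = 1, f0 & y = last c1 L1] | [/\ k = n.-2, f1 & y = last c1 post]]).
  move=> nk hk /ZP[->|/L1P[yI|->|[hf ->]]|/postP[hf ->]|/uI yI].
  - rewrite eq_sym nX //; split=> //; rewrite e_sym h1 // => /eqP E; constructor 1.
    have nf : ~~ f1 by apply/negP => /hi1 ?; nlia.
    by rewrite lpost (negbTE nf); split=> //; nlia.
  - by have [h2 h3] := aXI _ _ _ s0 (wX k nk) yI; rewrite h2 h3.
  - rewrite eq_sym nX //; split=> //; rewrite e_sym h0 // => /eqP E; constructor 2.
    have nf : ~~ f0 by apply/negP => /lo1 ?; nlia.
    by rewrite lL1 (negbTE nf).
  - have L := lo1 hf; rewrite wne // wadj //; split; first by nlia.
    by move=> E; constructor 3; rewrite lL1 hf; split=> //; nlia.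
  - have L := hi1 hf; rewrite wne // wadj //; split; first by nlia.
    by move=> E; constructor 4; rewrite lpost hf; split=> //; nlia.
  - by have [h2 h3] := aXI _ _ _ s1 (wX k nk) yI; rewrite h2 h3.
apply: (K4_bags e_sym nowheel (B0 := [set c2]) (s0 := fun=> true) (B1 := B1) (s1 := sgW)
  (B2 := B2) (s2 := sgW) (B3 := Z) (s3 := sgZ)).
- split=> //; first exact: (bag1 e_irr).
    by apply: alt; rewrite ?leqnn.
  by apply: alt; rewrite ?leqnn ?orbT.
- split.
  + split; last by exists c2; rewrite ?inE //; apply/touchP; exists (w a) => //; apply: inB; nlia.
    move=> x y /set1P-> /(BP _ _ _ bn')[k [hk nk ->]]; split; first exact: nX.
    move=> /(sepab k nk); rewrite sgw //; have -> : k < b by nlia.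
    by case: eqP => // _ ?; nlia.
  + split; last by exists c2; rewrite ?inE //; apply/touchP; exists (w b) => //; apply: inB; nlia.
    move=> x y /set1P-> /(BP _ _ _ hin)[k [hk nk ->]]; split; first exact: nX.
    move=> /(sepab k nk); rewrite sgw //; have -> : (k < b) = false by nlia.
    by case: eqP => // _ ?; nlia.
  + split; last first.
      exists c2; rewrite ?inE //; apply/touchP; exists (last c1 u) => //.
      by rewrite e_sym (lastE _ _ _ _ pu) ?mem_last.
    move=> x y /set1P-> /ZP[->|/L1P[yI|->|[hf ->]]|/postP[hf ->]|yu].
    * by rewrite eq_sym e_sym e12.
    * by have [h2 h3] := n02 y c2 yI (set11 _); rewrite eq_sym e_sym h2 h3.
    * by rewrite e20.
    * split; first exact: nX.
      move=> /(sepab 0 n0) /=; have -> : (false == c) = false by move: hf; rewrite /f0 => ->.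
      by move=> ?; nlia.
    * split; first exact: nX.
      by move=> /(sepab _ n1); move: hf (bn1 hf); rewrite /f1 => -> ? ?; nlia.
    * have yc : y \in c1 :: u by rewrite inE yu orbT.
      rewrite e_sym (lastE _ _ _ _ pu yc); split; last by move=> /eqP->.
      by apply: contraTneq (ipath_uniq pu) => ->; rewrite /= rcons_uniq yu !andbF.
- split.
  + split.
      move=> x y /(BP _ _ _ bn')[k [hk nk ->]] /(BP _ _ _ hin)[l [hl nl ->]].
      rewrite wne // wadj // !sgw //; split; first by nlia.
      move=> E; have -> : k = b.-1 by nlia.
      have -> : l = b by nlia.
      rewrite ltnn ob ob1 eqxx; split=> //.
      by have -> : b.-1 < b by nlia.
    exists (w b.-1); first by apply: inB; nlia.
    apply/touchP; exists (w b); first by apply: inB; nlia.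
    by rewrite wadj //; nlia.
  + split.
      move=> x y /(BP _ _ _ bn')[k [hk nk ->]] yZ.
      have hk' : lo <= k < hi by nlia.
      have [h2 h3] := WZ k y nk hk' yZ; split=> // /h3[] [Ek hf ->].
      * by nlia.
      * rewrite sgw // Ek; have -> : 0 < b by nlia.
        by move: hf; rewrite /f0 /=; case: (c).
      * rewrite sgw // Ek; have := a1 hf => ?; have -> : 1 < b by nlia.
        by move: hf; rewrite /f0 /= => ->.
      * by have := bn1 hf => ?; nlia.
    case: (boolP f0) => hf.
      have := a1 hf => ?; have := lo1 hf => ?.
      exists (w 1); first by apply: inB; nlia.
      apply/touchP; exists (last c1 L1) => //; rewrite lL1 hf wadj //; nlia.
    have lo0 : lo = 0 by rewrite /lo (negbTE hf).
    exists (w 0); first by apply: inB; nlia.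
    by apply/touchP; exists (last c1 L1) => //; rewrite lL1 (negbTE hf) e_sym h0.
  + split.
      move=> x y /(BP _ _ _ hin)[k [hk nk ->]] yZ.
      have hk' : lo <= k < hi by nlia.
      have [h2 h3] := WZ k y nk hk' yZ; split=> // /h3[] [Ek hf ->].
      * rewrite sgw // Ek; have -> : (n.-1 < b) = false by nlia.
        by [].
      * by nlia.
      * by have := a1 hf => ?; nlia.
      * have := bn1 hf => ?; rewrite sgw // Ek; have -> : (n.-2 < b) = false by nlia.
        split=> //; move: hf; rewrite /f1; have -> : n.-1 = n.-2.+1 by nlia.
        by rewrite /=; case: (odd _) (c) => [] [].
    case: (boolP f1) => hf.
      have := bn1 hf => ?; have := hi1 hf => ?; have n2 : n.-2 < n by nlia.
      exists (w n.-2); first by apply: inB; nlia.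
      apply/touchP; exists (last c1 post) => //; rewrite lpost hf wadj //; nlia.
    have hiE : hi = n by rewrite /hi (negbTE hf) subn0.
    exists (w n.-1); first by apply: inB; nlia.
    apply/touchP; exists (last c1 post) => //; rewrite lpost (negbTE hf) e_sym h1 //.
    by rewrite prednK.
Qed.

End Triads.

(** * Triads do not exist *)

Section NoTriad.
Variables (T : finType) (e : rel T).
Hypothesis e_sym : symmetric e.
Hypothesis e_irr : irreflexive e.
Hypothesis tri : forall x y z, e x y -> e y z -> e x z = false.
Hypothesis nowheel : forall m blk sg, ~ wheel e m blk sg.
Implicit Types (s t : seq T) (x y w : T) (A B K : {set T}).

Notation conn := (conn e).
Notation touch := (touch e).
Notation ipath := (ipath e).

Notation apart := (apart e).
Notation leg := (leg e).
Notation triad := (triad e).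

(** The contacts of [c2] with the path would have one parity or both, and each case has been
    refuted. *)
Lemma triad_path c0 c1 c2 (I0 I1 I2 X : {set T}) x s : triad c0 c1 c2 I0 I1 I2 X ->
  ipath (x :: s) -> {subset x :: s <= X} ->
  (forall y, y \in x :: s -> e c0 y = (y == x)) ->
  (forall y, y \in x :: s -> e c1 y = (y == last x s)) ->
  forall y, y \in x :: s -> e c2 y = false.
Proof.
move=> tr ps sX h0 h1 y ys; apply/negP => ey; have us := ipath_uniq ps.
have i0 i : i < size (x :: s) -> e c0 (nth c0 (x :: s) i) = (i == 0).
  move=> si; rewrite h0 ?mem_nth // -[x in _ == x]/(nth c0 (x :: s) 0).
  by rewrite (nth_eq c0 si).
have i1 i : i < size (x :: s) -> e c1 (nth c0 (x :: s) i) = (i.+1 == size (x :: s)).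
  move=> si; rewrite h1 ?mem_nth // (last_nth c0).
  by rewrite (nth_eq c0 si).
have [k sk Ek] := nth_ex c0 ys; rewrite -Ek in ey.
case: (boolP [exists j : 'I_(size (x :: s)), e c2 (nth c0 (x :: s) j) && (odd k != odd j)]).
  move=> /existsP[j /andP[ej kj]].
  exact: (triad_two_parities e_sym e_irr nowheel tr ps sX sk (ltn_ord j) i0 i1 ey ej kj).
rewrite negb_exists => /forallP h.
apply: (triad_one_parity e_sym e_irr nowheel (pi := odd k) tr ps sX sk i0 i1 ey) => j sj ej.
by have := h (Ordinal sj); rewrite /= ej /= negbK => /eqP.
Qed.

Lemma half_leg (R : seq T) c f : ipath R -> c \notin R ->
  (forall i, i < size R -> e c (nth c R i) = (i == 0)) -> f < size R ->
  leg [set nth c R f] (fun=> true) c (take f R).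
Proof.
move=> pR cR hc fR; have uR := ipath_uniq pR.
have tP y : y \in take f R -> exists2 i, i < f & y = nth c R i.
  move=> /(nth_ex c)[i si <-]; rewrite size_takel ?(ltnW fR) // in si.
  by exists i; rewrite ?nth_take.
have lE : last c (take f R) = if f == 0 then c else nth c R f.-1.
  case: (posnP f) => [->|f0]; first by rewrite take0.
  by rewrite -nth_last size_takel ?(ltnW fR) // nth_take ?prednK // ifN // -lt0n.
split.
- apply: ipath_cons; first by apply: (ipath_catl (t := drop f R)); rewrite cat_take_drop.
  move=> y /[dup] yt /tP[i fi ->]; have iR : i < size R by apply: ltn_trans fR.
  split; first by apply: contraNneq cR => ->; apply: mem_nth.
  rewrite hc //; have -> : head c (take f R) = nth c R 0.
    by rewrite -nth0 nth_take //; case: (f) fi.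
  by rewrite nth_eq //; case: (R) fR.
- apply/touchP; exists (nth c R f); rewrite ?inE // lE.
  case: (posnP f) => [->|f0]; first by rewrite hc //; case: (R) fR.
  have f1 := leq_ltn_trans (leq_pred f) fR.
  by rewrite (ipath_nth e_sym e_irr c pR f1 fR) prednK // eqxx.
move=> y z yc /set1P->; rewrite lE; move: yc; rewrite inE => /orP[/eqP->|/tP[i fi ->]].
  split; first by apply: contraNneq cR => ->; apply: mem_nth.
  by rewrite hc // => /eqP->.
have iR : i < size R by apply: ltn_trans fR.
rewrite nth_eq // (ipath_nth e_sym e_irr c pR) //; split; first by nlia.
move=> h; have -> : (f == 0) = false by apply/negbTE; nlia.
by split=> //; congr nth; nlia.
Qed.

(** By [triad_path], a shortest path [R] between [c0] and [c1] avoids the neighbours of [c2]. A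
    shortest path [Y] from [c2] to [R] avoids those of [c0] and [c1], again by [triad_path] with the
    contacts permuted. Thus [R] and [Y] form a subdivided star or a star with a small detour at its
    centre, and a tripod with a single vertex as centre arises. *)
Lemma triad_false c0 c1 c2 (I0 I1 I2 X : {set T}) : triad c0 c1 c2 I0 I1 I2 X ->
  conn X -> touch c0 X -> touch c1 X -> touch c2 X -> False.
Proof.
move=> tr cX t0 t1 t2.
have [fl [a01 a12 a20] ai [n02 n10 n21] [aX [x0 x1 x2]]] := tr.
have tex c : touch c X -> exists2 x, x \in X & e c x by move/touchP.
have [r0 [rs [pR RX hR0 hR1]]] := path_between e_sym cX (tex _ t0) (tex _ t1).
have hR2 := triad_path tr pR RX hR0 hR1.
set R := r0 :: rs in pR RX hR0 hR1 hR2; have uR := ipath_uniq pR.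
pose RS : {set T} := [set y in R].
have r0R : r0 \in R by apply: mem_head.
have RSX : RS \subset X by apply/fintype.subsetP => y; rewrite inE => /RX.
have [g gX tg] : exists2 g, g \in X & touch g RS.
  have /touchP[x xX ex] := t2.
  have xR : x \in X :\: RS.
    rewrite !inE xX andbT; apply/negP => xR; by rewrite hR2 in ex.
  have r0S : r0 \in RS by rewrite inE.
  have [g gXR tg] := conn_exit e_sym cX RSX r0S xR.
  by exists g => //; move: gXR; rewrite inE => /andP[].
have [y0 [ys [pY YX hY2 hYR]]] := path_between e_sym cX (tex _ t2)
  (b := fun y => touch y RS) (ex_intro2 _ _ g gX tg).
set Y := y0 :: ys in pY YX hY2 hYR; have uY := ipath_uniq pY.
pose yl := last y0 ys; have ylY : yl \in Y by apply: mem_last.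
have tyl : touch yl RS by rewrite hYR // eqxx.
pose m := size Y; pose n := size R.
have YE i : i < m -> nth c0 Y i \in Y by apply: mem_nth.
have ylE : yl = nth c0 Y m.-1 by rewrite /yl (last_nth c0).
have YR y : y \in Y -> y \notin R.
  move=> yY; apply/negP => yR; have [i si Ei] := nth_ex c0 yY.
  case: (posnP i) => [i0|i0].
    have yy0 : y = y0 by rewrite -Ei i0.
    by have := hY2 y yY; rewrite yy0 eqxx -yy0 hR2.
  have si1 : i.-1 < size Y by apply: leq_ltn_trans si; apply: leq_pred.
  have : touch (nth c0 Y i.-1) RS.
    apply/touchP; exists y; first by rewrite inE.
    by rewrite -Ei (ipath_nth e_sym e_irr c0 pY) // prednK // eqxx.
  rewrite hYR; last exact: mem_nth.
  rewrite -/yl ylE (nth_eq c0 si1) //.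
  by move=> /eqP E; rewrite /m in E; nlia.
have YRe y z : y \in Y -> y != yl -> z \in R -> e y z = false.
  move=> yY yn zR; apply/negP => eyz; case/negP: yn; rewrite -hYR //.
  by apply/touchP; exists z; rewrite ?inE.
pose YS : {set T} := [set y in Y].
have cRY : conn (RS :|: YS).
  have /touchP[z zR ez] := tyl.
  apply: (connU e_sym (conn_ipath e_sym e_irr pR) (conn_ipath e_sym e_irr pY) zR
    (b := yl)); first by rewrite inE.
  by rewrite e_sym ez orbT.
have RYX : {subset RS :|: YS <= X} by move=> z; rewrite !inE => /orP[/RX|/YX].
(* the first contact on Y is seen from a path between the other two contacts *)
have claim d0 d1 (J0 J1 J2 : {set T}) j : triad d0 d1 c2 J0 J1 J2 X -> touch d1 RS ->
    j < m -> e d0 (nth c0 Y j) -> (forall k, k < j -> e d1 (nth c0 Y k) = false) -> False.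
  move=> tr' td1 jm ej nk.
  have ex2 : exists2 z, z \in RS :|: YS & e c2 z.
    by exists y0; rewrite ?hY2 ?mem_head ?eqxx // !inE eqxx orbT.
  have ex1 : exists2 z, z \in RS :|: YS & e d1 z.
    by have /touchP[z zR ez] := td1; exists z; rewrite // inE zR.
  have [q0 [qs [pQ QX hQ2 hQ1]]] := path_between e_sym cRY ex2 ex1.
  have QX' : {subset q0 :: qs <= X} by move=> z /QX/RYX.
  have tr2 := triad_flip e_sym e_irr (triad_rot tr').
  have h := triad_path tr2 pQ QX' hQ2 hQ1.
  have [jQ|jQ] := boolP (nth c0 Y j \in q0 :: qs); first by rewrite h in ej.
  have cQ := conn_ipath e_sym e_irr pQ.
  pose f z := z \in seg Y 0 j.
  have segY z : z \in seg Y 0 j -> exists2 k, k < j & z = nth c0 Y k.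
    by move=> /(segP c0)[k [/andP[_ kj] _] ->]; exists k.
  have step u v : u \in q0 :: qs -> v \in q0 :: qs -> e u v -> f u -> f v.
    move=> uQ vQ euv /segY[k kj Eu]; have km : k < m by apply: ltn_trans jm.
    have uYS : u \in Y by rewrite Eu YE.
    have := QX v vQ; rewrite !in_set => /orP[vR|vY].
      exfalso; have un : u != yl.
        rewrite Eu ylE (nth_eq c0 km) //.
        by rewrite /m in jm *; nlia.
      by rewrite (YRe u v) in euv.
    have [l lm Ev] := nth_ex c0 vY.
    move: euv; rewrite Eu -Ev (ipath_nth e_sym e_irr c0 pY) // => kl.
    have lj : l != j by apply: contraNneq jQ => <-; rewrite Ev.
    by apply/(segP c0); exists l => //; split=> //; nlia.
  have fconst u v : u \in [set z in q0 :: qs] -> v \in [set z in q0 :: qs] -> f u = f v.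
    apply: (conn_const cQ) => z z'; rewrite !in_set => zQ zQ' ez.
    by apply/idP/idP; apply: step => //; rewrite e_sym.
  have q0Q : q0 \in q0 :: qs by apply: mem_head.
  have lQ : last q0 qs \in q0 :: qs by apply: mem_last.
  have fq0 : f q0.
    have eq0 : e c2 q0 by rewrite hQ2 // eqxx.
    have := QX q0 q0Q; rewrite !in_set => /orP[q0R|q0Y]; first by rewrite hR2 in eq0.
    have Eq : q0 = y0 by apply/eqP; rewrite -hY2.
    case: (posnP j) => [j0|j0]; first by case/negP: jQ; rewrite j0 /= -Eq.
    by apply/(segP c0); exists 0; rewrite ?Eq //; split.
  have : f (last q0 qs) by rewrite -(fconst q0) // inE.
  move=> /segY[k kj El]; have := nk k kj; rewrite -El.
  by have := hQ1 _ lQ; rewrite eqxx => ->.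
have td1 : touch c1 RS.
  have lR : last r0 rs \in R by apply: mem_last.
  by apply/touchP; exists (last r0 rs); rewrite ?hR1 ?eqxx // in_set.
have td0 : touch c0 RS by apply/touchP; exists r0; rewrite ?hR0 ?eqxx // in_set.
have noY k : k < m -> e c0 (nth c0 Y k) = false /\ e c1 (nth c0 Y k) = false.
  have [/existsP[k1 bk1]|] := boolP [exists k : 'I_m, e c0 (nth c0 Y k) || e c1 (nth c0 Y k)].
    have ex : exists k, (k < m) && (e c0 (nth c0 Y k) || e c1 (nth c0 Y k)).
      by exists k1; rewrite ltn_ord.
    case: (ex_minnP ex) => j /andP[jm ej] minj.
    have nb k' : k' < j -> e c0 (nth c0 Y k') || e c1 (nth c0 Y k') = false.
      move=> kj; apply/negP => h; have := minj k'; rewrite h (ltn_trans kj jm) => /(_ isT).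
      by rewrite leqNgt kj.
    exfalso; case/orP: ej => ej.
      apply: (claim c0 c1 I0 I1 I2 j tr td1 jm ej) => k' /nb.
      by case: (e c1 _); rewrite ?orbT.
    apply: (claim c1 c0 I0 I2 I1 j (triad_flip e_sym e_irr tr) td0 jm ej) => k' /nb.
    by case: (e c0 _).
  rewrite negb_exists => /forallP h km; have := h (Ordinal km); rewrite /= negb_or.
  by case/andP=> /negbTE-> /negbTE->.
have noY0 y : y \in Y -> e c0 y = false by move=> /(nth_ex c0)[k km <-]; have [] := noY k km.
have noY1 y : y \in Y -> e c1 y = false by move=> /(nth_ex c0)[k km <-]; have [] := noY k km.
have nc c y : c \notin X -> y \in X -> c != y by move=> cX' yX; apply: contraNneq cX' => ->.
pose w k := nth c0 R k.
have wR k : k < n -> w k \in R by apply: mem_nth.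
have w0 k : k < n -> e c0 (w k) = (k == 0).
  move=> kn; rewrite hR0 ?wR // -[r0]/(nth c0 R 0) (nth_eq c0 kn) //.
have w1 k : k < n -> e c1 (w k) = (k.+1 == n).
  by move=> kn; rewrite hR1 ?wR // (last_nth c0) (nth_eq c0 kn).
have wne k l : k < n -> l < n -> (w k == w l) = (k == l) by move=> kn ln; apply: nth_eq.
have wadj k l : k < n -> l < n -> e (w k) (w l) = (l == k.+1) || (k == l.+1).
  exact: (ipath_nth e_sym e_irr).
have sing x y : apart [set x] [set y] -> x != y /\ e x y = false by apply; rewrite inE.
have s0 : {subset I0 <= I0 :|: I1 :|: I2} by move=> z; rewrite !inE => ->.
have s1 : {subset I1 <= I0 :|: I1 :|: I2} by move=> z; rewrite !inE => ->; rewrite orbT.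
have s2 : {subset I2 <= I0 :|: I1 :|: I2} by move=> z; rewrite !inE => ->; rewrite orbT.
have fin x a b (G2 : seq T) : x \in X -> a < b -> b <= n ->
    leg [set x] (fun=> true) c0 (take a R) ->
    leg [set x] (fun=> true) c1 (rev (drop b R)) ->
    leg [set x] (fun=> true) c2 G2 -> {subset G2 <= Y} ->
    (forall y k, y \in G2 -> k < n -> (k < a) || (b <= k) -> e y (w k) = false) -> False.
  move=> xX ab bn l0 l1 l2 G2Y G2R.
  have tP y : y \in take a R -> exists2 k, k < a & y = w k.
    have an : a <= n by nlia.
    move=> /(nth_ex c0)[k sk <-]; rewrite size_takel // in sk.
    by exists k; rewrite ?nth_take.
  have dP y : y \in rev (drop b R) -> exists2 k, b <= k < n & y = w k.
    rewrite mem_rev => /(nth_ex c0)[k sk <-]; rewrite size_drop in sk.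
    by exists (b + k); rewrite ?nth_drop // leq_addr /= -ltn_subRL.
  have G0X y : y \in take a R -> y \in X by move=> /mem_take/RX.
  have G1X y : y \in rev (drop b R) -> y \in X by rewrite mem_rev => /mem_drop/RX.
  have G2X y : y \in G2 -> y \in X by move=> /G2Y/YX.
  have aXI (I : {set T}) (G : seq T) : {subset I <= I0 :|: I1 :|: I2} -> {subset G <= X} ->
      apart I [set y in G].
    move=> sI GX z y /sI zI; rewrite inE => /GX yX.
    by have [h1 h2] := aX y z yX zI; rewrite eq_sym e_sym.
  have xI (I : {set T}) (G : seq T) c : {subset I <= I0 :|: I1 :|: I2} -> {subset G <= X} ->
      apart I [set c] -> apart I [set y in c :: G].
    move=> sI GX aIc z y zI; rewrite in_set inE => /orP[yc|yG]; first by apply: aIc; rewrite ?inE.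
    by apply: (aXI I G sI GX); rewrite ?inE.
  have YRn y k : y \in Y -> k < n -> y != w k.
    by move=> yY kn; apply: contraNneq (YR y yY) => ->; apply: wR.
  have G01 : {subset take a R ++ rev (drop b R) <= X}.
    by move=> y; rewrite mem_cat => /orP[/G0X|/G1X].
  have G12 : {subset rev (drop b R) ++ G2 <= X}.
    by move=> y; rewrite mem_cat => /orP[/G1X|/G2X].
  have G20 : {subset G2 ++ take a R <= X}.
    by move=> y; rewrite mem_cat => /orP[/G2X|/G0X].
  apply: (tripod e_sym e_irr nowheel (bag1 e_irr x true) (And3 l0 l1 l2) fl _ ai).
  - split.
    + move=> u v; rewrite !in_set !inE => /orP[/eqP->|/tP[k ka ->]] /orP[/eqP->|/dP[l lb ->]].
      * exact: sing.
      * have ln : l < n by nlia.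
        rewrite w0 // nc // ?RX ?wR //; split=> //; apply/negbTE; nlia.
      * have kn : k < n by nlia.
        rewrite eq_sym e_sym w1 // nc // ?RX ?wR //; split=> //; apply/negbTE; nlia.
      * have kn : k < n by nlia.
        have ln : l < n by nlia.
        by rewrite wne // wadj //; split; [|apply/negbTE]; nlia.
    + move=> u v; rewrite !in_set !inE => /orP[/eqP->|/dP[l lb ->]] /orP[/eqP->|vG].
      * exact: sing.
      * by rewrite noY1 ?G2Y // nc // G2X.
      * have ln : l < n by nlia.
        by rewrite eq_sym e_sym hR2 ?wR // nc // RX // wR.
      * have ln : l < n by nlia.
        rewrite eq_sym e_sym G2R ?YRn ?G2Y //; case/andP: lb => ->; by rewrite orbT.
    + move=> u v; rewrite !in_set !inE => /orP[/eqP->|uG] /orP[/eqP->|/tP[k ka ->]].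
      * exact: sing.
      * have kn : k < n by nlia.
        by rewrite hR2 ?wR // nc // RX // wR.
      * by rewrite eq_sym e_sym noY0 ?G2Y // nc // G2X.
      * have kn : k < n by nlia.
        by rewrite G2R ?YRn ?G2Y // ka.
  - split; [exact: xI s0 G2X n02|exact: xI s1 G0X n10|exact: xI s2 G1X n21].
  - split; [exact: aXI s0 G01|exact: aXI s1 G12|exact: aXI s2 G20].
  - by apply: apart_sub aX => // z /set1P->.
have pRr : ipath (rev R) by apply: ipath_rev.
have c0R : c0 \notin R by apply: contra x0; apply: RX.
have c1R : c1 \notin rev R by rewrite mem_rev; apply: contra x1; apply: RX.
have c2Y : c2 \notin Y by apply: contra x2; apply: YX.
have rw k : k < n -> nth c1 (rev R) (n.-1 - k) = w k.
  move=> kn; rewrite nth_rev -/n; last by nlia.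
  rewrite (set_nth_default c0) -/n; last by nlia.
  by congr nth; nlia.
have w1' k : k < size (rev R) -> e c1 (nth c1 (rev R) k) = (k == 0).
  rewrite size_rev -/n => kn; have -> : k = n.-1 - (n.-1 - k) by nlia.
  rewrite rw; last by nlia.
  rewrite w1; last by nlia.
  by apply/eqP/eqP => ?; nlia.
have [z zR ez] := touchP _ _ _ tyl; rewrite inE in zR; have [k1 k1n Ek1] := nth_ex c0 zR.
pose tt k := (k < n) && e yl (w k).
have ex : exists k, tt k by exists k1; rewrite /tt k1n /w Ek1.
have bd k : tt k -> k <= n by rewrite /tt => /andP[/ltnW].
case: (ex_minnP ex) => f /andP[fn ef] minf; case: (ex_maxnP ex bd) => l /andP[ln el] maxl.
have fl' : f <= l by apply: minf; rewrite /tt ln.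
have rev_take k : k < n -> rev (drop k.+1 R) = take (n.-1 - k) (rev R).
  by move=> kn; rewrite take_rev; congr (rev (drop _ _)); rewrite -/n; nlia.
have Yw0 k : k < size Y -> e c2 (nth c2 Y k) = (k == 0).
  move=> km; rewrite hY2 ?mem_nth // (set_nth_default c0) // -[y0]/(nth c0 Y 0).
  by rewrite (nth_eq c0 km).
(* If the last vertex [yl] of [Y] sees a single vertex of [R], that vertex is the centre. Otherwise
   the centre is [yl], and the part of [R] strictly between its first and last neighbour is
   dropped. *)
move: fl'; rewrite leq_eqVlt => /orP[/eqP Efl|lt].
  have only k : k < n -> e yl (w k) -> k = f.
    move=> kn ek; have := minf k; have := maxl k; rewrite /tt kn ek => /(_ isT) ? /(_ isT) ?.
    by nlia.
  apply: (fin (w f) f f.+1 Y) => //.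
  - by apply/RX/wR.
  - exact: (half_leg pR c0R w0 fn).
  - rewrite rev_take // -(rw f fn); apply: half_leg => //.
    by rewrite size_rev -/n; nlia.
  - split.
    + apply: ipath_cons => // y yY; rewrite hY2 //; split=> //.
      by apply: contraNneq c2Y => ->.
    + by apply/touchP; exists (w f); rewrite ?inE.
    move=> y v yc /set1P->; move: yc; rewrite inE => /orP[/eqP->|yY].
      by rewrite hR2 ?wR // nc // RX // wR.
    split; first by apply: contraNneq (YR y yY) => ->; apply: wR.
    move=> eyw; split=> //; apply/eqP; apply: contraTT eyw => yn.
    by rewrite YRe // wR.
  - move=> y k yY kn hk; case: (eqVneq y yl) => [->|yn]; last by rewrite YRe ?wR.
    by apply/negP => /(only k kn) ?; move: hk; nlia.
have fl1 : f.+1 < l.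
  rewrite ltn_neqAle lt andbT; apply/eqP => E.
  have e12 : e (w f) (w l) by rewrite wadj // E eqxx.
  by rewrite (tri ef e12) in el.
apply: (fin yl f.+1 l (take m.-1 Y)) => //.
- exact: YX.
- exact: ltnW.
- have tP y : y \in take f.+1 R -> exists2 k, k < f.+1 & y = w k.
    move=> /(nth_ex c0)[k sk <-]; rewrite size_takel // in sk.
    by exists k; rewrite ?nth_take.
  have lE : last c0 (take f.+1 R) = w f.
    by rewrite -nth_last size_takel // nth_take.
  split.
  + apply: ipath_cons; first by apply: (ipath_catl (t := drop f.+1 R)); rewrite cat_take_drop.
    move=> y /mem_take yR; split; first by apply: nc => //; apply: RX.
    by rewrite hR0.
  + by apply/touchP; exists yl; rewrite ?inE // lE e_sym.
  move=> y v yc /set1P->; rewrite lE; move: yc; rewrite inE => /orP[/eqP->|/tP[k kf ->]].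
    by rewrite noY0 // nc // YX.
  have kn : k < n by nlia.
  split; first by rewrite eq_sym; apply: contraNneq (YR yl ylY) => ->; apply: wR.
  rewrite e_sym => ek; have := minf k; rewrite /tt kn ek => /(_ isT) ?.
  by split=> //; congr w; nlia.
- have dP y : y \in drop l R -> exists2 k, l <= k < n & y = w k.
    move=> /(nth_ex c0)[k sk <-]; rewrite size_drop in sk.
    by exists (l + k); rewrite ?nth_drop // leq_addr /= -ltn_subRL.
  have lE : last c1 (rev (drop l R)) = w l.
    by rewrite (drop_nth c0 ln) rev_cons last_rcons.
  split.
  + apply: ipath_cons; first by apply: (ipath_rev e_sym e_irr);
      apply: (ipath_catr (s := take l R)); rewrite cat_take_drop.
    move=> y; rewrite mem_rev => yd; have yR := mem_drop yd.
    split; first by apply: nc => //; apply: RX.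
    rewrite hR1 //.
    have -> : head c1 (rev (drop l R)) = last c0 (drop l R).
      by case: (drop l R) yd => [//|v s _]; rewrite lastI rev_rcons /= -lastI.
    have -> : last r0 rs = last c0 R by [].
    have -> : last c0 R = last c0 (take l R ++ drop l R) by rewrite cat_take_drop.
    by rewrite last_cat (drop_nth c0 ln).
  + by apply/touchP; exists yl; rewrite ?inE // lE e_sym.
  move=> y v; rewrite in_cons mem_rev => yc /set1P->; rewrite lE; case/orP: yc => [/eqP->|/dP[k kl ->]].
    by rewrite noY1 // nc // YX.
  have kn : k < n by nlia.
  split; first by rewrite eq_sym; apply: contraNneq (YR yl ylY) => ->; apply: wR.
  rewrite e_sym => ek; have := maxl k; rewrite /tt kn ek => /(_ isT) ?.
  by split=> //; congr w; nlia.
- have -> : yl = nth c2 Y m.-1 by rewrite ylE; apply: set_nth_default.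
  exact: half_leg.
- by move=> y /mem_take.
move=> y k yt kn _; apply: YRe; [exact: mem_take yt| |exact: wR].
have [i si <-] := nth_ex c0 yt; rewrite size_takel ?leq_pred // in si.
rewrite nth_take // ylE nth_eq //; first by nlia.
by rewrite (leq_trans si) // leq_pred.
Qed.

End NoTriad.

(** * Prolonging the rope *)

Section Stages.
Variables (T : finType) (e : rel T).
Hypothesis e_sym : symmetric e.
Hypothesis e_irr : irreflexive e.
Hypothesis tri : forall x y z, e x y -> e y z -> e x z = false.
Hypothesis no5 : forall a b c d f,
  e a b -> e b c -> e c d -> e d f -> e f a = false.
Hypothesis nowheel : forall m blk sg, ~ wheel e m blk sg.
Implicit Types (s t : seq T) (x y w : T) (A B K : {set T}).

Notation conn := (conn e).
Notation touch := (touch e).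
Notation col := (col e).
Notation ipath := (ipath e).

Notation apart := (apart e).
Notation flx := (flx e).
Notation lnk := (lnk e).
Notation guard := (guard e).
Notation flexed := (flexed e).

Lemma apartUl A A' B : apart A B -> apart A' B -> apart (A :|: A') B.
Proof. by move=> h h' x y /setUP[]; [apply: h|apply: h']. Qed.

Lemma ipath_ends s1 c s2 : ipath (s1 ++ c :: s2) -> apart [set y in s1] [set y in s2].
Proof.
move=> p x y; rewrite !inE => xs ys; have yc : y \in c :: s2 by rewrite inE ys orbT.
have [h1 ->] := ipath_cross p xs yc; split=> //=.
rewrite (_ : (y == c) = false) ?andbF //; apply/negbTE.
have /ipath_uniq/= /andP[cs _] := ipath_catr p.
by apply: contraNneq cs => <-.
Qed.

(* Any induced path ending at [c] extends to a guard through the flexible link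
   from [c] to the tip [q]. *)
Definition hook c (F : {set T}) q := forall Z : seq T, ipath (rcons Z c) ->
  apart [set y in Z] (q |: F) -> guard ([set y in rcons Z c] :|: (q |: F)) q 32.

Lemma flexed_flx q K P x s q' K' : flexed q K P x s q' K' ->
  flx q (([set y in behead (rcons P x)] :|: [set y in s]) :\ q') q'.
Proof.
move=> [[pP hP _] [rg _ qs exq aPs] _ _]; have [_ _ _ xs _] := rg.
have fl := ring_flx e_sym e_irr rg qs exq.
case: P pP hP aPs => [_ /= xq _|y P pP /= yq aPs].
  rewrite -xq => b; apply: lnk_sub (fl b) => z.
  by rewrite !inE => /andP[-> ->].
rewrite -yq => b; have l0 : lnk y [set z in P] x (odd (size P)).
  by exists P; split=> // z; rewrite inE.
have ap : apart (y |: [set z in P]) (q' |: ([set z in s] :\ q')).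
  apply: apart_sub aPs => z; rewrite !inE // => /orP[/eqP->|/andP[_]] //.
apply: lnk_sub (flx_compl l0 fl ap b) => z.
rewrite !inE mem_rcons inE => /orP[zP|/orP[/eqP->|/andP[-> ->]]]; last by rewrite orbT.
  rewrite zP !orbT andbT; apply/eqP => zq.
  by have [||/eqP] := aPs z z; rewrite ?inE ?zP ?orbT // zq.
by rewrite eqxx /= andbT; apply: contraNneq xs => ->.
Qed.

(** The hook holds since a path ending at [q] and followed by the path of [flexed] is again an
    induced path leading into the ring, so that [guard_ring] applies. *)
Lemma flex_stage q (K : {set T}) n : conn K -> q \notin K -> touch q K ->
  ~~ col K (2 * (n + 4)) ->
  exists (F : {set T}) q' (K' : {set T}), [/\ flx q F q', hook q F q',
    [/\ {subset q' |: F <= K}, q' \notin F, {subset K' <= K} & apart (q |: F) K'],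
    [/\ conn K', q' \notin K' & touch q' K'] & ~~ col K' n].
Proof.
move=> cK qK tq nK; have [P [x [s [q' [K' [fl nK']]]]]] :=
  flex_step e_sym e_irr tri no5 cK qK tq nK.
have [[pP hP bK] [rg sK qs exq aPs] [K'K cK' tq' q'K'] apK'] := fl.
have E : rcons P x = q :: behead (rcons P x).
  by rewrite -hP; case: (P) => [|? ?].
have q'K := sK _ qs.
have q'b : q' \notin rcons P x.
  apply/negP; rewrite mem_rcons inE => /orP[/eqP E'|qP].
    by have [_ _ _ + _] := rg; rewrite -E' qs.
  by have [||/eqP] := aPs q' q'; rewrite ?inE.
exists (([set y in behead (rcons P x)] :|: [set y in s]) :\ q'), q', K'; split=> //.
- exact: flexed_flx fl.
- move=> Z pZ aZ.
  have FE : q' |: ([set y in behead (rcons P x)] :|: [set y in s]) :\ q' =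
      [set y in behead (rcons P x)] :|: [set y in s].
    by rewrite setD1K // !inE qs orbT.
  rewrite FE in aZ *.
  have pZP : ipath (rcons Z q ++ behead (rcons P x)).
    rewrite cat_rcons -E; apply: ipath_cat => //.
      by move: pZ; rewrite -cats1 => /ipath_catl.
    move=> y z yZ; rewrite E inE => /orP[/eqP->|zb].
      have [h1 h2] : y != q /\ e y q = (y == last q Z) && (q == head y [:: q]).
        by apply: ipath_cross => //; rewrite ?cats1 ?inE.
      by rewrite h1 h2 /= !eqxx.
    have [||h1 h2] := aZ y z; rewrite ?inE ?zb // h1 h2; split=> //=.
    have zq : z != q.
      by apply: contraTneq pP => Ez; apply/negP => /ipath_uniq; rewrite E /= -Ez zb.
    by rewrite (negbTE zq) andbF.
  have -> : [set y in rcons Z q] :|: ([set y in behead (rcons P x)] :|: [set y in s]) =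
      [set y in rcons (Z ++ P) x] :|: [set y in s].
    apply/setP => y; rewrite rcons_cat E !inE mem_cat mem_rcons !inE.
    by rewrite -!orbA orbCA.
  apply: (guard_ring e_sym e_irr tri no5 nowheel) => //.
    by rewrite rcons_cat E -cat_rcons.
  move=> y z; rewrite inE mem_cat => /orP[yZ zs|yP zs].
    by apply: aZ; rewrite ?inE //; move: zs; rewrite inE => ->; rewrite orbT.
  by apply: aPs; rewrite // inE.
- split=> //.
  + move=> y; rewrite !inE => /orP[/eqP->//|/andP[_ /orP[/bK|/sK]]] //.
  + by rewrite !inE eqxx.
  + apply: apart_sub apK' => // y; rewrite !inE => /orP[/eqP->|/andP[-> /orP[yb|->]]].
    * rewrite E mem_head andbT; apply: contraNneq q'b => <-; by rewrite E mem_head.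
    * by rewrite E inE yb orbT.
    * by rewrite orbT.
Qed.

(* [Bd] is the rope without its tip [q], and [K] the part that remains. *)
Definition state (Bd : {set T}) q (K : {set T}) D : Prop :=
  [/\ conn K, q \notin K, touch q K, q \notin Bd /\ apart Bd K & guard (q |: Bd) q D].

Lemma guard_pair (V : {set T}) q u v : {subset V <= [set u; v]} -> q \notin V -> guard V q 4.
Proof.
move=> V2 qV; have g0 a : guard (V :&: [set a]) q 2.
  have [aV|aV] := boolP (a \in V).
    have -> : V :&: [set a] = [set a] by apply/setIidPr; rewrite sub1set.
    by apply: (guard1 e_sym e_irr tri nowheel); apply: contraNneq qV => <-.
  have -> : V :&: [set a] = set0.
    by apply/setP => y; rewrite !inE; apply/negP => /andP[+ /eqP E]; rewrite E (negbTE aV).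
  move=> t K d r _ _ _ _ _; apply: (col_sub (B := set0)); last exact: col0.
  apply/fintype.subsetP => y /dirtyP[_ _ [w [_ _ /touchP[z]]]]; by rewrite inE.
have -> : V = (V :&: [set u]) :|: (V :&: [set v]).
  rewrite -setIUr; apply/esym/setIidPl; exact/fintype.subsetP.
exact: (guardU (g0 u) (g0 v)).
Qed.

(** One contact followed by one odd ring. The guard grows by 36: 32 for the new piece, through its
    hook, and 4 for the at most two vertices of [V]. The condition on vertices of [W] inside [Bd],
    re-established for the new rope, ensures that a parent touching nothing of the rope is not one
    of its vertices either. *)
Lemma stage (J M W Bd K : {set T}) q D n : state Bd q K D ->
  {subset K <= J} -> q \in J -> (forall v, v \in J -> touch v W) ->
  (forall w, w \in W -> w \notin J) -> (forall w, w \in W -> touch w M) -> conn M ->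
  (forall w, w \in W -> w \in Bd -> touch w (q |: Bd)) ->
  ~~ col K (2 * (2 * (n + 4) + 3 + (D + 1))) ->
  exists (A : {set T}) c (F : {set T}) q' (V K' : {set T}),
  [/\ [/\ exists b, lnk q A c b, flx c F q' & hook c F q'],
      [/\ {subset q' |: F <= K}, {subset A <= K}, c \in K \/ c \in W & {subset V <= K :|: W}],
      [/\ apart Bd (q' |: (c |: (A :|: F) :|: V)),
          apart (q |: A) (q' |: F) & apart V (q' |: (q |: (A :|: F)))],
      [/\ conn (M :|: V), touch c (M :|: V), c \notin V &
          forall w, w \in W -> w \in q |: (c |: (A :|: F)) :|: V :|: Bd ->
            touch w (q' |: (q |: (c |: (A :|: F)) :|: V :|: Bd))] &
      [/\ state (q |: (c |: (A :|: F)) :|: V :|: Bd) q' K' (D + 36),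
          {subset K' <= K} & ~~ col K' n]].
Proof.
move=> [cK qK tq [qB aBK] gB] KJ qJ JW WJ WM cM WB nK.
have aRK : apart ((q |: Bd) :\ q) K.
  by apply: apart_sub aBK => // y; rewrite !inE => /andP[/negbTE-> /orP[]].
have WqK w : w \in W -> w \notin q |: K.
  move=> /WJ; apply: contra; rewrite !inE => /orP[/eqP->//|/KJ->//].
have qR : q \in q |: Bd by rewrite !inE eqxx.
have [A1 [c [A2 [q1 [K1 [V [ct nK1]]]]]]] := contact_step e_sym e_irr tri
  cK qK tq qR aRK gB (fun v vK => JW v (KJ v vK)) WqK WM cM nK.
have [[pc q1K cW] [K1K cK1 tq1 q1K1 aK1] [cMV [tcM cV] VW [aVp aVK1] [[va [vb V2]] Vt]]] := ct.
have [F1 [q' [K' [fl hk [FK q'F K'K aFK'] [cK' q'K' tq'] nK']]]] := flex_stage cK1 q1K1 tq1 nK1.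
pose A : {set T} := [set y in A1]; pose F : {set T} := [set y in A2] :|: (q1 |: F1).
have memK y : y \in A1 ++ A2 -> y \in K.
  move=> yA; have yc : y != c.
    apply: contraTneq pc => yc; apply/negP => /ipath_uniq; rewrite -cat_cons.
    rewrite cat_uniq /= mem_rcons inE negb_or rcons_uniq negb_or.
    case/and5P=> _ /andP[+ _] /andP[_ cA2] _ _; rewrite inE negb_or => /andP[_ cA1].
    by move: yA; rewrite mem_cat yc (negbTE cA1) (negbTE cA2).
  case: (cW y); first by move: yA; rewrite !mem_cat inE => /orP[]->; rewrite ?orbT.
    by [].
  by case=> /eqP; rewrite (negbTE yc).
have AK y : y \in A -> y \in K by rewrite inE => yA; apply: memK; rewrite mem_cat yA.
have q'FK1 y : y \in q' |: F1 -> y \in K1 by apply: FK.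
have q'K1 : q' \in K1 by apply: FK; rewrite !inE eqxx.
have F1K1 y : y \in F1 -> y \in K1 by move=> yF; apply: FK; rewrite !inE yF orbT.
have A2K y : y \in A2 -> y \in K by move=> yA; apply: memK; rewrite mem_cat yA orbT.
have FKK y : y \in q' |: F -> y \in K.
  rewrite !inE => /or4P[/eqP->|/A2K//|/eqP->//|/F1K1/K1K//]; exact: K1K.
have cKW : c \in K \/ c \in W.
  by case: (cW c); [rewrite mem_cat mem_head orbT|left|case; right].
have clB w : w \in W -> ~~ touch w (q |: Bd) -> apart Bd [set w].
  move=> wW nt y z yB /set1P->; split.
    by apply: contraNneq nt => yw; apply: WB => //; rewrite -yw.
  by rewrite e_sym; apply/negbTE; apply: contra nt => ew; apply/touchP; exists y;
    rewrite // !inE yB orbT.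
have aBc : apart Bd [set c].
  case: (cW c); first by rewrite mem_cat mem_head orbT.
    by move=> cK0 y z yB /set1P->; apply: aBK.
  by case=> _ cW' nt; apply: clB.
have aBV : apart Bd V.
  move=> y z yB zV; case: (VW z zV) => [zK|[zW nt]]; first exact: aBK.
  by apply: (clB z zW nt); rewrite ?inE.
have pcA2 : ipath (c :: rcons A2 q1) by rewrite -cat_cons in pc; apply: ipath_catr pc.
have l1 : lnk c [set y in A2] q1 (odd (size A2)).
  by exists A2; split=> // y; rewrite inE.
have acA2 : apart (c |: [set y in A2]) (q' |: F1).
  move=> y z yA /q'FK1 zK1; apply: aK1 => //; rewrite inE -cat_cons mem_cat inE.
  by move: yA; rewrite !inE => ->; rewrite orbT.
have flc : flx c F q' by apply: flx_compl l1 fl acA2.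
have lqc : lnk q A c (odd (size A1)).
  exists A1; split=> //; last by move=> y; rewrite inE.
  have : ipath ((q :: A1) ++ [:: c] ++ rcons A2 q1) by [].
  by rewrite catA cats1 => /ipath_catl.
have aqAF : apart (q |: A) (q' |: F).
  have h1 : apart [set y in q :: A1] [set y in rcons A2 q1].
    by apply: (ipath_ends (c := c)).
  move=> y z yA; have yp : y \in [set y in q :: A1 ++ c :: A2].
    by move: yA; rewrite !inE mem_cat => /orP[->//|->]; rewrite orbT.
  have yq : y \in [set y in q :: A1] by move: yA; rewrite !inE.
  rewrite !inE => /or4P[/eqP->|zA|/eqP->|zF].
  - exact: aK1.
  - by apply: h1; rewrite // inE mem_rcons inE zA orbT.
  - by apply: h1; rewrite // inE mem_rcons mem_head.
  - by apply: aK1 (F1K1 _ zF).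
have aVF : apart V (q' |: (q |: (A :|: F))).
  move=> y z yV; rewrite !inE => /or3P[/eqP->|/eqP->|/orP[zA|/or3P[zA|/eqP->|zF]]].
  - exact: aVK1.
  - by apply: aVp; rewrite // inE mem_head.
  - by apply: aVp; rewrite // inE inE mem_cat zA orbT.
  - by apply: aVp; rewrite // inE inE mem_cat mem_rcons inE zA !orbT.
  - by apply: aVp; rewrite // inE inE mem_cat mem_rcons mem_head !orbT.
  - exact: aVK1 (F1K1 _ zF).
have hkc : hook c F q'.
  move=> Z pZ aZ.
  have pZ' : ipath (rcons (Z ++ c :: A2) q1).
    rewrite rcons_cat /=; apply: ipath_cat => //.
      by move: pZ; rewrite -cats1 => /ipath_catl.
    move=> y z yZ; rewrite inE => /orP[/eqP->|zA].
      have pZ2 : ipath (Z ++ [:: c]) by rewrite cats1.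
      by have [h1 h2] := ipath_cross pZ2 yZ (mem_head c [::]); rewrite h1 h2 /= !eqxx.
    have [||h1 h2] := aZ y z; rewrite ?inE //.
      by move: zA; rewrite mem_rcons !inE => /orP[->|->]; rewrite ?orbT.
    rewrite h1 h2 /=; split=> //; rewrite (_ : (z == c) = false) ?andbF //.
    by apply: contraTF pcA2 => /eqP E; apply/negP => /ipath_uniq; rewrite /= -E zA.
  have -> : [set y in rcons Z c] :|: (q' |: F) = [set y in rcons (Z ++ c :: A2) q1] :|: (q' |: F1).
    apply/setP => y; rewrite /F !inE !mem_rcons !inE !mem_cat !inE.
    by case: (y == c) (y \in Z) (y == q') (y \in A2) (y == q1) (y \in F1) => [] [] [] [] [] [].
  apply: hk => // y z; rewrite inE mem_cat => /orP[yZ|yA] zF.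
    by apply: aZ; rewrite ?inE //; move: zF; rewrite /F !inE => /orP[->|->]; rewrite ?orbT.
  by apply: acA2 zF; move: yA; rewrite !inE.
have pA1c : ipath (rcons A1 c).
  have : ipath ([:: q] ++ rcons A1 c ++ rcons A2 q1) by rewrite cat_rcons.
  by move/ipath_catr/ipath_catl.
have gE : guard ([set y in rcons A1 c] :|: (q' |: F)) q' 32.
  by apply: hkc => //; apply: apart_sub aqAF => // y; rewrite !inE => ->; rewrite orbT.
have q'V : q' \notin V.
  by apply/negP => q'V; have [|/eqP] := aVF q' q' q'V; rewrite // !inE eqxx.
have gV := guard_pair V2 q'V.
pose E := [set y in rcons A1 c] :|: (q' |: F) :|: V.
have aBE : apart Bd E.
  apply: apartU => //; apply: apartU.
    move=> y z yB; rewrite inE mem_rcons inE => /orP[/eqP->|zA].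
      by apply: aBc; rewrite ?inE.
    by apply: aBK => //; apply: AK; rewrite inE.
  by move=> y z yB /FKK; apply: aBK.
have [t0 [pt0 t0E]] : exists t0, ipath (q :: rcons t0 q') /\ {subset rcons t0 q' <= E}.
  have ap : apart (q |: A) (q' |: F) := aqAF.
  have [t0 [pt0 t0s _]] := lnk_comp lqc (flc true) ap; exists t0; split=> // y.
  rewrite mem_rcons inE => /orP[/eqP->|/t0s]; first by rewrite !inE eqxx !orbT.
  rewrite /E /A !inE mem_rcons inE => /or3P[->|->|->]; by rewrite ?orbT.
have qE : q \notin E.
  apply/negP; rewrite !inE mem_rcons inE => /orP[/orP[|]|].
  - move: pc => /ipath_uniq; rewrite /= mem_cat inE mem_rcons inE !negb_or.
    by case/andP=> /and3P[/negbTE-> /negbTE-> _].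
  - by move=> h; move/negP: qK; apply; apply: FKK; rewrite !inE.
  - by move=> qV; have [|/eqP] := aVF q q qV; rewrite // !inE eqxx orbT.
have gN : guard (q |: Bd :|: E) q' (D + 36).
  have := @guard_ext _ e (q |: Bd) E q (rcons t0 q') D 36 gB pt0 t0E.
  rewrite last_rcons; apply=> //.
  - exact: (guardU gE gV).
  - by apply: apart_sub aBE => // y; rewrite !inE => /andP[/negbTE-> /orP[]].
have BdE : q' |: (q |: (c |: (A :|: F)) :|: V :|: Bd) = q |: Bd :|: E.
  apply/setP => y; rewrite /E /A !inE mem_rcons inE.
  by case: (y == q) (y == q') (y == c) (y \in A1) (y \in Bd) (y \in V)
    ((y \in A2) || ((y == q1) || (y \in F1))) => [] [] [] [] [] [] [].
have q'qA : q' \notin q |: A.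
  by apply/negP => h; have [|/eqP] := aqAF q' q' h; rewrite // !inE eqxx.
have q'c : q' != c.
  by have [||h _] := acA2 c q'; rewrite ?inE ?eqxx // eq_sym.
exists A, c, F, q', V, K'; split.
- by split=> //; exists (odd (size A1)).
- split=> // y yV; rewrite inE; case: (VW y yV) => [->//|[-> _]]; by rewrite orbT.
- split=> //.
  move=> y z yB; rewrite in_setU1 in_setU => zE; apply: aBE => //; move: zE.
  rewrite /E /A !inE mem_rcons inE.
  by case: (z == q') (z == c) (z \in A1) (z \in V)
    ((z \in A2) || ((z == q1) || (z \in F1))) => [] [] [] [] [].
- split=> // w wW; rewrite BdE; set RR := q |: Bd :|: E.
  rewrite !inE -!orbA => /or4P[/eqP wq|/eqP wc|wA|].
  + by have := WJ w wW; rewrite wq qJ.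
  + apply/touchP; exists (head q1 A2).
      rewrite /RR /E /F !inE; case: (A2) => [|a A2'] /=; first by rewrite eqxx !orbT.
      by rewrite mem_head !orbT.
    rewrite wc; have := ipath_cross (s := [:: c]) pcA2 (mem_head _ _).
    case: (A2) => [|a A2'] /=.
      by move=> /(_ q1); rewrite mem_head => /(_ isT)[_ ->]; rewrite !eqxx.
    by move=> /(_ a); rewrite mem_head => /(_ isT)[_ ->]; rewrite !eqxx.
  + by have := WJ w wW; rewrite KJ // AK // inE.
  case/or4P=> [wA|/eqP wq|wF|/orP[wV|wB]].
  + by have := WJ w wW; rewrite KJ // A2K.
  + by have := WJ w wW; rewrite wq KJ.
  + by have := WJ w wW; rewrite KJ // K1K // F1K1.
  + have /touchP[z zc ez] := Vt w wV; apply/touchP; exists z => //.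
    move: zc; rewrite /RR /E !inE mem_rcons inE => /orP[->|->]; by rewrite ?orbT.
  + have /touchP[z zR ez] := WB w wW wB; apply/touchP; exists z => //.
    by rewrite /RR inE zR.
split=> //; last by move=> y /K'K/K1K.
split=> //; last by rewrite BdE.
split.
  rewrite !inE !negb_or; move: q'qA; rewrite !inE negb_or => /andP[-> ->].
  rewrite q'c q'V /=.
  have q'A2 : q' \notin A2.
    apply/negP => h; have [||/eqP] := acA2 q' q'; rewrite ?inE ?h ?eqxx ?orbT //.
  have q'q1 : q' != q1 by apply: contraNneq q1K1 => <-.
  rewrite q'A2 q'q1 q'F /=.
  by apply/negP => q'B; have [|/eqP] := aBK q' q' q'B; rewrite // K1K.
move=> y z; rewrite !inE => yR zK'; have zK1 := K'K _ zK'; have zK := K1K _ zK1.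
move: yR => /orP[/orP[|yV]|yB]; last 2 first.
- exact: aVK1.
- exact: aBK.
have h1 u : u \in q :: A1 ++ c :: A2 -> u != z /\ e u z = false.
  by move=> us; apply: aK1; rewrite ?inE.
case/or3P=> [/eqP->|/eqP->|/orP[yA|/or3P[yA|/eqP->|yF]]].
- by apply: h1; rewrite mem_head.
- by apply: h1; rewrite in_cons mem_cat mem_head !orbT.
- by apply: h1; rewrite in_cons mem_cat yA !orbT.
- by apply: h1; rewrite in_cons mem_cat in_cons yA !orbT.
- by apply: aFK'; rewrite // !inE eqxx.
- by apply: aFK'; rewrite // !inE yF orbT.
Qed.

End Stages.

(** * Closing the rope *)

Section Rope.
Variables (T : finType) (e : rel T).
Hypothesis e_sym : symmetric e.
Hypothesis e_irr : irreflexive e.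
Hypothesis tri : forall x y z, e x y -> e y z -> e x z = false.
Hypothesis no5 : forall a b c d f,
  e a b -> e b c -> e c d -> e d f -> e f a = false.
Hypothesis nowheel : forall m blk sg, ~ wheel e m blk sg.
Implicit Types (s t : seq T) (x y w : T) (A B K : {set T}).

Notation conn := (conn e).
Notation touch := (touch e).
Notation col := (col e).
Notation ipath := (ipath e).

Notation apart := (apart e).
Notation flx := (flx e).
Notation lnk := (lnk e).
Notation guard := (guard e).
Notation triad := (triad e).
Notation state := (state e).

(* [U] and [M] are the two bodies, [Lp] and [Mp] the parents of [J] attached to
   them. *)
Definition frame (U Lp M Mp J : {set T}) : Prop :=
  [/\ [/\ conn U, conn M & conn J],
      [/\ forall x, x \in Lp -> touch x U, forall x, x \in Mp -> touch x M,
          forall v, v \in J -> touch v Lp & forall v, v \in J -> touch v Mp],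
      apart U (M :|: Mp :|: J), apart M J &
      [/\ forall x, x \in Lp -> x \notin U :|: (M :|: Mp :|: J),
          forall w, w \in Mp -> w \notin J & forall w, w \in Mp -> w \notin M]].

Lemma lnk_path x s y : ipath (x :: s) -> y \notin x :: s ->
  (forall z, z \in x :: s -> e y z = (z == last x s)) ->
  lnk x [set z in s] y (odd (size s)).
Proof.
move=> ps ys h; exists s; split=> // [|z]; last by rewrite inE.
rewrite -rcons_cons; apply: (ipath_rcons e_sym) => // z zs; rewrite h //; split=> //.
by apply: contraNneq ys => ->.
Qed.

Ltac ins := by let y := fresh in let h := fresh in move=> y h; rewrite ?in_setU h ?orbT.
Ltac leaf1 a12 a23 aB al aG aQF aI1 aI2 l2 l3 lR lJ :=
  let in2 := first [assumption | apply: l2; assumption] in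
  let in3 := first [assumption | apply: l3; in2] in
  first [ by apply: a12; [assumption|ins] | by apply: a23; [in2|ins]
  | by apply: aB; in3 | by apply: al; first [assumption | apply: lR; in3]
  | by apply: aG; first [assumption | apply: lJ; assumption] | by apply: aQF; ins
  | by apply: aI1; ins | by apply: aI2; ins ].
Ltac aps := repeat first [apply: apartU | apply: apartUl].

(* Two more stages; each raises the bound of the guard by 36, and by another 32
   for the hub path to the new contact: 41, 109, 177. *)
Definition rope_bound :=
  2 * (2 * (2 * (2 * (2 * (0 + 177) + 4) + 3 + (109 + 1)) + 4) + 3 + (41 + 1)).

(** The situation after the first contact [c0]: [l] is the parent attached to [U] where the rope
    starts, [Q] the stretch from [l] to [c0], empty if they coincide, [F0] the flexible link to the
    tip, and [V0] enlarges the hub. The closing parent [l'] misses only what is guarded and might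
    see [M]; therefore the hub paths to be used as the connected set of the triad are chosen and
    guarded before [l']. *)
Lemma rope_false (U Lp M Mp J Bd1 Q F0 V0 K1 : {set T}) l c0 q1 :
  frame U Lp M Mp J -> state Bd1 q1 K1 41 -> {subset K1 <= J} ->
  ~~ col K1 rope_bound ->
  l \in Lp -> flx c0 F0 q1 ->
  (Q = set0 /\ c0 = l \/ exists (A : {set T}) b,
    [/\ lnk l A c0 b, {subset A <= J}, c0 \in J :|: Mp & Q = l |: A]) ->
  {subset F0 <= J} -> q1 \in J ->
  {subset V0 <= J :|: Mp} -> {subset c0 |: (Q :|: F0 :|: V0) <= Bd1} ->
  (forall x, x \in Bd1 -> x \in Mp :|: Lp -> touch x (q1 |: Bd1)) ->
  {subset Bd1 <= J :|: Mp :|: Lp} ->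
  apart Q (q1 |: F0) -> apart (M :|: V0) (q1 |: (Q :|: F0)) ->
  conn (M :|: V0) -> touch c0 (M :|: V0) -> c0 \notin V0 -> False.
Proof.
move=> fr st1 K1J nK1 lLp fl0 hQ F0J q1J V0P sB1 Btouch B1P aQF aV0 cMV0 t0 c0V0.

(* The second contact and a guarded hub path from the first to it *)
have [[cU cM cJ] [LU WM JL JW] aU aMJ [LpD WJ WnM]] := fr.
have [cK1 q1K1 tq1 [q1B aB1K] g1] := st1.
have W1 w : w \in Mp -> w \in Bd1 -> touch w (q1 |: Bd1).
  by move=> wW wB; apply: Btouch; rewrite // inE wW.
have [A1 [c1 [F1 [q2 [V1 [K2 [[[b1 l1] fl1 hk1] [q2F1K A1K c1P V1P] [aE1 aI1 aV1]
  [cMV1 tc1 c1V1 W2] [st2 K21 nK2]]]]]]]] :=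
  stage e_sym e_irr tri no5 nowheel st1 K1J q1J JW WJ WM cM W1 nK1.
set Bd2 := q1 |: _ :|: _ :|: _ in W2 st2.
have q2F1J y : y \in q2 |: F1 -> y \in J by move=> /q2F1K/K1J.
have A1J y : y \in A1 -> y \in J by move=> /A1K/K1J.
have c1JW : c1 \in J :|: Mp by rewrite inE; case: c1P => [/K1J->|->]; rewrite ?orbT.
have V1JW y : y \in V1 -> y \in J :|: Mp.
  by move=> /V1P; rewrite !inE => /orP[/K1J->|->]; rewrite ?orbT.
have K2J y : y \in K2 -> y \in J by move=> /K21/K1J.
have [cK2 q2K2 tq2 [q2B aB2K] g2] := st2.
have inB2 y : y \in Bd2 = [|| y == q1, y == c1, y \in A1, y \in F1, y \in V1 | y \in Bd1].
  by rewrite /Bd2 !inE -!orbA.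
have JMn y : y \in J -> y \notin M.
  by move=> yJ; apply/negP => yM; have [/eqP] := aMJ y y yM yJ.
have JWMn y : y \in J :|: Mp -> y \notin M by rewrite inE => /orP[/JMn|/WnM].
have MV (V V' : {set T}) : conn (M :|: V) -> conn (M :|: V') -> conn (M :|: V :|: V').
  move=> cV cV'; have [x xM] : exists x, x \in M.
    have /touchP[v] := tq1; move=> /K1J/JW/touchP[w /WM/touchP[x xM _] _] _; by exists x.
  have -> : M :|: V :|: V' = (M :|: V) :|: (M :|: V').
    by rewrite setUACA setUid setUA.
  by apply: (connU e_sym cV cV' (a := x) (b := x)); rewrite ?eqxx // inE xM.
have cH1 := MV _ _ cMV0 cMV1; set H1 := M :|: V0 :|: V1 in cH1.
have exc0 : exists2 x, x \in H1 & e c0 x.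
  by have /touchP[x xM ex] := t0; exists x; rewrite // in_setU xM.
have exc1 : exists2 x, x \in H1 & e c1 x.
  have /touchP[x xM ex] := tc1; exists x => //; move: xM.
  by rewrite /H1 !inE => /orP[->|->]; rewrite ?orbT.
(* Followed by [c1], this path ends where the hook of the new ring starts, which then guards it at
   the price of 32. *)
have [p0 [ps [pP PH hP0 hP1]]] := path_between e_sym cH1 exc0 exc1.
set P := p0 :: ps in pP PH hP0 hP1.
have PP y : y \in P -> [\/ y \in M, y \in V0 | y \in V1].
  move=> /PH; rewrite /H1 !inE -orbA => /or3P[]; by [constructor 1|constructor 2|constructor 3].
have V0B1 y : y \in V0 -> y \in Bd1 by move=> yV; apply: sB1; rewrite !inE yV !orbT.
have aE1' y z : y \in Bd1 -> z \in q2 |: (c1 |: (A1 :|: F1) :|: V1) -> y != z /\ e y z = false.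
  exact: aE1.
have sE1 z : z \in q2 |: F1 -> z \in q2 |: (c1 |: (A1 :|: F1) :|: V1).
  by rewrite !inE => /orP[->|->]; rewrite ?orbT.
have aPF1 : apart [set y in P] (q2 |: F1).
  move=> y z; rewrite inE => /PP[yM|yV|yV] zF.
  - by apply: aMJ => //; apply: q2F1J.
  - by apply: aE1' (sE1 _ zF); apply: V0B1.
  - by apply: aV1 => //; move: zF; rewrite !inE => /orP[->|->]; rewrite ?orbT.
have c1P' : c1 \notin P.
  apply/negP => /PP[cM1|cV|cV]; last by rewrite cV in c1V1.
    by have := JWMn _ c1JW; rewrite cM1.
  by have [||/eqP] := aE1' c1 c1; rewrite ?V0B1 // !inE eqxx orbT.
have pPc1 : ipath (rcons P c1).
  apply: (ipath_rcons e_sym) => // y yP; split; last by rewrite hP1.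
  by apply: contraNneq c1P' => ->.
have gP := hk1 P pPc1 aPF1.
pose Bd2' := Bd2 :|: [set y in P].
have st2' : state Bd2' q2 K2 109.
  split=> //.
    split.
      rewrite in_setU negb_or q2B /= in_set; apply/negP => /PP[yM|/V0B1 yB|yV].
      - by have := JMn q2; rewrite yM q2F1J ?inE ?eqxx // => /(_ isT).
      - by have [|/eqP] := aE1' q2 q2 yB; rewrite // !inE eqxx.
      - by have [|/eqP] := aV1 q2 q2 yV; rewrite // !inE eqxx.
    move=> y z; rewrite in_setU [y \in [set _ in _]]inE => /orP[yB zK|/PP[yM|yV|yV] zK].
    - exact: aB2K.
    - by apply: aMJ => //; apply: K2J.
    - by apply: aB2K; rewrite // inB2 V0B1 ?orbT.
    - by apply: aB2K; rewrite // inB2 yV ?orbT.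
  have -> : q2 |: Bd2' = (q2 |: Bd2) :|: ([set y in rcons P c1] :|: (q2 |: F1)).
    apply/setP => y; rewrite !in_setU !in_set1 !in_set mem_rcons in_cons.
    by case: (y == q2) (y == c1) (y \in F1) (y \in P) (y == q1) (y \in A1) (y \in V1)
      (y \in Bd1) => [] [] [] [] [] [] [] [].
  exact: (guardU g2 gP).
have W2' w : w \in Mp -> w \in Bd2' -> touch w (q2 |: Bd2').
  move=> wW wB; have wB2 : w \in Bd2.
    move: wB; rewrite in_setU [w \in [set _ in _]]inE => /orP[//|/PP[wM|wV|wV]].
    - by have := WnM w wW; rewrite wM.
    - by rewrite inB2 V0B1 ?orbT.
    - by rewrite inB2 wV ?orbT.
  apply: touch_sub (W2 w wW wB2) => y.
  rewrite [_ \in q2 |: Bd2]in_setU1 [_ \in q2 |: Bd2']in_setU1 [y \in Bd2']in_setU.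
  by case/orP=> ->; rewrite ?orbT.
have q2J : q2 \in J by apply: q2F1J; rewrite !inE eqxx.

(* The third contact and a guarded hub path from it to the previous hub path *)
have [A2 [c2 [F2 [q3 [V2 [K3 [[[b2 l2] fl2 hk2] [q3F2K A2K c2P V2P] [aE2 aI2 aV2]
  [cMV2 tc2 c2V2 W3] [st3 K32 nK3]]]]]]]] :=
  stage e_sym e_irr tri no5 nowheel st2' K2J q2J JW WJ WM cM W2' nK2.
set Bd3 := q2 |: _ :|: _ :|: _ in W3 st3.
have q3F2J y : y \in q3 |: F2 -> y \in J by move=> /q3F2K/K2J.
have A2J y : y \in A2 -> y \in J by move=> /A2K/K2J.
have c2JW : c2 \in J :|: Mp by rewrite inE; case: c2P => [/K2J->|->]; rewrite ?orbT.
have V2JW y : y \in V2 -> y \in J :|: Mp.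
  by move=> /V2P; rewrite !inE => /orP[/K2J->|->]; rewrite ?orbT.
have [cK3 q3K3 tq3 [q3B aB3K] g3] := st3.
have K3J y : y \in K3 -> y \in J by move=> /K32/K2J.
have inB2' y : y \in Bd2' = (y \in Bd2) || (y \in P) by rewrite in_setU [in LHS]inE.
have inB3 y : y \in Bd3 = [|| y == q2, y == c2, y \in A2, y \in F2, y \in V2 | y \in Bd2'].
  by rewrite /Bd3 !in_setU !in_set1 -!orbA.
have B12 y : y \in Bd1 -> y \in Bd2' by move=> yB; rewrite inB2' inB2 yB !orbT.
have B23 y : y \in Bd2' -> y \in Bd3 by move=> yB; rewrite inB3 yB !orbT.
have aE2' y z : y \in Bd2' -> z \in q3 |: (c2 |: (A2 :|: F2) :|: V2) -> y != z /\ e y z = false.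
  exact: aE2.
have sE2 z : z \in q3 |: F2 -> z \in q3 |: (c2 |: (A2 :|: F2) :|: V2).
  by rewrite !inE => /orP[->|->]; rewrite ?orbT.
have c2E2 : c2 \in q3 |: (c2 |: (A2 :|: F2) :|: V2) by rewrite !inE eqxx orbT.
have A2E2 z : z \in A2 -> z \in q3 |: (c2 |: (A2 :|: F2) :|: V2).
  by rewrite !inE => ->; rewrite !orbT.
have V2E2 z : z \in V2 -> z \in q3 |: (c2 |: (A2 :|: F2) :|: V2).
  by rewrite !inE => ->; rewrite !orbT.
have c1E1 : c1 \in q2 |: (c1 |: (A1 :|: F1) :|: V1) by rewrite !inE eqxx orbT.
have A1E1 z : z \in A1 -> z \in q2 |: (c1 |: (A1 :|: F1) :|: V1).
  by rewrite !inE => ->; rewrite !orbT.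
have V1E1 z : z \in V1 -> z \in q2 |: (c1 |: (A1 :|: F1) :|: V1).
  by rewrite !inE => ->; rewrite !orbT.
have cH2 : conn (H1 :|: V2).
  have -> : H1 :|: V2 = M :|: (V0 :|: V1) :|: V2 by rewrite /H1 setUA.
  by apply: MV => //; rewrite setUA.
have exc2 : exists2 x, x \in H1 :|: V2 & e c2 x.
  have /touchP[x xM ex] := tc2; exists x => //; move: xM.
  by rewrite /H1 !inE => /orP[->|->]; rewrite ?orbT.
pose PS : {set T} := [set y in P].
have PB2 y : y \in P -> y \in Bd2' by move=> yP; rewrite inB2' yP orbT.
have c2P' y : y \in P -> y != c2 /\ e y c2 = false by move=> /PB2 yB; apply: aE2'.
have p0P : p0 \in P by apply: mem_head.
have PSH : PS \subset H1 :|: V2.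
  by apply/fintype.subsetP => y; rewrite in_set => /PH yH; rewrite in_setU yH.
have exP : exists2 x, x \in H1 :|: V2 & touch x PS.
  have [x xH ex] := exc2; have xnP : x \in (H1 :|: V2) :\: PS.
    rewrite in_setD xH andbT in_set; apply/negP => /c2P'[_].
    by rewrite e_sym ex.
  have p0S : p0 \in PS by rewrite in_set.
  have [g gD tg] := conn_exit e_sym cH2 PSH p0S xnP.
  by exists g => //; move: gD; rewrite in_setD => /andP[].
have [y0 [ys [pY YH hY0 hY1]]] := path_between e_sym cH2 exc2 exP.
set Y := y0 :: ys in pY YH hY0 hY1.
have HP y : y \in H1 :|: V2 -> [\/ y \in M, y \in V0, y \in V1 | y \in V2].
  rewrite /H1 !inE -!orbA => /or4P[]; by [constructor 1|constructor 2|constructor 3|constructor 4].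
have c2H : c2 \notin H1 :|: V2.
  apply/negP => /HP[cM'|cV|cV|cV].
  - by have := JWMn _ c2JW; rewrite cM'.
  - by have [|/eqP] := aE2' c2 c2 _ c2E2; rewrite ?B12 ?V0B1.
  - by have [|/eqP] := aE2' c2 c2 _ c2E2; rewrite // inB2' inB2 cV !orbT.
  - by rewrite cV in c2V2.
have HF2 y z : y \in H1 :|: V2 -> z \in q3 |: F2 -> y != z /\ e y z = false.
  move=> /HP[yM|yV|yV|yV] zF.
  - by apply: aMJ => //; apply: q3F2J.
  - by apply: aE2' (sE2 _ zF); apply/B12/V0B1.
  - by apply: aE2' (sE2 _ zF); rewrite inB2' inB2 yV !orbT.
  - by apply: aV2 => //; move: zF; rewrite !inE => /orP[->|->]; rewrite ?orbT.
have pYc2 : ipath (rcons (rev Y) c2).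
  rewrite -rev_cons; apply: (ipath_rev e_sym e_irr); apply: ipath_cons => // y yY.
  rewrite hY0 //; split=> //; by apply: contraNneq c2H => ->; apply: YH.
have aYF : apart [set y in rev Y] (q3 |: F2).
  by move=> y z; rewrite in_set mem_rev => /YH; apply: HF2.
have gY := hk2 (rev Y) pYc2 aYF.
pose R := (q3 |: Bd3) :|: ([set y in rcons (rev Y) c2] :|: (q3 |: F2)).
have gR : guard R q3 177 := guardU g3 gY.
have inR y : y \in R = [|| y == q3, y \in Bd3 | y \in Y].
  rewrite /R /Bd3 !in_setU !in_set1 !in_set mem_rcons in_cons mem_rev.
  by case: (y == q3) (y == q2) (y == c2) (y \in A2) (y \in F2) (y \in V2) (y \in Bd2')
    (y \in Y) => [] [] [] [] [] [] [] [].
(* A parent [l'] of the remaining part that sees nothing of the rope. *)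
have cS := conn_add e_sym cK3 tq3; have q3S : q3 \in q3 |: K3 by rewrite !inE eqxx.
have [d b] := bfs_exists cS q3S.
have HK3 y z : y \in H1 :|: V2 -> z \in K3 -> y != z /\ e y z = false.
  move=> /HP[yM|yV|yV|yV] zK.
  - by apply: aMJ => //; apply: K3J.
  - by apply: aB3K => //; apply/B23/B12/V0B1.
  - by apply: aB3K => //; apply/B23; rewrite inB2' inB2 yV !orbT.
  - by apply: aB3K => //; rewrite inB3 yV !orbT.
have cD r : col (dirty e R q3 [::] K3 d r) 177.
  apply: (gR [::] K3 d r) => //; first by move=> x y _; rewrite inE.
  move=> x y; rewrite in_setD1 in_setU inE inR orbF => /andP[xq].
  by rewrite (negbTE xq) /= => /orP[xB|/YH xH] yK; [apply: aB3K|apply: HK3].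
(* The innermost [0] of [rope_bound] enters here: a non-empty clean part of one level suffices to
   choose [l']. *)
have [r [Kf [sKf dKf _ nKf]]] := bfs_level e_sym b (subsetUr _ _) cD nK3.
have [v vKf] := ncol_nonempty nKf.
have := fintype.subsetP sKf v vKf; rewrite in_setD => /andP[vD vK3].
have /touchP[l' l'L evl'] := JL v (K3J v vK3).
have LpJ x : x \in Lp -> [/\ x \notin M, x \notin Mp & x \notin J].
  by move=> /LpD; rewrite !inE !negb_or => /andP[_ /andP[/andP[]]].
have dv : d v = r.
  exact: dKf.
have l'cl : ~~ touch l' R.
  apply: contra vD => tl; apply/dirtyP; split=> //; exists l'; split=> //.
    rewrite in_setU1 negb_or; have [_ _ nJ] := LpJ l' l'L.
    apply/andP; split; last by apply: contra nJ; apply: K3J.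
    by apply: contraNneq nJ => ->; apply: q3F2J; rewrite !inE eqxx.
  by apply/negP => /touchP[z]; rewrite inE.
have B1R y : y \in Bd1 -> y \in R by move=> /B12/B23 yB; rewrite inR yB orbT.
have sub1R : {subset q1 |: Bd1 <= R}.
  move=> y; rewrite in_setU1 => /orP[/eqP->|/B1R//].
  by rewrite inR B23 ?orbT // inB2' inB2 eqxx.
have l'R : l' \notin R.
  have [nM nMp nJ] := LpJ l' l'L.
  have nJW y : y \in J :|: Mp -> l' != y.
    by apply: contraTneq => <-; rewrite inE negb_or nJ nMp.
  have nH y : y \in H1 :|: V2 -> l' != y.
    move=> /HP[yM|/V0P yV|/V1JW yV|/V2JW yV]; try exact: nJW.
    by apply: contraNneq nM => ->.
  have nH1 y : y \in P -> l' != y by move=> /PH yH; apply: nH; rewrite in_setU yH.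
  have nJ' y : y \in J -> l' != y by apply: contraTneq => <-.
  have q3J : q3 \in J by apply: q3F2J; rewrite !inE eqxx.
  have F1J y : y \in F1 -> y \in J by move=> yF; apply: q2F1J; rewrite !inE yF orbT.
  have F2J y : y \in F2 -> y \in J by move=> yF; apply: q3F2J; rewrite !inE yF orbT.
  have key (t : bool) y : l' != y -> (l' == y) || t -> t by move=> /negbTE->.
  apply/negP; rewrite inR => /(key _ _ (nJ' _ q3J))/orP[|/YH/nH]; last by rewrite eqxx.
  rewrite inB3 => /(key _ _ (nJ' _ q2J))/(key _ _ (nJW _ c2JW))/orP[/A2J/nJ'|].
    by rewrite eqxx.
  move=> /orP[/F2J/nJ'|/orP[/V2JW/nJW|]]; rewrite ?eqxx // inB2' => /orP[|/nH1]; last first.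
    by rewrite eqxx.
  rewrite inB2 => /(key _ _ (nJ' _ q1J))/(key _ _ (nJW _ c1JW))/orP[/A1J/nJ'|].
    by rewrite eqxx.
  move=> /orP[/F1J/nJ'|/orP[/V1JW/nJW|lB]]; rewrite ?eqxx //.
  (* Among the pieces of the rope only [Bd1] can contain a vertex of [Lp], and such a vertex touches
     the rope, while [l'] does not. *)
  case/negP: l'cl; apply: touch_sub sub1R _; apply: Btouch => //.
  by rewrite inE l'L orbT.
have aRl y : y \in R -> y != l' /\ e y l' = false.
  move=> yR; split; first by apply: contraNneq l'R => <-.
  by rewrite e_sym; apply/negbTE; apply: contra l'cl => el; apply/touchP; exists y.

(* Closing the rope from the tip through [l'], the body [U] and [l] *)
have exq : exists2 x, x \in q3 |: K3 & pred1 q3 x by exists q3; rewrite /= ?eqxx.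
have exl' : exists2 x, x \in q3 |: K3 & e l' x by exists v; rewrite ?inE ?vK3 ?orbT // e_sym.
have [z0 [bs [pB BK hB0 hB1]]] := path_between e_sym cS exq exl'.
have Ez : z0 = q3.
  by have := hB0 z0 (mem_head _ _); rewrite /= eqxx => /eqP.
rewrite {z0}Ez in pB BK hB0 hB1.
have BK3 y : y \in bs -> y \in K3.
  move=> yb; have := BK y; rewrite in_cons yb orbT => /(_ isT); rewrite in_setU1.
  by case/orP=> // /eqP yq; have := ipath_uniq pB; rewrite /= -yq yb.
have l'J : l' \notin J by have [] := LpJ l' l'L.
have l'b : l' \notin q3 :: bs.
  apply/negP => /BK; rewrite in_setU1 => /orP[/eqP E|/K3J]; last by apply/negP.
  by move/negP: l'J; apply; rewrite E; apply: q3F2J; rewrite !inE eqxx.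
have lB := lnk_path pB l'b hB1.
have exl1 : exists2 x, x \in U & e l' x by apply/touchP/LU.
have exl2 : exists2 x, x \in U & e l x by apply/touchP/LU.
have [g0 [gs [pG GU hG0 hG1]]] := path_between e_sym cU exl1 exl2.
set G := g0 :: gs in pG GU hG0 hG1.
have aUS y z : y \in J :|: Mp -> z \in G -> y != z /\ e y z = false.
  move=> yJ /GU zU; have [|h1 h2] := aU z y zU; last by rewrite eq_sym e_sym.
  by move: yJ; rewrite !inE => /orP[->|->]; rewrite ?orbT.
have lR : l \in R.
  case: hQ => [[_ <-]|[A' [b' [_ _ _ EQ]]]]; apply/B1R/sB1.
    by rewrite in_setU1 eqxx.
  by rewrite EQ !inE eqxx !orbT.
have [lnl' ell'] := aRl l lR.
have l'G : l' \notin G.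
  apply/negP => /GU l'U; have /JW/touchP[w wW _] := K3J v vK3.
  have [|_] := aU l' v l'U; first by rewrite !inE K3J ?orbT.
  by rewrite e_sym evl'.
have lG : l \notin G.
  apply/negP => /GU lU.
  by have := LpD l lLp; rewrite in_setU lU.
have lGam : lnk l' [set z in G] l (odd (size G)).
  apply: (lnk_path) => [||z].
  - apply: ipath_cons => // y yG; rewrite hG0 //; split=> //.
    by apply: contraNneq l'G => ->.
  - by rewrite in_cons negb_or lnl' lG.
  - rewrite in_cons => /orP[/eqP->|zG]; last by rewrite hG1.
    rewrite ell'; apply/esym/negbTE; apply: contraNneq l'G => ->.
    by rewrite /= mem_last.
have XR y : y \in H1 :|: V2 -> y \in M :|: J :|: Mp.
  rewrite -setUA => /HP[yM|/V0P yV|/V1JW yV|/V2JW yV]; rewrite in_setU ?yM ?yV ?orbT //.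

(* Mutual position of the pieces of the closed rope and the hub paths *)
pose X : {set T} := [set y in P] :|: [set y in Y].
pose B : {set T} := [set y in bs]; pose GS : {set T} := [set y in G].
pose B' := B :|: (l' |: GS).
have XH y : y \in X -> y \in H1 :|: V2.
  by case/setUP; rewrite in_set; [move=> /PH yH; rewrite in_setU yH|apply: YH].
have sB2 y : y \in q1 |: (c1 |: (A1 :|: F1)) :|: V1 :|: Bd1 :|: [set y in P] -> y \in Bd2'.
  by [].
have a12 (S S' : {set T}) : {subset S <= Bd1} ->
    {subset S' <= q2 |: (c1 |: (A1 :|: F1) :|: V1)} -> apart S S'.
  by move=> h h'; apply: apart_sub aE1.
have a23 (S S' : {set T}) : {subset S <= Bd2'} ->
    {subset S' <= q3 |: (c2 |: (A2 :|: F2) :|: V2)} -> apart S S'.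
  by move=> h h'; apply: apart_sub aE2.
have aB (S : {set T}) : {subset S <= Bd3} -> apart S B.
  by move=> h y z /h yB; rewrite in_set => /BK3; apply: aB3K.
have al (S : {set T}) : {subset S <= R} -> apart S [set l'].
  by move=> h y z /h yR; rewrite in_set1 => /eqP->; apply: aRl.
have aG (S : {set T}) : {subset S <= M :|: J :|: Mp} -> apart S GS.
  move=> h y z /h yS; rewrite in_set => /GU zU; apply: (apart_sym e_sym aU) => //.
  by move: yS; rewrite !inE => /orP[/orP[]|] ->; rewrite ?orbT.
have ones (x : T) (S : {set T}) : x \in S -> {subset [set x] <= S}.
  by move=> xS y; rewrite in_set1 => /eqP->.
have c0B : {subset [set c0] <= Bd1} by apply: ones; apply: sB1; rewrite !inE eqxx.
have QB : {subset Q <= Bd1} by move=> y yQ; apply: sB1; rewrite !inE yQ !orbT.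
have F0B : {subset F0 <= Bd1} by move=> y yQ; apply: sB1; rewrite !inE yQ !orbT.
have q1B2 : {subset [set q1] <= Bd2'} by apply: ones; rewrite inB2' inB2 eqxx.
have c1B2 : {subset [set c1] <= Bd2'} by apply: ones; rewrite inB2' inB2 eqxx ?orbT.
have A1B2 : {subset A1 <= Bd2'} by move=> y yS; rewrite inB2' inB2 yS ?orbT.
have F1B2 : {subset F1 <= Bd2'} by move=> y yS; rewrite inB2' inB2 yS ?orbT.
have q2B3 : {subset [set q2] <= Bd3} by apply: ones; rewrite inB3 eqxx.
have c2B3 : {subset [set c2] <= Bd3} by apply: ones; rewrite inB3 eqxx ?orbT.
have A2B3 : {subset A2 <= Bd3} by move=> y yS; rewrite inB3 yS ?orbT.
have F2B3 : {subset F2 <= Bd3} by move=> y yS; rewrite inB3 yS ?orbT.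
have XR' : {subset X <= R}.
  by move=> y; rewrite inR => /setUP[]; rewrite in_set; [move=> /PB2/B23->|move->]; rewrite ?orbT.
have B1_2 (S : {set T}) : {subset S <= Bd1} -> {subset S <= Bd2'} by move=> h y /h/B12.
have B2_3 (S : {set T}) : {subset S <= Bd2'} -> {subset S <= Bd3} by move=> h y /h/B23.
have B3_R (S : {set T}) : {subset S <= Bd3} -> {subset S <= R}.
  by move=> h y /h yB; rewrite inR yB orbT.
have JJ (S : {set T}) : {subset S <= J :|: Mp} -> {subset S <= M :|: J :|: Mp}.
  by move=> h y /h; rewrite -setUA [y \in M :|: _]in_setU => ->; rewrite orbT.
have F0j : {subset F0 <= J :|: Mp} by move=> y /F0J yJ; rewrite in_setU yJ.
have A1j : {subset A1 <= J :|: Mp} by move=> y /A1J yJ; rewrite in_setU yJ.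
have A2j : {subset A2 <= J :|: Mp} by move=> y /A2J yJ; rewrite in_setU yJ.
have F1j : {subset F1 <= J :|: Mp}.
  by move=> y yS; rewrite in_setU q2F1J // in_setU yS orbT.
have F2j : {subset F2 <= J :|: Mp}.
  by move=> y yS; rewrite in_setU q3F2J // in_setU yS orbT.
have q1j : {subset [set q1] <= J :|: Mp} by apply: ones; rewrite in_setU q1J.
have q2j : {subset [set q2] <= J :|: Mp} by apply: ones; rewrite in_setU q2J.
have q3j : {subset [set q3] <= J :|: Mp}.
  by apply: ones; rewrite in_setU q3F2J // in_setU1 eqxx.
have c1j : {subset [set c1] <= J :|: Mp} by apply: ones.
have c2j : {subset [set c2] <= J :|: Mp} by apply: ones.
have Bj : {subset B <= J :|: Mp}.
  by move=> y; rewrite in_set => /BK3/K3J yJ; rewrite in_setU yJ.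
have aQF' (S : {set T}) : {subset S <= q1 |: F0} -> apart Q S by move=> h; apply: apart_sub aQF.
have aI1' (S S' : {set T}) : {subset S <= q1 |: A1} -> {subset S' <= q2 |: F1} -> apart S S'.
  by move=> h h'; apply: apart_sub aI1.
have aI2' (S S' : {set T}) : {subset S <= q2 |: A2} -> {subset S' <= q3 |: F2} -> apart S S'.
  by move=> h h'; apply: apart_sub aI2.

(* The three flexible links and the resulting triad *)
have fl0' : flx c0 (F0 :|: (q1 |: A1)) c1.
  by apply: flx_compr fl0 l1 _; aps; first [leaf1 a12 a23 aB al aG aQF' aI1' aI2' B1_2 B2_3 B3_R JJ | apply: (apart_sym e_sym); leaf1 a12 a23 aB al aG aQF' aI1' aI2' B1_2 B2_3 B3_R JJ].
have fl1' : flx c1 (F1 :|: (q2 |: A2)) c2.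
  by apply: flx_compr fl1 l2 _; aps; first [leaf1 a12 a23 aB al aG aQF' aI1' aI2' B1_2 B2_3 B3_R JJ | apply: (apart_sym e_sym); leaf1 a12 a23 aB al aG aQF' aI1' aI2' B1_2 B2_3 B3_R JJ].
have lB1 : {subset [set l] <= Bd1}.
  apply: ones; case: hQ => [[_ <-]|[A' [b' [_ _ _ EQ]]]]; first by apply/c0B; rewrite inE eqxx.
  by apply/QB; rewrite EQ !inE eqxx.
have [bl lq] : exists b', lnk q3 B' l b'.
  by eexists; apply: lnk_comp lB lGam _; aps; first [leaf1 a12 a23 aB al aG aQF' aI1' aI2' B1_2 B2_3 B3_R JJ | apply: (apart_sym e_sym); leaf1 a12 a23 aB al aG aQF' aI1' aI2' B1_2 B2_3 B3_R JJ].
have [b3 l3] : exists b', lnk q3 (B' :|: Q) c0 b'.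
  case: hQ => [[-> Ec]|[A [b' [lA AJ c0J EQ]]]]; first by exists bl; rewrite setU0 Ec.
  rewrite EQ; eexists; apply: lnk_comp lq lA _.
  have AQ : {subset A <= Bd1} by move=> y yA; apply: QB; rewrite EQ in_setU1 yA orbT.
  have Aj : {subset A <= J :|: Mp} by move=> y /AJ yJ; rewrite in_setU yJ.
  have c0j : {subset [set c0] <= J :|: Mp} by apply: ones.
  by aps; first [leaf1 a12 a23 aB al aG aQF' aI1' aI2' B1_2 B2_3 B3_R JJ | apply: (apart_sym e_sym); leaf1 a12 a23 aB al aG aQF' aI1' aI2' B1_2 B2_3 B3_R JJ].
have fl2' : flx c2 (F2 :|: (q3 |: (B' :|: Q))) c0.
  by apply: flx_compr fl2 l3 _; aps; first [leaf1 a12 a23 aB al aG aQF' aI1' aI2' B1_2 B2_3 B3_R JJ | apply: (apart_sym e_sym); leaf1 a12 a23 aB al aG aQF' aI1' aI2' B1_2 B2_3 B3_R JJ].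
have aX (S : {set T}) : apart M S -> apart V0 S -> apart V1 S -> apart V2 S -> apart X S.
  by move=> hM h0 h1 h2 y z /XH/HP[]; [apply: hM|apply: h0|apply: h1|apply: h2].
have aV0' (S S' : {set T}) : {subset S <= M :|: V0} -> {subset S' <= q1 |: (Q :|: F0)} ->
  apart S S' by move=> h h'; apply: apart_sub aV0.
have aV1' (S : {set T}) : {subset S <= q2 |: (q1 |: (A1 :|: F1))} -> apart V1 S.
  by move=> h; apply: apart_sub aV1.
have aV2' (S : {set T}) : {subset S <= q3 |: (q2 |: (A2 :|: F2))} -> apart V2 S.
  by move=> h; apply: apart_sub aV2.
have aMJ' (S : {set T}) : {subset S <= J} -> apart M S by move=> h; apply: apart_sub aMJ.
have V1B : {subset V1 <= Bd2'} by move=> y yS; rewrite inB2' inB2 yS ?orbT.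
have F1J : {subset F1 <= J} by move=> y yF; apply: q2F1J; rewrite in_setU1 yF orbT.
have F2J : {subset F2 <= J} by move=> y yF; apply: q3F2J; rewrite in_setU1 yF orbT.
have sq2J : {subset [set q2] <= J} by apply: ones.
have sq3J : {subset [set q3] <= J} by apply: ones; apply: q3F2J; rewrite in_setU1 eqxx.
have XB : apart X B by move=> y z /XH yH; rewrite in_set => /BK3; apply: HK3.
have XM : {subset X <= M :|: J :|: Mp} by move=> y /XH/XR.
have c0X : c0 \notin X.
  have c0M : c0 \notin M.
    case: hQ => [[_ ->]|[A' [b' [_ _ c0j _]]]]; last exact: JWMn.
    by have [] := LpJ l lLp.
  have c0B' : c0 \in Bd1 by apply: c0B; rewrite in_set1.
  apply/negP => /XH/HP[cM'|cV|/V1E1 cV|/V2E2 cV]; [by rewrite cM' in c0M|by rewrite cV in c0V0| |].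
    by have [/eqP] := aE1' _ _ c0B' cV.
  by have [/eqP] := aE2' _ _ (B12 _ c0B') cV.
have c1X : c1 \notin X.
  apply/setUP; rewrite !in_set => -[cP|/YH/HP[cM'|cV|cV|/V2E2 cV]].
  - by rewrite cP in c1P'.
  - by have := JWMn _ c1JW; rewrite cM'.
  - by have [/eqP] := aE1' _ _ (V0B1 _ cV) c1E1.
  - by rewrite cV in c1V1.
  - by have [|/eqP] := aE2' c1 _ _ cV; rewrite // inB2' inB2 eqxx orbT.
have c2X : c2 \notin X by apply: contra c2H; apply: XH.
have tr : triad c0 c1 c2 (F0 :|: (q1 |: A1)) (F1 :|: (q2 |: A2))
    (F2 :|: (q3 |: (B' :|: Q))) X.
  split.
  - by [].
  - by split; first [leaf1 a12 a23 aB al aG aQF' aI1' aI2' B1_2 B2_3 B3_R JJ | apply: (apart_sym e_sym); leaf1 a12 a23 aB al aG aQF' aI1' aI2' B1_2 B2_3 B3_R JJ].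
  - by split; aps; first [leaf1 a12 a23 aB al aG aQF' aI1' aI2' B1_2 B2_3 B3_R JJ | apply: (apart_sym e_sym); leaf1 a12 a23 aB al aG aQF' aI1' aI2' B1_2 B2_3 B3_R JJ].
  - by split; aps; first [leaf1 a12 a23 aB al aG aQF' aI1' aI2' B1_2 B2_3 B3_R JJ | apply: (apart_sym e_sym); leaf1 a12 a23 aB al aG aQF' aI1' aI2' B1_2 B2_3 B3_R JJ].
  - split; last by [].
    by repeat apply: (apartU (A := X)); first [exact: XB | leaf1 a12 a23 aB al aG aQF' aI1' aI2' B1_2 B2_3 B3_R JJ | apply: aX; first [by apply: aV0'; ins | by apply: aV1'; ins | by apply: aV2'; ins | by apply: aMJ'; assumption | leaf1 a12 a23 aB al aG aQF' aI1' aI2' B1_2 B2_3 B3_R JJ | apply: (apart_sym e_sym); leaf1 a12 a23 aB al aG aQF' aI1' aI2' B1_2 B2_3 B3_R JJ]].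
apply: (triad_false e_sym e_irr tri nowheel tr).
- have /touchP[x xP ex] : touch (last y0 ys) PS by rewrite hY1 // mem_last.
  have cP' := conn_ipath e_sym e_irr pP; have cY' := conn_ipath e_sym e_irr pY.
  apply: (connU e_sym cP' cY' (a := x) (b := last y0 ys)); rewrite ?in_set ?mem_last //.
    by move: xP; rewrite in_set.
  by rewrite e_sym ex orbT.
- by apply/touchP; exists p0; rewrite ?hP0 // in_setU in_set p0P.
- by apply/touchP; exists (last p0 ps); rewrite ?hP1 ?mem_last // in_setU in_set mem_last.
- have yY : y0 \in Y by apply: mem_head.
  by apply/touchP; exists y0; rewrite ?hY0 // in_setU !in_set yY orbT.
Qed.

End Rope.

(** * Colouring the last level of a frame *)

Section Frames.
Variables (T : finType) (e : rel T).
Hypothesis e_sym : symmetric e.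
Hypothesis e_irr : irreflexive e.
Hypothesis tri : forall x y z, e x y -> e y z -> e x z = false.
Hypothesis no5 : forall a b c d f,
  e a b -> e b c -> e c d -> e d f -> e f a = false.
Hypothesis nowheel : forall m blk sg, ~ wheel e m blk sg.
Implicit Types (s t : seq T) (x y w : T) (A B K : {set T}).

Notation touch := (touch e).
Notation col := (col e).
Notation nbr := (nbr e).

Notation apart := (apart e).
Notation flx := (flx e).
Notation lnk := (lnk e).
Notation guard := (guard e).
Notation state := (state e).

Lemma lnk_edge x y : e x y -> lnk x set0 y false.
Proof.
move=> exy; exists [::]; split=> //; apply: ipath_cons => [|z]; first by [].
rewrite inE => /eqP->; rewrite eqxx exy; split=> //.
by apply: contraTneq exy => ->; rewrite e_irr.
Qed.

(** If a parent [l] attached to [U] touches [M], it is itself the first contact and only a ring is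
    added; otherwise a full stage starts at a neighbour [s] of [l]. The initial guard 5 is 3 for the
    tip [s] and 2 for [l], and the stage raises it to 41; in the first case 2 + 32 stays below 41.
    The last 1 pays for deleting the neighbours of [l]. *)
Lemma frame_col U Lp M Mp J : frame e U Lp M Mp J ->
  col J (2 * (2 * (rope_bound + 4) + 3 + (5 + 1)) + 1).
Proof.
move=> fr; have [[cU cM cJ] [LU WM JL JW] aU aMJ [LpD WJ WnM]] := fr.
have := rope_false e_sym e_irr tri no5 nowheel fr.
generalize rope_bound => N rope.
apply/negPn/negP => nJ; have [x xJ] := ncol_nonempty nJ.
have /touchP[l lL xl] := JL x xJ.
have xN : J :&: nbr l != set0 by apply/set0Pn; exists x; rewrite inE xJ inE e_sym.
have [K [s [sK cK nK]]] := gate e_sym cJ (col_nbr tri J l) xN nJ.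
rewrite !inE => /andP[sJ els] tsK.
have KJ y : y \in K -> y \in J by move=> /(fintype.subsetP sK); rewrite inE => /andP[].
have Kl y : y \in K -> e l y = false.
  by move=> /(fintype.subsetP sK); rewrite !inE => /andP[/negbTE].
have LpJ y : y \in Lp -> [/\ y \notin M, y \notin Mp & y \notin J].
  by move=> /LpD; rewrite !inE !negb_or => /andP[_ /andP[/andP[]]].
have [lM lMp lJ] := LpJ l lL.
have nlJ y : y \in J -> l != y by apply: contraTneq => <-.
have ls := nlJ s sJ.
have sK' : s \notin K by apply: contraTN els => /Kl->.
have JMp y : y \in J -> y \notin Mp by apply: contraTN => /WJ.
have JLp y : y \in J -> y \notin Lp by apply: contraTN => /LpJ[].
have alK (S : {set T}) : {subset S <= K} -> apart [set l] S.
  by move=> h y z /set1P-> /h zK; rewrite Kl // nlJ ?KJ.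
have mono (S : {set T}) (q : T) (m n : nat) : m <= n -> guard S q m -> guard S q n.
  by move=> mn g t K' d r h1 h2 h3 h4 h5; apply: col_leq mn (g _ _ _ _ h1 h2 h3 h4 h5).
have lls := lnk_edge els.
have [tlM|ntlM] := boolP (touch l M).
  have nK1 : ~~ col K (2 * (N + 4)) by apply: contra nK; apply: col_leq; nlia.
  have [F [q [K1 [fl hk [FK qF K1K aF] [cK1 qK1 tq1] nK2]]]] :=
    flex_stage e_sym e_irr tri no5 nowheel cK sK' tsK nK1.
  have qK : q \in K by apply: FK; rewrite !inE eqxx.
  have FK' y : y \in F -> y \in K by move=> yF; apply: FK; rewrite !inE yF orbT.
  have fll : flx l (set0 :|: (s |: F)) q.
    by apply: flx_compl lls fl _; rewrite setU0; apply: alK.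
  have gq : guard (q |: (l |: (s |: F))) q 41.
    have -> : q |: (l |: (s |: F)) = [set l] :|: ([set y in rcons [::] s] :|: (q |: F)).
      apply/setP => y; rewrite !inE.
      by case: (y == l) (y == s) (y == q) (y \in F) => [] [] [] [].
    apply: (@mono _ _ (2 + 32)) => //.
    apply: guardU; first by apply: (guard1 e_sym e_irr tri nowheel); apply: nlJ; apply: KJ.
    by apply: hk => // y z; rewrite inE.
  have qs : q != s by apply: contraNneq sK' => <-.
  have st : state (l |: (s |: F)) q K1 41.
    split=> //; split.
      by rewrite !inE !negb_or eq_sym nlJ ?KJ //= qs.
    apply: apartUl; first by apply: alK.
    by move=> y z yF; apply: aF; move: yF; rewrite !inE => /orP[->//|->]; rewrite orbT.
  have sFJ y : y \in s |: F -> y \in J by rewrite !inE => /orP[/eqP->//|/FK'/KJ].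
  apply: (rope _ set0 _ set0 _ l l q st) fll _ _ _ _ _ _ _ _ _ _ _ _ => //.
  - by move=> y /K1K/KJ.
  - by left.
  - by move=> y; rewrite set0U; apply: sFJ.
  - exact: KJ.
  - by move=> y; rewrite inE.
  - by move=> y; rewrite !setU0 !set0U.
  - move=> y; rewrite in_setU1 => /orP[/eqP->|/sFJ yJ].
      by move=> _; apply/touchP; exists s; rewrite // !inE eqxx !orbT.
    by rewrite !inE (negbTE (JMp _ yJ)) (negbTE (JLp _ yJ)).
  - move=> y; rewrite in_setU1 => /orP[/eqP->|/sFJ yJ]; rewrite !inE ?lL ?orbT // yJ //.
  - by move=> y z; rewrite inE.
  - rewrite setU0 !set0U => y z yM zF; apply: aMJ => //.
    by move: zF; rewrite in_setU1 => /orP[/eqP->|/sFJ//]; apply: KJ.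
  - by rewrite setU0.
  - by rewrite setU0.
  - by rewrite inE.
have st0 : state [set l] s K 5.
  split=> //; first by split; [rewrite inE eq_sym|apply: alK].
  have -> : 5 = 3 + 2 by [].
  apply: guardU; first exact: (guard_tip e_sym e_irr tri nowheel).
  exact: (guard1 e_sym e_irr tri nowheel).
have W0 w : w \in Mp -> w \in [set l] -> touch w (s |: [set l]).
  by move=> wM /set1P E; rewrite E (negbTE lMp) in wM.
have [A [c [F [q [V [K1 [[[b0 lA] fl hk] [FK AK cP VP] [aE aI aV]
  [cMV tc cV W2] [st K1K nK1]]]]]]]] :=
  stage e_sym e_irr tri no5 nowheel st0 KJ sJ JW WJ WM cM W0 nK.
set Bd := s |: _ :|: _ :|: _ in W2 st.
have qFJ y : y \in q |: F -> y \in J by move=> /FK/KJ.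
have AJ y : y \in A -> y \in J by move=> /AK/KJ.
have cJM : c \in J :|: Mp by rewrite inE; case: cP => [/KJ->|->]; rewrite ?orbT.
have VJ y : y \in V -> y \in J :|: Mp.
  by move=> /VP; rewrite !inE => /orP[/KJ->|->]; rewrite ?orbT.
have BdP y : y \in Bd -> y \in J :|: Mp \/ y = l.
  rewrite !in_setU !in_set1 -!orbA => /or4P[/eqP->|/eqP->|/AJ yJ|]; try by left; rewrite ?in_setU ?sJ ?yJ.
    by left; rewrite -in_setU.
  case/or3P=> [yF|/VJ|/eqP]; [left|by rewrite in_setU; left|by right].
  by rewrite qFJ // !inE yF orbT.
have sBd y : y \in s |: (c |: (A :|: F)) :|: V :|: [set l] -> y \in Bd by [].
have [b1 ll] : exists b, lnk l (s |: A) c b.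
  eexists; rewrite -[s |: A]set0U; apply: lnk_comp lls lA _; rewrite setU0.
  by apply: apart_sub aE => // y; rewrite !inE => /orP[->|->]; rewrite ?orbT.
apply: (rope Bd (l |: (s |: A)) F V K1 l c q st) => //.
- by move=> y /K1K/KJ.
- right; exists (s |: A), b1; split=> //.
  by move=> y; rewrite !inE => /orP[/eqP->|/AJ].
- by move=> y yF; apply: qFJ; rewrite !inE yF orbT.
- by apply: qFJ; rewrite !inE eqxx.
- move=> y yS; apply: sBd; move: yS; rewrite !in_setU !in_set1.
  by case: (y == c) (y == l) (y == s) (y \in A) (y \in F) (y \in V) => [] [] [] [] [] [].
- move=> y yB; have [yJ|->] := BdP y yB; last first.
    by move=> _; apply/touchP; exists s; rewrite // in_setU1 sBd ?orbT // !inE eqxx.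
  rewrite inE => /orP[yMp|yL]; first exact: W2.
  by have [_ n1 n2] := LpJ y yL; move: yJ; rewrite inE (negbTE n1) (negbTE n2).
- by move=> y /BdP[|->]; rewrite !inE ?lL ?orbT // => ->.
- apply: apartUl; last by apply: aI.
  by apply: apart_sub aE => // y; rewrite !inE => /orP[->|->]; rewrite ?orbT.
- apply: apartUl.
    move=> y z yM; rewrite !inE -!orbA => /or4P[zq|/eqP->|zs|].
    + by apply: aMJ => //; apply: qFJ; rewrite !inE zq.
    + split; first by apply: contraNneq lM => <-.
      by rewrite e_sym; apply/negbTE; apply: contra ntlM => ely; apply/touchP; exists y.
    + by apply: aMJ => //; rewrite (eqP zs).
    + by case/orP=> [/AJ|zF]; [|have /qFJ : z \in q |: F by rewrite !inE zF orbT]; apply: aMJ.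
  move=> y z yV; have [->|zl] := eqVneq z l.
    have [|h1 h2] := aE l y (set11 _); first by rewrite !inE yV !orbT.
    by rewrite eq_sym e_sym.
  move=> zS; apply: aV => //; move: zS; rewrite !inE (negbTE zl) /=.
  by case: (z == q) (z == s) (z \in A) => [] [] [].
Qed.

End Frames.

(** * Triangle-free graphs without pentagons and wheels *)

Section Core.
Variables (T : finType) (e : rel T).
Hypothesis e_sym : symmetric e.
Hypothesis e_irr : irreflexive e.
Hypothesis tri : forall x y z, e x y -> e y z -> e x z = false.
Hypothesis no5 : forall a b c d f,
  e a b -> e b c -> e c d -> e d f -> e f a = false.
Hypothesis nowheel : forall m blk sg, ~ wheel e m blk sg.
Implicit Types (s t : seq T) (x y w : T) (A B K : {set T}).

Notation conn := (conn e).
Notation touch := (touch e).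
Notation col := (col e).
Notation nbr := (nbr e).

Notation apart := (apart e).

(** [U] is the ball of radius [r - 2], which is connected, [P] is the level [r.-1], and [K] lies on
    level [r]. Deleting the root and its neighbours, two colours in all, forces [r >= 2], so that
    the ball is not empty and misses [K] by two levels. *)
Lemma bfs_split (S : {set T}) n : conn S -> ~~ col S (2 * (n + 2)) ->
  exists U P K : {set T},
  [/\ [/\ conn U, conn K & ~~ col K n],
      [/\ {subset U <= S}, {subset P <= S} & {subset K <= S}],
      (forall x, x \in P -> touch x U) /\ (forall v, v \in K -> touch v P),
      apart U K & (forall x, x \in P -> x \notin U :|: K)].
Proof.
move=> cS nS; have [q qS] := ncol_nonempty nS.
have [d b] := bfs_exists cS qS; have [_ dq par d0 lip] := b.
pose D (r : nat) : {set T} := [set q] :|: S :&: nbr q.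
have cD r : col (D r) 2.
  rewrite (_ : 2 = 1 + 1) //; apply: colU; last exact: (col_nbr tri).
  by apply: col_indep => x y /set1P-> /set1P->; rewrite e_irr.
have [r [K [sK dK cK nK]]] := bfs_level e_sym b (subxx S) cD nS.
have KS x : x \in K -> x \in S by move=> /(fintype.subsetP sK); rewrite inE => /andP[].
have [v vK] := ncol_nonempty nK.
have r2 : 2 <= r.
  have /setDP[vS] := fintype.subsetP sK v vK.
  rewrite !inE vS negb_or => /andP[vq evq]; have := dK v vK.
  case: r {sK dK} => [/(d0 v vS) E|[dv|//]]; first by rewrite E eqxx in vq.
  have [|u uS [euv du]] := par v vS; first by rewrite dv.
  have /(d0 u uS) E : d u = 0 by move: du; rewrite dv; case.
  by rewrite -E euv in evq.
have up x y : x \in S -> y \in S -> e x y -> d y <= (d x).+1.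
  by move=> xS yS; apply: lip.
exists [set x in S | d x <= r - 2], [set x in S | d x == r.-1], K; split=> //.
- by split; [exact: (bfs_conn e_sym _ b)| |].
- by split=> [x|x|//]; rewrite inE => /andP[].
- split=> [x|x xK].
    rewrite inE => /andP[xS /eqP dx]; have [|u uS [eux du]] := par x xS; first by nlia.
    by apply/touchP; exists u; rewrite 1?[e x u]e_sym // inE uS /=; nlia.
  have xS := KS x xK; have dx := dK x xK.
  have [|u uS [eux du]] := par x xS; first by nlia.
  by apply/touchP; exists u; rewrite 1?[e x u]e_sym // inE uS /=; apply/eqP; nlia.
- move=> x y; rewrite inE => /andP[xS dx] yK; have dy := dK y yK; split.
    by apply/eqP => xy; move: dx; rewrite xy dy; nlia.
  by apply/negP => exy; have := up x y xS (KS y yK) exy; rewrite dy; nlia.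
- move=> x; rewrite inE => /andP[xS /eqP dx]; rewrite !inE xS /= negb_or.
  apply/andP; split; first by nlia.
  by apply/negP => /dK; nlia.
Qed.

(** The bound of [frame_col], carried back through two applications of [bfs_split]. *)
Definition core_bound := 2 * (2 * (2 * (2 * (rope_bound + 4) + 3 + (5 + 1)) + 1 + 2) + 2).

Lemma core_col A : col A core_bound.
Proof.
apply/negPn/negP => nA; have [C [_ cC nC _]] := ncol_comp e_sym nA.
have [U [P [H [[cU cH nH] [_ _ _] [PU HP] aUH Pd]]]] := bfs_split cC nC.
have [M [W [J [[cM cJ nJ] [MH WH JH] [WM JW] aMJ Wd]]]] := bfs_split cH nH.
case/negP: nJ; apply: (@frame_col _ e e_sym e_irr tri no5 nowheel U P M W J); split=> //.
- by split=> // v /JH/HP.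
- by apply: apart_sub aUH => // x; rewrite !inE -orbA => /or3P[/MH|/WH|/JH].
- split=> [x xP|w /Wd|w /Wd]; rewrite ?inE ?negb_or; try by case/andP.
  have := Pd x xP; rewrite inE negb_or => /andP[-> xH].
  by rewrite (contra (MH x) xH) (contra (WH x) xH) (contra (JH x) xH).
Qed.

End Core.

(** * Stable sets meeting all maximum cliques or all pentagons *)

Lemma count_enum (T : finType) (A K : {set T}) : count (mem A) (enum K) = #|K :&: A|.
Proof.
rewrite -size_filter cardE; congr size; rewrite /enum_mem -filter_predI.
by apply: eq_filter => v; rewrite /= inE andbC.
Qed.

Section Reduction.
Import Order.TTheory GRing.Theory Num.Theory.
Local Open Scope ring_scope.
Variables (R : realType) (T : finType) (e : rel T).
Hypothesis e_sym : symmetric e.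
Hypothesis e_irr : irreflexive e.
Hypothesis hp : h_perfect R e.
Implicit Types (A K S : {set T}) (z : R).

(** Cliques and odd cycles are both treated as sequences with an integral bound [k]. The weight of a
    sequence is an average of the numbers of its entries in the stable sets, so a tight sequence is
    tight for every set of positive weight; one such set therefore serves all sequences at once. *)
Lemma STAB_tight (x : {ffun T -> R}) : STAB R e x ->
  exists2 S : {set T}, stable e S & forall (s : seq T) (k : nat),
    (forall S' : {set T}, stable e S' -> (count (mem S') s <= k)%N) ->
    \sum_(v <- s) x v = k%:R -> count (mem S) s = k.
Proof.
case/STABP=> n [S [a [stS a0 a1 xE]]].
have [i ai] : exists i, 0 < a i.
  apply/existsP; case: existsP => // h; have := a1; rewrite big1 => [|i _].
    by move/eqP; rewrite eq_sym oner_eq0.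
  by apply/eqP; rewrite eq_le a0 andbT leNgt; apply/negP => ai; case: h; exists i.
exists (S i) => // s k le_k sumk; apply/eqP; rewrite -(eqr_nat R); apply/eqP.
apply: (tight (f := fun j => (count (mem (S j)) s)%:R) a0 a1 _ _ ai) => [j|].
  by rewrite ler_nat le_k.
rewrite -sumk; under [RHS]eq_bigr do rewrite xE.
rewrite exchange_big /=; apply: eq_bigr => j _; rewrite -mulr_sumr; congr (_ * _).
by elim: s {le_k sumk} => [|v s IH]; rewrite ?big_nil ?big_cons //= natrD IH.
Qed.

Definition flat (A : {set T}) (z : R) : {ffun T -> R} := [ffun v => if v \in A then z else 0].

Lemma sum_flat A z s : \sum_(v <- s) flat A z v = (count (mem A) s)%:R * z.
Proof.
elim: s => [|v s IH]; first by rewrite big_nil mul0r.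
by rewrite big_cons IH ffunE /= natrD mulrDl; case: (v \in A); rewrite ?mul1r ?mul0r.
Qed.

Lemma cliqueI K A : clique e K -> clique e (K :&: A).
Proof.
move=> /forall_inP h; apply/forall_inP => x; rewrite inE => /andP[xK _].
by apply/forall_inP => y; rewrite inE => /andP[yK _]; have /forall_inP/(_ y yK) := h x xK.
Qed.

Lemma flat_HSTAB A z w : 0 <= z -> w%:R * z <= 1 ->
  (forall K, clique e K -> K \subset A -> (#|K| <= w)%N) ->
  (forall c, odd_cycle e c -> (count (mem A) c)%:R * z <= ((size c)%:R - 1) / 2) ->
  HSTAB R e (flat A z).
Proof.
move=> z0 wz hK hc; split=> [v|K cK|c /hc]; last by rewrite sum_flat.
  by rewrite ffunE; case: ifP.
rewrite -big_enum sum_flat count_enum; apply: le_trans wz; apply: ler_wpM2r => //.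
by rewrite ler_nat hK ?cliqueI ?subsetIr.
Qed.

(** With weight [1 / w] a cycle of length [n >= 3] weighs at most [n / 3], which is at most
    [(n - 1) / 2]; this is where [w > 2] enters. Cliques of size [w] weigh exactly 1 and are
    therefore met. *)
Lemma hit_cliques A w : (2 < w)%N ->
  (forall K, clique e K -> K \subset A -> (#|K| <= w)%N) ->
  exists2 S : {set T}, stable e S & forall K, clique e K -> K \subset A ->
    #|K| = w -> exists2 v, v \in K & v \in S.
Proof.
move=> w2 hK; pose z : R := w%:R^-1.
have wz : w%:R * z = 1 by rewrite mulfV // pnatr_eq0; lia.
have w3 : 3 <= w%:R :> R by rewrite ler_nat.
have z0 : 0 <= z by rewrite invr_ge0 ler0n.
have z3 : 3 * z <= 1 by rewrite -[leRHS]wz; apply: ler_wpM2r.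
have : STAB R e (flat A z).
  rewrite hp; apply: (@flat_HSTAB _ _ w) => //; first by rewrite wz.
  move=> c /and4P[c2 _ _ _]; have c3 : 3 <= (size c)%:R :> R by rewrite ler_nat.
  have : (count (mem A) c)%:R <= (size c)%:R :> R by rewrite ler_nat count_size.
  move/(ler_wpM2r z0) => h; apply: le_trans h _.
  have : (size c)%:R * (3 * z) <= (size c)%:R * 1 by apply: ler_wpM2l.
  by lra.
case/STAB_tight=> S stS hS; exists S => // K cK KA Kw.
have /(hS (enum K) 1%N) : forall S', stable e S' -> (count (mem S') (enum K) <= 1)%N.
  move=> S' /stableP st; rewrite count_enum; apply/card_le1_eqP => x y.
  rewrite !inE => /andP[xK xS] /andP[yK yS]; apply/eqP/negPn/negP => xy.
  have /forall_inP/(_ x xK)/forall_inP/(_ y yK) := cK.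
  by rewrite (negbTE (st x y xS yS)) implybF eq_sym xy.
rewrite sum_flat count_enum (setIidPl KA) Kw => /(_ wz).
rewrite count_enum => KS; have /set0Pn[v] : K :&: S != set0 by rewrite -card_gt0 KS.
by rewrite inE => /andP[vK vS]; exists v.
Qed.

Lemma no_triangle A (x y z : T) :
  (forall K, clique e K -> K \subset A -> (#|K| <= 2)%N) ->
  x \in A -> y \in A -> z \in A -> e x y -> e y z -> e x z = false.
Proof.
move=> hK xA yA zA xy yz; apply/negP => xz.
have clc : clique e [set x; y; z].
  apply/forall_inP => u; rewrite !inE -orbA => uc; apply/forall_inP => v; rewrite !inE -orbA => vc.
  apply/implyP; move: uc vc => /or3P[] /eqP-> /or3P[] /eqP->; rewrite ?eqxx // => _;
    by rewrite // e_sym.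
have sub : [set x; y; z] \subset A.
  by apply/fintype.subsetP => u; rewrite !inE => /orP[/orP[]|] /eqP->.
have ne u v : e u v -> v == u = false.
  by move=> euv; apply: contraTF euv => /eqP->; rewrite e_irr.
have := hK _ clc sub; rewrite setUC cardsU1 !inE (ne _ _ xz) (ne _ _ yz) /=.
by rewrite cards2 eq_sym (ne _ _ xy).
Qed.

(** An odd cycle of length [n >= 5] weighs at most [2 n / 5], which is at most [(n - 1) / 2], with
    equality for [n = 5]. A triangle has at most two vertices in [A] and weighs at most [4 / 5].
    Pentagons in [A] are tight, and the stable set has two vertices on each. *)
Lemma hit_pentagons A : (forall K, clique e K -> K \subset A -> (#|K| <= 2)%N) ->
  exists2 S : {set T}, stable e S & forall c, odd_cycle e c -> size c = 5 ->
    {subset c <= A} -> exists2 v, v \in c & v \in S.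
Proof.
move=> hK; have : STAB R e (flat A (2 / 5)).
  rewrite hp; apply: (@flat_HSTAB _ _ 2) => //; try lra.
  move=> c /and4P[c2 oc cc uc]; have [c3|c3] := eqVneq (size c) 3.
    have : (count (mem A) c <= 2)%N.
      suff : (count (mem A) c < size c)%N by rewrite c3.
      rewrite ltn_neqAle count_size andbT.
      apply: contraTneq isT => /eqP; rewrite -all_count => /allP cA.
      case: (c) c3 cc cA => [|x [|y [|z [|]]]] //= _ /and4P[xy yz zx _] cA.
      by rewrite -(no_triangle hK (x := x) (y := y) (z := z)) ?cA ?inE ?eqxx ?orbT // e_sym zx.
    by rewrite -(ler_nat R) c3 => h; lra.
  have c5 : 5 <= (size c)%:R :> R.
    by rewrite ler_nat; move: c2 oc c3; case: (size c) => [|[|[|[|[|]]]]].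
  have : (count (mem A) c)%:R <= (size c)%:R :> R by rewrite ler_nat count_size.
  by lra.
case/STAB_tight=> S stS hS; exists S => // c oc c5 cA.
have /(hS c 2%N) : forall S', stable e S' -> (count (mem S') c <= 2)%N.
  move=> S' /stableP st; case: (c) c5 oc => [|x0 [|x1 [|x2 [|x3 [|x4 [|]]]]]] //= _.
  case/and4P=> _ _ /= /and5P[e0 e1 e2 e3 /andP[e4 _]] _.
  have no u v : e u v -> (u \in S') && (v \in S') = false.
    by move=> euv; apply/negP => /andP[uS vS]; have := st u v uS vS; rewrite euv.
  have := (no _ _ e0, no _ _ e1, no _ _ e2, no _ _ e3, no _ _ e4).
  by case: (x0 \in S') (x1 \in S') (x2 \in S') (x3 \in S') (x4 \in S')
    => [] [] [] [] [] [[[[]]]].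
rewrite sum_flat; have -> : count (mem A) c = 5 by rewrite -c5; apply/eqP; rewrite -all_count; apply/allP.
move=> /(_ ltac:(lra)) h; have : has (mem S) c by rewrite has_count h.
by case/hasP=> v vc vS; exists v.
Qed.

(** Each block contains an end of an edge inside [A] and is connected by such edges, so it lies in
    [A]. Vertices outside [A] may have further edges in [e]; the block number [m.+1] excludes them
    from the wheel. *)
Lemma wheel_restr A m blk sg : wheel (restr e A) m blk sg ->
  wheel e m (fun x => if x \in A then blk x else m.+1) sg.
Proof.
set f := fun x => _; case=> om Wc W3 W4 W5.
have inA x : (f x <= m)%N -> x \in A by rewrite /f; case: ifP => //; rewrite ltnn.
have fE x : x \in A -> f x = blk x by rewrite /f => ->.
have end_in x y : restr e A x y -> [/\ x \in A, y \in A & e x y] by case/and3P.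
have blkA b : (b <= m)%N -> exists2 x, x \in A & blk x = b.
  have [om' m1] := om; case: b => [_|b bm].
    by have [[x [y [bx _ /end_in[xA _ _]]]] _] := W5 0%N (ltnW m1); exists x.
  by have [[x [y [_ by_ /end_in[_ yA _]]]] _] := W5 b bm; exists y.
have subA b x : (b <= m)%N -> blk x = b -> x \in A.
  move=> bm bx; have [y yA yb] := blkA b bm.
  have <- : (y \in A) = (x \in A); last by [].
  apply: (conn_const (f := fun v => v \in A) (Wc b bm)); rewrite ?inE ?bx ?yb //.
  by move=> u v _ _ /end_in[-> ->].
split=> //.
- move=> b bm; have -> : [set x | f x == b] = [set x | blk x == b].
    apply/setP => x; rewrite !inE; apply/eqP/eqP => E; last by rewrite fE ?(subA b).
    by rewrite -fE // inA ?E.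
  apply/connP => x y xb yb; move/connP: (Wc b bm) => /(_ x y xb yb).
  by apply: connect_sub => u v /and3P[ub vb /end_in[_ _ uv]]; apply: connect1; apply/and3P.
- move=> x y xy xm E; have xA := inA x xm; have yA : y \in A by apply: inA; rewrite -E.
  by apply: W3; rewrite ?fE // -?fE // /restr xA yA.
- move=> x y xy xm ym; have xA := inA x xm; have yA := inA y ym.
  by rewrite (fE x xA) (fE y yA) in xm ym * => ne; apply: W4; rewrite // /restr xA yA.
- move=> i im; have [[x [y [bx by_ /end_in[xA yA xy]]]] [u [v [bu bv /end_in[uA vA uv]]]]] := W5 i im.
  by split; [exists x, y|exists u, v]; rewrite !fE.
Qed.

Lemma col_restr A n : col (restr e A) setT n -> col e A n.
Proof.
move=> /colP[f [f1 f2]]; apply/colP; exists f; split=> x; first by move=> _; apply: f1.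
by move=> y xA yA xy; apply: f2; rewrite ?inE // /restr xA yA.
Qed.

Lemma col_stable S : stable e S -> col e S 1.
Proof. by move/stableP => st; apply: col_indep. Qed.

Lemma col_triangle_free A :
  (forall K, clique e K -> K \subset A -> (#|K| <= 2)%N) -> col e A (core_bound + 1).
Proof.
move=> hK; have [S stS hS] := hit_pentagons hK.
suff h : col e (A :\: S) core_bound.
  apply: col_sub (colU h (col_stable stS)); apply/fintype.subsetP => v vA.
  by rewrite !inE vA andbT orNb.
apply: col_restr; set D := A :\: S; pose e' := restr e D.
have e's : symmetric e' by move=> x y; rewrite /e' /restr e_sym andbCA.
have e'i : irreflexive e' by move=> x; rewrite /e' /restr e_irr !andbF.
have DA x : x \in D -> x \in A by rewrite inE => /andP[].
have e'P x y : e' x y -> [/\ x \in D, y \in D & e x y] by case/and3P.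
have ne x y : e' x y -> x != y by apply: contraTneq => ->; rewrite e'i.
have tri x y w : e' x y -> e' y w -> e' x w = false.
  move=> /e'P[xD yD xy] /e'P[_ zD yz]; apply/negP => /e'P[_ _].
  by rewrite (no_triangle hK _ _ _ xy yz) ?DA.
apply: (@core_col _ e' e's e'i tri).
- move=> a b c d f ab bc cd df; apply/negP => fa.
  have ac : a != c by apply: contraTneq fa => E; rewrite e's E (tri _ _ _ cd df).
  have ad : a != d by apply: contraTneq cd => E; rewrite e's -E (tri _ _ _ ab bc).
  have bd : b != d by apply: contraTneq ab => E; rewrite e's E (tri _ _ _ df fa).
  have bf : b != f by apply: contraTneq df => E; rewrite e's -E (tri _ _ _ bc cd).
  have cf : c != f by apply: contraTneq bc => E; rewrite e's E (tri _ _ _ fa ab).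
  have [aD bD eab] := e'P _ _ ab; have [_ cD ebc] := e'P _ _ bc.
  have [_ dD ecd] := e'P _ _ cd; have [_ fD edf] := e'P _ _ df; have [_ _ efa] := e'P _ _ fa.
  have [|||v vc vS] := hS [:: a; b; c; d; f] _ _ _.
  - rewrite /odd_cycle /= eab ebc ecd edf efa !inE !negb_or ac ad bd bf cf.
    by rewrite (ne _ _ ab) (ne _ _ bc) (ne _ _ cd) (ne _ _ df) eq_sym (ne _ _ fa).
  - by [].
  - by move=> v; rewrite !inE => /or4P[/eqP->|/eqP->|/eqP->|/orP[]/eqP->]; apply: DA.
  have : v \in D by move: vc; rewrite !inE => /or4P[/eqP->|/eqP->|/eqP->|/orP[]/eqP->]; rewrite -?in_setD.
  by rewrite inE vS.
- move=> m blk sg W; apply: (wheel_not_hperfect (wheel_restr W) _ hp) => x y z.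
  have inD v : ((if v \in D then blk v else m.+1) <= m)%N -> v \in D.
    by case: ifP => //; rewrite ltnn.
  move=> /inD/DA xD /inD/DA yD /inD/DA zD xy yz.
  by rewrite (no_triangle hK xD yD zD xy yz).
Qed.

(** Removing a stable set that meets all cliques of size [n.+1 + 2] costs one colour and lowers the
    clique bound by one; the induction ends in the triangle-free case. *)
Lemma col_clique_le n A :
  (forall K, clique e K -> K \subset A -> (#|K| <= n + 2)%N) -> col e A (n + (core_bound + 1)).
Proof.
elim: n A => [|n IH] A hK; first exact: col_triangle_free.
have w2 : (2 < n.+1 + 2)%N by rewrite addn2.
have [S stS hS] := hit_cliques w2 hK.
have h : col e (A :\: S) (n + (core_bound + 1)).
  apply: IH => K cK KD; have KA := subset_trans KD (subsetDl _ _).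
  have := hK K cK KA; rewrite leq_eqVlt => /orP[/eqP Kn|]; last by rewrite addSn ltnS.
  have [v vK vS] := hS K cK KA Kn.
  by have := fintype.subsetP KD v vK; rewrite inE vS.
rewrite addSn -addn1; apply: col_sub (colU h (col_stable stS)).
by apply/fintype.subsetP => v vA; rewrite !inE vA andbT orNb.
Qed.

Lemma col_colourable n : col e setT n -> colourable e n.
Proof.
move=> /colP[f [f1 f2]]; exists (fun i : 'I_n => [set x | f x == i]); split=> [i|].
  apply/stableP => x y; rewrite !inE => /eqP fx /eqP fy; apply/negP => xy.
  by have := f2 x y (in_setT _) (in_setT _) xy; rewrite fx fy eqxx.
apply/setP => x; rewrite inE; apply/bigcupP; exists (Ordinal (f1 x (in_setT _))) => //.
by rewrite inE.
Qed.

End Reduction.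

Theorem theorem1p2 (R : realType) (T : finType) (e : rel T) :
  simple_graph e -> h_perfect R e ->
  colourable e (clique_number e + 199050)%N.
Proof.
case=> e_sym e_irr hp; apply: col_colourable.
have h : col e setT (clique_number e + (core_bound + 1)).
  (* Taking the clique number itself for [n] leaves room for two more, and so no case distinction
     for clique numbers below 2 arises. *)
  apply: (col_clique_le e_sym e_irr hp) => K cK _.
  rewrite -[#|K|]addn0; apply: leq_add => //; exact: (leq_bigmax_cond (F := fun K : {set T} => #|K|)).
(* What remains is [core_bound + 1], that is 107961, against the stated constant. *)
apply: col_leq h; rewrite leq_add2l.
by vm_compute.
Qed.
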